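(* Let $\varphi=\{\varphi_m\}_{m=1}^{\infty}$ be a family of convex functions $\varphi_m:\mathbb{R}\to\mathbb{R}$ such that (1) $\lim_{x\to\infty}\dfrac{\varphi_m(x)}{|x|}=+\infty$ for each $m\in\mathbb{N}$; (2) $\varphi_m(x)-\varphi_{m+1}(x)\ge\ln(1+|x|)$ for all $x\in\mathbb{R}$ and $m\in\mathbb{N}$. Let $\{(c_k^{(m)})_{k=1}^\infty\}_{m=1}^\infty$ be a family of sequences of positive numbers such that $\sum_{k=1}^\infty \dfrac{c_k^{(m)}}{c_k^{(m+1)}}<\infty$ for each $m\in\mathbb{N}$. Then the transformation $\mathcal{F}: S\in T^*\mapsto\hat S$ establishes a topological isomorphism between the spaces $T^*$ and $P$.
   Context: All functions in the spaces below are complex-valued; $x\to\infty$ means $|x|\to\infty$, and $\mathbb{N}=\{1,2,\dots\}$. For $m\in\mathbb{N}$ and $u\in C^m(\mathbb{R})$ put $$q_m(u)=\sup_{x\in\mathbb{R},\ 0\le\alpha\le m}\frac{|u^{(\alpha)}(x)|}{\exp(\varphi_m(x))}.$$ For each $m\in\mathbb{N}$ define the normed space $$T_m=\Big\{f=(f_1,\dots,f_k,\dots),\ f_k\in C^m(\mathbb{R}):\ p_m(f)=\sum_{k=1}^\infty c_k^{(m)}q_m(f_k)<\infty\Big\}$$ with norm $p_m$; one has $T_{m+1}\subset T_m$. Set $T=\bigcap_{m=1}^\infty T_m$ with the projective limit topology of the spaces $T_m$ (the locally convex topology defined by the norms $p_m$, $m\in\mathbb{N}$). $T^*$ is the strong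 dual of $T$: the space of continuous linear functionals on $T$ with the topology of uniform convergence on bounded sets. For $k\in\mathbb{N}$ and $\lambda\in\mathbb{C}$ let $(e^{-i\lambda x})_k\in T$ be the sequence whose $k$-th component is the function $x\mapsto e^{-i\lambda x}$, $x\in\mathbb{R}$, and whose other components are zero. For $S\in T^*$ let $\hat S=(\hat S_1,\dots,\hat S_k,\dots)$, where $\hat S_k(\lambda)=S((e^{-i\lambda x})_k)$, $\lambda\in\mathbb{C}$, $k\in\mathbb{N}$. For $m\in\mathbb{N}$ let $\tilde\varphi_m(x)=\sup_{y\in\mathbb{R}}(xy-\varphi_m(y))$, $x\in\mathbb{R}$. Let $H(\mathbb{C})$ be the space of entire functions and $$P_m=\Big\{g=(g_k)_{k=1}^\infty,\ g_k\in H(\mathbb{C}):\ \|g\|_m=\sup_{k\ge1}\sup_{\lambda\in\mathbb{C}}\frac{|g_k(\lambda)|}{c_k^{(m)}(1+|\lambda|)^m\exp(\tilde\varphi_m(\operatorname{Im}\lambda))}<\infty\Big\},$$ normed by $\|\cdot\|_m$. Set $P=\bigcup_{m=1}^\infty P_m$ with the (locally convex) inductive limit topology of the spaces $P_m$. *)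

(* Defs.v *)
From HB Require Import structures.
From mathcomp Require Import all_boot all_order all_algebra.
From mathcomp Require Import complex.
From mathcomp Require Import all_classical all_reals all_analysis.
From mathcomp Require Import ring lra.

Set Implicit Arguments.
Unset Strict Implicit.
Unset Printing Implicit Defensive.

Import Order.TTheory GRing.Theory Num.Theory.
Import numFieldNormedType.Exports.

Local Open Scope classical_set_scope.
Local Open Scope complex_scope.
Local Open Scope ring_scope.

(* ℂ as a normed space over itself *)
Notation cplx R := (R[i]^o).
Local Notation Re := complex.Re.
Local Notation Im := complex.Im.

Definition cabs (R : realType) (z : R[i]) : R := Normc.normc z.

Definition cexp (R : realType) (z : R[i]) : R[i] :=
  (expR (Re z) * cos (Im z)) +i* (expR (Re z) * sin (Im z)).

(* The filter of x -> oo in the sense |x| -> +oo *)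
Definition at_infinity {R : realType} : set_system R :=
  filter_from [set: R] (fun B => [set x : R | B < `|x|]).

Section Smooth.
Context {R : realType}.

(* derive1n is total, so f in C^n also asks that the derivatives exist. *)
Definition is_Cn (n : nat) (f : R -> R) : Prop :=
  (forall a, (a < n)%N -> forall x : R, derivable (derive1n a f) x 1)
  /\ continuous (derive1n n f).

(* Complex-valued functions of a real variable are differentiated
   componentwise. *)
Definition cis_Cn (n : nat) (u : R -> cplx R) : Prop :=
  is_Cn n (fun x => Re (u x)) /\ is_Cn n (fun x => Im (u x)).

Definition cderiv (n : nat) (u : R -> cplx R) : R -> cplx R :=
  fun x => derive1n n (fun y => Re (u y)) x +i* derive1n n (fun y => Im (u y)) x.

End Smooth.

Definition entire (R : realType) (g : cplx R -> cplx R) : Prop :=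
  forall z : cplx R, derivable g z 1.

(* phi m and coef m k stand for phi_m and c_k^(m) with m >= 1; the values at
   m = 0 are never used.  The components k = 1, 2, ... of a sequence are indexed
   from 0, so coef m k is the weight of the (k+1)-st component. *)
Record weights (R : realType) := Weights {
  phi : nat -> R -> R ;
  coef : nat -> nat -> R ;
  phi_convex : forall m, (0 < m)%N -> convex_function [set: R^o] (phi m) ;
  phi_superlinear : forall m, (0 < m)%N ->
    phi m x / `|x| @[x --> @at_infinity R] --> +oo ;
  phi_gap : forall m, (0 < m)%N -> forall x,
    ln (1 + `|x|) <= phi m x - phi m.+1 x ;
  coef_gt0 : forall m, (0 < m)%N -> forall k, 0 < coef m k ;
  coef_summable : forall m, (0 < m)%N ->
    (\sum_(0 <= k <oo) (coef m k / coef m.+1 k)%:E < +oo)%E }.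

Section Spaces.
Context {R : realType} (W : weights R).
Local Notation C := (cplx R).

Definition q_norm (m : nat) (u : R -> C) : \bar R :=
  ereal_sup [set r | exists x a, (a <= m)%N
    /\ r = (cabs (cderiv a u x) / expR (phi W m x))%:E].

Definition T_norm (m : nat) (f : nat -> R -> C) : \bar R :=
  (\sum_(0 <= k <oo) (coef W m k)%:E * q_norm m (f k))%E.

Definition Tm (m : nat) : set (nat -> R -> C) :=
  [set f | (forall k, cis_Cn m (f k)) /\ (T_norm m f < +oo)%E].

Definition Tset : set (nat -> R -> C) :=
  [set f | forall m, (0 < m)%N -> Tm m f].

(* The conjugate function of phi_m; the supremum is finite by
   phi_linear_bound below. *)
Definition phit (m : nat) (x : R) : R :=
  sup [set r | exists y, r = x * y - phi W m y].

Definition P_norm (m : nat) (g : nat -> C -> C) : \bar R :=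
  ereal_sup [set r | exists k (l : C), r = (cabs (g k l) /
    (coef W m k * (1 + cabs l) ^+ m * expR (phit m (Im l))))%:E].

Definition Pm (m : nat) : set (nat -> C -> C) :=
  [set g | (forall k, entire (g k)) /\ (P_norm m g < +oo)%E].

Definition Pset : set (nat -> C -> C) :=
  [set g | exists2 m, (0 < m)%N & Pm m g].

End Spaces.

Section CabsTheory.
Context {R : realType}.
Implicit Types z w : R[i].

Lemma cabs_ge0 z : 0 <= cabs z.
Proof. by case: z => a b; exact: sqrtr_ge0. Qed.

Lemma cabs0 : cabs (0 : R[i]) = 0.
Proof. exact: Normc.normc0. Qed.

Lemma cabsD z w : cabs (z + w) <= cabs z + cabs w.
Proof. exact: (@le_normcD R z w). Qed.

Lemma cabsM z w : cabs (z * w) = cabs z * cabs w.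
Proof. exact: Normc.normcM. Qed.

End CabsTheory.

Section SmoothTheory.
Context {R : realType}.

Lemma derive1n_lin n (f g : R -> R) (s t : R) : is_Cn n f -> is_Cn n g ->
  forall a, (a <= n)%N -> derive1n a (fun x => s * f x + t * g x) =
    (fun x => s * derive1n a f x + t * derive1n a g x).
Proof.
move=> [df _] [dg _]; elim=> [//|a IH] an.
rewrite derive1nS IH ?(ltnW an)//; apply/funext => x.
rewrite derive1E !derive1nS !derive1E.
have fx := df a an x; have gx := dg a an x.
have dsf : is_derive x 1 (s \*: derive1n a f) (s *: 'D_1 (derive1n a f) x).
  exact/is_deriveZ/derivableP.
have dtg : is_derive x 1 (t \*: derive1n a g) (t *: 'D_1 (derive1n a g) x).
  exact/is_deriveZ/derivableP.
exact: (@derive_val _ _ _ _ _ _ _ (is_deriveD dsf dtg)).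
Qed.

Lemma is_Cn_lin n (f g : R -> R) (s t : R) : is_Cn n f -> is_Cn n g ->
  is_Cn n (fun x => s * f x + t * g x).
Proof.
move=> Cf Cg; have E := derive1n_lin s t Cf Cg.
case: (Cf) (Cg) => [df cf] [dg cg]; split=> [a an x|].
  rewrite E ?(ltnW an)//; apply: derivableD; apply: derivableZ; [exact: df|exact: dg].
rewrite E// => x; apply: cvgD; apply: cvgM;
  by [exact: cvg_cst|exact: cf|exact: cg].
Qed.

Lemma is_Cn0 n : is_Cn n (fun _ : R => 0 : R).
Proof.
have E a : derive1n a (fun _ : R => 0 : R) = (fun _ => 0).
  elim: a => // a IH; rewrite derive1nS IH; apply/funext => x.
  by rewrite derive1_cst.
split=> [a _ x|]; rewrite E; first exact: derivable_cst.
by move=> x; exact: cst_continuous.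
Qed.

Lemma cis_Cn0 n : cis_Cn n (0 : R -> cplx R).
Proof. by split; exact: is_Cn0. Qed.

Let ReZ (z : R[i]) (u : R -> cplx R) :
  (fun x => Re ((z *: u) x)) = (fun x => Re z * Re (u x) + (- Im z) * Im (u x)).
Proof.
apply/funext => x; rewrite scalrfctE /=; case: z (u x) => [a b] [c d] /=.
by rewrite mulNr.
Qed.

Let ImZ (z : R[i]) (u : R -> cplx R) :
  (fun x => Im ((z *: u) x)) = (fun x => Re z * Im (u x) + Im z * Re (u x)).
Proof. by apply/funext => x; rewrite scalrfctE /=; case: z (u x) => [a b] [c d]. Qed.

Let ReD (u v : R -> cplx R) :
  (fun x => Re ((u + v) x)) = (fun x => 1 * Re (u x) + 1 * Re (v x)).
Proof.
by apply/funext => x; rewrite addrfctE !mul1r/=; case: (u x) (v x) => [a b] [c d].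
Qed.

Let ImD (u v : R -> cplx R) :
  (fun x => Im ((u + v) x)) = (fun x => 1 * Im (u x) + 1 * Im (v x)).
Proof.
by apply/funext => x; rewrite addrfctE !mul1r/=; case: (u x) (v x) => [a b] [c d].
Qed.

Lemma cis_CnZ n (z : R[i]) (u : R -> cplx R) : cis_Cn n u -> cis_Cn n (z *: u).
Proof. by move=> [ru iu]; split; rewrite ?ReZ ?ImZ; exact: is_Cn_lin. Qed.

Lemma cis_CnD n (u v : R -> cplx R) : cis_Cn n u -> cis_Cn n v -> cis_Cn n (u + v).
Proof.
by move=> [ru iu] [rv iv]; split; rewrite ?ReD ?ImD; exact: is_Cn_lin.
Qed.

Lemma cderivZ n a (z : R[i]) (u : R -> cplx R) x : (a <= n)%N -> cis_Cn n u ->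
  cderiv a (z *: u) x = z * cderiv a u x.
Proof.
move=> an [ru iu]; rewrite /cderiv ReZ ImZ (derive1n_lin _ _ ru iu)//.
rewrite (derive1n_lin _ _ iu ru)//; case: z => [b c]/=.
by rewrite mulNr.
Qed.

Lemma cderivD n a (u v : R -> cplx R) x : (a <= n)%N -> cis_Cn n u -> cis_Cn n v ->
  cderiv a (u + v) x = cderiv a u x + cderiv a v x.
Proof.
move=> an [ru iu] [rv iv]; rewrite /cderiv ReD ImD.
by rewrite (derive1n_lin _ _ ru rv)// (derive1n_lin _ _ iu iv)// !mul1r.
Qed.

Lemma derive1n_cst0 a : derive1n a (fun _ : R => 0 : R) = (fun _ => 0).
Proof.
elim: a => // a IH; rewrite derive1nS IH; apply/funext => x.
by rewrite derive1_cst.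
Qed.

Lemma cderiv0 a x : cderiv a (0 : R -> cplx R) x = 0.
Proof. by rewrite /cderiv /= !derive1n_cst0. Qed.

End SmoothTheory.

Section SpacesTheory.
Context {R : realType} (W : weights R).
Local Notation C := (cplx R).
Local Open Scope ereal_scope.

Lemma q_norm_ge0 m u : 0 <= q_norm W m u.
Proof.
apply: ereal_sup_ge; eexists; first by exists 0%R, 0%N.
by rewrite lee_fin divr_ge0 ?cabs_ge0 ?expR_ge0.
Qed.

Lemma q_norm_ub m u x a : (a <= m)%N ->
  (cabs (cderiv a u x) / expR (phi W m x))%:E <= q_norm W m u.
Proof. by move=> am; apply: ereal_sup_ubound; exists x, a. Qed.

Lemma q_norm0 m : q_norm W m 0%R = 0.
Proof.
apply/eqP; rewrite eq_le q_norm_ge0 andbT; apply: ge_ereal_sup => _ [x [a [am ->]]].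
by rewrite cderiv0 cabs0 mul0r.
Qed.

Lemma q_normD m u v : cis_Cn m u -> cis_Cn m v -> q_norm W m (u + v)%R <= q_norm W m u + q_norm W m v.
Proof.
move=> Cu Cv; apply: ge_ereal_sup => _ [x [a [am ->]]].
apply: le_trans (leeD (q_norm_ub u x am) (q_norm_ub v x am)).
rewrite (cderivD _ am Cu Cv) -EFinD lee_fin -mulrDl ler_wpM2r ?invr_ge0 ?expR_ge0//.
exact: cabsD.
Qed.

Lemma q_normZ m (z : R[i]) u : cis_Cn m u -> q_norm W m (z *: u)%R <= (cabs z)%:E * q_norm W m u.
Proof.
move=> Cu; apply: ge_ereal_sup => _ [x [a [am ->]]].
rewrite (cderivZ _ _ am Cu) cabsM -mulrA EFinM.
by rewrite lee_wpmul2l ?lee_fin ?cabs_ge0// q_norm_ub.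
Qed.

Let term_ge0 m f k : (0 < m)%N -> 0 <= (coef W m k)%:E * q_norm W m (f k).
Proof. by move=> m0; rewrite mule_ge0 ?lee_fin ?q_norm_ge0// ltW// coef_gt0. Qed.

Lemma T_norm_ge0 m f : (0 < m)%N -> 0 <= T_norm W m f.
Proof. by move=> m0; apply: nneseries_ge0 => k _ _; exact: term_ge0. Qed.

Lemma T_norm0 m : T_norm W m 0%R = 0.
Proof. by apply: eseries0 => k _ _; rewrite q_norm0 mule0. Qed.

Lemma T_normD m f g : (0 < m)%N -> (forall k, cis_Cn m (f k)) ->
  (forall k, cis_Cn m (g k)) -> T_norm W m (f + g)%R <= T_norm W m f + T_norm W m g.
Proof.
move=> m0 Cf Cg; rewrite -nneseriesD; [|by move=> *; exact: term_ge0..].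
apply: lee_nneseries => [k _ _|k _]; first exact: term_ge0.
rewrite -ge0_muleDr ?q_norm_ge0// lee_wpmul2l ?lee_fin ?(ltW (coef_gt0 W m0 k))//.
exact: q_normD.
Qed.

Lemma T_normZ m (z : R[i]) f : (0 < m)%N -> (forall k, cis_Cn m (f k)) ->
  T_norm W m (z *: f)%R <= (cabs z)%:E * T_norm W m f.
Proof.
move=> m0 Cf; rewrite -nneseriesZl; last by move=> *; exact: term_ge0.
apply: lee_nneseries => [k _ _|k _]; first exact: term_ge0.
rewrite muleCA lee_wpmul2l ?lee_fin ?(ltW (coef_gt0 W m0 k))//.
exact: q_normZ.
Qed.

Lemma Tset_closed : GRing.subsemimod_closed (mem (Tset W)).
Proof.
split; first split.
- apply/mem_set => m m0; split; last by rewrite T_norm0 ltry.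
  by move=> k; exact: cis_Cn0.
- move=> f g /set_mem Tf /set_mem Tg; apply/mem_set => m m0.
  have [[Cf pf] [Cg pg]] := (Tf m m0, Tg m m0).
  split=> [k|]; first exact: cis_CnD.
  exact: le_lt_trans (T_normD m0 Cf Cg) (lte_add_pinfty pf pg).
- move=> z f /set_mem Tf; apply/mem_set => m m0; have [Cf pf] := Tf m m0.
  split=> [k|]; first exact: cis_CnZ.
  apply: le_lt_trans (T_normZ _ m0 Cf) _.
  by rewrite lte_mul_pinfty ?lee_fin ?cabs_ge0.
Qed.

End SpacesTheory.

Record Tspace (R : realType) (W : weights R) := MkT {
  Tval :> nat -> R -> cplx R ;
  _ : Tval \in Tset W }.

Section TspaceInstances.
Context {R : realType} (W : weights R).
HB.instance Definition _ := [isSub for @Tval R W].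
HB.instance Definition _ := [Choice of Tspace W by <:].
HB.instance Definition _ :=
  GRing.SubChoice_isSubLmodule.Build R[i] (nat -> R -> cplx R)
    (fun f => f \in Tset W) (Tspace W) (Tset_closed W).

Definition T_ball (m : nat) (f : Tspace W) (e : R) : set (Tspace W) :=
  [set g : Tspace W | (T_norm W m (\val g - \val f)%R < e%:E)%E].

Definition T_balls : set_system (Tspace W) :=
  [set B | exists m f e, [/\ (0 < m)%N, 0 < e & B = T_ball m f e]].

(* The projective limit topology, generated by the open balls of all the norms
   T_norm m with m >= 1 *)
HB.instance Definition _ := isSubBaseTopological.Build (Tspace W) T_balls id.

End TspaceInstances.

(* B is bounded if it is absorbed by every neighbourhood of 0. *)
Definition vn_bounded (R : realType) (E : preTopologicalLmodType R[i])
    (B : set E) : Prop :=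
  forall U : set E, nbhs 0 U -> exists2 r : R, 0 < r &
    forall t : R, r < t -> B `<=` [set t%:C *: v | v in U].

Definition Tdual_set (R : realType) (W : weights R) : set (Tspace W -> cplx R) :=
  [set S : Tspace W -> cplx R | linear S /\ continuous S].

Record Tdual (R : realType) (W : weights R) := MkTdual {
  Tdualval :> Tspace W -> cplx R ;
  _ : Tdualval \in @Tdual_set R W }.

Section TdualInstances.
Context {R : realType} (W : weights R).

Lemma Tdual_closed : GRing.subsemimod_closed (mem (@Tdual_set R W)).
Proof.
split; first split.
- apply/mem_set; split; last by move=> x; exact: cst_continuous.
  by move=> a f g /=; rewrite scaler0 addr0.
- move=> S S' /set_mem[lS cS] /set_mem[lS' cS']; apply/mem_set; split.
    by move=> a f g; rewrite !addrfctE lS lS' scalerDr addrACA.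
  by move=> f; exact: (cvgD (cS f) (cS' f)).
- move=> z S /set_mem[lS cS]; apply/mem_set; split.
    by move=> a f g; rewrite !scalrfctE lS scalerDr !scalerA mulrC.
  move=> f; have H := cvgM (cvg_cst (z : cplx R)) (cS f).
  exact: H.
Qed.

HB.instance Definition _ := [isSub for @Tdualval R W].
HB.instance Definition _ := [Choice of Tdual W by <:].
HB.instance Definition _ :=
  GRing.SubChoice_isSubLmodule.Build R[i] (Tspace W -> cplx R)
    (fun S => S \in @Tdual_set R W) (Tdual W) Tdual_closed.

(* The strong topology: uniform convergence on the bounded subsets of T *)
HB.instance Definition _ := Topological.copy (Tdual W)
  (initial_topology (fun S : Tdual W =>
     (\val S : {family @vn_bounded R (Tspace W), Tspace W -> cplx R}))).
End TdualInstances.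

Section WeightsTheory.
Context {R : realType} (W : weights R).

Let phi_conv m (t a b : R) : (0 < m)%N -> 0 <= t -> t <= 1 ->
  phi W m (t * a + (1 - t) * b) <= t * phi W m a + (1 - t) * phi W m b.
Proof.
move=> m0 t0 t1; apply: (@phi_convex _ W _ m0 (Itv01 t0 t1) a b); exact: mem_set.
Qed.

Lemma phi_linear_bound m (y : R) : (0 < m)%N ->
  exists B, forall x, y * x - phi W m x <= B.
Proof.
move=> m0.
have [B0 _ HB0] : at_infinity [set x | `|y| <= phi W m x / `|x|].
  by apply: (@phi_superlinear _ W _ m0 [set r | `|y| <= r]); exact: nbhs_pinfty_ge.
pose B1 := Num.max B0 1.
have B1gt0 : 0 < B1 by rewrite lt_max ltr01 orbT.
pose K := `|phi W m (- B1)| + `|phi W m B1|.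
exists (`|y| * B1 - 2 * phi W m 0 + K + `|2 * phi W m 0|) => x.
have yx : y * x <= `|y| * `|x| by rewrite -normrM ler_norm.
have K0 : 0 <= K by rewrite addr_ge0.
have N0 := ler_norm (2 * phi W m 0); have N1 := normr_ge0 (2 * phi W m 0).
have [xB|xB] := ltP B1 `|x|.
  have x0 : 0 < `|x| by apply: lt_trans xB.
  have : `|y| <= phi W m x / `|x|.
    by apply: HB0 => /=; apply: le_lt_trans xB; rewrite le_max lexx.
  rewrite ler_pdivlMr// => h.
  have := mulr_ge0 (normr_ge0 y) (ltW B1gt0); lra.
have /andP[xl xr] : - B1 <= x <= B1 by rewrite -ler_norml.
pose t := (x + B1) / (2 * B1).
have t0 : 0 <= t by rewrite divr_ge0//; lra.
have t1 : t <= 1 by rewrite ler_pdivrMr; lra.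
have h1 := phi_conv (- B1) B1 m0 t0 t1.
have E1 : t * - B1 + (1 - t) * B1 = - x by rewrite /t; field; rewrite gt_eqF.
rewrite E1 in h1.
have h2 : t * phi W m (- B1) <= `|phi W m (- B1)|.
  apply: le_trans (ler_norm _) _; rewrite normrM ler_piMl//.
  by rewrite ger0_norm.
have h3 : (1 - t) * phi W m B1 <= `|phi W m B1|.
  apply: le_trans (ler_norm _) _; rewrite normrM ler_piMl//.
  by rewrite ger0_norm; lra.
have h4 : phi W m 0 <= 2^-1 * phi W m x + (1 - 2^-1) * phi W m (- x).
  have -> : 0 = 2^-1 * x + (1 - 2^-1) * (- x) by field.
  by apply: phi_conv => //; lra.
have h5 : `|y| * `|x| <= `|y| * B1 by rewrite ler_wpM2l.
rewrite /K in K0 *; lra.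
Qed.

Lemma phit_mono m (y : R) : (0 < m)%N -> phit W m y <= phit W m.+1 y.
Proof.
move=> m0; apply: sup_le; last first.
- split; first by eexists; exists 0; reflexivity.
  by have [B HB] := phi_linear_bound y (ltn0Sn m); exists B => _ [x ->]; exact: HB.
- by eexists; exists 0; reflexivity.
move=> _ [x ->]; apply/downP; exists (y * x - phi W m.+1 x); first by exists x.
have := phi_gap W m0 x; have : 0 <= ln (1 + `|x|) by rewrite ln_ge0// lerDl.
lra.
Qed.

Lemma coef_ratio m : (0 < m)%N ->
  exists2 K, 0 < K & forall k, coef W m k <= K * coef W m.+1 k.
Proof.
move=> m0; have := coef_summable W m0; set s := (X in (X < _)%E) => soo.
have c0 k := coef_gt0 W m0 k; have c1 k := coef_gt0 W (ltn0Sn m) k.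
have r0 k : (0 <= (coef W m k / coef W m.+1 k)%:E)%E.
  by rewrite lee_fin divr_ge0// ltW.
have s0 : (0 <= s)%E by apply: nneseries_ge0.
have sfin : s \is a fin_num by rewrite ge0_fin_numE.
exists (fine s + 1) => [|k]; first by rewrite ltr_wpDl// fine_ge0.
rewrite -ler_pdivrMr// -lee_fin EFinD fineK//.
apply: (@le_trans _ _ s); last by rewrite leeDl// lee_fin.
rewrite /s (@nneseriesD1 _ _ k)//; rewrite leeDl//; exact: nneseries_ge0.
Qed.

Local Open Scope ereal_scope.
Local Notation C := (cplx R).

Let wt m k (l : C) := (coef W m k * (1 + cabs l) ^+ m * expR (phit W m (Im l)))%R.

Let wt_gt0 m k (l : C) : (0 < m)%N -> (0 < wt m k l)%R.
Proof.
by move=> m0; rewrite !mulr_gt0 ?expR_gt0 ?coef_gt0 ?exprn_gt0 ?ltr_pwDl ?cabs_ge0.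
Qed.

Lemma Pnorm_ub m (g : nat -> C -> C) k (l : C) :
  (cabs (g k l) / wt m k l)%:E <= P_norm W m g.
Proof. by apply: ereal_sup_ubound; exists k, l. Qed.

Lemma Pnorm_ge0 m g : (0 < m)%N -> 0 <= P_norm W m g.
Proof.
move=> m0; apply: le_trans (Pnorm_ub m g 0%N 0%R).
by rewrite lee_fin divr_ge0 ?cabs_ge0// ltW// wt_gt0.
Qed.

Lemma Pnorm_mono m g : (0 < m)%N -> P_norm W m g < +oo -> P_norm W m.+1 g < +oo.
Proof.
move=> m0 goo; have [K K0 HK] := coef_ratio m0.
apply: (@le_lt_trans _ _ (K%:E * P_norm W m g)); last first.
  by rewrite lte_mul_pinfty// lee_fin ltW.
apply: ge_ereal_sup => _ [k [l ->]].
apply: le_trans (lee_wpmul2l _ (Pnorm_ub m g k l)); last by rewrite lee_fin ltW.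
rewrite -EFinM lee_fin -/(wt m.+1 k l) mulrCA ler_wpM2l ?cabs_ge0//.
rewrite ler_pdivlMr ?wt_gt0// mulrC ler_pdivrMr ?wt_gt0// /wt !mulrA.
apply: ler_pM; rewrite ?expR_ge0// ?ler_expR ?phit_mono//.
  by rewrite mulr_ge0 ?ltW ?coef_gt0 ?exprn_gt0 ?ltr_pwDl ?cabs_ge0.
apply: ler_pM; rewrite ?HK//; first by rewrite ltW ?coef_gt0.
  by rewrite exprn_ge0// addr_ge0 ?cabs_ge0.
by rewrite exprS ler_peMl ?exprn_ge0 ?addr_ge0 ?cabs_ge0// lerDl cabs_ge0.
Qed.

Lemma Pm_mono m n : (0 < m)%N -> (m <= n)%N -> Pm W m `<=` Pm W n.
Proof.
move=> m0 /subnKC <-; elim: (n - m)%N => [|d IH] g; first by rewrite addn0.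
move=> /IH[eg ng]; split; first exact: eg.
by rewrite addnS; apply: Pnorm_mono ng; rewrite addn_gt0 m0.
Qed.

Lemma Pm_add m g h : (0 < m)%N -> Pm W m g -> Pm W m h -> Pm W m (g + h)%R.
Proof.
move=> m0 [eg ng] [eh nh]; split=> [k z|]; first exact: derivableD (eg k z) (eh k z).
apply: le_lt_trans (lte_add_pinfty ng nh); apply: ge_ereal_sup => _ [k [l ->]].
apply: le_trans (leeD (Pnorm_ub m g k l) (Pnorm_ub m h k l)).
rewrite -EFinD lee_fin -/(wt m k l) -mulrDl ler_wpM2r ?invr_ge0 ?(ltW (wt_gt0 _ _ m0))//.
exact: cabsD.
Qed.

Lemma Pm_scale m (a : R[i]) g : (0 < m)%N -> Pm W m g -> Pm W m (a *: g)%R.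
Proof.
move=> m0 [eg ng]; split=> [k z|]; first exact: derivableZ (eg k z).
apply: (@le_lt_trans _ _ ((cabs a)%:E * P_norm W m g)); last first.
  by rewrite lte_mul_pinfty ?lee_fin ?cabs_ge0.
apply: ge_ereal_sup => _ [k [l ->]].
apply: le_trans (lee_wpmul2l _ (Pnorm_ub m g k l)); last by rewrite lee_fin cabs_ge0.
by rewrite -EFinM lee_fin [cabs _](cabsM a (g k l)) mulrA.
Qed.

Lemma Pset_closed : GRing.subsemimod_closed (mem (Pset W)).
Proof.
split; first split.
- apply/mem_set; exists 1%N => //; split=> [k z|]; first exact: derivable_cst.
  apply: (@le_lt_trans _ _ 0) => //; apply: ge_ereal_sup => _ [k [l ->]].
  by rewrite [cabs _](@cabs0 R) mul0r.
- move=> g h /set_mem[m m0 Pg] /set_mem[n n0 Ph]; apply/mem_set.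
  exists (maxn m n); first by rewrite leq_max m0.
  apply: Pm_add; first by rewrite leq_max m0.
    exact: Pm_mono m0 (leq_maxl m n) _ Pg.
  exact: Pm_mono n0 (leq_maxr m n) _ Ph.
- move=> a g /set_mem[m m0 Pg]; apply/mem_set; exists m => //; exact: Pm_scale.
Qed.

End WeightsTheory.

Record Pspace (R : realType) (W : weights R) := MkP {
  Pval :> nat -> cplx R -> cplx R ;
  _ : Pval \in Pset W }.

Definition absolutely_convex (R : realType) (E : lmodType R[i]) (V : set E) : Prop :=
  convex_set V /\ forall (a : R[i]) v, `|a| <= 1 -> V v -> V (a *: v).

Section PspaceInstances.
Context {R : realType} (W : weights R).

HB.instance Definition _ := [isSub for @Pval R W].
HB.instance Definition _ := [Choice of Pspace W by <:].
HB.instance Definition _ :=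
  GRing.SubChoice_isSubLmodule.Build R[i] (nat -> cplx R -> cplx R)
    (fun g => g \in Pset W) (Pspace W) (Pset_closed W).

(* The locally convex inductive limit topology: a base of neighbourhoods of 0 is
   formed by the absolutely convex sets whose trace on each P_m is a
   neighbourhood of 0 for the norm P_norm m.  Such sets are absorbing, since P
   is the union of the P_m. *)
Definition ind_nbhs0 (V : set (Pspace W)) : Prop :=
  absolutely_convex V /\
  forall m, (0 < m)%N -> exists2 e : R, 0 < e &
    forall g : Pspace W, (P_norm W m (\val g) < e%:E)%E -> V g.

Definition ind_open : set_system (Pspace W) :=
  [set U | forall g, U g -> exists2 V, ind_nbhs0 V &
     forall v, V v -> U (g + v)].

Lemma ind_openT : ind_open setT.
Proof.
move=> g _; exists setT => //; split; last by move=> m _; exists 1.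
by split=> // x y t _ _; exact: mem_set.
Qed.

Lemma ind_openI : setI_closed ind_open.
Proof.
move=> A B oA oB g [Ag Bg]; have [U [[cU bU] nU] UA] := oA g Ag.
have [V [[cV bV] nV] VB] := oB g Bg; exists (U `&` V).
  split; first split.
  - move=> x y t /set_mem[Ux Vx] /set_mem[Uy Vy]; apply/mem_set; split.
      by apply/set_mem/cU; exact/mem_set.
    by apply/set_mem/cV; exact/mem_set.
  - by move=> a v a1 [Uv Vv]; split; [exact: bU|exact: bV].
  move=> m m0; have [e e0 He] := nU m m0; have [d d0 Hd] := nV m m0.
  exists (Num.min e d); first by rewrite lt_min e0.
  move=> h; rewrite EFin_min lt_min => /andP[h1 h2].
  by split; [exact: He|exact: Hd].
by move=> v [Uv Vv]; split; [exact: UA|exact: VB].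
Qed.

Lemma ind_open_bigU (I : Type) (f : I -> set (Pspace W)) :
  (forall i, ind_open (f i)) -> ind_open (\bigcup_i f i).
Proof.
move=> of_ g [i _ fg]; have [V nV Vf] := of_ i g fg; exists V => // v Vv.
by exists i => //; exact: Vf.
Qed.

HB.instance Definition _ := isOpenTopological.Build (Pspace W)
  ind_openT ind_openI ind_open_bigU.

End PspaceInstances.

Section Exponentials.
Context {R : realType}.

Let is_derive_lin (w x : R) : is_derive x 1 (fun y => w * y) w.
Proof.
have H : is_derive x 1 (w \*: @id R) (w *: (1 : R)) by exact: is_deriveZ.
by apply: is_derive_eq H _; rewrite /GRing.scale/= mulr1.
Qed.

Let is_derive_expc (w1 w2 a b x : R) :
  is_derive x 1 (fun y => expR (w1 * y) * (a * cos (w2 * y) + b * sin (w2 * y)))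
   (expR (w1 * x) * ((w1 * a + w2 * b) * cos (w2 * x)
      + (w1 * b - w2 * a) * sin (w2 * x))).
Proof.
have dE := is_derive1_comp (is_derive_expR (w1 * x)) (is_derive_lin w1 x).
have dC := is_derive1_comp (is_derive_cos (w2 * x)) (is_derive_lin w2 x).
have dS := is_derive1_comp (is_derive_sin (w2 * x)) (is_derive_lin w2 x).
apply: is_derive_eq (is_deriveM dE (is_deriveD (is_deriveZ a dC) (is_deriveZ b dS))) _.
rewrite addrfctE /= /GRing.scale/=; ring.
Qed.

Let Re_expE (z w : R[i]) : (fun x : R => Re (z * cexp (w * x%:C))) =
  (fun x => expR (Re w * x) * (Re z * cos (Im w * x) + (- Im z) * sin (Im w * x))).
Proof.
apply/funext => x; case: z w => [a b] [c d] /=.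
rewrite !mulr0 subr0 add0r; ring.
Qed.

Let Im_expE (z w : R[i]) : (fun x : R => Im (z * cexp (w * x%:C))) =
  (fun x => expR (Re w * x) * (Im z * cos (Im w * x) + Re z * sin (Im w * x))).
Proof.
apply/funext => x; case: z w => [a b] [c d] /=.
rewrite !mulr0 subr0 add0r; ring.
Qed.

Let dRe (z w : R[i]) (x : R) : is_derive x 1 (fun x : R => Re (z * cexp (w * x%:C)))
  (Re (z * w * cexp (w * x%:C))).
Proof.
rewrite [X in is_derive _ _ _ X](congr1 (@^~ x) (Re_expE (z * w) w)) Re_expE.
apply: is_derive_eq (is_derive_expc _ _ _ _ _) _.
case: z w => [a b] [c d] /=; ring.
Qed.

Let dIm (z w : R[i]) (x : R) : is_derive x 1 (fun x : R => Im (z * cexp (w * x%:C)))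
  (Im (z * w * cexp (w * x%:C))).
Proof.
rewrite [X in is_derive _ _ _ X](congr1 (@^~ x) (Im_expE (z * w) w)) Im_expE.
apply: is_derive_eq (is_derive_expc _ _ _ _ _) _.
case: z w => [a b] [c d] /=; ring.
Qed.

Let derive1n_Re n (z w : R[i]) : derive1n n (fun x : R => Re (z * cexp (w * x%:C))) =
  (fun x => Re (z * w ^+ n * cexp (w * x%:C))).
Proof.
elim: n => [|n IH]; first by rewrite expr0 mulr1.
rewrite derive1nS IH; apply/funext => x; rewrite derive1E.
by rewrite (@derive_val _ _ _ _ _ _ _ (dRe _ _ _)) exprSr mulrA.
Qed.

Let derive1n_Im n (z w : R[i]) : derive1n n (fun x : R => Im (z * cexp (w * x%:C))) =
  (fun x => Im (z * w ^+ n * cexp (w * x%:C))).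
Proof.
elim: n => [|n IH]; first by rewrite expr0 mulr1.
rewrite derive1nS IH; apply/funext => x; rewrite derive1E.
by rewrite (@derive_val _ _ _ _ _ _ _ (dIm _ _ _)) exprSr mulrA.
Qed.

Let cexp1 (w : R[i]) : (fun x : R => cexp (w * x%:C)) =
  (fun x : R => 1 * cexp (w * x%:C)).
Proof. by apply/funext => x; rewrite mul1r. Qed.

Lemma cis_Cn_cexp n (w : R[i]) : cis_Cn n (fun x : R => cexp (w * x%:C)).
Proof.
rewrite cexp1; split; split=> [a _ x|].
- rewrite derive1n_Re; have [D _] := dRe (1 * w ^+ a) w x; exact: D.
- rewrite derive1n_Re => x; apply: differentiable_continuous.
  have [D _] := dRe (1 * w ^+ n) w x; exact/derivable1_diffP.
- rewrite derive1n_Im; have [D _] := dIm (1 * w ^+ a) w x; exact: D.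
- rewrite derive1n_Im => x; apply: differentiable_continuous.
  have [D _] := dIm (1 * w ^+ n) w x; exact/derivable1_diffP.
Qed.

Lemma cderiv_cexp n (w : R[i]) (x : R) :
  cderiv n (fun x : R => cexp (w * x%:C)) x = w ^+ n * cexp (w * x%:C).
Proof.
rewrite cexp1 /cderiv derive1n_Re derive1n_Im mul1r.
by case: (w ^+ n * _).
Qed.

Lemma cabs_cexp (z : R[i]) : cabs (cexp z) = expR (Re z).
Proof.
rewrite /cabs /cexp /= !exprMn -mulrDr cos2Dsin2 mulr1 sqrtr_sqr.
by rewrite ger0_norm ?expR_ge0.
Qed.

Lemma cabsX (z : R[i]) n : cabs (z ^+ n) = cabs z ^+ n.
Proof.
elim: n => [|n IH]; first by rewrite !expr0; exact: Normc.normc1.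
by rewrite !exprS cabsM IH.
Qed.

Definition exp_seq (k : nat) (l : cplx R) : nat -> R -> cplx R :=
  fun j x => if j == k then cexp (- 'i%C * l * x%:C) else 0.

Lemma exp_seq_Tset (W : weights R) k l : exp_seq k l \in Tset W.
Proof.
have qexp m : (0 < m)%N -> (q_norm W m (fun x => cexp (- 'i%C * l * x%:C)%R) < +oo)%E.
  move=> m0; have [B HB] := phi_linear_bound W (Im l) m0.
  apply: (@le_lt_trans _ _ ((1 + cabs (- 'i%C * l)) ^+ m * expR B)%R%:E); last exact: ltry.
  apply: ge_ereal_sup => _ [x [a [am ->]]]; rewrite lee_fin cderiv_cexp cabsM cabs_cexp.
  rewrite -mulrA -expRN -expRD ler_pM ?exprn_ge0 ?cabs_ge0 ?expR_ge0//.
    apply: (@le_trans _ _ ((1 + cabs (- 'i%C * l)) ^+ a)).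
      by rewrite cabsX lerXn2r ?nnegrE ?addr_ge0 ?cabs_ge0// lerDr.
    by rewrite ler_weXn2l// lerDl cabs_ge0.
  rewrite ler_expR; apply: le_trans (HB x); rewrite lerD2r.
  by case: l {HB} => a' b' /=; rewrite le_eqVlt; apply/orP; left; apply/eqP; ring.
apply/mem_set => m m0; split=> [j|].
  rewrite /exp_seq; case: eqP => _; [exact: cis_Cn_cexp|exact: cis_Cn0].
have g0 j : (0 <= (coef W m j)%:E * q_norm W m (exp_seq k l j))%E.
  by rewrite mule_ge0 ?q_norm_ge0// lee_fin ltW// coef_gt0.
rewrite /T_norm (@nneseriesD1 _ _ k)//= eseries0 ?adde0.
  rewrite lte_mul_pinfty ?lee_fin ?(ltW (coef_gt0 W m0 k))//.
  by rewrite /exp_seq eqxx; exact: qexp.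
move=> j _ jk; rewrite /exp_seq (negbTE jk).
by rewrite [q_norm _ _ _](@q_norm0 R W m) mule0.
Qed.

End Exponentials.

Section Transform.
Context {R : realType} (W : weights R).

Definition exp_T (k : nat) (l : cplx R) : Tspace W := MkT (exp_seq_Tset W k l).

Definition hat (S : Tdual W) : nat -> cplx R -> cplx R :=
  fun k l => S (exp_T k l).

End Transform.

Definition topological_isomorphism (R : realType)
    (E F : preTopologicalLmodType R[i]) (f : E -> F) : Prop :=
  linear f /\ exists g : F -> E,
    [/\ cancel f g, cancel g f, continuous f & continuous g].

(* Main.v *)
(* Surjectivity.  Let |g(l)| <= c (1 + |l|)^m exp(phit_m (Im l)).  Writing
   g(l) = g(a) kappa(l - a) + (l - a) G(l) with kappa(w) = int_0^1 exp(-i w x) dx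
   trades one power of |l| for one derivative: if S represents G, then
   u |-> g(a) int_0^1 exp(i a x) u(x) dx + S(i u' - a u) represents g.  After m + 2
   such steps, at a = m + 1, ..., 0, g decays like |l|^-2 on horizontal lines, so
   its inverse Fourier transform h does not depend on the line of integration
   (Cauchy).  Taking for Im l a subgradient of phi_m at x gives
   |h(x)| <= C exp(- phi_m(x)), because phi_m is its own biconjugate, and S is
   integration against h.  The gap phi_m - phi_(m+1) >= ln(1 + |x|) makes all
   estimates uniform at the cost of passing from m to m + 2.

   Injectivity and continuity.  Cutting f_k off to [-r, r] and convolving with a
   power of the trigonometric polynomial (1 + cos(pi t / D)) / 2 gives finite-rank
   operators Q, with values in the span of the exponentials, such that
   p_m(f - Q f) <= eps p_(m+2)(f) for all m <= n; so the exponentials are total.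
   If Q_n is such an operator with eps = delta_n, delta_n decreasing fast, and
   P_n = Q_(n+1) - Q_n, then the images of the unit balls of p_(n+2) under
   P_n / tau_n form a bounded set of T.  A functional S that is at most 1 on it
   has small S o P_n, and S = sum_n 2^-(n+1) (2^(n+1) S o P_n) is a convex
   combination of functionals whose transforms lie in a given absolutely convex
   neighbourhood of 0. *)
Require Import Defs.
From mathcomp Require Import all_boot all_order all_algebra.
From mathcomp Require Import complex.
From mathcomp Require Import all_classical all_reals all_analysis.
From mathcomp Require Import measurable_realfun ring lra.
Import Order.TTheory GRing.Theory Num.Theory.
Import numFieldNormedType.Exports.
Local Open Scope classical_set_scope.
Local Open Scope ring_scope.


(** A difference quotient is shown to be continuous at its centre, not derivable there. This shapes
    the complex analysis: the centres lie on the real axis, so that after any number of division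
    steps the function is still derivable off that axis and continuous on it; line integrals are
    moved across horizontal lines on which only continuity is known; and a functional first gets the
    prescribed transform off the real axis, the axis itself being reached by continuity. The
    inversion formula treats the half-lines x >= 0 and x <= 0 separately, with the contour raised,
    respectively lowered, by 1 relative to the point l. Each half yields a Cauchy kernel on its own
    line, and equating the two lines is a contour integral around l. The division steps work because
    kappa is 1 at 0, decays like 1/|w| and is O(exp(|Im w|)), which exp(phit_m) dominates since
    phit_m(s) >= |s| - const. Their constants are linear in the bound on g and otherwise independent
    of g, so surjectivity comes with an estimate on each P_m, and the inverse is continuous without
    an open mapping theorem. *)

Section PaleyWiener.
Set Implicit Arguments.
Unset Strict Implicit.
Unset Printing Implicit Defensive.
Local Open Scope complex_scope.
Local Open Scope ring_scope.
Local Notation Re := complex.Re.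
Local Notation Im := complex.Im.

(** * Complex-valued functions and integrals *)

Section ComplexBasics.
Context {R : realType}.
Local Notation C := (cplx R).
Implicit Types z w : R[i].

Lemma normc_cabs z : `|z| = (cabs z)%:C.
Proof. by case: z. Qed.

Lemma cabsN z : cabs (- z) = cabs z.
Proof. by rewrite /cabs; case: z => a b /=; rewrite !sqrrN. Qed.

Lemma cabsB z w : cabs (z - w) = cabs (w - z).
Proof. by rewrite -cabsN opprB. Qed.

Lemma cabs_real (x : R) : cabs x%:C = `|x|.
Proof. by rewrite /cabs /= expr0n addr0 sqrtr_sqr. Qed.

Lemma cabs1 : cabs (1 : R[i]) = 1.
Proof. exact: Normc.normc1. Qed.

Lemma cabs_eq0 z : cabs z = 0 -> z = 0.
Proof. exact: Normc.eq0_normc. Qed.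

Lemma cabs_gt0 z : z != 0 -> 0 < cabs z.
Proof.
by move=> z0; rewrite lt_def cabs_ge0 andbT; apply: contra z0 => /eqP/cabs_eq0/eqP.
Qed.

Lemma cabsV z : cabs z^-1 = (cabs z)^-1.
Proof.
have [->|z0] := eqVneq z 0; first by rewrite invr0 cabs0 invr0.
have c0 : cabs z != 0 by rewrite gt_eqF// cabs_gt0.
by apply: (mulfI c0); rewrite -cabsM !divff ?cabs1.
Qed.

Lemma Re_le_cabs z : `|Re z| <= cabs z.
Proof.
case: z => a b; rewrite /cabs /= -[leLHS]sqrtr_sqr ler_sqrt ?lerDl ?sqr_ge0//.
by rewrite addr_ge0 ?sqr_ge0.
Qed.

Lemma Im_le_cabs z : `|Im z| <= cabs z.
Proof.
case: z => a b; rewrite /cabs /= -[leLHS]sqrtr_sqr ler_sqrt ?lerDr ?sqr_ge0//.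
by rewrite addr_ge0 ?sqr_ge0.
Qed.

Lemma cabs_le_ReIm z : cabs z <= `|Re z| + `|Im z|.
Proof.
have {1}-> : z = (Re z)%:C + 'i * (Im z)%:C by case: z => a b; simpc.
apply: le_trans (cabsD _ _) _; rewrite cabsM !cabs_real.
have -> : cabs ('i : R[i]) = 1 by rewrite /cabs/= expr0n add0r expr1n sqrtr1.
by rewrite mul1r.
Qed.

Lemma lt_cabs_norm z (e : R) : (cabs z < e) = (`|z| < e%:C).
Proof. by rewrite normc_cabs ltcR. Qed.

(** The norm of [C] takes its values in [R[i]], so a radius is a positive element of [R[i]], hence
    real. This lemma and those derived from it trade such radii for elements of [R]. *)
Lemma nbhs_cplxP (z : C) (A : set C) :
  nbhs z A <-> exists2 e : R, 0 < e & forall w : C, cabs (w - z) < e -> A w.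
Proof.
split.
  move=> /nbhs_normP[e /= e0 H].
  have er : e \is Num.real by rewrite gtr0_real.
  have eE : e = (Re e)%:C by rewrite RRe_real.
  exists (Re e); first by rewrite -ltcR -eE.
  move=> w we; apply: H => /=; rewrite -opprB normrN -[X in _ < X]/(e) eE.
  by rewrite -lt_cabs_norm.
move=> [e e0 H]; apply: (proj2 (@nbhs_normP _ C z A)); exists e%:C; rewrite /= ?ltcR//.
by move=> w /= we; apply: H; rewrite lt_cabs_norm -normrN opprB.
Qed.

Lemma continuous_cplxP {T : topologicalType} (f : T -> C) (x : T) :
  {for x, continuous f} <->
  forall e : R, 0 < e -> nbhs x [set y | cabs (f y - f x) < e].
Proof.
split=> [cf e e0|H].
  apply: (cf [set w | cabs (w - f x) < e]); apply/nbhs_cplxP; exists e => //.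
move=> A /nbhs_cplxP[e e0 He]; apply: filterS (H e e0) => y /= ye.
exact: He.
Qed.

Lemma continuous_cplx_epsP (f : C -> C) (z : C) :
  {for z, continuous f} <->
  forall e : R, 0 < e -> exists2 d : R, 0 < d &
    forall w, cabs (w - z) < d -> cabs (f w - f z) < e.
Proof.
rewrite continuous_cplxP; split=> H e e0; first by move/nbhs_cplxP: (H e e0).
by apply/nbhs_cplxP; exact: H.
Qed.

Lemma derivable_cplxP (f : C -> C) (z : C) :
  derivable f z 1 <-> exists l : R[i], forall e : R, 0 < e -> exists2 d : R, 0 < d &
    forall h : R[i], cabs h < d -> cabs (f (z + h) - f z - l * h) <= e * cabs h.
Proof.
split.
  move=> /cvg_ex[l Hl]; exists l => e e0.
  have /(_ [set w | cabs (w - l) < e]) := Hl; rewrite /= => /(_ _)/= [].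
    by apply/nbhs_cplxP; exists e.
  move=> d0 /= d0gt H.
  have dE : d0 = (Re d0)%:C by rewrite RRe_real// gtr0_real.
  exists (Re d0); first by rewrite -ltcR -dE.
  move=> h hd; have [->|h0] := eqVneq h 0.
    by rewrite addr0 subrr mulr0 subr0 cabs0 mulr0.
  have := H h; rewrite /= sub0r normrN dE -lt_cabs_norm => /(_ hd h0).
  rewrite /GRing.scale /= mulr1 => /ltW H1.
  have -> : f (z + h) - f z - l * h = (h^-1 * (f (h + z) - f z) - l) * h.
    by rewrite mulrBl mulrAC mulVf// mul1r (addrC h z).
  by rewrite cabsM ler_wpM2r ?cabs_ge0.
move=> [l Hl]; apply/cvg_ex; exists l => A /nbhs_cplxP[e e0 HA].
have [d d0 Hd] := Hl (e / 2) (divr_gt0 e0 (ltr0Sn _ 1)).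
exists d%:C; first by rewrite /= ltcR.
move=> h /=; rewrite sub0r normrN -lt_cabs_norm => hd h0; apply: HA.
have -> : (h^-1 *: (f (h *: (1 : C) + z) - f z) - l) =
    h^-1 * (f (z + h) - f z - l * h).
  by rewrite mulrBr mulrCA mulVf// mulr1 /GRing.scale /= mulr1 (addrC h z).
rewrite cabsM cabsV.
apply: (@le_lt_trans _ _ (e / 2)); last by rewrite ltr_pdivrMr// ltr_pMr// ltr1n.
by rewrite mulrC ler_pdivrMr ?cabs_gt0// Hd.
Qed.

Lemma derivable_continuous_cplx (f : C -> C) (z : C) :
  derivable f z 1 -> {for z, continuous f}.
Proof.
move=> /derivable_cplxP[l Hl]; apply/continuous_cplx_epsP => e e0.
have [d d0 Hd] := Hl 1 ltr01.
have L0 : 0 < cabs l + 1 + 1 by rewrite -addrA ltr_wpDl ?cabs_ge0.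
exists (Num.min d (e / (cabs l + 1 + 1))); first by rewrite lt_min d0 divr_gt0.
move=> w; rewrite lt_min => /andP[wd we].
have := Hd _ wd; rewrite subrKC mul1r => H1.
have -> : f w - f z = (f w - f z - l * (w - z)) + l * (w - z) by rewrite subrK.
apply: le_lt_trans (cabsD _ _) _; rewrite cabsM.
apply: (@le_lt_trans _ _ ((cabs l + 1) * cabs (w - z))).
  by rewrite mulrDl mul1r addrC lerD2l.
rewrite ltr_pdivlMr// in we; apply: le_lt_trans we; rewrite mulrC ler_wpM2l ?cabs_ge0//.
by rewrite lerDl.
Qed.

Lemma cexpD z w : cexp (z + w) = cexp z * cexp w.
Proof.
case: z w => [a b] [c d]; rewrite /cexp /= expRD cosD sinD; simpc.
by congr (_ +i* _); ring.
Qed.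

Lemma cexp0 : cexp (0 : R[i]) = 1.
Proof. by rewrite /cexp /= expR0 cos0 sin0 mulr0 mulr1. Qed.

End ComplexBasics.

Section ContinuousCplx.
Context {R : realType} {T : topologicalType}.
Local Notation C := (cplx R).
Lemma continuous_cplxD (f g : T -> C) (x : T) : {for x, continuous f} ->
  {for x, continuous g} -> {for x, continuous (fun y => f y + g y : C)}.
Proof. by move=> cf cg; exact: (cvgD cf cg). Qed.

Lemma continuous_cplxB (f g : T -> C) (x : T) : {for x, continuous f} ->
  {for x, continuous g} -> {for x, continuous (fun y => f y - g y : C)}.
Proof. by move=> cf cg; exact: (cvgB cf cg). Qed.

Lemma continuous_cplxM (f g : T -> C) (x : T) : {for x, continuous f} ->
  {for x, continuous g} -> {for x, continuous (fun y => f y * g y : C)}.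
Proof. by move=> cf cg; exact: (cvgM cf cg). Qed.

Lemma continuous_cplxV (f : T -> C) (x : T) : {for x, continuous f} ->
  f x != 0 -> {for x, continuous (fun y => (f y)^-1 : C)}.
Proof. by move=> cf f0; exact: (cvgV f0 cf). Qed.
End ContinuousCplx.

(** * Componentwise integration of complex-valued functions *)

Section ComplexIntegral.
Context {R : realType}.
Local Notation C := (cplx R).
Local Notation mu := (@lebesgue_measure R).
Implicit Types (A : set (measurableTypeR R)) (f g : R -> C).

Definition cint A f : C :=
  (\int[mu]_(x in A) Re (f x)) +i* (\int[mu]_(x in A) Im (f x)).

Definition cintegrable A f : Prop :=
  mu.-integrable A (fun x => (Re (f x))%:E) /\
  mu.-integrable A (fun x => (Im (f x))%:E).

Lemma eq_cint A f g : (forall x, A x -> f x = g x) -> cint A f = cint A g.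
Proof.
by move=> fg; congr (_ +i* _); apply: eq_Rintegral => x /set_mem Ax; rewrite fg.
Qed.

Lemma eq_cintegrable A f g : measurable A -> (forall x, A x -> f x = g x) ->
  cintegrable A f -> cintegrable A g.
Proof.
move=> mA fg [rf If]; split; [move: rf|move: If]; apply: eq_integrable => // x /set_mem Ax;
  by rewrite /= fg.
Qed.

Lemma ReDE (z w : R[i]) : Re (z + w) = Re z + Re w. Proof. by case: z w => a b [c d]. Qed.
Lemma ImDE (z w : R[i]) : Im (z + w) = Im z + Im w. Proof. by case: z w => a b [c d]. Qed.
Lemma ReNE (z : R[i]) : Re (- z) = - Re z. Proof. by case: z. Qed.
Lemma ImNE (z : R[i]) : Im (- z) = - Im z. Proof. by case: z. Qed.
Lemma ReME (z w : R[i]) : Re (z * w) = Re z * Re w - Im z * Im w.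
Proof. by case: z w => a b [c d]. Qed.
Lemma ImME (z w : R[i]) : Im (z * w) = Re z * Im w + Im z * Re w.
Proof. by case: z w => a b [c d]. Qed.

Lemma cplx_eq (z w : R[i]) : Re z = Re w -> Im z = Im w -> z = w.
Proof. by case: z w => a b [c d] /= -> ->. Qed.

Lemma cintegrableD A f g : measurable A -> cintegrable A f -> cintegrable A g ->
  cintegrable A (fun x => f x + g x).
Proof.
move=> mA [rf If] [rg ig]; split.
  by apply: eq_integrable (integrableD mA rf rg) => // x _; rewrite /= ReDE EFinD.
by apply: eq_integrable (integrableD mA If ig) => // x _; rewrite /= ImDE EFinD.
Qed.

Lemma cintD A f g : measurable A -> cintegrable A f -> cintegrable A g ->
  cint A (fun x => f x + g x) = cint A f + cint A g.
Proof.
move=> mA [rf If] [rg ig]; apply: cplx_eq; rewrite ?ReDE ?ImDE /= -RintegralD//;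
  by apply: eq_Rintegral => x _; rewrite ?ReDE ?ImDE.
Qed.

Lemma cintegrableZ A (z : R[i]) f : measurable A -> cintegrable A f ->
  cintegrable A (fun x => z * f x).
Proof.
move=> mA [rf If]; split.
  have H := integrableB mA (integrableZl mA (Re z) rf) (integrableZl mA (Im z) If).
  by apply: eq_integrable H => // x _; rewrite /= ReME EFinB !EFinM.
have H := integrableD mA (integrableZl mA (Re z) If) (integrableZl mA (Im z) rf).
by apply: eq_integrable H => // x _; rewrite /= ImME EFinD !EFinM.
Qed.

Lemma cintZ A (z : R[i]) f : measurable A -> cintegrable A f ->
  cint A (fun x => z * f x) = z * cint A f.
Proof.
move=> mA [rf If]; have H := integrableZl mA.
have Hr k := H _ _ k _ rf; have Hi k := H _ _ k _ If.
apply: cplx_eq; rewrite ?ReME ?ImME /=.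
  rewrite -!RintegralZl// -RintegralB//; [|exact: Hr|exact: Hi].
  by apply: eq_Rintegral => x _; rewrite ReME.
rewrite -!RintegralZl// -RintegralD//; [|exact: Hi|exact: Hr].
by apply: eq_Rintegral => x _; rewrite ImME.
Qed.

Lemma cintegrableN A f : measurable A -> cintegrable A f ->
  cintegrable A (fun x => - f x).
Proof.
move=> mA cf; apply: eq_cintegrable (cintegrableZ (-1) mA cf) => // x _.
by rewrite mulN1r.
Qed.

Lemma cintegrableB A f g : measurable A -> cintegrable A f -> cintegrable A g ->
  cintegrable A (fun x => f x - g x).
Proof. by move=> mA cf cg; apply: cintegrableD => //; exact: cintegrableN. Qed.

Lemma cintN A f : measurable A -> cintegrable A f ->
  cint A (fun x => - f x) = - cint A f.
Proof.
move=> mA cf; rewrite -mulN1r -cintZ//.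
by apply: eq_cint => x _; rewrite mulN1r.
Qed.

Lemma cintB A f g : measurable A -> cintegrable A f -> cintegrable A g ->
  cint A (fun x => f x - g x) = cint A f - cint A g.
Proof.
by move=> mA cf cg; rewrite cintD ?cintN//; exact: cintegrableN.
Qed.

(** Real and imaginary parts are estimated separately, which costs the factor 2; no constant below
    has to be sharp. *)
Lemma le_cint A f (g : R -> R) : measurable A -> cintegrable A f ->
  mu.-integrable A (EFin \o g) -> (forall x, A x -> cabs (f x) <= g x) ->
  cabs (cint A f) <= 2 * \int[mu]_(x in A) g x.
Proof.
move=> mA [rf If] ig fg; apply: le_trans (cabs_le_ReIm _) _ => /=.
have H (h : R -> R) : mu.-integrable A (EFin \o h) ->
    (forall x, A x -> `|h x| <= g x) ->
    `|\int[mu]_(x in A) h x| <= \int[mu]_(x in A) g x.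
  move=> ih hg; apply: le_trans (le_normr_Rintegral mA ih) _.
  apply: le_Rintegral => //; exact: integrable_norm.
rewrite mulr_natl mulr2n lerD// H// => x Ax; apply: le_trans (fg x Ax).
  exact: Re_le_cabs.
exact: Im_le_cabs.
Qed.

Lemma cintegrable_le A f (g : R -> R) : measurable A ->
  measurable_fun A (fun x => Re (f x)) -> measurable_fun A (fun x => Im (f x)) ->
  mu.-integrable A (EFin \o g) -> (forall x, A x -> cabs (f x) <= g x) ->
  cintegrable A f.
Proof.
move=> mA mr mi ig fg; split.
- apply: le_integrable ig => //; first exact/measurable_EFinP.
  move=> x Ax; rewrite /= lee_fin.
  by rewrite (le_trans (Re_le_cabs _))// (le_trans (fg x Ax))// ler_norm.
- apply: le_integrable ig => //; first exact/measurable_EFinP.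
  move=> x Ax; rewrite /= lee_fin.
  by rewrite (le_trans (Im_le_cabs _))// (le_trans (fg x Ax))// ler_norm.
Qed.

Lemma continuous_Re {T : topologicalType} (f : T -> C) (x : T) :
  {for x, continuous f} -> {for x, continuous (fun y => Re (f y))}.
Proof.
move=> /continuous_cplxP H; apply/(@cvgrPdist_lt R R^o) => e e0.
apply: filterS (H e e0) => y /=; apply: le_lt_trans.
by rewrite -normrN opprB -ReNE -ReDE Re_le_cabs.
Qed.

Lemma continuous_Im {T : topologicalType} (f : T -> C) (x : T) :
  {for x, continuous f} -> {for x, continuous (fun y => Im (f y))}.
Proof.
move=> /continuous_cplxP H; apply/(@cvgrPdist_lt R R^o) => e e0.
apply: filterS (H e e0) => y /=; apply: le_lt_trans.
by rewrite -normrN opprB -ImNE -ImDE Im_le_cabs.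
Qed.

Lemma continuous_ReIm {T : topologicalType} (f : T -> C) (x : T) :
  {for x, continuous (fun y => Re (f y))} -> {for x, continuous (fun y => Im (f y))} ->
  {for x, continuous f}.
Proof.
move=> /(@cvgrPdist_lt R R^o) cr /(@cvgrPdist_lt R R^o) ci.
apply/continuous_cplxP => e e0; have e20 : 0 < e / 2 by rewrite divr_gt0.
apply: filterS2 (cr _ e20) (ci _ e20) => y /= yr yi.
rewrite (le_lt_trans (cabs_le_ReIm _))// (splitr e) ReDE ReNE ImDE ImNE.
by rewrite ltrD// distrC.
Qed.

Lemma continuous_cintegrable (a b : R) f : {in `[a, b], continuous f} ->
  cintegrable `[a, b] f.
Proof.
move=> cf; split; apply: continuous_compact_integrable; try exact: segment_compact.
  apply: continuous_in_subspaceT => x /set_mem xab; exact/continuous_Re/cf.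
apply: continuous_in_subspaceT => x /set_mem xab; exact/continuous_Im/cf.
Qed.

Lemma cint_itvD (a b c : R) f : a <= b -> b <= c -> cintegrable `[a, c] f ->
  cint `[a, c] f = cint `[a, b] f + cint `[b, c] f.
Proof.
move=> ab bc [rf If].
have H (h : R -> R) : mu.-integrable `[a, c] (EFin \o h) ->
    \int[mu]_(x in `[a, c]) h x = \int[mu]_(x in `[a, b]) h x + \int[mu]_(x in `[b, c]) h x.
  move=> ih; have := @Rintegral_itvB R h (BLeft a) (BRight c) b ih.
  rewrite !bnd_simp => /(_ ab bc)/eqP; rewrite subr_eq addrC => /eqP ->; congr (_ + _).
  rewrite Rintegral_itv_obnd_cbnd//; apply: integrableS ih => //.
  by apply: subset_itvScc; rewrite bnd_simp.
by rewrite /cint !H.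
Qed.

Lemma is_derive_continuous (F : R -> R) (df x : R) : is_derive x 1 F df ->
  {for x, continuous F}.
Proof. by move=> [dF _]; apply: differentiable_continuous; exact/derivable1_diffP. Qed.

Lemma Rintegral_FTC2 (F f : R -> R) (a b : R) : a <= b ->
  (forall x : R, is_derive x 1 F (f x)) -> continuous f ->
  \int[mu]_(x in `[a, b]) f x = F b - F a.
Proof.
rewrite le_eqVlt => /predU1P[->|ab] dF cf.
  by rewrite set_itv1 Rintegral_set1 subrr.
rewrite /Rintegral (@continuous_FTC2 R f F)//.
- exact: continuous_subspaceT.
- split=> [x _||]; first by case: (dF x).
    exact/cvg_at_right_filter/(is_derive_continuous (dF a)).
  exact/cvg_at_left_filter/(is_derive_continuous (dF b)).
- by move=> x _; rewrite derive1E; exact: derive_val.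
Qed.

Lemma cint_affine (a b : R) (u v : R[i]) : a < b ->
  cint `[a, b] (fun x => u + v * x%:C) =
  u * (b - a)%:C + v * ((b ^+ 2 - a ^+ 2) / 2)%:C.
Proof.
move=> ab.
have H (p q : R) : \int[mu]_(x in `[a, b]) (p + q * x) = p * (b - a) + q * ((b ^+ 2 - a ^+ 2) / 2).
  have dF (x : R) : is_derive x 1 (fun x => p * x + q * (x ^+ 2 / 2)) (p + q * x).
    by apply: is_derive_eq; rewrite /GRing.scale/=; field.
  rewrite (Rintegral_FTC2 (ltW ab) dF); first by field.
  move=> x; apply: cvgD; first exact: cvg_cst.
  by apply: cvgM; [exact: cvg_cst|exact: cvg_id].
apply: cplx_eq; rewrite ?ReDE ?ImDE ?ReME ?ImME /= ?mulr0 ?subr0 ?addr0 ?add0r -H;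
  by apply: eq_Rintegral => x _; rewrite ?ReDE ?ImDE ?ReME ?ImME /= ?mulr0 ?subr0 ?add0r.
Qed.

End ComplexIntegral.

(** * Goursat's theorem and shifts of horizontal lines *)

Section Bisection.
Context {R : realType}.

Lemma exists_half_pow_lt (K e : R) : 0 < e -> exists n : nat, K / 2 ^+ n < e.
Proof.
move=> e0; exists (Num.bound (`|K| / e)).
have B := archi_boundP (divr_ge0 (normr_ge0 K) (ltW e0)).
set n := Num.bound _ in B *.
have N : (n%:R : R) <= 2 ^+ n by rewrite -natrX ler_nat ltnW// ltn_expl.
rewrite ltr_pdivrMr ?exprn_gt0//; apply: le_lt_trans (ler_norm K) _.
rewrite -ltr_pdivrMl// mulrC; exact: lt_le_trans B N.
Qed.

Variables (a b c d : R) (J : R -> R -> R -> R -> R).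

Let sub x y w h := [/\ a <= x, x + w <= b, c <= y & y + h <= d] /\ 0 < w /\ 0 < h.

Hypothesis J_split : forall x y w h, sub x y w h ->
  J x y w h <= J x y (w / 2) (h / 2) + J (x + w / 2) y (w / 2) (h / 2)
    + J x (y + h / 2) (w / 2) (h / 2) + J (x + w / 2) (y + h / 2) (w / 2) (h / 2).

Hypothesis J_small : forall p q, a <= p <= b -> c <= q <= d ->
  forall e, 0 < e -> exists2 r, 0 < r & forall x y w h, sub x y w h ->
    x <= p <= x + w -> y <= q <= y + h -> w < r -> h < r ->
    J x y w h <= e * (w + h) ^+ 2.

(** Goursat's quartering argument, detached from integrals. If the value on the whole rectangle were
    positive, one quarter of each rectangle would keep at least a quarter of its share; at the
    common point of the nested rectangles this contradicts the quadratic smallness [J_small]. *)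
Lemma bisection_le0 : a < b -> c < d -> J a c (b - a) (d - c) <= 0.
Proof.
move=> ab cd; rewrite leNgt; apply/negP; set J0 := J _ _ _ _ => J0gt.
pose w n := (b - a) / 2 ^+ n; pose h n := (d - c) / 2 ^+ n.
have wS n : w n.+1 = w n / 2 by rewrite /w exprS invfM mulrA mulrAC.
have hS n : h n.+1 = h n / 2 by rewrite /h exprS invfM mulrA mulrAC.
have w0 n : 0 < w n by rewrite divr_gt0 ?exprn_gt0 ?subr_gt0.
have h0 n : 0 < h n by rewrite divr_gt0 ?exprn_gt0 ?subr_gt0.
pose P n (u : R * R) := sub u.1 u.2 (w n) (h n) /\ J0 / 4 ^+ n <= J u.1 u.2 (w n) (h n).
(* The implication stands under the existential quantifier, so that a successor exists for every [u]
   and [choice] applies. *)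
have step n (u : R * R) : exists v : R * R, P n u ->
    [/\ P n.+1 v, u.1 <= v.1, v.1 + w n.+1 <= u.1 + w n, u.2 <= v.2 &
        v.2 + h n.+1 <= u.2 + h n].
  have [Pu|nPu] := pselect (P n u); last by exists u.
  have [su Ju] := Pu; have := J_split su; rewrite -wS -hS.
  have [[s1 s2 s3 s4] _] := su.
  have w1 := w0 n.+1; have h1 := h0 n.+1; have w2 := wS n; have h2 := hS n.
  have Q : J0 / 4 ^+ n.+1 = J0 / 4 ^+ n / 4 by rewrite exprS invfM mulrA mulrAC.
  set q := J0 / 4 ^+ n in Q Ju.
  have [Q1|Q1] := leP (q / 4) (J u.1 u.2 (w n.+1) (h n.+1)).
    move=> _; exists u => _; split; rewrite /=; try lra.
    by split; [split; [split; lra|]|rewrite Q].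
  have [Q2|Q2] := leP (q / 4) (J (u.1 + w n.+1) u.2 (w n.+1) (h n.+1)).
    move=> _; exists (u.1 + w n.+1, u.2) => _; split; rewrite /=; try lra.
    by split; [split; [split=> /=; lra|]|rewrite Q].
  have [Q3|Q3] := leP (q / 4) (J u.1 (u.2 + h n.+1) (w n.+1) (h n.+1)).
    move=> _; exists (u.1, u.2 + h n.+1) => _; split; rewrite /=; try lra.
    by split; [split; [split=> /=; lra|]|rewrite Q].
  have [Q4|Q4] := leP (q / 4) (J (u.1 + w n.+1) (u.2 + h n.+1) (w n.+1) (h n.+1)).
    move=> _; exists (u.1 + w n.+1, u.2 + h n.+1) => _; split; rewrite /=; try lra.
    by split; [split; [split=> /=; lra|]|rewrite Q].
  by move=> H; exfalso; lra.
have [f Hf] := choice (fun nu : nat * (R * R) => step nu.1 nu.2).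
pose s := fix s n := if n is m.+1 then f (m, s m) else (a, c).
have Ps n : P n (s n).
  elim: n => [|n IH]; last by have [] := Hf (n, s n) IH.
  split; last by rewrite expr0 divr1 /w /h expr0 !divr1.
  by split; [rewrite /w /h expr0 !divr1; split=> /=; lra|].
have HS n := Hf (n, s n) (Ps n).
have near1 n m : (s n).1 <= (s m).1 + w m.
  have H k : (s n).1 <= (s (n + k)%N).1.
    elim: k => [|k IH]; first by rewrite addn0.
    by apply: le_trans IH _; rewrite addnS; have [] := HS (n + k)%N.
  have G k : (s (m + k)%N).1 + w (m + k)%N <= (s m).1 + w m.
    elim: k => [|k IH]; first by rewrite addn0.
    by apply: le_trans IH; rewrite addnS; have [] := HS (m + k)%N.
  by have := H m; have := G n; rewrite addnC; have := w0 (n + m)%N; lra.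
have near2 n m : (s n).2 <= (s m).2 + h m.
  have H k : (s n).2 <= (s (n + k)%N).2.
    elim: k => [|k IH]; first by rewrite addn0.
    by apply: le_trans IH _; rewrite addnS; have [] := HS (n + k)%N.
  have G k : (s (m + k)%N).2 + h (m + k)%N <= (s m).2 + h m.
    elim: k => [|k IH]; first by rewrite addn0.
    by apply: le_trans IH; rewrite addnS; have [] := HS (m + k)%N.
  by have := H m; have := G n; rewrite addnC; have := h0 (n + m)%N; lra.
have lim (u v : nat -> R) : (forall n m, u n <= u m + v m) ->
    exists p, forall n, u n <= p <= u n + v n.
  move=> H; exists (sup (range u)) => n; apply/andP; split.
    apply: ub_le_sup; last by exists n.
    by exists (u 0%N + v 0%N) => _ [m _ <-].
  by apply: ge_sup; [exists (u 0%N), 0%N|move=> _ [m _ <-]].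
have [p Hp] := lim _ _ near1; have [q Hq] := lim _ _ near2.
(* With this [e] the upper bound at stage n is half of J0 / 4^n, against the lower bound J0 /
   4^n. *)
pose e := J0 / (2 * ((b - a) + (d - c)) ^+ 2).
have S0 : 0 < ((b - a) + (d - c)) ^+ 2 by rewrite exprn_gt0// addr_gt0 ?subr_gt0.
have e0 : 0 < e by rewrite divr_gt0// mulr_gt0.
have pab : a <= p <= b.
  by have := Hp 0%N; rewrite /= /w expr0 divr1 addrC subrK.
have qcd : c <= q <= d.
  by have := Hq 0%N; rewrite /= /h expr0 divr1 addrC subrK.
have [r r0 Hr] := J_small pab qcd e0.
have [n Hn] := exists_half_pow_lt (Num.max (b - a) (d - c)) r0.
have Hw : w n < r.
  by apply: le_lt_trans Hn; rewrite ler_pM2r ?invr_gt0 ?exprn_gt0// le_max lexx.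
have Hh : h n < r.
  by apply: le_lt_trans Hn; rewrite ler_pM2r ?invr_gt0 ?exprn_gt0// le_max lexx orbT.
have [sn Jn] := Ps n.
have := le_trans Jn (Hr _ _ _ _ sn (Hp n) (Hq n) Hw Hh).
have -> : w n + h n = ((b - a) + (d - c)) / 2 ^+ n by rewrite /w /h -mulrDl.
rewrite expr_div_n -exprM mulnC exprM mulrA.
rewrite (_ : 2 ^+ 2 = 4 :> R); last by rewrite -natrX.
rewrite ler_pM2r ?invr_gt0 ?exprn_gt0// /e.
set S := _ ^+ 2 in S0 *.
have -> : J0 / (2 * S) * S = J0 / 2 by field; rewrite gt_eqF.
by clear -J0gt; lra.
Qed.

End Bisection.

Section Goursat.
Context {R : realType}.
Local Notation C := (cplx R).
Implicit Types F : C -> C.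

Definition rect_int F (a b c d : R) : C :=
  cint `[a, b] (fun x : R => F (x +i* c)) + 'i * cint `[c, d] (fun y : R => F (b +i* y))
  - cint `[a, b] (fun x : R => F (x +i* d)) - 'i * cint `[c, d] (fun y : R => F (a +i* y)).

Definition on_rect (a b c d : R) F (P : C -> Prop) :=
  forall x y, a <= x <= b -> c <= y <= d -> P (x +i* y).

Lemma continuous_affine_cplx (u v : R[i]) (z : C) :
  {for z, continuous (fun w : C => u + v * w : C)}.
Proof.
apply/continuous_cplx_epsP => e e0; have v0 : 0 < cabs v + 1 by rewrite ltr_wpDl ?cabs_ge0.
exists (e / (cabs v + 1)) => [|w]; first by rewrite divr_gt0.
rewrite ltr_pdivlMr// => H; rewrite opprD addrACA subrr add0r -mulrBr cabsM.
by apply: le_lt_trans H; rewrite mulrC ler_wpM2l ?cabs_ge0// lerDl.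
Qed.

Lemma complex_subE (x y x' y' : R) : (x +i* y) - (x' +i* y') = (x - x') +i* (y - y').
Proof. by []. Qed.

Lemma cabs_horizontal (x x' y : R) : cabs ((x +i* y) - (x' +i* y)) = `|x - x'|.
Proof. by rewrite complex_subE subrr cabs_real. Qed.

Lemma cabs_vertical (x y y' : R) : cabs ((x +i* y) - (x +i* y')) = `|y - y'|.
Proof. by rewrite complex_subE subrr /cabs /= expr0n add0r sqrtr_sqr. Qed.

Lemma continuous_horizontal F (x y : R) : {for (x +i* y : C), continuous F} ->
  {for x, continuous (fun x : R => F (x +i* y))}.
Proof.
move=> /continuous_cplx_epsP H; apply/continuous_cplxP => e e0.
have [d d0 Hd] := H e e0; apply/nbhs_normP; exists d => // x' /= xx'.
by apply: Hd; rewrite cabs_horizontal distrC.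
Qed.

Lemma continuous_vertical F (x y : R) : {for (x +i* y : C), continuous F} ->
  {for y, continuous (fun y : R => F (x +i* y))}.
Proof.
move=> /continuous_cplx_epsP H; apply/continuous_cplxP => e e0.
have [d d0 Hd] := H e e0; apply/nbhs_normP; exists d => // x' /= xx'.
by apply: Hd; rewrite cabs_vertical distrC.
Qed.

Lemma cintegrable_horizontal F (a b c d y : R) :
  on_rect a b c d F (fun z => {for z, continuous F}) -> c <= y <= d ->
  cintegrable `[a, b] (fun x => F (x +i* y)).
Proof.
move=> cF cd; apply: continuous_cintegrable => x; rewrite in_itv /= => xab.
exact/continuous_horizontal/cF.
Qed.

Lemma cintegrable_vertical F (a b c d x : R) :
  on_rect a b c d F (fun z => {for z, continuous F}) -> a <= x <= b ->
  cintegrable `[c, d] (fun y => F (x +i* y)).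
Proof.
move=> cF ab; apply: continuous_cintegrable => y; rewrite in_itv /= => ycd.
exact/continuous_vertical/cF.
Qed.

Lemma rect_int_splitx F (a m b c d : R) : a <= m -> m <= b -> c <= d ->
  on_rect a b c d F (fun z => {for z, continuous F}) ->
  rect_int F a b c d = rect_int F a m c d + rect_int F m b c d.
Proof.
move=> am mb cd cF; rewrite /rect_int.
rewrite (@cint_itvD R a m b (fun x => F (x +i* c)))//; last first.
  by apply: cintegrable_horizontal cF _; rewrite lexx.
rewrite (@cint_itvD R a m b (fun x => F (x +i* d)))//; last first.
  by apply: cintegrable_horizontal cF _; rewrite lexx cd.
by ring.
Qed.

Lemma rect_int_splity F (a b c m d : R) : a <= b -> c <= m -> m <= d ->
  on_rect a b c d F (fun z => {for z, continuous F}) ->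
  rect_int F a b c d = rect_int F a b c m + rect_int F a b m d.
Proof.
move=> ab cm md cF; rewrite /rect_int.
rewrite (@cint_itvD R c m d (fun x => F (b +i* x)))//; last first.
  by apply: cintegrable_vertical cF _; rewrite lexx ab.
rewrite (@cint_itvD R c m d (fun x => F (a +i* x)))//; last first.
  by apply: cintegrable_vertical cF _; rewrite lexx ab.
by ring.
Qed.

Lemma cabs_cint_itv_le (f : R -> C) (a b M : R) : a <= b -> cintegrable `[a, b] f ->
  (forall x, a <= x <= b -> cabs (f x) <= M) -> cabs (cint `[a, b] f) <= 2 * M * (b - a).
Proof.
move=> ab cf fM; have iM : (@lebesgue_measure R).-integrable `[a, b] (EFin \o cst M).
  apply: continuous_compact_integrable; first exact: segment_compact.
  by apply: continuous_subspaceT => x; exact: cst_continuous.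
apply: le_trans (@le_cint R `[a, b] f (cst M) _ cf iM _) _ => //.
rewrite Rintegral_cst//= lebesgue_measure_itv/= lte_fin.
have := ab; rewrite le_eqVlt => /predU1P[->|ab']; first by rewrite ltxx /= subrr !mulr0.
by rewrite ab' /= mulrA.
Qed.

Lemma cabs_i : cabs ('i : R[i]) = 1.
Proof. by rewrite /cabs/= expr0n add0r expr1n sqrtr1. Qed.

Lemma cabs_rect_int_le F (a b c d M : R) : a <= b -> c <= d ->
  on_rect a b c d F (fun z => {for z, continuous F}) ->
  on_rect a b c d F (fun z => cabs (F z) <= M) ->
  cabs (rect_int F a b c d) <= 4 * M * ((b - a) + (d - c)).
Proof.
move=> ab cd cF FM.
have H y : c <= y <= d -> cabs (cint `[a, b] (fun x => F (x +i* y))) <= 2 * M * (b - a).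
  move=> ycd; apply: cabs_cint_itv_le => //.
    exact: cintegrable_horizontal cF ycd.
  by move=> x xab; exact: FM.
have V x : a <= x <= b -> cabs (cint `[c, d] (fun y => F (x +i* y))) <= 2 * M * (d - c).
  move=> xab; apply: cabs_cint_itv_le => //.
    exact: cintegrable_vertical cF xab.
  by move=> y ycd; exact: FM.
have aab : a <= a <= b by rewrite lexx.
have bab : a <= b <= b by rewrite lexx ab.
have ccd : c <= c <= d by rewrite lexx.
have dcd : c <= d <= d by rewrite lexx cd.
rewrite /rect_int; apply: le_trans (cabsD _ _) _; rewrite cabsN cabsM cabs_i mul1r.
apply: le_trans (lerD (le_trans (cabsD _ _) (lerD (cabsD _ _) (lexx _))) (V _ aab)) _.
rewrite cabsN cabsM cabs_i mul1r.
have := H _ ccd; have := H _ dcd; have := V _ bab; lra.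
Qed.

Lemma rect_intB F G (a b c d : R) : a <= b -> c <= d ->
  on_rect a b c d F (fun z => {for z, continuous F}) ->
  on_rect a b c d G (fun z => {for z, continuous G}) ->
  rect_int (fun z => F z - G z) a b c d = rect_int F a b c d - rect_int G a b c d.
Proof.
move=> ab cd cF cG.
have aab : a <= a <= b by rewrite lexx.
have bab : a <= b <= b by rewrite lexx ab.
have ccd : c <= c <= d by rewrite lexx.
have dcd : c <= d <= d by rewrite lexx cd.
have H y (ycd : c <= y <= d) := cintB (measurable_itv `[a, b])
  (cintegrable_horizontal cF ycd) (cintegrable_horizontal cG ycd).
have V x (xab : a <= x <= b) := cintB (measurable_itv `[c, d])
  (cintegrable_vertical cF xab) (cintegrable_vertical cG xab).
rewrite /rect_int (H _ ccd) (H _ dcd) (V _ aab) (V _ bab).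
by ring.
Qed.

Lemma rect_int_affine (u v : R[i]) (a b c d : R) : a < b -> c < d ->
  rect_int (fun z => u + v * z) a b c d = 0.
Proof.
move=> ab cd; rewrite /rect_int.
have H y : cint `[a, b] (fun x : R => u + v * (x +i* y)) =
    cint `[a, b] (fun x : R => (u + v * (0 +i* y)) + v * x%:C).
  apply: eq_cint => x _; rewrite -addrA -mulrDr; congr (_ + _ * _).
  by apply: cplx_eq; rewrite ?ReDE ?ImDE /= ?add0r ?addr0.
have V x : cint `[c, d] (fun y : R => u + v * (x +i* y)) =
    cint `[c, d] (fun y : R => (u + v * x%:C) + (v * 'i) * y%:C).
  apply: eq_cint => y _; rewrite -mulrA -addrA -mulrDr; congr (_ + _ * _).
  by apply: cplx_eq; rewrite ?ReDE ?ImDE ?ReME ?ImME /= ?(mul0r, mul1r, mulr0, subr0, addr0, add0r).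
rewrite !H !V !cint_affine//.
clear H V; case: u v => [u1 u2] [v1 v2].
apply: cplx_eq; rewrite ?(ReDE, ImDE, ReNE, ImNE, ReME, ImME) /=; by field.
Qed.

(** An affine function has zero integral around a rectangle, so near a point F may be replaced by
    its first-order remainder, whose size times the perimeter is quadratically small. *)
Theorem Goursat F (a b c d : R) : a < b -> c < d ->
  on_rect a b c d F (fun z => derivable F z 1) -> rect_int F a b c d = 0.
Proof.
move=> ab cd dF; apply: cabs_eq0; apply/eqP; rewrite eq_le cabs_ge0 andbT.
have cF : on_rect a b c d F (fun z => {for z, continuous F}).
  by move=> x y xab ycd; exact/derivable_continuous_cplx/dF.
have E1 : b = a + (b - a) by rewrite addrC subrK.
have E2 : d = c + (d - c) by rewrite addrC subrK.
rewrite [X in rect_int F a X c d]E1 [X in rect_int F a _ c X]E2.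
have cS x y w h : [/\ a <= x, x + w <= b, c <= y & y + h <= d] ->
    on_rect x (x + w) y (y + h) F (fun z => {for z, continuous F}).
  move=> [h1 h2 h3 h4] p q /andP[p1 p2] /andP[q1 q2]; apply: cF; apply/andP; split; lra.
apply: (@bisection_le0 R a b c d (fun x y w h => cabs (rect_int F x (x + w) y (y + h)))) => //.
- move=> x y w h [sub [w0 h0]]; have cs := cS _ _ _ _ sub.
  have w2 : x + w = x + w / 2 + w / 2 by field.
  have h2 : y + h = y + h / 2 + h / 2 by field.
  rewrite (@rect_int_splity F x (x + w) y (y + h / 2) (y + h))//; [|by clear -w0; lra|by clear -h0; lra..].
  have x1 : x <= x + w / 2 by clear -w0; lra.
  have x2 : x + w / 2 <= x + w by clear -w0; lra.
  have y1 : y <= y + h / 2 by clear -h0; lra.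
  have y2 : y + h / 2 <= y + h by clear -h0; lra.
  have S1 := @rect_int_splitx F x (x + w / 2) (x + w) y (y + h / 2) x1 x2 y1.
  have S2 := @rect_int_splitx F x (x + w / 2) (x + w) (y + h / 2) (y + h) x1 x2 y2.
  rewrite [X in cabs (X + _)]S1; last first.
    by move=> p q p1 /andP[q1 q2]; apply: cs => //; rewrite q1 (le_trans q2).
  rewrite [X in cabs (_ + X)]S2; last first.
    by move=> p q p1 /andP[q1 q2]; apply: cs => //; rewrite q2 andbT (le_trans _ q1).
  rewrite -w2 -h2; apply: le_trans (cabsD _ _) _; rewrite -[leRHS]addrA; apply: lerD; exact: cabsD.
move=> p q pab qcd e e0.
have /derivable_cplxP[l Hl] := dF p q pab qcd.
have [r r0 Hr] := Hl (e / 4) (divr_gt0 e0 (ltr0Sn _ 3)).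
(* Sides below r / 2 keep the rectangle within distance r of the point. The e / 4 chosen above
   cancels the factor 4 of the perimeter estimate. *)
exists (r / 2); first by rewrite divr_gt0.
move=> x y w h [sub [w0 h0]] /andP[xp px] /andP[yq qy] wr hr.
have cs := cS _ _ _ _ sub.
set A := fun z : C => (F (p +i* q) - l * (p +i* q)) + l * z.
have cA : on_rect x (x + w) y (y + h) A (fun z => {for z, continuous A}).
  by move=> x' y' _ _; exact: continuous_affine_cplx.
have xw : x < x + w by rewrite ltrDl.
have yh : y < y + h by rewrite ltrDl.
have -> : rect_int F x (x + w) y (y + h) = rect_int (fun z => F z - A z) x (x + w) y (y + h).
  by rewrite (rect_intB (ltW xw) (ltW yh) cs cA) [X in _ - X]rect_int_affine// subr0.
have -> : e * (w + h) ^+ 2 = 4 * (e / 4 * (w + h)) * ((x + w - x) + (y + h - y)).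
  by field.
apply: cabs_rect_int_le; [exact: ltW|exact: ltW| |].
  by move=> x' y' hx hy; apply: continuous_cplxB; [exact: cs|exact: cA].
move=> x' y' /andP[x1 x2] /andP[y1 y2].
have D : cabs ((x' +i* y') - (p +i* q)) <= w + h.
  apply: le_trans (cabs_le_ReIm _) _; rewrite complex_subE /=.
  by apply: lerD; rewrite ler_norml; apply/andP; split; lra.
have /Hr : cabs ((x' +i* y') - (p +i* q)) < r by apply: le_lt_trans D _; lra.
rewrite subrKC /A mulrBr => H.
have -> : F (x' +i* y') - (F (p +i* q) - l * (p +i* q) + l * (x' +i* y')) =
  F (x' +i* y') - F (p +i* q) - (l * (x' +i* y') - l * (p +i* q)) by ring.
by apply: le_trans H _; rewrite ler_wpM2l// divr_ge0// ltW.
Qed.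

End Goursat.

(** * Moving an integral from one horizontal line to another *)

Section Strip.
Context {R : realType}.
Local Notation C := (cplx R).
Local Notation mu := (@lebesgue_measure R).

(** The common integrable majorant: complex integrals over the whole line are controlled by
    multiples of it. *)
Definition cau (x : R) : R := (1 + x ^+ 2)^-1.

Lemma cau_gt0 x : 0 < cau x.
Proof. by rewrite invr_gt0 ltr_pwDl ?sqr_ge0. Qed.

Lemma cau_le1 x : cau x <= 1.
Proof. by rewrite invf_le1 ?ltr_pwDl ?sqr_ge0// lerDl sqr_ge0. Qed.

Lemma continuous_cau : continuous cau.
Proof. exact: continuous_oneDsqrV. Qed.

Lemma integrable_cau : mu.-integrable setT (EFin \o cau).
Proof.
apply/integrableP; split.
  by apply/measurable_EFinP; apply: continuous_measurable_fun; exact: continuous_cau.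
under eq_integral do rewrite /= ger0_norm ?(ltW (cau_gt0 _))//.
rewrite ge0_symfun_integralT.
- have := @integral0y_oneDsqr R; rewrite set_itvcy => ->.
  by rewrite -EFinM ltry.
- by move=> x; rewrite ltW// cau_gt0.
- exact: continuous_cau.
- by move=> x; rewrite /= /cau sqrrN.
Qed.

Lemma continuous_ReR (f : R -> C) : continuous f -> continuous (fun x => Re (f x)).
Proof. by move=> cf x; exact: continuous_Re (cf x). Qed.

Lemma continuous_ImR (f : R -> C) : continuous f -> continuous (fun x => Im (f x)).
Proof. by move=> cf x; exact: continuous_Im (cf x). Qed.

Lemma continuous_measurableR (h : R -> R) : continuous h ->
  measurable_fun [set: measurableTypeR R] h.
Proof. exact: continuous_measurable_fun. Qed.

Lemma cau_cintegrable (f : R -> C) (M : R) : continuous f ->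
  (forall x, cabs (f x) <= M * cau x) -> cintegrable setT f.
Proof.
move=> cf fM; have iM := integrableZl measurableT M integrable_cau.
apply: (@cintegrable_le R setT f (fun x => M * cau x)) => //.
- by apply: continuous_measurable_fun; exact: continuous_ReR.
- by apply: continuous_measurable_fun; exact: continuous_ImR.
Qed.

Lemma le_cint_cau (f : R -> C) (M : R) : continuous f ->
  (forall x, cabs (f x) <= M * cau x) ->
  cabs (cint setT f) <= 2 * M * \int[mu]_x cau x.
Proof.
move=> cf fM; have iM := integrableZl measurableT M integrable_cau.
have -> : 2 * M * \int[mu]_x cau x = 2 * \int[mu]_x (M * cau x).
  by rewrite RintegralZl ?mulrA//; exact: integrable_cau.
by apply: le_cint => //; exact: cau_cintegrable fM.
Qed.

Lemma Rintegral_dct (h : R -> R) (g_ : nat -> R -> R) (g : R -> R) :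
  mu.-integrable setT (EFin \o h) ->
  (forall n, measurable_fun [set: measurableTypeR R] (g_ n)) ->
  measurable_fun [set: measurableTypeR R] g ->
  (forall x, g_ n x @[n --> \oo] --> g x) ->
  (forall n x, `|g_ n x| <= h x) ->
  (\int[mu]_x g_ n x) @[n --> \oo] --> \int[mu]_x g x.
Proof.
move=> ih mg_ mg cg gh.
have [] := @dominated_convergence _ _ R mu setT measurableT
  (fun n x => (g_ n x)%:E) (EFin \o g) (EFin \o h).
- by move=> n; exact/measurable_EFinP.
- exact/measurable_EFinP.
- by apply: aeW => x _; apply: cvg_EFin; [near=> n|exact: cg].
- exact: ih.
- by apply: aeW => x n _; rewrite /= lee_fin.
move=> ig _ H; apply: fine_cvg; rewrite /Rintegral fineK//.
exact: integrable_fin_num.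
Unshelve. all: by end_near. Qed.

Lemma cvg_trunc (h : R -> R) : mu.-integrable setT (EFin \o h) ->
  (\int[mu]_(x in `[- n.+1%:R, n.+1%:R]) h x) @[n --> \oo] --> \int[mu]_x h x.
Proof.
move=> ih; have mh : measurable_fun [set: measurableTypeR R] h.
  by apply/measurable_EFinP; exact: measurable_int ih.
under eq_fun do rewrite Rintegral_mkcond.
apply: (@Rintegral_dct (fun x => `|h x|)) => //.
- exact: integrable_norm.
- move=> n; apply/measurable_restrict => //; exact: measurable_funS mh.
- move=> x; apply: cvg_near_cst; exists (Num.bound `|x|) => // n /= nx.
  rewrite patchE mem_set//= in_itv /= -ler_norml.
  apply: le_trans (ltW (archi_boundP (normr_ge0 x))) _.
  by rewrite ler_nat (leq_trans nx).
- by move=> n x; rewrite patchE; case: ifP => _//; rewrite normr0.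
Qed.

Lemma cvg_eq_of_dist (u v : nat -> R) (a b K : R) :
  u n @[n --> \oo] --> a -> v n @[n --> \oo] --> b ->
  (forall n, `|u n - v n| <= K / n.+1%:R) -> a = b.
Proof.
move=> ua vb H; apply/eqP; rewrite -subr_eq0; apply/eqP.
rewrite -(cvg_lim (@Rhausdorff R) (cvgB ua vb)); apply: cvg_lim; first exact: Rhausdorff.
apply/norm_cvg0P; apply: (@squeeze_cvgr _ _ _ _ (cst 0) (fun n => K * harmonic n)).
- by near=> n; rewrite normr_ge0 /=; exact: H.
- exact: cvg_cst.
- by rewrite -(mulr0 K); apply: cvgM; [exact: cvg_cst|exact: cvg_harmonic].
Unshelve. all: by end_near. Qed.

(** Goursat on rectangles with abscissas -(n+1) and n+1. On the vertical sides [cau] is at most 1 /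
    (n+1), so these contribute O(1/n), while the horizontal sides converge to the two line
    integrals. *)
Lemma strip_shift_closed (F : C -> C) (c d M : R) : c < d ->
  (forall x y : R, c <= y <= d -> derivable F (x +i* y) 1) ->
  (forall x y : R, c <= y <= d -> cabs (F (x +i* y)) <= M * cau x) ->
  cint setT (fun x => F (x +i* c)) = cint setT (fun x => F (x +i* d)).
Proof.
move=> cd dF FM.
have cF x y : c <= y <= d -> {for (x +i* y : C), continuous F}.
  by move=> ycd; exact/derivable_continuous_cplx/dF.
have ccd : c <= c <= d by rewrite lexx ltW.
have dcd : c <= d <= d by rewrite lexx ltW.
have ci y : c <= y <= d -> cintegrable setT (fun x => F (x +i* y)).
  move=> ycd; apply: (@cau_cintegrable _ M) => x; last exact: FM.
  exact/continuous_horizontal/cF.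
have ncd : 0 <= d - c by rewrite subr_ge0 ltW.
have M0 : 0 <= M.
  rewrite -(@pmulr_lge0 _ (cau 0)) ?cau_gt0//.
  exact: le_trans (cabs_ge0 _) (FM 0 c ccd).
pose L n : R := n.+1%:R; have L0 n : 0 < L n by rewrite ltr0n.
pose T y n := cint `[- L n, L n] (fun x => F (x +i* y)).
have TE n : cabs (T c n - T d n) <= 4 * M * (d - c) / L n.
  have n0 : - L n < L n by rewrite gtrN.
  have := @Goursat R F _ _ _ _ n0 cd (fun x y _ => dF x y).
  rewrite /rect_int -/(T c n) -/(T d n).
  set V1 := cint _ (fun y => F (L n +i* y)); set V2 := cint _ (fun y => F (- L n +i* y)).
  move=> E; have -> : T c n - T d n = 'i * (V2 - V1) by rewrite -[LHS]subr0 -E; ring.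
  have VM x : L n <= `|x| -> cabs (cint `[c, d] (fun y => F (x +i* y))) <= 2 * (M / L n) * (d - c).
    move=> Lx; apply: cabs_cint_itv_le; first exact: ltW.
      apply: continuous_cintegrable => y; rewrite in_itv /= => ycd.
      exact/continuous_vertical/cF.
    move=> y /FM-/(_ x) H; apply: le_trans H _; rewrite ler_wpM2l// lef_pV2 ?posrE//; last first.
      by rewrite ltr_pwDl ?sqr_ge0.
    have L1 : 1 <= L n by rewrite ler1n.
    apply: le_trans Lx _; rewrite -[x ^+ 2]real_normK ?num_real//.
    by have := sqr_ge0 (`|x| - 1); have := normr_ge0 x; nra.
  have := VM (L n); rewrite ger0_norm ?(ltW (L0 n))// => /(_ (lexx _)) H1.
  have := VM (- L n); rewrite normrN ger0_norm ?(ltW (L0 n))// => /(_ (lexx _)) H2.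
  rewrite cabsM cabs_i mul1r; apply: le_trans (cabsD _ _) _; rewrite cabsN.
  apply: le_trans (lerD H2 H1) _; rewrite le_eqVlt; apply/orP; left; apply/eqP; ring.
have cT y : c <= y <= d ->
    Re (T y n) @[n --> \oo] --> Re (cint setT (fun x => F (x +i* y))) /\
    Im (T y n) @[n --> \oo] --> Im (cint setT (fun x => F (x +i* y))).
  by move=> /ci[i1 i2]; split; exact: cvg_trunc.
apply: cplx_eq.
- apply: (cvg_eq_of_dist (cT c ccd).1 (cT d dcd).1) => n.
  by apply: le_trans (TE n); rewrite -ReNE -ReDE Re_le_cabs.
- apply: (cvg_eq_of_dist (cT c ccd).2 (cT d dcd).2) => n.
  by apply: le_trans (TE n); rewrite -ImNE -ImDE Im_le_cabs.
Qed.

Lemma cint_dct (f_ : nat -> R -> C) (f : R -> C) (M : R) :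
  (forall n, continuous (f_ n)) -> continuous f ->
  (forall n x, cabs (f_ n x) <= M * cau x) ->
  (forall x (e : R), 0 < e -> \forall n \near \oo, cabs (f_ n x - f x) < e) ->
  Re (cint setT (f_ n)) @[n --> \oo] --> Re (cint setT f) /\
  Im (cint setT (f_ n)) @[n --> \oo] --> Im (cint setT f).
Proof.
move=> cf_ cf fM H; split.
- apply: (@Rintegral_dct (fun x => M * cau x)).
  + exact: (integrableZl measurableT M integrable_cau).
  + by move=> n; exact: (continuous_measurableR (continuous_ReR (cf_ n))).
  + by apply: continuous_measurable_fun; exact: continuous_ReR.
  + move=> x; apply/(@cvgrPdist_lt R R^o) => e e0; apply: filterS (H x e e0) => n /=.
    by apply: le_lt_trans; rewrite distrC -ReNE -ReDE Re_le_cabs.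
  + by move=> n x; apply: le_trans (fM n x); exact: Re_le_cabs.
- apply: (@Rintegral_dct (fun x => M * cau x)).
  + exact: (integrableZl measurableT M integrable_cau).
  + by move=> n; exact: (continuous_measurableR (continuous_ImR (cf_ n))).
  + by apply: continuous_measurable_fun; exact: continuous_ImR.
  + move=> x; apply/(@cvgrPdist_lt R R^o) => e e0; apply: filterS (H x e e0) => n /=.
    by apply: le_lt_trans; rewrite distrC -ImNE -ImDE Im_le_cabs.
  + by move=> n x; apply: le_trans (fM n x); exact: Im_le_cabs.
Qed.

(** Inner lines have equal integrals by the closed case, and each boundary line is a limit of inner
    ones by continuity and dominated convergence. Hence derivability is asked in the open strip
    only. *)
Lemma strip_shift (F : C -> C) (c d M : R) : c <= d ->
  (forall x y : R, c <= y <= d -> {for (x +i* y : C), continuous F}) ->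
  (forall x y : R, c < y < d -> derivable F (x +i* y) 1) ->
  (forall x y : R, c <= y <= d -> cabs (F (x +i* y)) <= M * cau x) ->
  cint setT (fun x => F (x +i* c)) = cint setT (fun x => F (x +i* d)).
Proof.
rewrite le_eqVlt => /predU1P[->//|cd] cF dF FM.
pose L y := cint setT (fun x => F (x +i* y)).
pose m := (c + d) / 2.
have cm : c < m by rewrite /m ltr_pdivlMr//; lra.
have md : m < d by rewrite /m ltr_pdivrMr//; lra.
have Lin y z : c < y -> y < z -> z < d -> L y = L z.
  move=> cy yz zd; apply: (@strip_shift_closed F y z M) => // x t /andP[yt tz].
    by apply: dF; rewrite (lt_le_trans cy)//= (le_lt_trans tz).
  by apply: FM; rewrite (ltW (lt_le_trans cy yt))// (ltW (le_lt_trans tz zd)).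
have Lm y : c < y < d -> L y = L m.
  by move=> /andP[cy yd]; have [ym|my|->//] := ltgtP y m; [|apply/esym]; apply: Lin.
have Llim y (u : nat -> R) : c <= y <= d -> (forall n, c < u n < d) ->
    u n @[n --> \oo] --> y -> L y = L m.
  move=> ycd ucd uy.
  have [] := @cint_dct (fun n x => F (x +i* u n)) (fun x => F (x +i* y)) M.
  - move=> n x; apply/continuous_horizontal/cF.
    by have /andP[/ltW-> /ltW->] := ucd n.
  - by move=> x; exact/continuous_horizontal/cF.
  - by move=> n x; apply: FM; have /andP[/ltW-> /ltW->] := ucd n.
  - move=> x e e0; have /continuous_cplxP/(_ e e0) := continuous_vertical (cF x y ycd).
    by move=> H; exact: (uy _ H).
  have E n : cint setT (fun x => F (x +i* u n)) = L m by exact: Lm.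
  under eq_fun do rewrite E.
  move=> /(cvg_lim (@Rhausdorff R)); rewrite lim_cst; last exact: Rhausdorff.
  move=> rE; under eq_fun do rewrite E.
  move=> /(cvg_lim (@Rhausdorff R)); rewrite lim_cst; last exact: Rhausdorff.
  by move=> iE; apply: cplx_eq.
have harm (w : R) : w * harmonic n @[n --> \oo] --> 0.
  by rewrite -(mulr0 w); apply: cvgM; [exact: cvg_cst|exact: cvg_harmonic].
have h01 n : 0 < (@harmonic R n) / 2 < 1.
  have h1 : @harmonic R n <= 1 by rewrite invf_le1 ?ltr0n// ler1n.
  have h0 := @harmonic_gt0 R n; apply/andP; split; lra.
have w0 : 0 < d - c by rewrite subr_gt0.
transitivity (L m).
- apply: (Llim c (fun n => c + ((d - c) / 2) * harmonic n)).
  + by rewrite lexx ltW.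
  + move=> n; have := h01 n; set h := harmonic n => /andP[h1 h2].
    apply/andP; split; nra.
  + by rewrite -[X in _ --> X]addr0; apply: cvgD; [exact: cvg_cst|exact: harm].
- apply/esym; apply: (Llim d (fun n => d + ((c - d) / 2) * harmonic n)).
  + by rewrite lexx ltW.
  + move=> n; have := h01 n; set h := harmonic n => /andP[h1 h2].
    apply/andP; split; nra.
  + by rewrite -[X in _ --> X]addr0; apply: cvgD; [exact: cvg_cst|exact: harm].
Qed.

End Strip.

(** * Fourier inversion *)

Section Fubini.
Context {R : realType}.
Local Notation C := (cplx R).
Local Notation mu := (@lebesgue_measure R).
Local Notation MR := (measurableTypeR R).

Lemma Rintegral_Fubini (f : MR * MR -> R) :
  (mu \x mu)%E.-integrable setT (EFin \o f) ->
  (forall x, mu.-integrable setT (fun y => (f (x, y))%:E)) ->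
  (forall y, mu.-integrable setT (fun x => (f (x, y))%:E)) ->
  \int[mu]_x \int[mu]_y f (x, y) = \int[mu]_y \int[mu]_x f (x, y).
Proof.
move=> fi fx fy; have := @Fubini _ _ MR MR R mu mu (EFin \o f) fi.
rewrite /Rintegral => H; congr fine.
transitivity (\int[mu]_x \int[mu]_y (f (x, y))%:E)%E.
  by apply: eq_integral => x _; rewrite fineK//; exact: integrable_fin_num.
transitivity (\int[mu]_y \int[mu]_x (f (x, y))%:E)%E; first exact: H.
by apply: eq_integral => x _; rewrite fineK//; exact: integrable_fin_num.
Qed.

Lemma integrable_kernel (e g : R -> R) (k : MR * MR -> R) :
  mu.-integrable setT (EFin \o e) -> mu.-integrable setT (EFin \o g) ->
  measurable_fun setT k -> (forall z, `|k z| <= 1) ->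
  (mu \x mu)%E.-integrable setT (fun z : MR * MR => (e z.1 * (g z.2 * k z))%:E).
Proof.
move=> ie ig mk k1.
have me : measurable_fun [set: MR] e by apply/measurable_EFinP; exact: measurable_int ie.
have mg : measurable_fun [set: MR] g by apply/measurable_EFinP; exact: measurable_int ig.
have mf : measurable_fun [set: MR * MR] (fun z : MR * MR => (e z.1 * (g z.2 * k z))%:E).
  apply/measurable_EFinP; apply: measurable_funM; first exact: measurableT_comp.
  by apply: measurable_funM => //; exact: measurableT_comp.
apply: (proj2 (@integrable12ltyP _ _ MR MR R mu mu _ mf)).
apply: (@le_lt_trans _ _ (\int[mu]_x (`|e x|%:E * \int[mu]_y `|g y|%:E))%E).
  apply: ge0_le_integral => //.
  - by move=> x _; apply: integral_ge0.
  - apply: (@measurable_fun_fubini_tonelli_F _ _ MR MR R mu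
      (fun z : MR * MR => `|(e z.1 * (g z.2 * k z))%:E|)%E) => //.
    exact: measurableT_comp.
  - apply: emeasurable_funM => //; apply/measurable_EFinP; exact: measurableT_comp.
  move=> x _; rewrite -ge0_integralZl//.
  - apply: ge0_le_integral => //.
    + by apply: measurableT_comp => //; exact: (measurableT_comp mf).
    + by apply/measurable_EFinP; apply: measurable_funM => //; exact: measurableT_comp.
    move=> y _; rewrite /= lee_fin !normrM ler_wpM2l// ler_piMr//.
  - apply/measurable_EFinP; exact: measurableT_comp.
have gfin : (\int[mu]_y `|g y|%:E < +oo)%E by case/integrableP: ig.
have gfn : (\int[mu]_y `|g y|%:E)%E \is a fin_num by rewrite ge0_fin_numE ?integral_ge0.
rewrite ge0_integralZr//; last 2 first.
- by apply/measurable_EFinP; exact: measurableT_comp.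
- exact: integral_ge0.
have efn : (\int[mu]_x `|e x|%:E)%E \is a fin_num.
  by rewrite ge0_fin_numE ?integral_ge0//; case/integrableP: ie.
rewrite -ge0_fin_numE; first exact: fin_numM efn gfn.
by rewrite mule_ge0// integral_ge0.
Qed.

Local Notation D := (`[0%R, +oo[%classic : set MR).

Lemma measurable_halfline : measurable D.
Proof. exact: measurable_itv. Qed.

(** For a nonnegative integrand the fundamental theorem on a half-line yields integrability along
    with the value. The trigonometric integrands below are made nonnegative by adding [expR (- x)],
    whose integral is subtracted afterwards. *)
Lemma FTC2y_cvg0 (f F : R -> R) : (forall x, 0 <= x -> 0 <= f x) -> continuous f ->
  (forall x : R, is_derive x 1 F (f x)) -> (exists K, forall x, `|F x| <= K * expR (- x)) ->
  mu.-integrable D (EFin \o f) /\ \int[mu]_(x in D) f x = - F 0.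
Proof.
move=> f0 cf dF [K FK].
have Fl : F x @[x --> +oo] --> 0.
  apply/norm_cvg0P; apply: (@squeeze_cvgr _ _ _ _ (cst 0) (fun x => K * expR (- x))).
  - by near=> x; rewrite normr_ge0 /=; exact: FK.
  - exact: cvg_cst.
  - by rewrite -(mulr0 K); apply: cvgM; [exact: cvg_cst|exact: cvgr_expR].
have E : (\int[mu]_(x in D) (f x)%:E = 0%:E - (F 0)%:E)%E.
  apply: ge0_continuous_FTC2y => //.
  - exact: continuous_subspaceT.
  - exact/cvg_at_right_filter/(is_derive_continuous (dF 0)).
  - by move=> x _; rewrite derive1E; exact: derive_val.
split; last by rewrite /Rintegral E /= sub0r.
apply/integrableP; split.
  apply/measurable_EFinP; apply: measurable_funS (continuous_measurableR cf) => //.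
rewrite [X in (X < _)%E](_ : _ = (\int[mu]_(x in D) (f x)%:E)%E); last first.
  apply: eq_integral => x; rewrite inE /= in_itv /= andbT => x0.
  by rewrite ger0_norm// f0.
by rewrite [X in (X < _)%E]E -EFinB ltry.
Unshelve. all: by end_near. Qed.

Lemma integral_expN : mu.-integrable D (EFin \o (fun x => expR (- x))) /\
  \int[mu]_(x in D) expR (- x) = 1.
Proof.
have [||x||i E] := @FTC2y_cvg0 (fun x => expR (- x)) (fun x => - expR (- x)).
- by move=> x _; exact: expR_ge0.
- by move=> x; apply: continuous_comp; [exact: opp_continuous|exact: continuous_expR].
- by apply: is_derive_eq; rewrite /GRing.scale /= mulrN mulr1 opprK.
- by exists 1 => x; rewrite normrN mul1r ger0_norm// expR_ge0.
by split=> //; rewrite E oppr0 expR0 opprK.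
Qed.

Lemma is_derive_cosM (u x : R) : is_derive x 1 (fun x => cos (u * x)) (- u * sin (u * x)).
Proof.
have dl : is_derive x 1 (fun y => u * y) u.
  by apply: is_derive_eq; rewrite /GRing.scale /= mulr1.
by apply: is_derive_eq (is_derive1_comp (is_derive_cos (u * x)) dl) _; rewrite mulrC mulrN mulNr.
Qed.

Lemma is_derive_sinM (u x : R) : is_derive x 1 (fun x => sin (u * x)) (u * cos (u * x)).
Proof.
have dl : is_derive x 1 (fun y => u * y) u.
  by apply: is_derive_eq; rewrite /GRing.scale /= mulr1.
by apply: is_derive_eq (is_derive1_comp (is_derive_sin (u * x)) dl) _; rewrite mulrC.
Qed.

Lemma is_derive_expN (x : R) : is_derive x 1 (fun x => expR (- x)) (- expR (- x)).
Proof. by apply: is_derive_eq; rewrite /GRing.scale /= mulrN mulr1. Qed.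

Lemma continuous_sinM (u : R) : continuous (fun x => sin (u * x)).
Proof. by move=> x; exact: is_derive_continuous (is_derive_sinM u x). Qed.

Lemma continuous_cosM (u : R) : continuous (fun x => cos (u * x)).
Proof. by move=> x; exact: is_derive_continuous (is_derive_cosM u x). Qed.

Lemma continuous_expN : continuous (fun x : R => expR (- x)).
Proof. by move=> x; exact: is_derive_continuous (is_derive_expN x). Qed.

Lemma integral_expN_cos (u : R) : \int[mu]_(x in D) (expR (- x) * cos (u * x)) = (1 + u ^+ 2)^-1.
Proof.
have u0 : 1 + u ^+ 2 != 0 by rewrite gt_eqF// ltr_pwDl ?sqr_ge0.
have [ie Ee] := integral_expN.
have [||x||i E] := @FTC2y_cvg0 (fun x => expR (- x) + expR (- x) * cos (u * x))
  (fun x => - expR (- x) + expR (- x) * ((u / (1 + u ^+ 2)) * sin (u * x) - (1 + u ^+ 2)^-1 * cos (u * x))).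
- move=> x _; have := cos_geN1 (u * x) => h; rewrite -[X in X + _]mulr1 -mulrDr.
  by apply: mulr_ge0; [exact: expR_ge0|lra].
- move=> x; apply: cvgD; first exact: continuous_expN.
  by apply: cvgM; [exact: continuous_expN|exact: continuous_cosM].
- have d1 := is_derive_expN x; have d2 := is_derive_cosM u x; have d3 := is_derive_sinM u x.
  apply: is_derive_eq; rewrite /GRing.scale /=; field.
  by rewrite u0.
- exists (1 + (`|u / (1 + u ^+ 2)| + `|(1 + u ^+ 2)^-1|)) => x; rewrite mulrDl mul1r.
  apply: le_trans (ler_normD _ _) _; rewrite normrN ger0_norm ?expR_ge0// lerD2l.
  rewrite normrM ger0_norm ?expR_ge0// mulrC ler_wpM2r ?expR_ge0//.
  apply: le_trans (ler_normB _ _) _; rewrite !normrM lerD// ler_piMr// ler_norml.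
  + by rewrite sin_geN1 sin_le1.
  + by rewrite cos_geN1 cos_le1.
have := RintegralB (mu := mu) (measurable_itv `[0%R, +oo[) i ie.
rewrite {}E Ee => E.
transitivity (\int[mu]_(x in D) (expR (- x) + expR (- x) * cos (u * x) - expR (- x))).
  by apply: eq_Rintegral => x _; rewrite addrAC subrr add0r.
by rewrite E oppr0 mulr0 sin0 cos0 expR0; field.
Qed.

Lemma integral_expN_sin (u : R) : \int[mu]_(x in D) (expR (- x) * sin (u * x)) = u / (1 + u ^+ 2).
Proof.
have u0 : 1 + u ^+ 2 != 0 by rewrite gt_eqF// ltr_pwDl ?sqr_ge0.
have [ie Ee] := integral_expN.
have [||x||i E] := @FTC2y_cvg0 (fun x => expR (- x) + expR (- x) * sin (u * x))
  (fun x => - expR (- x) - expR (- x) * ((1 + u ^+ 2)^-1 * sin (u * x) + (u / (1 + u ^+ 2)) * cos (u * x))).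
- move=> x _; have := sin_geN1 (u * x) => h; rewrite -[X in X + _]mulr1 -mulrDr.
  by apply: mulr_ge0; [exact: expR_ge0|lra].
- move=> x; apply: cvgD; first exact: continuous_expN.
  by apply: cvgM; [exact: continuous_expN|exact: continuous_sinM].
- have d1 := is_derive_expN x; have d2 := is_derive_cosM u x; have d3 := is_derive_sinM u x.
  apply: is_derive_eq; rewrite /GRing.scale /=; field.
  by rewrite u0.
- exists (1 + (`|(1 + u ^+ 2)^-1| + `|u / (1 + u ^+ 2)|)) => x; rewrite mulrDl mul1r.
  apply: le_trans (ler_normB _ _) _; rewrite normrN ger0_norm ?expR_ge0// lerD2l.
  rewrite normrM ger0_norm ?expR_ge0// mulrC ler_wpM2r ?expR_ge0//.
  apply: le_trans (ler_normD _ _) _; rewrite !normrM lerD// ler_piMr// ler_norml.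
  + by rewrite sin_geN1 sin_le1.
  + by rewrite cos_geN1 cos_le1.
have := RintegralB (mu := mu) (measurable_itv `[0%R, +oo[) i ie.
rewrite {}E Ee => E.
transitivity (\int[mu]_(x in D) (expR (- x) + expR (- x) * sin (u * x) - expR (- x))).
  by apply: eq_Rintegral => x _; rewrite addrAC subrr add0r.
by rewrite E oppr0 mulr0 sin0 cos0 expR0; field.
Qed.

(** The half-line enters as the restriction of exp(-x) to it, so that Fubini is applied on the whole
    plane, where the product of two integrable functions with a bounded kernel is integrable. *)
Lemma halfline_Fubini (g : R -> R) (k : MR * MR -> R) :
  mu.-integrable setT (EFin \o g) ->
  measurable_fun setT k -> (forall z, `|k z| <= 1) ->
  mu.-integrable D (EFin \o (fun x => expR (- x) * \int[mu]_t (g t * k (x, t)))) /\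
  \int[mu]_(x in D) (expR (- x) * \int[mu]_t (g t * k (x, t))) =
  \int[mu]_t (g t * \int[mu]_(x in D) (expR (- x) * k (x, t))).
Proof.
move=> ig mk k1; set e := (fun x : R => expR (- x)) \_ D.
have ie : mu.-integrable setT (EFin \o e).
  have := proj1 (integrable_mkcond (mu := mu) _ measurable_halfline) integral_expN.1.
  apply: eq_integrable => // x _ /=; rewrite /e !patchE; by case: ifP.
have mg : measurable_fun [set: MR] g by apply/measurable_EFinP; exact: measurable_int ig.
have me : measurable_fun [set: MR] e by apply/measurable_EFinP; exact: measurable_int ie.
have fi := integrable_kernel ie ig mk k1.
have mk1 x : measurable_fun [set: MR] (fun t => k (x, t)) by exact: measurableT_comp.
have mk2 t : measurable_fun [set: MR] (fun x => k (x, t)) by exact: measurableT_comp.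
have ik x : mu.-integrable setT (fun t => (g t * k (x, t))%:E).
  apply: le_integrable (integrable_norm ig) => //.
    by apply/measurable_EFinP; exact: measurable_funM.
  by move=> t _; rewrite /= lee_fin normr_id normrM ler_piMr.
have ek t : mu.-integrable setT (fun x => (e x * k (x, t))%:E).
  apply: le_integrable (integrable_norm ie) => //.
    by apply/measurable_EFinP; exact: measurable_funM.
  by move=> x _; rewrite /= lee_fin normr_id normrM ler_piMr.
have fx (x : MR) : mu.-integrable setT (fun t => (e x * (g t * k (x, t)))%:E).
  exact: (integrableZl measurableT (e x) (ik x)).
have ft (t : MR) : mu.-integrable setT (fun x => (e x * (g t * k (x, t)))%:E).
  have := integrableZl measurableT (g t) (ek t).
  by apply: eq_integrable => // x _ /=; rewrite -EFinM mulrCA.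
have E := @Rintegral_Fubini (fun z => e z.1 * (g z.2 * k z)) fi fx ft.
have PE (F : R -> R) : (fun x => expR (- x) * F x) \_ D = (fun x => e x * F x).
  by apply/funext => x; rewrite /e !patchE; case: ifP => //; rewrite mul0r.
split.
  apply: (proj2 (integrable_mkcond (mu := mu) _ measurable_halfline)).
  have := @integrable_fubini_F _ _ MR MR R mu mu _ fi.
  apply: eq_integrable => // x _ /=.
  rewrite /fubini_F /= -/(comp EFin _) restrict_EFin PE /=.
  rewrite -(RintegralZl _ measurableT (ik x)) /Rintegral fineK//.
  exact: integrable_fin_num (fx x).
rewrite Rintegral_mkcond PE.
transitivity (\int[mu]_x \int[mu]_y (e x * (g y * k (x, y)))).
  by apply: eq_Rintegral => x _; rewrite RintegralZl//; exact: ik.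
rewrite E; apply: eq_Rintegral => t _.
rewrite (Rintegral_mkcond _ D) PE -RintegralZl//; last exact: ek.
by apply: eq_Rintegral => x _; rewrite mulrCA.
Qed.

End Fubini.

Section ContinuousBase.
Context {R : realType}.
Local Notation C := (cplx R).

Lemma continuous_cplx_cst {T : topologicalType} (c : C) (x : T) :
  {for x, continuous (fun _ : T => c)}.
Proof.
apply/continuous_cplxP => e e0; apply: filterS filterT => y _ /=.
by rewrite subrr cabs0.
Qed.

Lemma continuous_cplx_subl (a z : C) : {for z, continuous (fun w : C => w - a : C)}.
Proof.
apply/continuous_cplx_epsP => e e0; exists e => // w we.
by rewrite opprB addrA subrK.
Qed.

Lemma derivable_cplx_cst (c z : C) : derivable (fun _ : C => c) z 1.
Proof. exact: derivable_cst. Qed.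

Lemma derivable_cplx_subl (a z : C) : derivable (fun w : C => w - a : C) z 1.
Proof.
apply/derivable_cplxP; exists 1 => e e0; exists 1 => // h _.
have -> : z + h - a - (z - a) - 1 * h = 0 by ring.
by rewrite cabs0 mulr_ge0 ?cabs_ge0 ?ltW.
Qed.

Lemma derivable_cplxD (f g : C -> C) (z : C) : derivable f z 1 -> derivable g z 1 ->
  derivable (fun w => f w + g w : C) z 1.
Proof. by move=> df dg; exact: (derivableD df dg). Qed.

Lemma derivable_cplxB (f g : C -> C) (z : C) : derivable f z 1 -> derivable g z 1 ->
  derivable (fun w => f w - g w : C) z 1.
Proof. by move=> df dg; exact: (derivableB df dg). Qed.

Lemma derivable_cplxM (f g : C -> C) (z : C) : derivable f z 1 -> derivable g z 1 ->
  derivable (fun w => f w * g w : C) z 1.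
Proof. by move=> df dg; exact: (derivableM df dg). Qed.

Lemma derivable_cplxV (f : C -> C) (z : C) : derivable f z 1 -> f z != 0 ->
  derivable (fun w => (f w)^-1 : C) z 1.
Proof. by move=> df f0; exact: (derivableV f0 df). Qed.

Lemma derivable_cplx_near (f g : C -> C) (z : C) : (\forall w \near z, f w = g w) ->
  derivable f z 1 -> derivable g z 1.
Proof.
move=> /nbhs_cplxP[r r0 fg] /derivable_cplxP[l Hl]; apply/derivable_cplxP; exists l => e e0.
have [d d0 Hd] := Hl e e0; exists (Num.min d r); first by rewrite lt_min d0.
move=> h; rewrite lt_min => /andP[hd hr]; rewrite -!fg; first exact: Hd.
- by rewrite subrr cabs0.
- by rewrite addrC addKr.
Qed.

End ContinuousBase.

(** * Difference quotients filled in at their centre *)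

Section DifferenceQuotient.
Context {R : realType}.
Local Notation C := (cplx R).
Implicit Types (g : C -> C) (a l z : C).

(** When [l] is the derivative at [a], this is the continuous extension of the quotient. Away from
    [a] it inherits derivability from [g]; at [a] only continuity is proved. *)
Definition dquot g a l : C -> C := fun z => if z == a then l else (g z - g a) / (z - a).

Definition has_cderiv g a l := forall e : R, 0 < e -> exists2 d : R, 0 < d &
  forall h : R[i], cabs h < d -> cabs (g (a + h) - g a - l * h) <= e * cabs h.

Lemma dquot_near g a l (e : R) : has_cderiv g a l -> 0 < e ->
  exists2 d : R, 0 < d & forall z, cabs (z - a) < d -> cabs (dquot g a l z - l) <= e.
Proof.
move=> gl e0; have [d d0 Hd] := gl e e0; exists d => // z zd; rewrite /dquot.
case: (eqVneq z a) => [_|za]; first by rewrite subrr cabs0 ltW.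
have za0 : z - a != 0 by rewrite subr_eq0.
have := Hd _ zd; rewrite subrKC => H.
have -> : (g z - g a) / (z - a) - l = (g z - g a - l * (z - a)) / (z - a).
  by rewrite [RHS]mulrBl mulfK.
by rewrite cabsM cabsV ler_pdivrMr ?cabs_gt0.
Qed.

Lemma continuous_dquot_at g a l : has_cderiv g a l -> {for a, continuous (dquot g a l)}.
Proof.
move=> gl; apply/continuous_cplx_epsP => e e0.
have [d d0 Hd] := dquot_near gl (divr_gt0 e0 (ltr0Sn _ 1)).
exists d => // w /Hd; rewrite {3}/dquot eqxx => H; apply: le_lt_trans H _.
by rewrite ltr_pdivrMr// ltr_pMr// ltr1n.
Qed.

Lemma near_neq_cplx a z : z != a -> \forall w \near z, w != a.
Proof.
move=> za; apply/nbhs_cplxP; exists (cabs (z - a)); first by rewrite cabs_gt0 ?subr_eq0.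
by move=> w; apply: contraTneq => ->; rewrite cabsB ltxx.
Qed.

Lemma near_dquot g a l z : z != a ->
  \forall w \near z, (g w - g a) / (w - a) = dquot g a l w.
Proof.
by move=> /near_neq_cplx; apply: filterS => w wa; rewrite /dquot (negbTE wa).
Qed.

Lemma continuous_dquot g a l z : z != a -> {for z, continuous g} ->
  {for z, continuous (dquot g a l)}.
Proof.
move=> za cg; have H := @near_dquot g a l z za.
have E : dquot g a l z = (g z - g a) / (z - a) by rewrite /dquot (negbTE za).
rewrite /prop_for /continuous_at E.
apply: cvg_trans; first exact: near_eq_cvg H.
have c1 : {for z, continuous (fun w => g w - g a : C)}.
  exact: (continuous_cplxB cg (@continuous_cplx_cst R C (g a) z)).
have c2 : {for z, continuous (fun w => (w - a)^-1 : C)}.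
  by apply: (continuous_cplxV (@continuous_cplx_subl R a z)); rewrite subr_eq0.
exact: (continuous_cplxM c1 c2).
Qed.

Lemma derivable_dquot g a l z : z != a -> derivable g z 1 -> derivable (dquot g a l) z 1.
Proof.
move=> za dg; have H := @near_dquot g a l z za.
have d1 := derivable_cplxB dg (@derivable_cplx_cst R (g a) z).
have d2 : derivable (fun w => (w - a)^-1 : C) z 1.
  by apply: (derivable_cplxV (@derivable_cplx_subl R a z)); rewrite subr_eq0.
exact: (derivable_cplx_near H (derivable_cplxM d1 d2)).
Qed.

End DifferenceQuotient.

(** * Second-order expansion and derivative of the complex exponential *)

Section ComplexExp.
Context {R : realType}.
Local Notation C := (cplx R).

Lemma MVT_bound (f df : R -> R) (K a b : R) : a <= b ->
  (forall x : R, is_derive x 1 f (df x)) -> (forall x, a <= x <= b -> `|df x| <= K) ->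
  `|f b - f a| <= K * (b - a).
Proof.
move=> ab dF dK.
have [|c cab ->] := @MVT_segment R f df a b ab (fun x _ => dF x).
- by apply: continuous_subspaceT => x; exact: is_derive_continuous (dF x).
- rewrite normrM (ger0_norm (x := b - a)) ?subr_ge0// ler_wpM2r ?subr_ge0//.
  by apply: dK; move: cab; rewrite in_itv.
Qed.

Lemma is_derive_expM (w x : R) : is_derive x 1 (fun y => expR (w * y)) (w * expR (w * x)).
Proof.
have dl : is_derive x 1 (fun y => w * y) w.
  by apply: is_derive_eq; rewrite /GRing.scale /= mulr1.
by apply: is_derive_eq (is_derive1_comp (is_derive_expR (w * x)) dl) _; rewrite mulrC.
Qed.

Lemma is_derive_Re_cexp (h : R[i]) (t : R) :
  is_derive t 1 (fun t : R => Re (cexp (h * t%:C))) (Re (h * cexp (h * t%:C))).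
Proof.
have d1 := is_derive_expM (Re h) t; have d2 := is_derive_cosM (Im h) t.
have -> : (fun t : R => Re (cexp (h * t%:C))) =
    (fun t : R => expR (Re h * t) * cos (Im h * t)).
  by apply/funext => x; case: h {d1 d2} => a b /=; rewrite !mulr0 subr0 add0r.
apply: is_derive_eq; case: h {d1 d2} => a b; rewrite /GRing.scale /= !mulr0 subr0 add0r; ring.
Qed.

Lemma is_derive_Im_cexp (h : R[i]) (t : R) :
  is_derive t 1 (fun t : R => Im (cexp (h * t%:C))) (Im (h * cexp (h * t%:C))).
Proof.
have d1 := is_derive_expM (Re h) t; have d2 := is_derive_sinM (Im h) t.
have -> : (fun t : R => Im (cexp (h * t%:C))) =
    (fun t : R => expR (Re h * t) * sin (Im h * t)).
  by apply/funext => x; case: h {d1 d2} => a b /=; rewrite !mulr0 subr0 add0r.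
apply: is_derive_eq; case: h {d1 d2} => a b; rewrite /GRing.scale /= !mulr0 subr0 add0r; ring.
Qed.

Lemma cabs_cexp_le (z : R[i]) : cabs (cexp z) <= expR (cabs z).
Proof.
by rewrite cabs_cexp ler_expR (le_trans (ler_norm _))// Re_le_cabs.
Qed.

Lemma cabsZr (h : R[i]) (t : R) : cabs (h * t%:C) = cabs h * `|t|.
Proof. by rewrite cabsM cabs_real. Qed.

Lemma cabs_scale01 (h : R[i]) (t : R) : 0 <= t <= 1 -> cabs (h * t%:C) <= cabs h.
Proof.
by move=> /andP[t0 t1]; rewrite cabsZr ler_piMr ?cabs_ge0// ger0_norm.
Qed.

Lemma cabs_cexp_sub1 (h : R[i]) : cabs (cexp h - 1) <= 2 * cabs h * expR (cabs h).
Proof.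
pose K := cabs h * expR (cabs h).
have B (t : R) : 0 <= t <= 1 -> cabs (h * cexp (h * t%:C)) <= K.
  move=> t01; rewrite cabsM ler_wpM2l ?cabs_ge0//.
  by apply: le_trans (cabs_cexp_le _) _; rewrite ler_expR cabs_scale01.
have := @MVT_bound _ _ K 0 1 ler01 (is_derive_Re_cexp h) (fun t t01 => le_trans (Re_le_cabs _) (B t t01)).
have := @MVT_bound _ _ K 0 1 ler01 (is_derive_Im_cexp h) (fun t t01 => le_trans (Im_le_cabs _) (B t t01)).
rewrite subr0 !mulr1 mulr0 cexp0 => H1 H2.
apply: le_trans (cabs_le_ReIm _) _; rewrite ReDE ImDE ReNE ImNE.
by rewrite -mulrA mulr_natl mulr2n lerD.
Qed.

(** The mean value estimate is applied a second time: the derivative in t of exp(h t) - h t is h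
    (exp(h t) - 1), already bounded by the first-order estimate. Each passage through real and
    imaginary parts doubles the constant. *)
Lemma cabs_cexp_sub1_le (h : R[i]) :
  cabs (cexp h - 1 - h) <= 4 * cabs h ^+ 2 * expR (cabs h).
Proof.
pose K := cabs h * (2 * cabs h * expR (cabs h)).
have B (t : R) : 0 <= t <= 1 -> cabs (h * (cexp (h * t%:C) - 1)) <= K.
  move=> t01; rewrite cabsM ler_wpM2l ?cabs_ge0//.
  apply: le_trans (cabs_cexp_sub1 _) _; have H := cabs_scale01 h t01.
  by rewrite ler_pM ?expR_ge0 ?ler_expR ?mulr_ge0 ?cabs_ge0// ler_wpM2l.
have dR (t : R) : is_derive t 1 (fun t : R => Re (cexp (h * t%:C)) - Re h * t)
    (Re (h * (cexp (h * t%:C) - 1))).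
  have d1 := is_derive_Re_cexp h t.
  by apply: is_derive_eq; rewrite /GRing.scale /= mulrBr mulr1 mulr1 ReDE ReNE.
have dI (t : R) : is_derive t 1 (fun t : R => Im (cexp (h * t%:C)) - Im h * t)
    (Im (h * (cexp (h * t%:C) - 1))).
  have d1 := is_derive_Im_cexp h t.
  by apply: is_derive_eq; rewrite /GRing.scale /= mulrBr mulr1 mulr1 ImDE ImNE.
have := @MVT_bound _ _ K 0 1 ler01 dR (fun t t01 => le_trans (Re_le_cabs _) (B t t01)).
have := @MVT_bound _ _ K 0 1 ler01 dI (fun t t01 => le_trans (Im_le_cabs _) (B t t01)).
rewrite subr0 !mulr1 !mulr0 cexp0 !subr0 => H1 H2.
apply: le_trans (cabs_le_ReIm _) _; rewrite !ReDE !ImDE !ReNE !ImNE.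
rewrite addrAC /= subr0; apply: le_trans (lerD H2 H1) _.
by rewrite /K le_eqVlt; apply/orP; left; apply/eqP; ring.
Qed.

Lemma derivable_cexp (z : C) : derivable (@cexp R : C -> C) z 1.
Proof.
apply/derivable_cplxP; exists (cexp z) => e e0.
pose B := cabs (cexp z) * 4 * expR 1 + 1.
have B0 : 0 < B by rewrite ltr_wpDl ?mulr_ge0 ?cabs_ge0 ?expR_ge0.
exists (Num.min 1 (e / B)); first by rewrite lt_min ltr01 divr_gt0.
move=> h; rewrite lt_min => /andP[h1]; rewrite ltr_pdivlMr// => h2.
have -> : cexp (z + h) - cexp z - cexp z * h = cexp z * (cexp h - 1 - h).
  by rewrite cexpD !mulrBr mulr1.
rewrite cabsM; apply: le_trans (ler_wpM2l (cabs_ge0 _) (cabs_cexp_sub1_le _)) _.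
apply: (@le_trans _ _ (cabs h * B * cabs h)); last by rewrite ler_wpM2r ?cabs_ge0 ?ltW.
have E1 : expR (cabs h) <= expR 1 by rewrite ler_expR ltW.
have c0 := cabs_ge0 (cexp z); have h0 := cabs_ge0 h.
have -> : cabs (cexp z) * (4 * cabs h ^+ 2 * expR (cabs h)) =
  cabs h * (cabs (cexp z) * 4 * expR (cabs h)) * cabs h by ring.
rewrite ler_wpM2r// ler_wpM2l// /B.
by apply: (@le_trans _ _ (cabs (cexp z) * 4 * expR 1)); rewrite ?ler_wpM2l ?mulr_ge0 ?lerDl.
Qed.

End ComplexExp.

(** * The inverse Fourier integral on horizontal lines *)

Section Inversion.
Context {R : realType}.
Local Notation C := (cplx R).
Local Notation mu := (@lebesgue_measure R).
Local Notation MR := (measurableTypeR R).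
Local Notation D := (`[0%R, +oo[%classic : set MR).
Implicit Types G : C -> C.

Lemma continuous_RcplxM (f g : R -> C) : continuous f -> continuous g ->
  continuous (fun x => f x * g x : C).
Proof. by move=> cf cg x; exact: continuous_cplxM (cf x) (cg x). Qed.

Lemma continuous_Rcplx_cst (c : C) : continuous (fun _ : R => c).
Proof. by move=> x; exact: continuous_cplx_cst. Qed.

Definition strip_decay G := forall A : R, exists M, forall x y : R, `|y| <= A ->
  cabs (G (x +i* y)) <= M * cau x.

Definition ker (x : R) (z : R[i]) : C := cexp ('i * z * x%:C).

Lemma cabs_ker (x t y : R) : cabs (ker x (t +i* y)) = expR (- (y * x)).
Proof.
rewrite /ker cabs_cexp; congr expR.
by rewrite ReME ReME ImME /= !mul0r !mulr0 !mul1r sub0r subr0 mulNr.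
Qed.

Lemma derivable_ker (x : R) (z : C) : derivable (ker x : C -> C) z 1.
Proof.
apply/derivable_cplxP; have /derivable_cplxP[l Hl] := @derivable_cexp R ('i * z * x%:C).
exists (l * ('i * x%:C)) => e e0.
have [d d0 Hd] := Hl (e / (1 + `|x|)) (divr_gt0 e0 (ltr_pwDl ltr01 (normr_ge0 x))).
have X0 : 0 < 1 + `|x| by rewrite ltr_pwDl.
exists (d / (1 + `|x|)); first by rewrite divr_gt0.
move=> h; rewrite ltr_pdivlMr// => hd.
have hx : cabs ('i * h * x%:C) = cabs h * `|x| by rewrite cabsZr cabsM cabs_i mul1r.
have hx1 : cabs h * `|x| <= cabs h * (1 + `|x|) by rewrite ler_wpM2l ?cabs_ge0// lerDr.
have /Hd : cabs ('i * h * x%:C) < d by rewrite hx (le_lt_trans hx1).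
rewrite /ker hx (_ : l * ('i * x%:C) * h = l * ('i * h * x%:C)); last by ring.
rewrite (_ : 'i * (z + h) * x%:C = 'i * z * x%:C + 'i * h * x%:C); last by ring.
move=> H; apply: le_trans H _; rewrite -mulrA ler_wpM2l ?(ltW e0)// mulrC ler_pdivrMr//.
Qed.

Lemma continuous_ker (x : R) (z : C) : {for z, continuous (ker x : C -> C)}.
Proof. exact/derivable_continuous_cplx/derivable_ker. Qed.

Lemma continuous_ker_x (z : R[i]) : continuous (fun x : R => ker x z).
Proof.
move=> x; apply: continuous_ReIm.
- apply: (@is_derive_continuous R _ _ x); exact: is_derive_Re_cexp.
- apply: (@is_derive_continuous R _ _ x); exact: is_derive_Im_cexp.
Qed.

Lemma continuous_ker_line (x y : R) : continuous (fun t : R => ker x (t +i* y)).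
Proof. by move=> t; exact/continuous_horizontal/continuous_ker. Qed.

Definition lineF G (y x : R) : C := cint setT (fun t : R => G (t +i* y) * ker x (t +i* y)).
(** The factor 1 / (2 pi) is omitted; the inversion formula carries [2 * pi] on its right-hand side
    instead. *)
Definition invFourier G (x : R) : C := lineF G 0 x.

Variable G : C -> C.
Hypothesis cG : forall z, {for z, continuous G}.
Hypothesis dG : forall x y : R, y != 0 -> derivable G (x +i* y) 1.
Hypothesis bG : strip_decay G.

Lemma continuous_line (y : R) : continuous (fun t : R => G (t +i* y)).
Proof. by move=> t; exact/continuous_horizontal/cG. Qed.

(** The real axis, where G is only known to be continuous, is a boundary line of the strip between
    the heights 0 and y. *)
Lemma lineF_shift (y x : R) : lineF G y x = invFourier G x.
Proof.
have cF (z : C) : {for z, continuous (fun z => G z * ker x z)}.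
  by apply: continuous_cplxM; [exact: cG|exact: continuous_ker].
have dF (t s : R) : s != 0 -> derivable (fun z => G z * ker x z) (t +i* s : C) 1.
  by move=> s0; apply: derivable_cplxM; [exact: dG|exact: derivable_ker].
have [M HM] := bG `|y|.
have bF (t s : R) : `|s| <= `|y| ->
    cabs (G (t +i* s) * ker x (t +i* s)) <= M * expR (`|y| * `|x|) * cau t.
  move=> sy; rewrite cabsM cabs_ker mulrAC ler_pM ?cabs_ge0 ?expR_ge0 ?HM//.
  rewrite ler_expR -mulNr (le_trans (ler_norm _))// normrM normrN ler_wpM2r//.
have [y0|y0] := leP 0 y.
- have sh := @strip_shift R (fun z => G z * ker x z) 0 y (M * expR (`|y| * `|x|)) y0
    (fun t s _ => cF (t +i* s)).
  apply/esym/sh => t s /andP[s0 sy]; first by apply: dF; rewrite gt_eqF.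
  by apply: bF; rewrite !ger0_norm.
- have sh := @strip_shift R (fun z => G z * ker x z) y 0 (M * expR (`|y| * `|x|)) (ltW y0)
    (fun t s _ => cF (t +i* s)).
  apply: sh => t s /andP[sy s0]; first by apply: dF; rewrite lt_eqF.
  by apply: bF; rewrite !ler0_norm ?(ltW y0)// lerN2.
Qed.

(** The height y may be chosen anew for each x, although the left-hand side does not depend on
    it. *)
Lemma cabs_invFourier_le (y x M : R) : (forall t : R, cabs (G (t +i* y)) <= M * cau t) ->
  cabs (invFourier G x) <= 2 * (M * expR (- (y * x))) * \int[mu]_t cau t.
Proof.
move=> HM; rewrite -(lineF_shift y); apply: le_cint_cau.
  exact: (continuous_RcplxM (@continuous_line y) (@continuous_ker_line x y)).
by move=> t; rewrite cabsM cabs_ker mulrAC ler_wpM2r ?expR_ge0.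
Qed.

Lemma continuous_cint_param (f : R -> R -> C) (M : R) :
  (forall x, continuous (f x)) -> (forall t, continuous (f ^~ t)) ->
  (forall x t, cabs (f x t) <= M * cau t) ->
  continuous (fun x => cint setT (f x)).
Proof.
move=> c1 c2 fM x.
have iM : mu.-integrable setT (EFin \o (fun t => M * cau t)).
  exact: (integrableZl measurableT M integrable_cau).
have ci y := cau_cintegrable (c1 y) (fM y).
have xI : x \in (`]x - 1, x + 1[%classic : set R).
  by apply/mem_set; rewrite /= in_itv /=; apply/andP; split; lra.
apply: continuous_ReIm => /=.
- apply: (@continuity_under_integral R _ MR mu (fun y t => Re (f y t)) setT measurableT
    (x - 1) (x + 1) _ _ _ iM _ x xI) => //.
  + by move=> y _; exact: (ci y).1.
  + by apply: aeW => t _ y _; exact: continuous_Re (c2 t y).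
  + by move=> y _; apply: aeW => t _; apply: le_trans (fM y t); exact: Re_le_cabs.
- apply: (@continuity_under_integral R _ MR mu (fun y t => Im (f y t)) setT measurableT
    (x - 1) (x + 1) _ _ _ iM _ x xI) => //.
  + by move=> y _; exact: (ci y).2.
  + by apply: aeW => t _ y _; exact: continuous_Im (c2 t y).
  + by move=> y _; apply: aeW => t _; apply: le_trans (fM y t); exact: Im_le_cabs.
Qed.

Lemma continuous_invFourier : continuous (invFourier G).
Proof.
have [M HM] := bG 0; apply: (@continuous_cint_param _ M).
- by move=> x; exact: (continuous_RcplxM (@continuous_line 0) (@continuous_ker_line x 0)).
- by move=> t; exact: (continuous_RcplxM (@continuous_Rcplx_cst _) (@continuous_ker_x _)).
- by move=> x t; rewrite cabsM cabs_ker mul0r oppr0 expR0 mulr1 HM// normr0.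
Qed.

End Inversion.

(** * Half-line integrals of a line integral *)

Section HalfLine.
Context {R : realType}.
Local Notation C := (cplx R).
Local Notation mu := (@lebesgue_measure R).
Local Notation MR := (measurableTypeR R).
Local Notation D := (`[0%R, +oo[%classic : set MR).

Lemma integrable_mul_le1 (g k : R -> R) : mu.-integrable setT (EFin \o g) ->
  measurable_fun [set: MR] k -> (forall t, `|k t| <= 1) ->
  mu.-integrable setT (EFin \o (fun t => g t * k t)).
Proof.
move=> ig mk k1.
have mg : measurable_fun [set: MR] g by apply/measurable_EFinP; exact: measurable_int ig.
apply: le_integrable (integrable_norm ig) => //.
  by apply/measurable_EFinP; exact: measurable_funM.
by move=> t _; rewrite /= lee_fin normr_id normrM ler_piMr.
Qed.

(** This is 1 / (1 - i u), the integral of exp(-x) exp(i u x) over the half-line. *)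
Definition cpole (u : R) : R[i] := (1 + u ^+ 2)^-1 +i* (u / (1 + u ^+ 2)).

Lemma onesqr_gt0 (u : R) : 0 < 1 + u ^+ 2.
Proof. by rewrite ltr_pwDl ?sqr_ge0. Qed.

Lemma norm_onesqrV_le1 (u : R) : `|(1 + u ^+ 2)^-1| <= 1.
Proof.
by rewrite ger0_norm ?invr_ge0 ?(ltW (onesqr_gt0 u))// invf_le1 ?onesqr_gt0// lerDl sqr_ge0.
Qed.

Lemma norm_div_onesqr_le1 (u : R) : `|u / (1 + u ^+ 2)| <= 1.
Proof.
rewrite normrM normfV (ger0_norm (ltW (onesqr_gt0 u))) ler_pdivrMr ?onesqr_gt0// mul1r.
rewrite -[X in _ <= 1 + X]real_normK ?num_real//.
by have := sqr_ge0 (`|u| - 1); have := normr_ge0 u; nra.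
Qed.

Lemma continuous_onesqrV : continuous (fun u : R => (1 + u ^+ 2)^-1).
Proof. exact: continuous_oneDsqrV. Qed.

Lemma continuous_div_onesqr : continuous (fun u : R => u / (1 + u ^+ 2)).
Proof. by move=> u; apply: cvgM; [exact: cvg_id|exact: continuous_onesqrV]. Qed.

Lemma continuous_affineR (s a : R) : continuous (fun t : R => s * (t - a)).
Proof.
by move=> t; apply: cvgM; [exact: cvg_cst|apply: cvgB; [exact: cvg_id|exact: cvg_cst]].
Qed.

Lemma continuous_affine_comp (f : R -> R) (s a : R) : continuous f ->
  continuous (fun t : R => f (s * (t - a))).
Proof. by move=> cf t; apply: continuous_comp; [exact: continuous_affineR|exact: cf]. Qed.

Lemma norm_cos_le1 (x : R) : `|cos x| <= 1.
Proof. by rewrite ler_norml cos_geN1 cos_le1. Qed.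

Lemma norm_sin_le1 (x : R) : `|sin x| <= 1.
Proof. by rewrite ler_norml sin_geN1 sin_le1. Qed.

Lemma cexp_i (x : R) : cexp ('i * x%:C) = cos x +i* sin x :> R[i].
Proof. rewrite /cexp; have -> : Re ('i * x%:C) = 0 by rewrite ReME /= mul0r mulr0 subrr.
have -> : Im ('i * x%:C) = x by rewrite ImME /= mul0r mul1r add0r.
by rewrite expR0 !mul1r. Qed.

(** Fubini is applied to four real integrals, the real or imaginary part of g against a cosine or
    sine; the resulting half-line integrals assemble to [cpole]. *)
Lemma halfline_cFubini (g : R -> C) (M s a : R) (inner : R -> C) : continuous g ->
  (forall t, cabs (g t) <= M * cau t) ->
  (forall x, inner x =
    cint setT (fun t => g t * ((expR (- x))%:C * cexp ('i * (s * (t - a) * x)%:C)))) ->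
  cintegrable D inner /\
  cint D inner = cint setT (fun t => g t * cpole (s * (t - a))).
Proof.
move=> cg gM innerE.
have [i1 i2] := cau_cintegrable cg gM.
pose arg (z : MR * MR) : R := s * (z.2 - a) * z.1.
have marg : measurable_fun [set: MR * MR] arg.
  apply: measurable_funM => //; apply: measurable_funM => //.
  exact: measurable_funB.
have mcos : measurable_fun [set: MR * MR] (fun z => cos (arg z)).
  by apply: measurableT_comp marg; apply: continuous_measurable_fun; exact: continuous_cos.
have msin : measurable_fun [set: MR * MR] (fun z => sin (arg z)).
  by apply: measurableT_comp marg; apply: continuous_measurable_fun; exact: continuous_sin.
have c1 z : `|cos (arg z)| <= 1 by exact: norm_cos_le1.
have s1 z : `|sin (arg z)| <= 1 by exact: norm_sin_le1.
have mcx x : measurable_fun [set: MR] (fun t => cos (arg (x, t))).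
  exact: (measurableT_comp mcos (measurable_pair1 x)).
have msx x : measurable_fun [set: MR] (fun t => sin (arg (x, t))).
  exact: (measurableT_comp msin (measurable_pair1 x)).
have [j1 E1] := halfline_Fubini i1 mcos c1.
have [j2 E2] := halfline_Fubini i2 msin s1.
have [j3 E3] := halfline_Fubini i1 msin s1.
have [j4 E4] := halfline_Fubini i2 mcos c1.
have ReE x : Re (inner x) = expR (- x) * \int[mu]_t (Re (g t) * cos (arg (x, t)))
    - expR (- x) * \int[mu]_t (Im (g t) * sin (arg (x, t))).
  have a1 := integrable_mul_le1 i1 (mcx x) (fun t => c1 (x, t)).
  have a2 := integrable_mul_le1 i2 (msx x) (fun t => s1 (x, t)).
  rewrite innerE -mulrBr -(RintegralB measurableT a1 a2).
  rewrite -(RintegralZl _ measurableT (integrableB measurableT a1 a2)).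
  apply: eq_Rintegral => t _; rewrite cexp_i !ReME ImME /= /arg /=; ring.
have ImE x : Im (inner x) = expR (- x) * \int[mu]_t (Re (g t) * sin (arg (x, t)))
    + expR (- x) * \int[mu]_t (Im (g t) * cos (arg (x, t))).
  have a1 := integrable_mul_le1 i1 (msx x) (fun t => s1 (x, t)).
  have a2 := integrable_mul_le1 i2 (mcx x) (fun t => c1 (x, t)).
  rewrite innerE -mulrDr -(RintegralD measurableT a1 a2).
  rewrite -(RintegralZl _ measurableT (integrableD measurableT a1 a2)).
  apply: eq_Rintegral => t _; rewrite cexp_i ImME ReME ImME /= /arg /=; ring.
have cin : cintegrable D inner.
  split.
    apply: eq_integrable (integrableB measurable_halfline j1 j2).
      exact: measurable_halfline.
    by move=> x _; rewrite /= ReE EFinB.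
  apply: eq_integrable (integrableD measurable_halfline j3 j4).
    exact: measurable_halfline.
  by move=> x _; rewrite /= ImE EFinD.
split; first exact: cin.
have cp := continuous_affine_comp (s := s) (a := a) continuous_onesqrV.
have cq := continuous_affine_comp (s := s) (a := a) continuous_div_onesqr.
have p1 t := norm_onesqrV_le1 (s * (t - a)).
have q1 t := norm_div_onesqr_le1 (s * (t - a)).
have b1 := integrable_mul_le1 i1 (continuous_measurableR cp) p1.
have b2 := integrable_mul_le1 i2 (continuous_measurableR cq) q1.
have b3 := integrable_mul_le1 i1 (continuous_measurableR cq) q1.
have b4 := integrable_mul_le1 i2 (continuous_measurableR cp) p1.
apply: cplx_eq => /=.
- under eq_Rintegral do rewrite ReE.
  rewrite (RintegralB measurable_halfline j1 j2) E1 E2.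
  under [in RHS]eq_Rintegral do rewrite ReME /=.
  rewrite (RintegralB measurableT b1 b2); congr (_ - _); apply: eq_Rintegral => t _; congr (_ * _).
    by rewrite /arg /= integral_expN_cos.
  by rewrite /arg /= integral_expN_sin.
- under eq_Rintegral do rewrite ImE.
  rewrite (RintegralD measurable_halfline j3 j4) E3 E4.
  under [in RHS]eq_Rintegral do rewrite ImME /=.
  rewrite (RintegralD measurableT b3 b4); congr (_ + _); apply: eq_Rintegral => t _; congr (_ * _).
    by rewrite /arg /= integral_expN_sin.
  by rewrite /arg /= integral_expN_cos.
Qed.

End HalfLine.

(** * A regularised Cauchy kernel and its integral *)

Section PoissonConstant.
Context {R : realType}.
Local Notation C := (cplx R).
Local Notation mu := (@lebesgue_measure R).
Local Notation MR := (measurableTypeR R).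

Lemma cau_shift_le (t a : R) : cau (t - a) <= 2 * (1 + a ^+ 2) * cau t.
Proof.
rewrite /cau ler_pdivlMr ?onesqr_gt0// mulrC ler_pdivrMr ?onesqr_gt0//.
have := sqr_ge0 (t - 2 * a); have := sqr_ge0 (a * (t - a)); nra.
Qed.

(** On the lines Im w = s with s = 1 or -1, [cauP] and [- s * cauQ] are the real and imaginary parts
    of 4 / (w (4 + w^2)) = 1/w - w / (4 + w^2). The subtracted term makes the Cauchy kernel 1/w
    integrable, and its poles 2i and -2i lie outside the strip |Im w| <= 1. *)
Definition cauQ (u : R) : R := 12 / ((1 + u ^+ 2) * (9 + u ^+ 2)).
Definition cauP (u : R) : R := 4 * u / ((1 + u ^+ 2) * (9 + u ^+ 2)).

Let n9 (u : R) : 0 < 9 + u ^+ 2. Proof. by rewrite ltr_pwDl ?sqr_ge0. Qed.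

Let c9 : continuous (fun u : R => (9 + u ^+ 2)^-1).
Proof.
move=> u; apply: cvgV; first by rewrite gt_eqF.
by apply: cvgD; [exact: cvg_cst|exact: exprn_continuous].
Qed.

Lemma continuous_cauQ : continuous cauQ.
Proof.
have -> : cauQ = (fun u => 12 * ((1 + u ^+ 2)^-1 * (9 + u ^+ 2)^-1)).
  by apply/funext => u; rewrite /cauQ invfM.
move=> u; apply: cvgM; first exact: cvg_cst.
by apply: cvgM; [exact: continuous_onesqrV|exact: c9].
Qed.

Lemma continuous_cauP : continuous cauP.
Proof.
have -> : cauP = (fun u => 4 * (u / (1 + u ^+ 2) * (9 + u ^+ 2)^-1)).
  by apply/funext => u; rewrite /cauP invfM !mulrA.
move=> u; apply: cvgM; first exact: cvg_cst.
by apply: cvgM; [exact: continuous_div_onesqr|exact: c9].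
Qed.

Lemma cauQ_le u : `|cauQ u| <= 2 * cau u.
Proof.
have h1 := onesqr_gt0 u; have h9 := n9 u.
rewrite ger0_norm ?divr_ge0 ?mulr_ge0 ?(ltW h1) ?(ltW h9)//.
rewrite /cauQ invfM mulrCA mulrC ler_wpM2r ?invr_ge0 ?(ltW h1)// ler_pdivrMr//.
by have := sqr_ge0 u; lra.
Qed.

Lemma cauP_le u : `|cauP u| <= 4 * cau u.
Proof.
have h1 := onesqr_gt0 u; have h9 := n9 u.
rewrite normrM normfV normrM (ger0_norm (ltW (mulr_gt0 h1 h9))) ger0_norm//.
rewrite invfM mulrCA mulrC ler_wpM2r ?invr_ge0 ?(ltW h1)// ler_pdivrMr//.
rewrite ler_wpM2l// -[X in _ <= 9 + X]real_normK ?num_real//.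
by have := sqr_ge0 (`|u| - 1); have := normr_ge0 u; nra.
Qed.

Lemma continuous_shiftR (f : R -> R) (a : R) : continuous f ->
  continuous (fun t : R => f (t - a)).
Proof.
move=> cf t; apply: continuous_comp; last exact: cf.
by apply: cvgB; [exact: cvg_id|exact: cvg_cst].
Qed.

Let shift_le (f : R -> R) (K a t : R) : 0 <= K -> (forall u, `|f u| <= K * cau u) ->
  `|f (t - a)| <= K * (2 * (1 + a ^+ 2)) * cau t.
Proof.
by move=> K0 fK; apply: le_trans (fK _) _; rewrite -mulrA ler_wpM2l// cau_shift_le.
Qed.

Lemma integrable_shift_cau (f : R -> R) (K a : R) : 0 <= K -> continuous f ->
  (forall u, `|f u| <= K * cau u) ->
  mu.-integrable setT (EFin \o (fun t => f (t - a))).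
Proof.
move=> K0 cf fK.
have iM := integrableZl measurableT (K * (2 * (1 + a ^+ 2))) (@integrable_cau R).
apply: le_integrable iM => //.
  by apply/measurable_EFinP; apply: continuous_measurableR; exact: continuous_shiftR.
move=> t _; rewrite /= lee_fin; apply: le_trans (shift_le a t K0 fK) _; exact: ler_norm.
Qed.

Lemma cvg_atan_shift (a k : R) : 0 < k -> atan (k * (n.+1%:R - a)) @[n --> \oo] --> (pi / 2 : R).
Proof.
move=> k0; have H : k * (n.+1%:R - a) @[n --> \oo] --> +oo.
  apply/cvgryPge => A; near=> n.
  rewrite -ler_pdivrMl// lerBrDr; apply: (@le_trans _ _ n%:R); last by rewrite ler_nat.
  by near: n; exact: nbhs_infty_ger.
exact: (@cvg_comp _ _ _ (fun n : nat => k * (n.+1%:R - a)) (@atan R) _ _ _ H (@cvgy_atan R)).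
Unshelve. all: by end_near. Qed.

Lemma is_derive_atan_affine (k a x : R) :
  is_derive x 1 (fun t => atan (k * (t - a))) (k / (1 + (k * (x - a)) ^+ 2)).
Proof.
have dl : is_derive x 1 (fun y => k * (y - a)) k.
  by apply: is_derive_eq; rewrite /GRing.scale /= subr0 mulr1.
have dA := @is_derive1_comp R (@atan R) (fun y => k * (y - a)) x _ _ (is_derive1_atan _) dl.
by apply: is_derive_eq dA _; rewrite mulrC.
Qed.

(** Partial fractions give 12 / ((1 + u^2) (9 + u^2)) = 3/2 (1 / (1 + u^2) - 1 / (9 + u^2)), which
    is integrated by arctangents; the value is 3/2 (pi - pi / 3). *)
Lemma integral_cauQ (a : R) : \int[mu]_t cauQ (t - a) = pi.
Proof.
have iQ := @integrable_shift_cau cauQ 2 a (ler0n _ 2) continuous_cauQ cauQ_le.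
have := cvg_trunc iQ; move=> /(cvg_lim (@Rhausdorff R)) <-; apply: cvg_lim; first exact: Rhausdorff.
pose Th t : R := 3 / 2 * atan (1 * (t - a)) - 1 / 2 * atan (3^-1 * (t - a)).
have dTh (x : R) : is_derive x 1 Th (cauQ (x - a)).
  have d1 := is_derive_atan_affine 1 a x; have d2 := is_derive_atan_affine 3^-1 a x.
  have n1 := onesqr_gt0 (x - a); have n2 := n9 (x - a).
  apply: is_derive_eq; rewrite /GRing.scale /= /cauQ !mul1r.
  by field; rewrite !gt_eqF.
have cQ := continuous_shiftR (a := a) continuous_cauQ.
have E n : \int[mu]_(x in `[- n.+1%:R, n.+1%:R]) cauQ (x - a) = Th n.+1%:R - Th (- n.+1%:R).
  by apply: Rintegral_FTC2 => //; rewrite ge0_cp.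
under eq_fun do rewrite E.
have lim1 : Th n.+1%:R @[n --> \oo] --> 3 / 2 * (pi / 2) - 1 / 2 * (pi / 2).
  apply: cvgB; apply: cvgM; [exact: cvg_cst| |exact: cvg_cst|].
    by apply: cvg_atan_shift.
  by apply: cvg_atan_shift; rewrite invr_gt0.
have lim2 : Th (- n.+1%:R) @[n --> \oo] --> - (3 / 2 * (pi / 2) - 1 / 2 * (pi / 2)).
  have EN n : Th (- n.+1%:R) = - (3 / 2 * atan (1 * (n.+1%:R - - a)) - 1 / 2 * atan (3^-1 * (n.+1%:R - - a))).
    have e k : k * (- n.+1%:R - a) = - (k * (n.+1%:R - - a)) by ring.
    by rewrite /Th !e !atanN; ring.
  under eq_fun do rewrite EN.
  apply: cvgN; apply: cvgB; apply: cvgM; [exact: cvg_cst| |exact: cvg_cst|].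
    by apply: cvg_atan_shift.
  by apply: cvg_atan_shift; rewrite invr_gt0.
have -> : (pi : R) = 3 / 2 * (pi / 2) - 1 / 2 * (pi / 2) - - (3 / 2 * (pi / 2) - 1 / 2 * (pi / 2)) by field.
exact: cvgB lim1 lim2.
Qed.

End PoissonConstant.

(** * The inversion formula off the real axis *)

Section InversionTheorem.
Context {R : realType}.
Local Notation C := (cplx R).
Local Notation mu := (@lebesgue_measure R).
Local Notation MR := (measurableTypeR R).
Local Notation D := (`[0%R, +oo[%classic : set MR).

Lemma strip_shift_exc1 (F : C -> C) (c d M p : R) : c <= d ->
  (forall x y : R, c <= y <= d -> {for (x +i* y : C), continuous F}) ->
  (forall x y : R, c < y < d -> y != p -> derivable F (x +i* y) 1) ->
  (forall x y : R, c <= y <= d -> cabs (F (x +i* y)) <= M * cau x) ->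
  cint setT (fun x => F (x +i* c)) = cint setT (fun x => F (x +i* d)).
Proof.
move=> cd cF dF FM.
have [/andP[cp pd]|out] := boolP (c < p < d).
  transitivity (cint setT (fun x => F (x +i* p))).
    apply: (@strip_shift R F c p M (ltW cp)) => x y /andP[h1 h2].
    - by apply: cF; rewrite h1 (le_trans h2 (ltW pd)).
    - by apply: dF; rewrite ?(lt_eqF h2)// h1 (lt_trans h2 pd).
    - by apply: FM; rewrite h1 (le_trans h2 (ltW pd)).
  apply: (@strip_shift R F p d M (ltW pd)) => x y /andP[h1 h2].
  - by apply: cF; rewrite h2 (le_trans (ltW cp) h1).
  - by apply: dF; rewrite ?(gt_eqF h1)// h2 (lt_trans cp h1).
  - by apply: FM; rewrite h2 (le_trans (ltW cp) h1).
apply: (@strip_shift R F c d M cd) => // x y ycd; apply: dF => //.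
by apply: contraNneq out => <-.
Qed.

(** The strip is cut at the heights where F is only known to be continuous. In the application these
    are the real axis and the height of the point at which the formula is evaluated. *)
Lemma strip_shift_exc2 (F : C -> C) (c d M p q : R) : c <= q -> q <= d ->
  (forall x y : R, c <= y <= d -> {for (x +i* y : C), continuous F}) ->
  (forall x y : R, c < y < d -> y != p -> y != q -> derivable F (x +i* y) 1) ->
  (forall x y : R, c <= y <= d -> cabs (F (x +i* y)) <= M * cau x) ->
  cint setT (fun x => F (x +i* c)) = cint setT (fun x => F (x +i* d)).
Proof.
move=> cq qd cF dF FM; transitivity (cint setT (fun x => F (x +i* q))).
  apply: (@strip_shift_exc1 F c q M p cq) => x y /andP[h1 h2].
  - by apply: cF; rewrite h1 (le_trans h2 qd).
  - by move=> yp; apply: dF; rewrite ?(lt_eqF h2)// h1 (lt_le_trans h2 qd).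
  - by apply: FM; rewrite h1 (le_trans h2 qd).
apply: (@strip_shift_exc1 F q d M p qd) => x y /andP[h1 h2].
- by apply: cF; rewrite h2 (le_trans cq h1).
- by move=> yp; apply: dF; rewrite ?(gt_eqF h1)// h2 (le_lt_trans cq h1).
- by apply: FM; rewrite h2 (le_trans cq h1).
Qed.

(* 1/w = - i s (1 + i s u)/(1 + u^2) for w = u + i s, s = 1 or -1 *)
Lemma cpole_invE (u s : R) : s ^+ 2 = 1 -> (u +i* s)^-1 = - 'i * s%:C * cpole (s * u) :> R[i].
Proof.
move=> s1; have su : (s * u) ^+ 2 = u ^+ 2 by rewrite exprMn s1 mul1r.
have n1 := onesqr_gt0 u.
have w0 : (u +i* s) != 0 :> R[i].
  apply/eqP => -[_ s0]; move: s1; rewrite s0 expr0n /= => /eqP.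
  by rewrite eq_sym oner_eq0.
apply: (mulfI w0); rewrite divff//; apply: cplx_eq;
  rewrite ?(ReME, ImME, ReNE, ImNE) /= su.
- transitivity ((s ^+ 2 + s ^+ 2 * u ^+ 2) / (1 + u ^+ 2)); last by field; rewrite gt_eqF.
  by rewrite s1 mul1r divff ?gt_eqF.
- transitivity (s * u * (s ^+ 2 - 1) / (1 + u ^+ 2)); last by field; rewrite gt_eqF.
  by rewrite s1 subrr mulr0 mul0r.
Qed.

Definition cauK (u s : R) : R[i] := cauP u +i* (- s * cauQ u).

Lemma cauKE (u s : R) : s ^+ 2 = 1 ->
  cauK u s = 4 / ((u +i* s) * (4 + (u +i* s) ^+ 2)) :> R[i].
Proof.
move=> s1; have n1 := onesqr_gt0 u; have n9 : 0 < 9 + u ^+ 2 by rewrite ltr_pwDl ?sqr_ge0.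
have wE : (u +i* s) * (4 + (u +i* s) ^+ 2) = (u * (1 + u ^+ 2)) +i* (3 * s * (1 + u ^+ 2)) :> R[i].
  apply: cplx_eq; rewrite expr2 ?(ReME, ImME, ReDE, ImDE) /=.
    transitivity (4 * u + u ^+ 3 - 3 * s ^+ 2 * u); first by ring.
    by rewrite s1; ring.
  transitivity (4 * s + 3 * u ^+ 2 * s - s * s ^+ 2); first by ring.
  by rewrite s1; ring.
have w0 : (u +i* s) * (4 + (u +i* s) ^+ 2) != 0 :> R[i].
  rewrite wE; apply/eqP => -[_ /eqP]; rewrite !mulf_eq0 (gt_eqF n1) orbF pnatr_eq0 /=.
  by move=> /eqP s0; move: s1; rewrite s0 expr0n /= => /eqP; rewrite eq_sym oner_eq0.
apply: (mulIf w0); rewrite mulfVK// wE; apply: cplx_eq;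
  rewrite ?(ReME, ImME, ReNE, ImNE) /= /cauP /cauQ.
- transitivity ((4 * u ^+ 2 + 36 * s ^+ 2) / (9 + u ^+ 2)); first by field; rewrite !gt_eqF.
  by rewrite s1; field; rewrite gt_eqF.
- by field; rewrite !gt_eqF.
Qed.

Lemma cauK_cint (a s : R) : s ^+ 2 = 1 ->
  cintegrable setT (fun t => cauK (t - a) s) /\
  cint setT (fun t => cauK (t - a) s) = (\int[mu]_t cauP (t - a)) +i* (- s * pi).
Proof.
move=> s1.
have iQ := @integrable_shift_cau R (@cauQ R) 2 a (ler0n _ 2) (@continuous_cauQ R) (@cauQ_le R).
have iP := @integrable_shift_cau R (@cauP R) 4 a (ler0n _ 4) (@continuous_cauP R) (@cauP_le R).
split; first split.
- exact: iP.
- exact: (integrableZl measurableT (- s) iQ).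
- by rewrite /cint /= (RintegralZl _ measurableT iQ) integral_cauQ.
Qed.

Definition halfS (h : R -> C) (u : R -> C) : C :=
  cint D (fun x => h x * u x) + cint D (fun x => h (- x) * u (- x)).

Variable G : C -> C.
Hypothesis cG : forall z, {for z, continuous G}.
Hypothesis dG : forall x y : R, y != 0 -> derivable G (x +i* y) 1.
Hypothesis bG : strip_decay G.

(** On the line of height b + s the kernel has modulus exp(- (b + s) s x) and the exponential has
    modulus exp(b s x). Since s^2 = 1 the product is exp(-x), which makes the half-line integral
    converge. *)
Lemma halfline_invFourier (a b s : R) : s ^+ 2 = 1 ->
  let inner x := invFourier G (s * x) * cexp (- 'i * (a +i* b) * (s * x)%:C) in
  cintegrable D inner /\
  cint D inner = cint setT (fun t => G (t +i* (b + s)) * cpole (s * (t - a))).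
Proof.
move=> s1 inner; have [M HM] := bG `|b + s|.
apply: (@halfline_cFubini R (fun t => G (t +i* (b + s))) M s a inner).
- exact: (continuous_line cG (y := b + s)).
- by move=> t; exact: HM.
move=> x; rewrite /inner -(lineF_shift cG dG bG (b + s)) mulrC /lineF.
rewrite -cintZ; last 2 first.
- exact: measurableT.
- apply: (@cau_cintegrable R _ (M * expR (- ((b + s) * (s * x))))).
    exact: (continuous_RcplxM (continuous_line cG (y := b + s)) (@continuous_ker_line R (s * x) (b + s))).
  by move=> t; rewrite cabsM cabs_ker mulrAC ler_wpM2r ?expR_ge0// HM.
apply: eq_cint => t _; rewrite mulrCA; congr (_ * _).
have -> : (expR (- x))%:C = cexp (- x)%:C :> R[i].
  by rewrite /cexp /= cos0 sin0 mulr1 mulr0.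
rewrite /ker -!cexpD; congr cexp.
apply: cplx_eq; rewrite ?(ReDE, ImDE, ReME, ImME, ReNE, ImNE) /=; last by ring.
transitivity (- (s ^+ 2) * x); first by ring.
by rewrite s1; ring.
Qed.

Lemma pole_denom_ge (u v : R) : `|v| <= 1 -> 3 + u ^+ 2 <= cabs (4 + (u +i* v) ^+ 2 : R[i]).
Proof.
move=> v1; apply: le_trans (Re_le_cabs _); apply: le_trans (ler_norm _).
rewrite expr2 ReDE ReME /=; have : v ^+ 2 <= 1 by rewrite -[v ^+ 2]real_normK ?num_real// expr_le1.
by have := sqr_ge0 u; nra.
Qed.

(** With la = a + i b, the function F(z) = (G(z) - G(la)) / (z - la) + G(la) (z - la) / (4 + (z -
    la)^2) has no pole in the strip. Away from la it equals G(z) / (z - la) minus G(la) times the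
    regularised Cauchy kernel, hence decays like [cau]. The equality of its integrals on the two
    boundary lines takes the place of the residue theorem. *)
Lemma inversion_strip (a b : R) : b != 0 ->
  exists F : C -> C, [/\
    cint setT (fun t => F (t +i* (b - 1))) = cint setT (fun t => F (t +i* (b + 1))) &
    forall t s : R, s ^+ 2 = 1 ->
      F (t +i* (b + s)) = (- 'i * s%:C) * (G (t +i* (b + s)) * cpole (s * (t - a)))
        - G (a +i* b) * cauK (t - a) s].
Proof.
move=> b0; pose la : C := a +i* b.
have [l Hl] : exists l, has_cderiv G la l.
  by have /derivable_cplxP := @dG a b b0.
pose den (z : C) : C := 4 + (z - la) * (z - la).
pose F (z : C) : C := dquot G la l z + G la * ((z - la) * (den z)^-1).
exists F.
have wE (t y : R) : (t +i* y : C) - la = (t - a) +i* (y - b) by [].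
have denE (t y : R) : `|y - b| <= 1 -> 3 + (t - a) ^+ 2 <= cabs (den (t +i* y)).
  by move=> /(pole_denom_ge (t - a)); rewrite /den wE expr2.
have den0 (t y : R) : `|y - b| <= 1 -> den (t +i* y) != 0.
  move=> /(denE t) H; apply/eqP => E; move: H; rewrite E cabs0 leNgt.
  by rewrite (@lt_le_trans _ _ 3)// lerDl sqr_ge0.
have strip y : b - 1 <= y <= b + 1 -> `|y - b| <= 1.
  by move=> /andP[h1 h2]; rewrite ler_norml; apply/andP; split; lra.
have cden (z : C) : {for z, continuous den}.
  have c1 := @continuous_cplx_subl R la z.
  exact: (continuous_cplxD (@continuous_cplx_cst R C 4 z) (continuous_cplxM c1 c1)).
have dden (z : C) : derivable den z 1.
  have d1 := @derivable_cplx_subl R la z.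
  exact: (derivable_cplxD (@derivable_cplx_cst R 4 z) (derivable_cplxM d1 d1)).
have cdq (z : C) : {for z, continuous (dquot G la l)}.
  have [->|zl] := eqVneq z la; first exact: (continuous_dquot_at Hl).
  by apply: continuous_dquot zl _; exact: cG.
split; last first.
  move=> t s s1; have sn : `|b + s - b| <= 1.
    by rewrite (addrC b) addrK -(@expr_le1 _ 2)// real_normK ?num_real// s1.
  have s0 : s != 0 by apply/eqP => E; move: s1; rewrite E expr0n => /eqP; rewrite eq_sym oner_eq0.
  have bs : b + s != b by rewrite -subr_eq0 (addrC b) addrK.
  rewrite /F /dquot; have -> : (t +i* (b + s) == la :> R[i]) = false.
    by apply/negbTE; rewrite eq_complex /= negb_and bs orbT.
  have dn := den0 t _ sn; rewrite /den wE in dn *; rewrite (addrC b) addrK in dn *.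
  set w := (t - a) +i* s in dn *; have w0 : w != 0.
    by rewrite eq_complex /= negb_and s0 orbT.
  rewrite cauKE// -/w [- 'i * s%:C * _]mulrCA -(cpole_invE (t - a) s1) -/w expr2.
  by field; rewrite w0 dn.
have [M HM] := bG (`|b| + 1).
have [d0 d00 Hd] := dquot_near Hl ltr01.
pose d := Num.min d0 1; have dp : 0 < d by rewrite lt_min d00 ltr01.
pose g := cabs (G la).
have g0 : 0 <= g by exact: cabs_ge0.
pose A := 2 * (1 + a ^+ 2).
have A0 : 0 <= A by rewrite mulr_ge0// addr_ge0// sqr_ge0.
have M0 : 0 <= M.
  rewrite -(@pmulr_lge0 _ (cau 0)) ?cau_gt0//.
  by apply: le_trans (cabs_ge0 _) (HM 0 0 _); rewrite normr0 addr_ge0.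
have l0 : 0 <= cabs l + 1 + g by rewrite !addr_ge0 ?cabs_ge0.
have dV : 0 <= d^-1 by rewrite invr_ge0 ltW.
have X1 : 0 <= (cabs l + 1 + g) * (2 * A) by rewrite mulr_ge0// mulr_ge0.
have X2 : 0 <= M / d + 4 * g / d * A.
  apply: addr_ge0; first exact: mulr_ge0.
  by apply: mulr_ge0 => //; apply: mulr_ge0 => //; exact: mulr_ge0.
(* The two summands of the constant serve the points near la, where the quotient is bounded, and the
   points away from it, where the form with the kernel decays. The exceptional heights are 0,
   because of G, and b, because of la. *)
apply: (@strip_shift_exc2 F (b - 1) (b + 1) ((cabs l + 1 + g) * (2 * A) + (M / d + 4 * g / d * A)) 0 b).
- by rewrite gerBl.
- by rewrite lerDl.
- move=> t y /strip yb.
  have c1 := @continuous_cplx_subl R la (t +i* y).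
  have c2 := continuous_cplxV (cden (t +i* y)) (den0 t y yb).
  exact: (continuous_cplxD (cdq _) (continuous_cplxM (@continuous_cplx_cst R C (G la) _)
    (continuous_cplxM c1 c2))).
- move=> t y /andP[y1 y2] y0 yb.
  have yb1 : `|y - b| <= 1 by apply: strip; rewrite !ltW.
  have d1 : derivable (dquot G la l) (t +i* y : C) 1.
    apply: derivable_dquot; last exact: dG.
    by rewrite eq_complex /= negb_and yb orbT.
  have d2 := @derivable_cplx_subl R la (t +i* y).
  have d3 := derivable_cplxV (dden (t +i* y)) (den0 t y yb1).
  exact: (derivable_cplxD d1 (derivable_cplxM (@derivable_cplx_cst R (G la) _)
    (derivable_cplxM d2 d3))).
move=> t y ybs; have yb := strip y ybs.
have ct := cau_gt0 t.
have cw : 0 < cabs (den (t +i* y)) by rewrite cabs_gt0// den0.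
have de := denE t y yb.
have [near|far] := ltP (cabs ((t +i* y : C) - la)) d.
- apply: (@le_trans _ _ ((cabs l + 1 + g) * (2 * A) * cau t)); last first.
    by rewrite ler_wpM2r ?(ltW ct)// lerDl.
  have near1 : cabs ((t +i* y : C) - la) <= 1.
    by apply: ltW; apply: lt_le_trans near _; rewrite ge_min lexx orbT.
  have near0 : cabs ((t +i* y : C) - la) < d0.
    by apply: lt_le_trans near _; rewrite ge_min lexx.
  have ta : (t - a) ^+ 2 <= 1.
    rewrite -[leLHS]real_normK ?num_real// expr_le1//.
    by apply: le_trans near1; rewrite wE; exact: (Re_le_cabs ((t - a) +i* (y - b))).
  have cA : 1 <= 2 * A * cau t.
    have := cau_shift_le t a; rewrite -/A => H; rewrite -mulrA.
    have : 2^-1 <= cau (t - a) by rewrite lef_pV2 ?posrE ?onesqr_gt0//; lra.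
    by move=> H2; have := le_trans H2 H; lra.
  rewrite -mulrA; apply: (@le_trans _ _ ((cabs l + 1 + g) * 1)); last by rewrite ler_wpM2l.
  rewrite mulr1 /F; apply: le_trans (cabsD _ _) _; apply: lerD.
    rewrite -[dquot _ _ _ _](subrK l); apply: le_trans (cabsD _ _) _.
    by rewrite addrC lerD2l Hd.
  rewrite !cabsM -[leRHS]mulr1 ler_wpM2l// cabsV ler_pdivrMr// mul1r.
  apply: le_trans near1 (le_trans _ de); have := sqr_ge0 (t - a); lra.
apply: (@le_trans _ _ ((M / d + 4 * g / d * A) * cau t)); last first.
  by rewrite ler_wpM2r ?(ltW ct)// lerDr.
have wd : cabs ((t +i* y : C) - la) > 0 by exact: lt_le_trans far.
have w0 : (t +i* y : C) - la != 0.
  by apply/eqP => E; move: wd; rewrite E cabs0 ltxx.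
have -> : F (t +i* y) = G (t +i* y) / ((t +i* y : C) - la)
    - G la * (4 / (((t +i* y : C) - la) * den (t +i* y))).
  rewrite /F /dquot -subr_eq0 (negbTE w0); have := den0 t y yb; rewrite /den.
  by set w := _ - la in w0 *; move=> dn; field; rewrite w0 dn.
apply: le_trans (cabsD _ _) _; rewrite [leRHS]mulrDl cabsN !cabsM !cabsV; apply: lerD.
  rewrite mulrAC ler_pM ?cabs_ge0 ?invr_ge0 ?cabs_ge0//; last by rewrite lef_pV2 ?posrE.
  apply: HM; rewrite -lerBlDl; apply: le_trans yb; exact: lerB_dist.
have c4 : cabs (4 : R[i]) = 4.
  have -> : (4 : R[i]) = (4%:R : R)%:C by rewrite rmorph_nat.
  by rewrite cabs_real ger0_norm.
rewrite cabsM c4 [X in g * (4 * X)]invfM.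
have -> : 4 * g / d * A * cau t = g * (4 * (d^-1 * (A * cau t))) by ring.
rewrite ler_wpM2l// ler_wpM2l// ler_pM ?invr_ge0 ?cabs_ge0//.
  by rewrite lef_pV2 ?posrE.
apply: le_trans (cau_shift_le t a); rewrite lef_pV2 ?posrE ?onesqr_gt0//.
by apply: le_trans de; lra.
Qed.

Lemma cintegrable_cpole (y a s : R) :
  cintegrable setT (fun t => G (t +i* y) * cpole (s * (t - a))).
Proof.
have [M HM] := bG `|y|; apply: (@cau_cintegrable R _ (M * 2)).
  apply: continuous_RcplxM; first exact: (continuous_line cG (y := y)).
  move=> t; apply: continuous_ReIm => /=.
    exact: (continuous_affine_comp (s := s) (a := a) (@continuous_onesqrV R)).
  exact: (continuous_affine_comp (s := s) (a := a) (@continuous_div_onesqr R)).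
move=> t; rewrite cabsM mulrAC ler_pM ?cabs_ge0//; first exact: HM.
apply: le_trans (cabs_le_ReIm _) _; rewrite /= -[2]/(1 + 1).
by apply: lerD; [exact: norm_onesqrV_le1|exact: norm_div_onesqr_le1].
Qed.

(** On the line of height b + s the integral of F is - i s times a half-line integral, minus G(a + i
    b) times the integral of [cauK]. When the lines s = 1 and s = -1 are equated, the integrals of
    [cauP] cancel and those of [cauQ] add up to 2 pi. *)
Theorem halfS_invFourier (a b : R) : b != 0 ->
  halfS (invFourier G) (fun x => cexp (- 'i * (a +i* b) * x%:C)) =
  (2 * pi)%:C * G (a +i* b).
Proof.
move=> b0; have [F [EF FE]] := inversion_strip a b0.
have p1 : (1 : R) ^+ 2 = 1 by rewrite expr1n.
have m1 : (- 1 : R) ^+ 2 = 1 by rewrite sqrrN expr1n.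
have [_ Ep] := halfline_invFourier a b p1.
have [_ Em] := halfline_invFourier a b m1.
have line s : s ^+ 2 = 1 -> cint setT (fun t => F (t +i* (b + s))) =
    (- 'i * s%:C) * cint setT (fun t => G (t +i* (b + s)) * cpole (s * (t - a)))
    - G (a +i* b) * cint setT (fun t => cauK (t - a) s).
  move=> s1; have [iK _] := cauK_cint a s1.
  have iG := cintegrable_cpole (b + s) a s.
  rewrite -(cintZ _ measurableT iG) -(cintZ _ measurableT iK).
  rewrite -(cintB measurableT (cintegrableZ _ measurableT iG) (cintegrableZ _ measurableT iK)).
  by apply: eq_cint => t _; exact: FE.
rewrite (line _ p1) (line _ m1) -Ep -Em (cauK_cint a p1).2 (cauK_cint a m1).2 in EF.
rewrite /halfS; have -> : cint D (fun x => invFourier G x * cexp (- 'i * (a +i* b) * x%:C)) =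
    cint D (fun x => invFourier G (1 * x) * cexp (- 'i * (a +i* b) * (1 * x)%:C)).
  by apply: eq_cint => x _; rewrite mul1r.
have -> : cint D (fun x => invFourier G (- x) * cexp (- 'i * (a +i* b) * (- x)%:C)) =
    cint D (fun x => invFourier G (- 1 * x) * cexp (- 'i * (a +i* b) * (- 1 * x)%:C)).
  by apply: eq_cint => x _; rewrite mulN1r.
move: EF; set Y := cint D _; set X := cint D _; set P := \int[mu]_t _; move=> EF.
have i2 : 'i * 'i = - 1 :> R[i] by rewrite -expr2 sqr_i.
have -> : X + Y = - 'i * ((- 'i * (-1)%:C * Y) - (- 'i * 1%:C * X)).
  rewrite rmorphN rmorph1 /=; transitivity (- ('i * 'i) * (X + Y)); last by ring.
  by rewrite i2 opprK mul1r.
have -> : - 'i * (-1)%:C * Y - - 'i * 1%:C * X =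
    G (a +i* b) * ((P +i* (- -1 * pi)) - (P +i* (- 1 * pi))).
  rewrite mulrBr; move/eqP: EF; rewrite subr_eq => /eqP ->; ring.
rewrite complex_subE subrr mulrCA [RHS]mulrC; congr (_ * _).
apply: cplx_eq; rewrite ?(ReME, ImME) /=; ring.
Qed.

End InversionTheorem.

(** * Conjugate functions *)

Section Conjugate.
Context {R : realType} (W : weights R) (m : nat).
Hypothesis m0 : (0 < m)%N.
Local Notation phi := (phi W m).
Local Notation phit := (phit W m).

Lemma phi_convexE (t a b : R) : 0 <= t -> t <= 1 ->
  phi (t * a + (1 - t) * b) <= t * phi a + (1 - t) * phi b.
Proof.
by move=> t0 t1; apply: (@phi_convex _ W _ m0 (Itv01 t0 t1) a b); exact: mem_set.
Qed.

Lemma phi_three_points (x y z : R) : y < x -> x < z ->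
  (phi x - phi y) * (z - x) <= (phi z - phi x) * (x - y).
Proof.
move=> yx xz; have yz : 0 < z - y by rewrite subr_gt0 (lt_trans yx).
pose t := (z - x) / (z - y).
have t0 : 0 <= t by rewrite divr_ge0 ?subr_ge0 ?ltW// -subr_gt0.
have t1 : t <= 1 by rewrite ler_pdivrMr// mul1r; lra.
have := @phi_convexE t y z t0 t1.
have -> : t * y + (1 - t) * z = x by rewrite /t; field; rewrite gt_eqF.
move=> H; have := ler_wpM2r (ltW yz) H.
have -> : (t * phi y + (1 - t) * phi z) * (z - y) = (z - x) * phi y + (x - y) * phi z.
  by rewrite /t; field; rewrite gt_eqF.
by nra.
Qed.

(** Convexity bounds the slopes of chords to the left of x by those of chords to the right; the
    supremum of the left slopes is a subgradient. *)
Lemma subgradient (x : R) : exists s, forall y, phi x + s * (y - x) <= phi y.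
Proof.
pose sl y := (phi x - phi y) / (x - y).
pose A := [set sl y | y in [set y | y < x]].
have ub (z : R) : x < z -> ubound A ((phi z - phi x) / (z - x)).
  move=> xz _ [y /= yx <-]; rewrite /sl ler_pdivrMr ?subr_gt0// mulrAC ler_pdivlMr ?subr_gt0//.
  exact: phi_three_points.
have ne : A !=set0 by exists (sl (x - 1)), (x - 1) => //=; rewrite gtrBl.
have hub : has_ubound A by exists ((phi (x + 1) - phi x) / (x + 1 - x)); apply: ub; rewrite ltrDl.
exists (sup A) => y; have [yx|xy|->] := ltgtP y x; last by rewrite subrr mulr0 addr0.
- have : sl y <= sup A by apply: ub_le_sup => //; exists y.
  rewrite /sl ler_pdivrMr ?subr_gt0//; lra.
- have : sup A <= (phi y - phi x) / (y - x) by apply: ge_sup => //; exact: ub.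
  rewrite ler_pdivlMr ?subr_gt0//; lra.
Qed.

Lemma phit_ub (s x : R) : s * x - phi x <= phit s.
Proof.
apply: ub_le_sup; last by exists x.
by have [B HB] := phi_linear_bound W s m0; exists B => _ [y ->].
Qed.

Lemma phit_le (s B : R) : (forall x, s * x - phi x <= B) -> phit s <= B.
Proof.
move=> H; apply: ge_sup; first by exists (s * 0 - phi 0), 0.
by move=> _ [y ->].
Qed.

(** For |s| <= A one has s x <= A |x|, so each competitor in the supremum is at most the conjugate
    at A or at - A, according to the sign of x. *)
Lemma phit_bound (A s : R) : `|s| <= A -> phit s <= `|phit A| + `|phit (- A)|.
Proof.
move=> sA; apply: phit_le => x.
have H1 := phit_ub A x; have H2 := phit_ub (- A) x.
have N1 := ler_norm (phit A); have N2 := ler_norm (phit (- A)).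
have P1 := normr_ge0 (phit A); have P2 := normr_ge0 (phit (- A)).
move: sA; rewrite ler_norml => /andP[s1 s2].
by have [x0|x0] := leP 0 x; nra.
Qed.

(** The supremum is tested at 1 and -1. This linear lower bound lets exp(phit) absorb the factor
    exp(|Im w|) that comes with [kappa]. *)
Lemma phit_ge_abs (s : R) : `|s| - (`|phi 1| + `|phi (- 1)|) <= phit s.
Proof.
have H1 := phit_ub s 1; have H2 := phit_ub s (- 1).
have N1 := ler_norm (phi 1); have N2 := ler_norm (phi (- 1)).
have P1 := normr_ge0 (phi 1); have P2 := normr_ge0 (phi (- 1)).
by case: (ger0P s) => s0; lra.
Qed.

Definition bipolar_cst : R := `|phit 1| + `|phit (- 1)| + `|phi 0|.

(* [hclass] below controls g only on the lines [1 <= |Im l|]; restricting the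
   biconjugate of phi to [1 <= |s|] costs a constant. *)
Lemma bipolar_away (x : R) : exists2 s, 1 <= `|s| & phit s - s * x <= bipolar_cst - phi x.
Proof.
have [s Hs] := subgradient x.
have E : phit s <= s * x - phi x.
  by apply: phit_le => y; have := Hs y; lra.
have P1 := normr_ge0 (phit 1); have P2 := normr_ge0 (phit (- 1)); have P3 := normr_ge0 (phi 0).
have [s1|s1] := leP 1 `|s|; first by exists s => //; rewrite /bipolar_cst; lra.
move: s1; rewrite ltr_norml => /andP[s1 s2].
have N1 := ler_norm (phit 1); have N2 := ler_norm (phit (- 1)).
have N3 := ler_norm (phi 0); have H0 := Hs 0.
have [x0|x0] := leP 0 x.
- by exists 1; rewrite ?normr1// /bipolar_cst; nra.
- by exists (- 1); rewrite ?normrN ?normr1// /bipolar_cst; nra.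
Qed.

Lemma phi_le_01 (x : R) : 0 <= x <= 1 -> phi x <= `|phi 0| + `|phi 1|.
Proof.
move=> /andP[x0 x1]; have := @phi_convexE x 1 0 x0 x1; rewrite mulr1 mulr0 addr0 => H.
apply: le_trans H _; have P1 := normr_ge0 (phi 1); have P3 := normr_ge0 (phi 0).
have N1 := ler_norm (phi 1); have N3 := ler_norm (phi 0); nra.
Qed.

End Conjugate.

(** * The function kappa: value at 0, decay, derivability *)

Section Kappa.
Context {R : realType}.
Local Notation C := (cplx R).
Local Notation mu := (@lebesgue_measure R).

Lemma continuous_of_real : continuous (fun x : R => x%:C : C).
Proof.
move=> x; apply/continuous_cplxP => e e0; apply/nbhs_normP; exists e => // y /=.
by rewrite subrr expr0n addr0 sqrtr_sqr distrC.
Qed.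

Lemma continuous_cexp_line (h : R[i]) : continuous (fun x : R => cexp (h * x%:C) : C).
Proof.
move=> x; apply: continuous_ReIm.
- by apply: (@is_derive_continuous R _ _ x); exact: is_derive_Re_cexp.
- by apply: (@is_derive_continuous R _ _ x); exact: is_derive_Im_cexp.
Qed.

Lemma cintegrable_seg (a b : R) (f : R -> C) : continuous f -> cintegrable `[a, b] f.
Proof. by move=> cf; apply: continuous_cintegrable => x _; exact: cf. Qed.

Lemma cint_cexp (h : R[i]) : h * cint `[0, 1] (fun x : R => cexp (h * x%:C)) = cexp h - 1.
Proof.
have ci := @cintegrable_seg 0 1 _ (@continuous_cexp_line h).
have ch := continuous_RcplxM (@continuous_Rcplx_cst R h) (@continuous_cexp_line h).
rewrite -cintZ//; apply: cplx_eq => /=.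
- rewrite (Rintegral_FTC2 ler01 (is_derive_Re_cexp h) (continuous_ReR ch)).
  by rewrite mulr1 mulr0 cexp0.
- rewrite (Rintegral_FTC2 ler01 (is_derive_Im_cexp h) (continuous_ImR ch)).
  by rewrite mulr1 mulr0 cexp0.
Qed.

Definition kappa (w : C) : C := cint `[0, 1] (fun x : R => cexp (- 'i * w * x%:C)).

Lemma kappa0 : kappa 0 = 1.
Proof.
have -> : kappa 0 = cint `[0, 1] (fun x : R => 1 + 0 * x%:C).
  by apply: eq_cint => x _; rewrite mulr0 !mul0r cexp0 addr0.
by rewrite cint_affine// mul0r addr0 subr0 mulr1.
Qed.

Lemma cabs_exp_seg (w : R[i]) (x : R) : 0 <= x <= 1 ->
  cabs (cexp (- 'i * w * x%:C)) <= expR `|Im w|.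
Proof.
move=> /andP[x0 x1]; rewrite cabs_cexp ler_expR.
rewrite ReME ReME ImME ReNE ImNE /= oppr0 !mul0r !mulr0 subr0 sub0r mulN1r opprK.
by apply: le_trans (ler_norm _) _; rewrite normrM (ger0_norm x0) ler_piMr.
Qed.

(** The summand 1 is handled by the trivial estimate on [0, 1], the summand |w| by the identity w
    kappa(w) = i (exp(- i w) - 1). *)
Lemma kappa_le (w : R[i]) : (1 + cabs w) * cabs (kappa w) <= 4 * expR `|Im w|.
Proof.
have E1 : 1 <= expR `|Im w| by rewrite -expR0 ler_expR.
rewrite mulrDl mul1r.
have -> : (4 : R) * expR `|Im w| = 2 * expR `|Im w| * (1 - 0) + (expR `|Im w| + expR `|Im w|) by ring.
apply: lerD.
  apply: cabs_cint_itv_le => //; first exact: cintegrable_seg (@continuous_cexp_line _).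
  by move=> x x01; exact: cabs_exp_seg.
rewrite -cabsM.
have -> : w * kappa w = 'i * (- 'i * w * kappa w).
  by rewrite !mulrA mulrN -expr2 sqr_i opprK mul1r.
rewrite cint_cexp cabsM cabs_i mul1r.
apply: le_trans (cabsD _ _) _; rewrite cabsN cabs1; apply: lerD => //.
by have := @cabs_exp_seg w 1; rewrite mulr1 ler01 lexx; apply.
Qed.

Lemma cabs_kappa_le (w : R[i]) : cabs (kappa w) <= 4 * expR `|Im w|.
Proof.
apply: le_trans (kappa_le w); rewrite ler_peMl ?cabs_ge0//.
by rewrite lerDl cabs_ge0.
Qed.

Lemma derivable_kappa (w : C) : derivable kappa w 1.
Proof.
apply/derivable_cplxP.
pose f (x : R) : C := (- 'i * x%:C) * cexp (- 'i * w * x%:C).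
exists (cint `[0, 1] f) => e e0.
pose B := 8 * expR `|Im w| * expR 1.
have B0 : 0 < B by rewrite !mulr_gt0 ?expR_gt0.
exists (Num.min 1 (e / B)); first by rewrite lt_min ltr01 divr_gt0.
move=> h; rewrite lt_min => /andP[h1 h2].
have clin := continuous_RcplxM (@continuous_Rcplx_cst R (- 'i)) (@continuous_of_real).
have cf : continuous f by exact: continuous_RcplxM clin (@continuous_cexp_line _).
have i1 := @cintegrable_seg 0 1 _ (@continuous_cexp_line (- 'i * (w + h))).
have i2 := @cintegrable_seg 0 1 _ (@continuous_cexp_line (- 'i * w)).
have i3 := @cintegrable_seg 0 1 _ cf.
have i3h := cintegrableZ h (measurable_itv `[0, 1]) i3.
rewrite [cint _ f * h]mulrC -(cintZ _ (measurable_itv `[0, 1]) i3).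
rewrite -(cintB (measurable_itv `[0, 1]) i1 i2).
have i12 := cintegrableB (measurable_itv `[0, 1]) i1 i2.
rewrite -(cintB (measurable_itv `[0, 1]) i12 i3h).
apply: le_trans (_ : 2 * (expR `|Im w| * (4 * cabs h ^+ 2 * expR 1)) * (1 - 0) <= _).
  apply: cabs_cint_itv_le => //; first exact: cintegrableB.
  move=> x x01.
  have -> : cexp (- 'i * (w + h) * x%:C) - cexp (- 'i * w * x%:C) - h * f x =
      cexp (- 'i * w * x%:C) * (cexp (- 'i * h * x%:C) - 1 - (- 'i * h * x%:C)).
    rewrite /f mulrDr mulrDl cexpD; ring.
  rewrite cabsM ler_pM ?cabs_ge0 ?cabs_exp_seg//.
  apply: le_trans (cabs_cexp_sub1_le _) _.
  have hx : cabs (- 'i * h * x%:C) <= cabs h.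
    by apply: le_trans (cabs_scale01 _ x01) _; rewrite cabsM cabsN cabs_i mul1r.
  have X1 : 4 * cabs (- 'i * h * x%:C) ^+ 2 <= 4 * cabs h ^+ 2.
    by rewrite ler_wpM2l// lerXn2r ?nnegrE ?cabs_ge0.
  apply: ler_pM => //; rewrite ?expR_ge0 ?mulr_ge0 ?exprn_ge0 ?cabs_ge0//.
  by rewrite ler_expR (le_trans hx)// ltW.
have -> : 2 * (expR `|Im w| * (4 * cabs h ^+ 2 * expR 1)) * (1 - 0) = B * cabs h * cabs h.
  by rewrite /B; ring.
by rewrite ler_wpM2r ?cabs_ge0// mulrC -ler_pdivlMr// ltW.
Qed.

End Kappa.

(** * Representation of entire functions by functionals *)

Section HolomorphicClass.
Context {R : realType} (W : weights R) (m : nat).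
Hypothesis m0 : (0 < m)%N.
Local Notation C := (cplx R).

(* Growth (1 + |l|)^(n - 2); the points j < n are those where later steps divide
   by l - j. *)
Definition hclass (n : nat) (c : R) (g : C -> C) : Prop :=
  [/\ forall z : C, {for z, continuous g},
      forall x y : R, y != 0 -> derivable g (x +i* y : C) 1,
      forall j : nat, (j < n)%N ->
        derivable g (j%:R +i* 0 : C) 1 /\ cabs (g (j%:R +i* 0)) <= c,
      forall A : R, exists M, forall x y : R, `|y| <= A ->
        cabs (g (x +i* y)) <= M * ((1 + `|x|) ^+ n * cau x) &
      forall x y : R, 1 <= `|y| -> cabs (g (x +i* y)) * (1 + cabs (x +i* y)) ^+ 2 <=
        c * ((1 + cabs (x +i* y)) ^+ n * expR (phit W m y))].

Lemma X2cau_ge1 (x : R) : 1 <= (1 + `|x|) ^+ 2 * cau x.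
Proof.
rewrite ler_pdivlMr ?onesqr_gt0// mul1r -[x ^+ 2]real_normK ?num_real//.
by have := normr_ge0 x; nra.
Qed.

Lemma cabs_ge_Re (x y : R) : `|x| <= cabs (x +i* y).
Proof. exact: (Re_le_cabs (x +i* y)). Qed.

Lemma cabs_ge_Im (x y : R) : `|y| <= cabs (x +i* y).
Proof. exact: (Im_le_cabs (x +i* y)). Qed.

(** K depends on the weight and on n only, and the new bound is linear in c. The constant M of the
    growth on strips may depend on the function: it only serves to move contours. *)
Lemma hclass_step (n : nat) : exists2 K : R, 0 <= K & forall (g : C -> C) (c : R),
  0 <= c -> hclass n.+1 c g -> exists2 G : C -> C, hclass n (K * c) G &
    forall z, g z = g (n%:R +i* 0) * kappa (z - (n%:R +i* 0)) + (z - (n%:R +i* 0)) * G z.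
Proof.
pose a : R := n%:R; pose ac : C := a +i* 0.
have a0 : 0 <= a by exact: ler0n.
pose K0 : R := `|phi W m 1| + `|phi W m (- 1)|.
(* [expR K0] pays for replacing exp(|y|) by exp(phit y); 4 (1 + a) comes from [kappa_le] after
   recentring from z - a to z. *)
pose K1 : R := 1 + 4 * (1 + a) * expR K0.
have K10 : 0 <= K1 by rewrite addr_ge0// !mulr_ge0 ?expR_ge0// addr_ge0.
exists (5 + K1 * (2 + a)); first by rewrite addr_ge0// mulr_ge0// addr_ge0.
move=> g c c0 [cg dg pg sg qg].
have [dga gac] := pg n (ltnSn n); rewrite -/a -/ac in dga gac.
pose gt (z : C) : C := g z - g ac * kappa (z - ac).
have dk (z : C) : derivable (fun z : C => kappa (z - ac) : C) z 1.
  have /derivable_cplxP[l Hl] := @derivable_kappa R (z - ac).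
  apply/derivable_cplxP; exists l => e e0; have [d d0 Hd] := Hl e e0.
  by exists d => // h hd; rewrite (addrAC z h); exact: Hd.
have ck (z : C) : {for z, continuous (fun z : C => kappa (z - ac) : C)}.
  exact/derivable_continuous_cplx/dk.
have cgt (z : C) : {for z, continuous gt}.
  exact: (continuous_cplxB (cg z) (continuous_cplxM (@continuous_cplx_cst R C (g ac) z) (ck z))).
have dgt (z : C) : derivable g z 1 -> derivable gt z 1.
  move=> dgz; exact: (derivable_cplxB dgz (derivable_cplxM (@derivable_cplx_cst R (g ac) z) (dk z))).
have gta : gt ac = 0 by rewrite /gt subrr kappa0 mulr1 subrr.
have [l Hl] : exists l, has_cderiv gt ac l.
  by have /derivable_cplxP := dgt ac dga.
have subE (x y : R) : (x +i* y : C) - ac = (x - a) +i* y by rewrite complex_subE subr0.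
have ImE (x y : R) : Im ((x +i* y : C) - ac) = y by rewrite /= subr0.
pose G := dquot gt ac l.
have GE (z : C) : z != ac -> G z = gt z / (z - ac).
  by move=> za; rewrite /G /dquot (negbTE za) gta subr0.
have kb (x y : R) : cabs (kappa ((x +i* y : C) - ac)) * (1 + cabs (x +i* y)) <= 4 * (1 + a) * expR `|y|.
  have H := kappa_le ((x +i* y : C) - ac); rewrite ImE in H.
  have Z : 1 + cabs (x +i* y) <= (1 + a) * (1 + cabs ((x +i* y : C) - ac)).
    have : cabs (x +i* y) <= cabs ((x +i* y : C) - ac) + a.
      apply: le_trans (_ : cabs ((x +i* y : C) - ac) + cabs ac <= _).
        by rewrite -{1}[x +i* y](subrK ac) cabsD.
      by rewrite lerD2l /ac cabs_real ger0_norm.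
    have w0 := cabs_ge0 ((x +i* y : C) - ac); have := mulr_ge0 a0 w0; lra.
  apply: le_trans (ler_wpM2l (cabs_ge0 _) Z) _.
  rewrite mulrCA (mulrC 4) -(mulrA (1 + a)) ler_wpM2l ?addr_ge0//.
  by rewrite mulrC.
have gz (z : C) : g z = g ac * kappa (z - ac) + (z - ac) * G z.
  have [->|za] := eqVneq z ac; first by rewrite subrr kappa0 mulr1 mul0r addr0.
  by rewrite GE// mulrCA divff ?subr_eq0// mulr1 /gt addrC subrK.
exists G; last exact: gz.
split.
- move=> z; have [->|za] := eqVneq z ac; first exact: (continuous_dquot_at Hl).
  exact: (@continuous_dquot R gt ac l z za (cgt z)).
- move=> x y y0; have xya : (x +i* y : C) != ac by rewrite eq_complex /= negb_and y0 orbT.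
  exact: (@derivable_dquot R gt ac l _ xya (dgt _ (dg x y y0))).
- move=> j jn; have ja : (j%:R +i* 0 : C) != ac.
    by rewrite eq_complex /= negb_and eqr_nat ltn_eqF.
  have [dgj gj] := pg j (ltnW jn).
  split; first exact: (@derivable_dquot R gt ac l _ ja (dgt _ dgj)).
  rewrite GE// cabsM cabsV.
  have D1 : 1 <= cabs ((j%:R +i* 0 : C) - ac).
    apply: le_trans (Re_le_cabs _); rewrite subE /= distrC ger0_norm ?subr_ge0 ?ler_nat ?(ltnW jn)//.
    by rewrite -natrB ?(ltnW jn)// ler1n subn_gt0.
  rewrite ler_pdivrMr ?(lt_le_trans ltr01)//.
  apply: le_trans (_ : 5 * c <= _).
    apply: le_trans (cabsD _ _) _; rewrite cabsN cabsM.
    have -> : 5 * c = c + c * 4 by ring.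
    apply: lerD => //; apply: ler_pM => //; try exact: cabs_ge0.
    apply: le_trans (cabs_kappa_le _) _; rewrite subE /= normr0 expR0 mulr1//.
  have KK : 0 <= K1 * (2 + a) by rewrite mulr_ge0// addr_ge0.
  apply: (@le_trans _ _ ((5 + K1 * (2 + a)) * c)); first by rewrite ler_wpM2r// lerDl.
  by rewrite ler_peMr// mulr_ge0// addr_ge0.
(* Within distance d of the centre the quotient is close to l; farther away, division by z - a gains
   one power of 1 + |x|. *)
- move=> A; have [M HM] := sg A.
  have [d0 d00 Hd] := dquot_near Hl ltr01.
  pose d := Num.min d0 1; have dp : 0 < d by rewrite lt_min d00 ltr01.
  pose M2 := c * (4 * (1 + a) * expR A).
  pose Kd := (1 + a) / d + 1.
  pose M1 := (cabs l + 1) * (3 + 2 * a ^+ 2).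
  exists (M1 + (`|M| + M2) * Kd) => x y yA.
  have X1 : 1 <= 1 + `|x| by rewrite lerDl.
  have Xp : 0 < 1 + `|x| by rewrite ltr_pwDl.
  set Y := (1 + `|x|) ^+ n * cau x.
  have Yc : cau x <= Y by rewrite ler_peMl ?(ltW (cau_gt0 x))// exprn_ege1.
  have Y0 : 0 <= Y by apply: le_trans Yc; rewrite ltW// cau_gt0.
  have M20 : 0 <= M2 by rewrite !mulr_ge0 ?expR_ge0// addr_ge0.
  have Kd0 : 0 <= Kd by rewrite addr_ge0// divr_ge0 ?(ltW dp)// addr_ge0.
  have M10 : 0 <= M1.
    rewrite mulr_ge0 ?addr_ge0 ?cabs_ge0// mulr_ge0 ?sqr_ge0//.
  have MM0 : 0 <= (`|M| + M2) * Kd by rewrite mulr_ge0// addr_ge0.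
  have [near|far] := ltP (cabs ((x +i* y : C) - ac)) d.
    apply: (@le_trans _ _ (M1 * Y)); last by rewrite ler_wpM2r// lerDl.
    have near0 : cabs ((x +i* y : C) - ac) < d0.
      by apply: lt_le_trans near _; rewrite ge_min lexx.
    have near1 : `|x - a| <= 1.
      apply: (@le_trans _ _ (cabs ((x +i* y : C) - ac))).
        by rewrite subE; exact: cabs_ge_Re.
      by apply: ltW; apply: lt_le_trans near _; rewrite ge_min lexx orbT.
    apply: (@le_trans _ _ (cabs l + 1)).
      rewrite -[G _](subrK l); apply: le_trans (cabsD _ _) _.
      by rewrite addrC lerD2l; exact: Hd.
    rewrite -[leLHS]mulr1 -mulrA ler_wpM2l ?addr_ge0 ?cabs_ge0//.
    apply: le_trans (_ : (3 + 2 * a ^+ 2) * cau x <= _).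
      rewrite ler_pdivlMr ?onesqr_gt0// mul1r.
      have : (x - a) ^+ 2 <= 1 by rewrite -[leLHS]real_normK ?num_real// expr_le1.
      have := sqr_ge0 (x - 2 * a); nra.
    by rewrite ler_wpM2l// addr_ge0// mulr_ge0// sqr_ge0.
  apply: (@le_trans _ _ ((`|M| + M2) * Kd * Y)); last by rewrite ler_wpM2r// lerDr.
  have w0 : 0 < cabs ((x +i* y : C) - ac) by exact: lt_le_trans far.
  have za : (x +i* y : C) != ac.
    by apply: contraTneq w0 => ->; rewrite subrr cabs0 ltxx.
  rewrite GE// cabsM cabsV ler_pdivrMr//.
  have XK : 1 + `|x| <= Kd * cabs ((x +i* y : C) - ac).
    rewrite mulrDl mul1r.
    have H1 : 1 + a <= (1 + a) / d * cabs ((x +i* y : C) - ac).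
      by rewrite -[leLHS]mulr1 -mulrA ler_wpM2l ?addr_ge0// mulrC ler_pdivlMr// mul1r.
    have H2 : `|x| <= a + cabs ((x +i* y : C) - ac).
      rewrite -[x in `|x|](subrK a) addrC; apply: le_trans (ler_normD _ _) _.
      by rewrite (ger0_norm a0) lerD2l subE; exact: cabs_ge_Re.
    by lra.
  have gtY : cabs (gt (x +i* y)) <= (`|M| + M2) * ((1 + `|x|) * Y).
    have XYE : (1 + `|x|) ^+ n.+1 * cau x = (1 + `|x|) * Y by rewrite exprS mulrA.
    have XY0 : 0 <= (1 + `|x|) * Y by rewrite mulr_ge0// ltW.
    apply: le_trans (cabsD _ _) _; rewrite mulrDl; apply: lerD.
      rewrite -XYE; apply: le_trans (HM x y yA) _; rewrite ler_wpM2r ?XYE// ler_norm//.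
    rewrite cabsN cabsM /M2 -(mulrA c); apply: ler_pM; [exact: cabs_ge0|exact: cabs_ge0|exact: gac|].
    apply: (@le_trans _ _ (cabs (kappa ((x +i* y : C) - ac)) * (1 + `|x|) * ((1 + `|x|) * Y))).
      rewrite -mulrA ler_peMr ?cabs_ge0//.
      apply: le_trans (X2cau_ge1 x) _.
      rewrite expr2 -!mulrA ler_wpM2l ?(ltW Xp)// ler_wpM2l ?(ltW Xp)//.
    rewrite ler_wpM2r//.
    apply: le_trans (_ : 4 * (1 + a) * expR `|y| <= _).
      apply: le_trans (kb x y); rewrite ler_wpM2l ?cabs_ge0// lerD2l; exact: cabs_ge_Re.
    by rewrite ler_wpM2l ?mulr_ge0 ?addr_ge0// ler_expR.
  apply: le_trans gtY _; move: (cabs _) XK => w XK.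
  have -> : (`|M| + M2) * Kd * Y * w = (`|M| + M2) * ((Kd * w) * Y) by ring.
  by rewrite ler_wpM2l ?addr_ge0// ler_wpM2r.
(* Here |z - a| >= |y| >= 1 because a is real, so no point is near the centre and the estimate is
   uniform in g. *)
- move=> x y y1; set Z := 1 + cabs (x +i* y).
  have Z1 : 1 <= Z by rewrite lerDl cabs_ge0.
  have Z0 : 0 <= Z by apply: le_trans Z1.
  have w1 : 1 <= cabs ((x +i* y : C) - ac).
    by rewrite subE; exact: le_trans y1 (cabs_ge_Im _ _).
  have w0 : 0 < cabs ((x +i* y : C) - ac) by exact: lt_le_trans w1.
  have za : (x +i* y : C) != ac.
    by apply: contraTneq w0 => ->; rewrite subrr cabs0 ltxx.
  have ZK : Z <= (2 + a) * cabs ((x +i* y : C) - ac).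
    have : cabs (x +i* y) <= cabs ((x +i* y : C) - ac) + a.
      apply: le_trans (_ : cabs ((x +i* y : C) - ac) + cabs ac <= _).
        by rewrite -{1}[x +i* y](subrK ac) cabsD.
      by rewrite lerD2l /ac cabs_real ger0_norm.
    by rewrite /Z; have := mulr_ge0 a0 (ltW w0); nra.
  set E := expR (phit W m y); have E0 : 0 < E by exact: expR_gt0.
  have gtZ : cabs (gt (x +i* y)) * Z ^+ 2 <= c * K1 * (Z ^+ n * E) * Z.
    have -> : c * K1 * (Z ^+ n * E) * Z = c * (Z ^+ n.+1 * E) + c * (4 * (1 + a) * (expR K0 * E) * (Z ^+ n * Z)).
      by rewrite /K1 exprS; ring.
    apply: le_trans (ler_wpM2r (exprn_ge0 2 Z0) (cabsD _ _)) _.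
    rewrite mulrDl; apply: lerD; first exact: qg.
    rewrite cabsN cabsM -(mulrA (cabs (g ac))).
    apply: ler_pM; [exact: cabs_ge0|by rewrite mulr_ge0 ?cabs_ge0 ?exprn_ge0|exact: gac|].
    rewrite expr2 [leLHS]mulrA; apply: ler_pM; [by rewrite mulr_ge0 ?cabs_ge0|exact: Z0| |].
    + apply: le_trans (kb x y) _; rewrite ler_wpM2l ?mulr_ge0 ?addr_ge0// -expRD ler_expR.
      by rewrite addrC -lerBlDr; exact: phit_ge_abs.
    + by rewrite ler_peMl// exprn_ege1.
  rewrite GE// cabsM cabsV mulrAC ler_pdivrMr//.
  apply: le_trans gtZ _.
  have cK : 0 <= c * K1 * (Z ^+ n * E) by rewrite !mulr_ge0 ?exprn_ge0 ?(ltW E0).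
  apply: le_trans (ler_wpM2l cK ZK) _.
  move: (cabs _) w0 => w w0.
  have -> : c * K1 * (Z ^+ n * E) * ((2 + a) * w) = K1 * (2 + a) * (c * (Z ^+ n * E) * w) by ring.
  have -> : (5 + K1 * (2 + a)) * c * (Z ^+ n * E) * w =
      (5 + K1 * (2 + a)) * (c * (Z ^+ n * E) * w) by ring.
  rewrite ler_wpM2r//; last by rewrite lerDr.
  by rewrite !mulr_ge0 ?exprn_ge0 ?(ltW E0) ?(ltW w0).
Qed.

End HolomorphicClass.

Section SmoothDerivatives.
Context {R : realType}.
Local Notation C := (cplx R).

Lemma is_Cn_S n (f : R -> R) : is_Cn n.+1 f -> is_Cn n f.
Proof.
move=> [df _]; split=> [a an|]; first by apply: df; exact: ltnW.
by move=> x; apply: differentiable_continuous; apply/derivable1_diffP; exact: df.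
Qed.

Lemma is_Cn_le m n (f : R -> R) : (m <= n)%N -> is_Cn n f -> is_Cn m f.
Proof.
move=> /subnKC <-; elim: (n - m)%N => [|d IH]; first by rewrite addn0.
by rewrite addnS => /is_Cn_S.
Qed.

Lemma is_Cn_derive n (f : R -> R) : is_Cn n.+1 f -> is_Cn n (derive1n 1 f).
Proof.
have E a : derive1n a (derive1n 1 f) = derive1n a.+1 f by rewrite [RHS]derive1Sn.
by move=> [df cf]; split=> [a an|]; rewrite E; [exact: df|exact: cf].
Qed.

Lemma cis_Cn_le m n (u : R -> C) : (m <= n)%N -> cis_Cn n u -> cis_Cn m u.
Proof. by move=> mn [cr ci]; split; exact: is_Cn_le mn _. Qed.

Lemma cis_Cn_derive n (u : R -> C) : cis_Cn n.+1 u -> cis_Cn n (cderiv 1 u).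
Proof. by move=> [cr ci]; split; [exact: (is_Cn_derive cr)|exact: (is_Cn_derive ci)]. Qed.

Lemma cderiv_cderiv1 a (u : R -> C) x : cderiv a (cderiv 1 u) x = cderiv a.+1 u x.
Proof.
have E (f : R -> R) : derive1n a (derive1n 1 f) = derive1n a.+1 f by rewrite [RHS]derive1Sn.
by rewrite /cderiv -!E.
Qed.

Lemma cderiv0E (u : R -> C) x : cderiv 0 u x = u x.
Proof. by rewrite /cderiv /=; case: (u x). Qed.

Lemma cis_Cn_continuous n (u : R -> C) : cis_Cn n u -> continuous u.
Proof.
move=> /(cis_Cn_le (leq0n n))[[_ cr] [_ ci]] x.
by apply: continuous_ReIm; [exact: cr|exact: ci].
Qed.

End SmoothDerivatives.

(** * Functionals on functions of weighted growth *)

Section Representation.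
Context {R : realType} (W : weights R) (m : nat).
Hypothesis m0 : (0 < m)%N.
Local Notation C := (cplx R).
Local Notation mu := (@lebesgue_measure R).
Local Notation MR := (measurableTypeR R).
Local Notation D := (`[0%R, +oo[%classic : set MR).
Local Notation phi := (phi W m).

(** The factor [cau] makes the pairing with a function of size exp(- phi) converge. For the
    components of an element of T it is supplied by the gap between phi_m and phi_(m+2). *)
Definition good (n : nat) (u : R -> C) (M : R) : Prop := cis_Cn n u /\
  forall a x, (a <= n)%N -> cabs (cderiv a u x) <= M * (expR (phi x) * cau x).

(** S is a function on all of [R -> C], but linearity and the bound are asserted on good functions
    only. The transform is prescribed off the real axis, where the inversion formula is
    available. *)
Definition rep (n : nat) (S : (R -> C) -> C) (B : R) (g : C -> C) : Prop :=
  [/\ forall (z : R[i]) u v M N, good n u M -> good n v N -> S (z *: u + v) = z * S u + S v,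
      forall u M, 0 <= M -> good n u M -> cabs (S u) <= B * M &
      forall a b : R, b != 0 -> S (fun x : R => cexp (- 'i * (a +i* b) * x%:C)) = g (a +i* b)].

Lemma good_lin n (z : R[i]) u v M N : good n u M -> good n v N ->
  good n (z *: u + v) (cabs z * M + N).
Proof.
move=> [cu bu] [cv bv]; split; first exact/cis_CnD/cv/cis_CnZ.
move=> a x an; rewrite (cderivD _ an)//; last exact: cis_CnZ.
rewrite (cderivZ _ _ an)// (le_trans (cabsD _ _))// mulrDl cabsM -mulrA lerD ?bv//.
by rewrite ler_wpM2l ?cabs_ge0// bu.
Qed.

(** Since 1 + x^2 <= exp(2 |x|), the factor [cau] amounts to changing the slope by 2, which the
    superlinear growth of phi allows. *)
Lemma good_exp n (l : R[i]) : exists2 M, 0 <= M & good n (fun x : R => cexp (- 'i * l * x%:C)) M.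
Proof.
pose w : R[i] := - 'i * l.
have [B1 H1] := phi_linear_bound W (Re w + 2) m0.
have [B2 H2] := phi_linear_bound W (Re w - 2) m0.
exists ((1 + cabs w) ^+ n * expR (`|B1| + `|B2|)).
  by rewrite mulr_ge0 ?expR_ge0// exprn_ge0// addr_ge0 ?cabs_ge0.
split; first exact: cis_Cn_cexp.
move=> a x an; rewrite -/w cderiv_cexp cabsM cabs_cexp cabsX -mulrA ler_pM ?exprn_ge0 ?cabs_ge0 ?expR_ge0//.
  apply: le_trans (_ : (1 + cabs w) ^+ a <= _).
    by rewrite lerXn2r ?nnegrE ?addr_ge0 ?cabs_ge0// lerDr.
  by rewrite ler_weXn2l// lerDl cabs_ge0.
rewrite mulrA ler_pdivlMr ?onesqr_gt0//.
have X : 1 + x ^+ 2 <= expR (2 * `|x|).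
  rewrite expRM_natl; apply: (@le_trans _ _ ((1 + `|x|) ^+ 2)).
    by rewrite -[x ^+ 2]real_normK ?num_real//; have := normr_ge0 x; nra.
  by rewrite lerXn2r ?nnegrE ?addr_ge0 ?expR_ge0// expR_ge1Dx.
apply: le_trans (ler_wpM2l (expR_ge0 _) X) _.
rewrite -!expRD ler_expR ReME /= mulr0 subr0.
have := H1 x; have := H2 x; have := ler_norm B1; have := ler_norm B2.
have := normr_ge0 B1; have := normr_ge0 B2.
by case: (ger0P x) => x0; lra.
Qed.

Lemma good0_continuous u M : good 0 u M -> continuous u.
Proof. by move=> [cu _]; exact: cis_Cn_continuous cu. Qed.

Lemma good0_le u M x : good 0 u M -> cabs (u x) <= M * (expR (phi x) * cau x).
Proof. by move=> [_ bu]; have := bu 0%N x (leqnn _); rewrite cderiv0E. Qed.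

Lemma cau_cintegrable_half (f : R -> C) (M : R) : continuous f ->
  (forall x, cabs (f x) <= M * cau x) -> cintegrable D f.
Proof.
move=> cf fM; have [i1 i2] := cau_cintegrable cf fM.
split; first exact: (integrableS measurableT measurable_halfline (@subsetT _ D) i1).
exact: (integrableS measurableT measurable_halfline (@subsetT _ D) i2).
Qed.

Lemma integrable_cau_half : mu.-integrable D (EFin \o @cau R).
Proof. exact: (integrableS measurableT measurable_halfline (@subsetT _ D) (@integrable_cau R)). Qed.

Lemma le_cint_cau_half (f : R -> C) (M : R) : continuous f ->
  (forall x, cabs (f x) <= M * cau x) ->
  cabs (cint D f) <= 2 * (M * \int[mu]_(x in D) cau x).
Proof.
move=> cf fM; rewrite -(RintegralZl _ measurable_halfline integrable_cau_half).
apply: (le_cint measurable_halfline (cau_cintegrable_half cf fM)).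
  exact: (integrableZl measurable_halfline M integrable_cau_half).
by move=> x _; exact: fM.
Qed.

Lemma cauN (x : R) : cau (- x) = cau x.
Proof. by rewrite /cau sqrrN. Qed.

Lemma continuous_flip (f : R -> C) : continuous f -> continuous (fun x : R => f (- x)).
Proof. by move=> cf x; apply: continuous_comp; [exact: opp_continuous|exact: cf]. Qed.

Lemma rep_halfS (h : R -> C) (B : R) : continuous h -> 0 <= B ->
  (forall x, cabs (h x) <= B * expR (- phi x)) ->
  [/\ forall (z : R[i]) u v M N, good 0 u M -> good 0 v N ->
        halfS h (z *: u + v) = z * halfS h u + halfS h v &
      forall u M, 0 <= M -> good 0 u M ->
        cabs (halfS h u) <= (4 * \int[mu]_(x in D) cau x) * B * M].
Proof.
move=> ch B0 hB.
have bnd u M : 0 <= M -> good 0 u M -> forall x, cabs (h x * u x) <= B * M * cau x.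
  move=> M0 gu x; rewrite cabsM.
  apply: le_trans (ler_pM (cabs_ge0 _) (cabs_ge0 _) (hB x) (good0_le x gu)) _.
  rewrite expRN; have E0 : expR (phi x) != 0 by rewrite gt_eqF ?expR_gt0.
  by rewrite le_eqVlt; apply/orP; left; apply/eqP; field.
have cont u M : good 0 u M -> continuous (fun x => h x * u x).
  by move=> gu; exact: continuous_RcplxM ch (good0_continuous gu).
have good_nneg u M : good 0 u M -> good 0 u `|M|.
  move=> [cu bu]; split=> // a x an; apply: le_trans (bu a x an) _.
  by rewrite ler_wpM2r ?ler_norm// mulr_ge0 ?expR_ge0// ltW// cau_gt0.
have int1 u M : good 0 u M -> cintegrable D (fun x => h x * u x).
  move=> /[dup] gu /good_nneg gu'.
  exact: cau_cintegrable_half (cont _ _ gu) (bnd _ _ (normr_ge0 M) gu').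
have int2 u M : good 0 u M -> cintegrable D (fun x => h (- x) * u (- x)).
  move=> /[dup] gu /good_nneg gu'.
  apply: (@cau_cintegrable_half _ (B * `|M|)) => [|x].
    exact: (continuous_flip (cont _ _ gu)).
  by rewrite -cauN; exact: bnd.
split=> [z u v M N gu gv|u M M0 gu].
- have mD := @measurable_halfline R.
  have z1 := cintegrableZ z mD (int1 _ _ gu); have z2 := cintegrableZ z mD (int2 _ _ gu).
  rewrite /halfS mulrDr -(cintZ z mD (int1 _ _ gu)) -(cintZ z mD (int2 _ _ gu)).
  rewrite addrACA -(cintD mD z1 (int1 _ _ gv)) -(cintD mD z2 (int2 _ _ gv)).
  by congr (_ + _); apply: eq_cint => x _; rewrite addrfctE scalrfctE mulrDr; congr (_ + _);
    rewrite mulrCA.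
- have H1 := le_cint_cau_half (cont _ _ gu) (bnd _ _ M0 gu).
  have H2 : cabs (cint D (fun x => h (- x) * u (- x))) <= 2 * (B * M * \int[mu]_(x in D) cau x).
    apply: (@le_cint_cau_half _ (B * M)) => [|x]; first exact: (continuous_flip (cont _ _ gu)).
    by rewrite -cauN; exact: bnd.
  rewrite /halfS; apply: le_trans (cabsD _ _) _; apply: le_trans (lerD H1 H2) _.
  by move: (\int[mu]_(x in D) cau x) => I; rewrite le_eqVlt; apply/orP; left; apply/eqP; ring.
Qed.

Lemma rep0 : exists2 K, 0 <= K & forall g c, 0 <= c -> hclass W m 0 c g ->
  exists S, rep 0 S (K * c) g.
Proof.
pose I := \int[mu]_x cau x; pose ID := \int[mu]_(x in D) cau x.
have I0 : 0 <= I by apply: Rintegral_ge0 => x _; rewrite ltW// cau_gt0.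
have ID0 : 0 <= ID by apply: Rintegral_ge0 => x _; rewrite ltW// cau_gt0.
have pi0 : 0 < 2 * pi :> R by rewrite mulr_gt0// pi_gt0.
pose K1 := 2 * expR (bipolar_cst W m) * I.
exists ((2 * pi)^-1 * (4 * ID) * K1).
  by rewrite !mulr_ge0 ?expR_ge0 ?invr_ge0 ?(ltW pi0).
move=> g c c0 [cg dg _ sg qg].
have bg : strip_decay g.
  by move=> A; have [M HM] := sg A; exists M => x y yA; have := HM x y yA; rewrite expr0 mul1r.
pose h := invFourier g.
have ch : continuous h by exact: (continuous_invFourier cg bg).
have hB x : cabs (h x) <= K1 * c * expR (- phi x).
  have [s s1 Hs] := bipolar_away W m0 x.
  have gs (t : R) : cabs (g (t +i* s)) <= c * expR (phit W m s) * cau t.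
    have := qg t s s1; rewrite expr0 mul1r => H.
    rewrite ler_pdivlMr ?onesqr_gt0//; apply: le_trans H.
    rewrite ler_wpM2l ?cabs_ge0//; apply: (@le_trans _ _ ((1 + `|t|) ^+ 2)).
      by rewrite -[t ^+ 2]real_normK ?num_real//; have := normr_ge0 t; nra.
    by rewrite lerXn2r ?nnegrE ?addr_ge0 ?cabs_ge0// lerD2l; exact: cabs_ge_Re.
  apply: le_trans (cabs_invFourier_le cg dg bg x gs) _.
  rewrite -/I -(mulrA c) -expRD.
  have -> : K1 * c * expR (- phi x) = 2 * (c * (expR (bipolar_cst W m + - phi x))) * I.
    by rewrite /K1 expRD; ring.
  by rewrite ler_wpM2r// ler_wpM2l// ler_wpM2l// ler_expR.
have K1c : 0 <= K1 * c by rewrite !mulr_ge0 ?expR_ge0.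
have [lS bS] := rep_halfS ch K1c hB.
exists (fun u => ((2 * pi)^-1)%:C * halfS h u); split.
- move=> z u v M N gu gv; rewrite (lS z u v M N gu gv) mulrDr; congr (_ + _).
  by rewrite mulrCA.
- move=> u M M0 gu; rewrite cabsM cabs_real ger0_norm ?invr_ge0 ?(ltW pi0)//.
  apply: le_trans (ler_wpM2l _ (bS u M M0 gu)) _; first by rewrite invr_ge0 ltW.
  by rewrite -/ID le_eqVlt; apply/orP; left; apply/eqP; rewrite !mulrA.
- move=> a b b0; rewrite (halfS_invFourier cg dg bg a b0) mulrA -rmorphM mulVf ?gt_eqF//.
  by rewrite mul1r.
Qed.

Lemma goodZ n (z : R[i]) u M : good n u M -> good n (z *: u) (cabs z * M).
Proof.
move=> [cu bu]; split=> [|a x an]; first exact: cis_CnZ.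
by rewrite (cderivZ _ _ an)// cabsM -mulrA ler_wpM2l ?cabs_ge0// bu.
Qed.

Lemma good_le n k u M : (k <= n)%N -> good n u M -> good k u M.
Proof.
move=> kn [cu bu]; split; first exact: cis_Cn_le kn cu.
by move=> a x ak; apply: bu; exact: leq_trans ak kn.
Qed.

Lemma good_cderiv n u M : good n.+1 u M -> good n (cderiv 1 u) M.
Proof.
move=> [cu bu]; split=> [|a x an]; first exact: cis_Cn_derive.
by rewrite cderiv_cderiv1 bu.
Qed.

Definition shift_op (a : R[i]) (u : R -> C) : R -> C := (- a) *: u + 'i *: cderiv 1 u.

Lemma good_shift_op n a u M : good n.+1 u M -> good n (shift_op a u) ((cabs a + 1) * M).
Proof.
move=> gu; have := good_lin (- a) (good_le (leqnSn n) gu) (goodZ 'i (good_cderiv gu)).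
by rewrite cabsN cabs_i mulrDl.
Qed.

Lemma shift_op_lin a (z : R[i]) u v : cis_Cn 1 u -> cis_Cn 1 v ->
  shift_op a (z *: u + v) = z *: shift_op a u + shift_op a v.
Proof.
move=> cu cv; apply/funext => x.
have E x' (f g : R -> C) (b b' : R[i]) : (b *: f + b' *: g) x' = b * f x' + b' * g x' by [].
have -> : (z *: shift_op a u + shift_op a v) x = z * shift_op a u x + shift_op a v x by [].
rewrite /shift_op !E addrfctE scalrfctE.
rewrite (cderivD _ (leqnn 1) (cis_CnZ z cu) cv) (cderivZ _ _ (leqnn 1) cu).
rewrite /GRing.scale /=; ring.
Qed.

Lemma shift_op_exp a (l : R[i]) : shift_op a (fun x : R => cexp (- 'i * l * x%:C)) =
  (l - a) *: (fun x : R => cexp (- 'i * l * x%:C)).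
Proof.
apply/funext => x; rewrite /shift_op !addrfctE !scalrfctE cderiv_cexp expr1 /GRing.scale /=.
have i2 : 'i * 'i = -1 :> R[i] by rewrite -expr2 sqr_i.
transitivity ((- a - ('i * 'i) * l) * cexp (- 'i * l * x%:C)); first ring.
by rewrite i2; ring.
Qed.

Lemma rep_exists n : exists2 K, 0 <= K & forall g c, 0 <= c -> hclass W m n c g ->
  exists S, rep n S (K * c) g.
Proof.
elim: n => [|n [K' K'0 IH]]; first exact: rep0.
have [K1 K10 step] := hclass_step W m0 n.
pose a : R[i] := n%:R +i* 0; pose E := expR (`|phi 0| + `|phi 1|).
exists (2 * E + K' * K1 * (cabs a + 1)).
  by rewrite addr_ge0 ?mulr_ge0 ?addr_ge0 ?expR_ge0 ?cabs_ge0.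
move=> g c c0 hg; have [G hG Gg] := step g c c0 hg.
have K1c : 0 <= K1 * c by rewrite mulr_ge0.
have [S0 [lS bS eS]] := IH G _ K1c hG.
have ga : cabs (g a) <= c by case: hg => _ _ /(_ n (ltnSn n))[].
pose e (x : R) : C := cexp (- 'i * (- a) * x%:C).
have ce : continuous e by exact: continuous_cexp_line.
have eint u M : good n.+1 u M -> cintegrable (`[0%R, 1%R] : set MR) (fun x => e x * u x).
  by move=> /(good_le (leq0n _))/good0_continuous cu; exact/cintegrable_seg/continuous_RcplxM.
have good1 u M : good n.+1 u M -> cis_Cn 1 u by move=> [cu _]; exact: cis_Cn_le cu.
have m01 : measurable (`[0%R, 1%R] : set MR) by exact: measurable_itv.
exists (fun u => g a * cint `[0%R, 1%R] (fun x => e x * u x) + S0 (shift_op a u)); split.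
- move=> z u v M N gu gv; rewrite (shift_op_lin a z (good1 _ _ gu) (good1 _ _ gv)).
  rewrite (lS z _ _ _ _ (good_shift_op a gu) (good_shift_op a gv)).
  have -> : cint `[0%R, 1%R] (fun x => e x * (z *: u + v) x) =
      z * cint `[0%R, 1%R] (fun x => e x * u x) + cint `[0%R, 1%R] (fun x => e x * v x).
    rewrite -(cintZ z m01 (eint _ _ gu)) -(cintD m01 (cintegrableZ z m01 (eint _ _ gu)) (eint _ _ gv)).
    by apply: eq_cint => x _; rewrite addrfctE scalrfctE /GRing.scale /=; ring.
  ring.
- move=> u M M0 gu; apply: le_trans (cabsD _ _) _; rewrite cabsM.
  rewrite mulrDl mulrDl; apply: lerD.
    have -> : 2 * E * c * M = c * (2 * (E * M) * (1 - 0)) by ring.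
    apply: ler_pM ga _; rewrite ?cabs_ge0//.
    apply: cabs_cint_itv_le => //; first exact: eint gu.
    move=> x x01; rewrite cabsM -[E * M]mul1r; apply: ler_pM; rewrite ?cabs_ge0//.
      apply: le_trans (cabs_exp_seg _ x01) _.
      by rewrite /a /= oppr0 normr0 expR0.
    apply: le_trans (good0_le x (good_le (leq0n _) gu)) _.
    rewrite mulrC ler_wpM2r//.
    apply: le_trans (_ : expR (phi x) * 1 <= _).
      by rewrite ler_wpM2l ?expR_ge0// cau_le1.
    by rewrite mulr1 ler_expR phi_le_01.
  have aM : 0 <= (cabs a + 1) * M by rewrite mulr_ge0 ?addr_ge0 ?cabs_ge0.
  apply: le_trans (bS _ _ aM (good_shift_op a gu)) _.
  by rewrite le_eqVlt; apply/orP; left; apply/eqP; ring.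
- move=> x y y0; rewrite shift_op_exp.
  have [M M0 gM] := good_exp n (x +i* y).
  have gz : good n (0 : R -> C) 0.
    split=> [|b t bn]; first exact: cis_Cn0.
    by rewrite cderiv0 cabs0 mul0r.
  have S00 : S0 0 = 0.
    apply: cabs_eq0; apply/eqP; rewrite eq_le cabs_ge0 andbT.
    by have := bS 0 0 (lexx 0) gz; rewrite mulr0.
  rewrite -[X in S0 X]addr0 (lS _ _ _ _ _ gM gz) S00 addr0 eS//.
  rewrite [RHS]Gg; congr (g _ * _ + _).
  rewrite /kappa; apply: eq_cint => t _.
  by rewrite /e -cexpD -/a; congr cexp; rewrite -mulrDl -mulrDr addrC.
Qed.

End Representation.

(** * Real-valued norms on T and its neighbourhoods *)

Section TNorm.
Context {R : realType} (W : weights R).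
Local Notation C := (cplx R).
Implicit Types (f g : Tspace W) (m : nat).

Definition tnorm m f : R := fine (T_norm W m (\val f)).

Lemma TvalD f g : \val (f + g) = \val f + \val g :> (nat -> R -> C).
Proof. exact: raddfD. Qed.

Lemma TvalZ (z : R[i]) f : \val (z *: f) = z *: (\val f) :> (nat -> R -> C).
Proof. exact: linearZ. Qed.

Lemma Tval0 : \val (0 : Tspace W) = 0 :> (nat -> R -> C).
Proof. exact: raddf0. Qed.

Lemma Tspace_cis_Cn n f k : cis_Cn n (f k).
Proof.
by have /set_mem/(_ n.+1 (ltn0Sn n))[/(_ k) H _] := valP f; exact: cis_Cn_le (leqnSn n) H.
Qed.

Lemma T_norm_lty m f : (0 < m)%N -> (T_norm W m (\val f) < +oo)%E.
Proof. by move=> m0; have /set_mem/(_ m m0)[] := valP f. Qed.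

Lemma tnormE m f : (0 < m)%N -> T_norm W m (\val f) = (tnorm m f)%:E.
Proof. by move=> m0; rewrite fineK// ge0_fin_numE ?T_norm_lty// T_norm_ge0. Qed.

Lemma tnorm_ge0 m f : (0 < m)%N -> 0 <= tnorm m f.
Proof. by move=> m0; rewrite fine_ge0// T_norm_ge0. Qed.

Lemma tnormD m f g : (0 < m)%N -> tnorm m (f + g) <= tnorm m f + tnorm m g.
Proof.
move=> m0; rewrite -lee_fin EFinD -!tnormE// TvalD.
exact: (@T_normD R W m (\val f) (\val g) m0 (Tspace_cis_Cn m f) (Tspace_cis_Cn m g)).
Qed.

Lemma tnormZ m (z : R[i]) f : (0 < m)%N -> tnorm m (z *: f) <= cabs z * tnorm m f.
Proof.
move=> m0; rewrite -lee_fin EFinM -!tnormE// TvalZ.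
exact: (@T_normZ R W m z (\val f) m0 (Tspace_cis_Cn m f)).
Qed.

Lemma tnormN m f : (0 < m)%N -> tnorm m (- f) = tnorm m f.
Proof.
move=> m0; have H g : tnorm m (- g) <= tnorm m g.
  by rewrite -scaleN1r (le_trans (tnormZ _ _ m0))// cabsN cabs1 mul1r.
by apply/eqP; rewrite eq_le H -{1}[f]opprK H.
Qed.

Lemma tnorm0 m : tnorm m 0 = 0.
Proof. by rewrite /tnorm Tval0 T_norm0. Qed.

Lemma tnormB m f g : (0 < m)%N -> tnorm m (f - g) <= tnorm m f + tnorm m g.
Proof. by move=> m0; rewrite (le_trans (tnormD _ _ m0))// tnormN. Qed.

Definition qnorm m f k : R := fine (q_norm W m (f k)).

Lemma q_norm_term_le m f k : (0 < m)%N ->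
  ((coef W m k)%:E * q_norm W m (f k) <= T_norm W m (\val f))%E.
Proof.
move=> m0; rewrite /T_norm (@nneseriesD1 _ _ k)//.
  by rewrite leeDl// nneseries_ge0// => j _ _; rewrite mule_ge0 ?q_norm_ge0// lee_fin ltW// coef_gt0.
by move=> j _; rewrite mule_ge0 ?q_norm_ge0// lee_fin ltW// coef_gt0.
Qed.

Lemma qnormE m f k : (0 < m)%N -> q_norm W m (f k) = (qnorm m f k)%:E.
Proof.
move=> m0; rewrite fineK// ge0_fin_numE ?q_norm_ge0//.
have := le_lt_trans (q_norm_term_le f k m0) (T_norm_lty f m0).
have := q_norm_ge0 W m (f k); move: (q_norm W m (f k)) => [r| |] //.
  by rewrite !ltry.
by rewrite gt0_muley ?ltxx// lte_fin coef_gt0.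
Qed.

Lemma qnorm_ge0 m f k : 0 <= qnorm m f k.
Proof. by rewrite fine_ge0// q_norm_ge0. Qed.

Lemma qnorm_le m f k : (0 < m)%N -> coef W m k * qnorm m f k <= tnorm m f.
Proof. by move=> m0; rewrite -lee_fin EFinM -qnormE// -tnormE// q_norm_term_le. Qed.

Lemma cderiv_qnorm m f k a x : (0 < m)%N -> (a <= m)%N ->
  cabs (cderiv a (f k) x) <= qnorm m f k * expR (phi W m x).
Proof.
move=> m0 am; rewrite -ler_pdivrMr ?expR_gt0//.
by rewrite -lee_fin -qnormE//; exact: q_norm_ub.
Qed.

Lemma tnorm_series m f : (0 < m)%N ->
  (\sum_(0 <= k <oo) (coef W m k * qnorm m f k)%:E)%E = (tnorm m f)%:E.
Proof.
by move=> m0; rewrite -tnormE//; apply: eq_eseriesr => k _; rewrite qnormE// EFinM.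
Qed.

Lemma phi_le m x : (0 < m)%N -> phi W m.+1 x <= phi W m x.
Proof.
move=> m0; have := phi_gap W m0 x; have : 0 <= ln (1 + `|x|) by rewrite ln_ge0// lerDl.
lra.
Qed.

Lemma expR_phi_gap m x : (0 < m)%N ->
  (1 + `|x|) * expR (phi W m.+1 x) <= expR (phi W m x).
Proof.
move=> m0; have x1 : 0 < 1 + `|x| by rewrite ltr_pwDl.
rewrite -[X in X * _]lnK ?posrE// -expRD ler_expR; have := phi_gap W m0 x; lra.
Qed.

Lemma expR_phi_gap2 m x : (0 < m)%N ->
  expR (phi W m.+2 x) <= expR (phi W m x) * cau x.
Proof.
move=> m0; have x1 : 0 < 1 + `|x| by rewrite ltr_pwDl.
rewrite ler_pdivlMr ?onesqr_gt0//; apply: le_trans (expR_phi_gap x m0).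
apply: le_trans (_ : (1 + `|x|) * ((1 + `|x|) * expR (phi W m.+2 x)) <= _); last first.
  by rewrite ler_wpM2l ?(ltW x1)// expR_phi_gap.
rewrite mulrC mulrA ler_wpM2r ?expR_ge0//.
by rewrite -[x ^+ 2]real_normK ?num_real//; have := normr_ge0 x; nra.
Qed.

Lemma q_norm_mono m u : (0 < m)%N -> (q_norm W m u <= q_norm W m.+1 u)%E.
Proof.
move=> m0; apply: ge_ereal_sup => _ [x [a [am ->]]].
apply: le_trans (q_norm_ub W u x (leqW am)).
by rewrite lee_fin ler_wpM2l ?cabs_ge0// lef_pV2 ?posrE ?expR_gt0// ler_expR phi_le.
Qed.

Lemma tnorm_step m : (0 < m)%N -> exists2 K, 0 < K & forall f, tnorm m f <= K * tnorm m.+1 f.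
Proof.
move=> m0; have [K K0 HK] := coef_ratio W m0; exists K => // f.
rewrite -lee_fin EFinM -!tnormE// /T_norm -nneseriesZl.
  apply: lee_nneseries => k _.
    by rewrite mule_ge0 ?q_norm_ge0// lee_fin ltW// coef_gt0.
  rewrite muleA -EFinM; apply: lee_pmul; rewrite ?q_norm_ge0 ?q_norm_mono ?lee_fin//.
  by rewrite ltW// coef_gt0.
by move=> k _; rewrite mule_ge0 ?q_norm_ge0// lee_fin ltW// coef_gt0.
Qed.

Lemma tnorm_mono m n : (0 < m)%N -> (m <= n)%N ->
  exists2 K, 0 < K & forall f, tnorm m f <= K * tnorm n f.
Proof.
move=> m0 /subnKC <-; elim: (n - m)%N => [|d [K K0 IH]].
  by exists 1 => // f; rewrite addn0 mul1r.
have [K' K'0 H] := @tnorm_step (m + d) (ltn_addr _ m0).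
exists (K * K') => [|f]; first exact: mulr_gt0.
rewrite addnS -mulrA; apply: le_trans (IH f) _; apply: ler_wpM2l (H f); exact: ltW.
Qed.

Lemma T_ballE m f e : (0 < m)%N -> T_ball m f e = [set g | tnorm m (g - f) < e].
Proof. by move=> m0; apply/seteqP; split=> g; rewrite /T_ball /= -lte_fin -tnormE. Qed.

Lemma open_T_ball m f e : (0 < m)%N -> 0 < e -> open (T_ball m f e).
Proof.
move=> m0 e0; exists [set T_ball m f e]; last by rewrite bigcup_set1.
by move=> _ ->; apply: finI_from1; exists m, f, e.
Qed.

(** The subbase consists of balls of all the norms about arbitrary centres. A finite intersection of
    them around f contains a ball of a single norm centred at f, because each norm is dominated by a
    multiple of every later one. *)
Lemma nbhs_tnormP f (U : set (Tspace W)) : nbhs f U <->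
  exists m e, [/\ (0 < m)%N, 0 < e & forall g, tnorm m (g - f) < e -> U g].
Proof.
split=> [|[m [e [m0 e0 H]]]]; last first.
  rewrite nbhsE; exists (T_ball m f e); last by rewrite T_ballE.
  by split; [exact: open_T_ball|rewrite T_ballE//= subrr tnorm0].
rewrite nbhsE => -[B [[D' D'sub DB] Bf] BU]; move: Bf BU; rewrite -DB => -[A D'A Af] BU.
have [F FD FA] := D'sub A D'A.
have {BU}AU : A `<=` U by move=> g Ag; apply: BU; exists A.
pose s : seq (set (Tspace W)) := finmap.enum_fset F.
suff [m [e [m0 e0 H]]] : exists m e, [/\ (0 < m)%N, 0 < e &
    forall g, tnorm m (g - f) < e -> forall B', B' \in s -> B' g].
  by exists m, e; split=> // g /H H'; apply: AU; rewrite -FA => B' /= /H'.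
have {}Af B' : B' \in s -> B' f by move=> B'F; move: Af; rewrite -FA => /(_ B' B'F).
have {}FD B' : B' \in s -> T_balls B' by move=> /FD/set_mem.
move: s Af FD => {F FA AU A D'A D' D'sub DB B}; elim => [_ _|B' s IH Af FD].
  by exists 1%N, 1.
have [B''|B''|m [e [m0 e0 H]]] := IH.
- by move=> sB; apply: Af; rewrite inE sB orbT.
- by move=> sB; apply: FD; rewrite inE sB orbT.
have B'f := Af B' (mem_head _ _); have [m' [f' [e' [m'0 e'0 E]]]] := FD B' (mem_head _ _).
move: B'f; rewrite E T_ballE//= => d; set r := tnorm m' (f - f') in d.
have [K K0 HK] := tnorm_mono m0 (leq_maxl m m').
have [K' K'0 HK'] := tnorm_mono m'0 (leq_maxr m m').
exists (maxn m m'), (Num.min (e / K) ((e' - r) / K')); split.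
- by rewrite leq_max m0.
- by rewrite lt_min !divr_gt0// subr_gt0.
move=> g h C.
have [h1 h2] : tnorm (maxn m m') (g - f) < e / K /\ tnorm (maxn m m') (g - f) < (e' - r) / K'.
  by apply/andP; rewrite -lt_min.
move: h1 h2; rewrite (ltr_pdivlMr _ _ K0) (ltr_pdivlMr _ _ K'0) => h1 h2.
rewrite inE => /orP[/eqP->|sC].
  change (tnorm m' (g - f') < e').
  have -> : g - f' = (g - f) + (f - f') by rewrite addrA subrK.
  apply: le_lt_trans (tnormD _ _ m'0) _; rewrite -/r -ltrBrDr.
  by apply: le_lt_trans h2; rewrite mulrC HK'.
by apply: H sC; apply: le_lt_trans h1; rewrite mulrC HK.
Qed.

Lemma continuous_tnorm_bounded (S : Tspace W -> C) : linear S -> continuous S ->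
  exists m M, [/\ (0 < m)%N, 0 <= M & forall f, cabs (S f) <= M * tnorm m f].
Proof.
move=> lS /(_ 0) cS.
have S0 : S 0 = 0 by have := lS (-1) 0 0; rewrite !scaler0 addr0 scaleN1r addNr.
have S1 : nbhs (0 : Tspace W) [set f | cabs (S f) < 1].
  apply: (cS [set z | cabs z < 1]); apply/nbhs_cplxP; exists 1 => // w.
  by rewrite S0 subr0.
have /nbhs_tnormP[m [e [m0 e0 He]]] := S1.
exists m, (2 / e); split=> //; first by rewrite divr_ge0// ltW.
have SZ (t : R[i]) g : S (t *: g) = t * S g by have := lS t g 0; rewrite addr0 S0 addr0.
move=> f; rewrite leNgt; apply/negP => bad.
have n0 := tnorm_ge0 f m0.
have c0 : 0 < cabs (S f) by apply: le_lt_trans bad; rewrite mulr_ge0// divr_ge0// ltW.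
(* Scaling by the value of S instead of the norm of f avoids a separate case for norm zero. *)
have : cabs (S ((cabs (S f))^-1%:C *: f)) < 1.
  apply: He; rewrite subr0; apply: le_lt_trans (tnormZ _ _ m0) _.
  rewrite cabs_real ger0_norm ?invr_ge0 ?cabs_ge0// mulrC ltr_pdivrMr//.
  have : 2 / e * tnorm m f * e < cabs (S f) * e by rewrite ltr_pM2r.
  have -> : 2 / e * tnorm m f * e = 2 * tnorm m f by field; rewrite gt_eqF.
  lra.
by rewrite SZ cabsM cabs_real ger0_norm ?invr_ge0 ?cabs_ge0// mulVf ?gt_eqF// ltxx.
Qed.

Lemma tnorm_bounded_continuous (S : Tspace W -> C) m M : linear S -> (0 < m)%N ->
  (forall f, cabs (S f) <= M * tnorm m f) -> continuous S.
Proof.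
move=> lS m0 bS f; apply/continuous_cplxP => e e0; apply/nbhs_tnormP.
have M1 : 0 < `|M| + 1 by rewrite ltr_wpDl.
exists m, (e / (`|M| + 1)); split=> [||g] //; first exact: divr_gt0.
rewrite ltr_pdivlMr// => h /=.
have -> : S g - S f = S (g - f).
  have -> : g - f = (- 1) *: f + g by rewrite scaleN1r addrC.
  by rewrite lS scaleN1r addrC.
apply: le_lt_trans (bS _) _; apply: le_lt_trans h; rewrite mulrC.
rewrite ler_wpM2l ?tnorm_ge0//; have := ler_norm M; lra.
Qed.

End TNorm.

(** * Absolutely convergent complex series *)

Section ComplexSeries.
Context {R : realType}.
Local Notation C := (cplx R).

Definition absum (B : R) (a : nat -> C) : Prop :=
  forall n, \sum_(0 <= k < n) cabs (a k) <= B.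

Definition csum (a : nat -> C) : C :=
  limn (series (fun k => Re (a k))) +i* limn (series (fun k => Im (a k))).

Lemma bounded_series_cvg (B : R) (u : nat -> R) :
  (forall n, \sum_(0 <= k < n) `|u k| <= B) -> cvgn (series u).
Proof.
move=> uB; apply: normed_cvg; apply: nondecreasing_is_cvgn; last by exists B => _ [n _ <-]; exact: uB.
by apply: nondecreasing_series => n _ _; exact: normr_ge0.
Qed.

Lemma bounded_series_le (B : R) (u : nat -> R) :
  (forall n, \sum_(0 <= k < n) `|u k| <= B) -> `|limn (series u)| <= B.
Proof.
move=> uB; have cn : cvgn [normed series u].
  apply: nondecreasing_is_cvgn; last by exists B => _ [n _ <-]; exact: uB.
  by apply: nondecreasing_series => n _ _; exact: normr_ge0.
apply: le_trans (lim_series_norm cn) _; apply: limr_le => //.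
by apply: nearW => n; exact: uB.
Qed.

Lemma absum_Re B a : absum B a -> forall n, \sum_(0 <= k < n) `|Re (a k)| <= B.
Proof. by move=> aB n; apply: le_trans (aB n); apply: ler_sum => k _; exact: Re_le_cabs. Qed.

Lemma absum_Im B a : absum B a -> forall n, \sum_(0 <= k < n) `|Im (a k)| <= B.
Proof. by move=> aB n; apply: le_trans (aB n); apply: ler_sum => k _; exact: Im_le_cabs. Qed.

Lemma csum_le B a : absum B a -> cabs (csum a) <= 2 * B.
Proof.
move=> aB; apply: le_trans (cabs_le_ReIm _) _ => /=.
have H1 := bounded_series_le (absum_Re aB); have H2 := bounded_series_le (absum_Im aB).
by rewrite mulr_natl mulr2n lerD.
Qed.

Lemma csum_lin A B (z : R[i]) a b : absum A a -> absum B b ->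
  csum (fun k => z * a k + b k) = z * csum a + csum b.
Proof.
move=> aA bB.
have ra := bounded_series_cvg (absum_Re aA); have ia := bounded_series_cvg (absum_Im aA).
have rb := bounded_series_cvg (absum_Re bB); have ib := bounded_series_cvg (absum_Im bB).
have lin (s t : R) (u v w : nat -> R) : cvgn (series u) -> cvgn (series v) -> cvgn (series w) ->
    limn (series (fun k => s * u k + t * v k + w k)) =
    s * limn (series u) + t * limn (series v) + limn (series w).
  move=> cu cv cw.
  have -> : (fun k => s * u k + t * v k + w k) = (s *: u + t *: v) + w by [].
  have su := is_cvg_seriesZ (k := s) cu; have sv := is_cvg_seriesZ (k := t) cv.
  have suv := is_cvg_seriesD su sv.
  by rewrite (lim_seriesD suv cw) (lim_seriesD su sv) (lim_seriesZ s cu) (lim_seriesZ t cv).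
apply: cplx_eq.
- rewrite ReDE ReME /= -mulNr -lin//; congr (limn (series _)).
  by apply/funext => k; rewrite ReDE ReME mulNr.
- rewrite ImDE ImME /= -lin//; congr (limn (series _)).
  by apply/funext => k; rewrite ImDE ImME.
Qed.

Lemma csum_single k a : (forall j, j != k -> a j = 0) -> csum a = a k.
Proof.
have E (u : nat -> R) : (forall j, j != k -> u j = 0) -> limn (series u) = u k.
  move=> u0; apply: cvg_lim => //; apply: cvg_near_cst.
  exists k.+1 => // n /= kn; rewrite /series /= (bigD1_seq k) ?iota_uniq ?mem_index_iota//=.
  by rewrite big1 ?addr0// => j jk; exact: u0.
move=> a0; rewrite /csum !E.
- by case: (a k).
- by move=> j /a0 ->.
- by move=> j /a0 ->.
Qed.

End ComplexSeries.

(** * Functionals with a prescribed transform *)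

Section Surjectivity.
Context {R : realType} (W : weights R) (m : nat).
Hypothesis m0 : (0 < m)%N.
Local Notation C := (cplx R).

Definition Pbound (c : R) (g : C -> C) : Prop :=
  forall l, cabs (g l) <= c * (1 + cabs l) ^+ m * expR (phit W m (Im l)).

(** Growth of order m corresponds to n = m + 2 in [hclass]. K is there to control the values at the
    points 0, ..., m + 1. *)
Lemma hclass_of_entire : exists2 K, 0 <= K & forall c g, 0 <= c -> entire g ->
  Pbound c g -> hclass W m m.+2 (K * c) g.
Proof.
pose K := 1 + (1 + m.+2%:R) ^+ m * expR (phit W m 0).
have K0 : 0 <= K by rewrite addr_ge0// mulr_ge0 ?expR_ge0// exprn_ge0// addr_ge0.
have K1 : 1 <= K by rewrite lerDl mulr_ge0 ?expR_ge0// exprn_ge0// addr_ge0.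
exists K; first exact: K0.
move=> c g c0 eg bg; apply: And5.
- by move=> z; apply: derivable_continuous_cplx; exact: eg.
- by move=> x y _; exact: eg.
- move=> j jm; split; first exact: eg.
  have jE : cabs (j%:R +i* 0 : R[i]) = j%:R by rewrite [LHS]cabs_real ger0_norm.
  apply: le_trans (bg _) _; rewrite jE -mulrA [K * c]mulrC; apply: (ler_wpM2l c0).
  apply: le_trans (_ : (1 + m.+2%:R) ^+ m * expR (phit W m 0) <= K); last by rewrite lerDr.
  rewrite ler_wpM2r ?expR_ge0//.
  have jm' : 1 + j%:R <= 1 + m.+2%:R :> R by rewrite lerD2l ler_nat ltnW.
  by rewrite lerXn2r// nnegrE addr_ge0.
- move=> A; pose B := `|A|; pose P := expR (`|phit W m B| + `|phit W m (- B)|).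
  have B0 : 0 <= B by exact: normr_ge0.
  exists (c * (1 + B) ^+ m * P) => x y yA.
  have {}yA : `|y| <= B by rewrite (le_trans yA)// ler_norm.
  apply: le_trans (bg _) _ => /=.
  have X1 : 0 <= 1 + `|x| by rewrite addr_ge0.
  have -> : c * (1 + B) ^+ m * P * ((1 + `|x|) ^+ m.+2 * cau x) =
     c * ((1 + B) * (1 + `|x|)) ^+ m * P * ((1 + `|x|) ^+ 2 * cau x).
    by rewrite exprMn -addn2 exprD; ring.
  rewrite -[X in X <= _]mulr1; apply: ler_pM; rewrite ?X2cau_ge1 ?ler01//.
    by rewrite !mulr_ge0 ?expR_ge0 ?exprn_ge0// addr_ge0 ?cabs_ge0.
  apply: ler_pM; rewrite ?expR_ge0 ?ler_expR ?phit_bound//.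
    by rewrite !mulr_ge0 ?exprn_ge0// addr_ge0 ?cabs_ge0.
  rewrite ler_wpM2l// lerXn2r ?nnegrE ?mulr_ge0 ?addr_ge0 ?cabs_ge0//.
  apply: le_trans (_ : 1 + (`|x| + `|y|) <= _); first by rewrite lerD2l; exact: (cabs_le_ReIm (x +i* y)).
  have := normr_ge0 x; nra.
- move=> x y y1; set z := x +i* y.
  have Z1 : 0 <= 1 + cabs z by rewrite addr_ge0 ?cabs_ge0.
  have -> : K * c * ((1 + cabs z) ^+ m.+2 * expR (phit W m y)) =
     K * (c * (1 + cabs z) ^+ m * expR (phit W m y)) * (1 + cabs z) ^+ 2.
    by rewrite -addn2 exprD; ring.
  rewrite ler_wpM2r ?exprn_ge0//; apply: le_trans (bg z) _ => /=.
  by rewrite ler_peMl// !mulr_ge0 ?expR_ge0 ?exprn_ge0.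
Qed.

Lemma good_Tspace (f : Tspace W) k : good W m m.+2 (f k) (qnorm m.+2 f k).
Proof.
split=> [|a x am]; first exact: Tspace_cis_Cn.
apply: le_trans (cderiv_qnorm f k x (ltn0Sn _) am) _.
by rewrite ler_wpM2l ?qnorm_ge0// expR_phi_gap2.
Qed.

Lemma tnorm_partial (f : Tspace W) n j : (0 < n)%N ->
  \sum_(0 <= k < j) coef W n k * qnorm n f k <= tnorm n f.
Proof.
move=> n0; rewrite -lee_fin -tnorm_series// -sumEFin; apply: nneseries_lim_ge => k _ _.
by rewrite lee_fin mulr_ge0 ?qnorm_ge0// ltW// coef_gt0.
Qed.

(** S f is the sum of S_k (f_k), where S_k represents g_k. The bound on S_k carries c_k^(m),
    dominated by a multiple of c_k^(m+2), so the series converges absolutely with sum controlled by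
    p_(m+2)(f). That K does not depend on g is what continuity of the inverse rests on. *)
Lemma exists_functional : exists2 K, 0 <= K & forall (g : nat -> C -> C) (N : R), 0 <= N ->
  (forall k, entire (g k)) -> (forall k, Pbound (coef W m k * N) (g k)) ->
  exists S : Tdual W, (forall f, cabs (S f) <= K * N * tnorm m.+2 f) /\
    forall k (a b : R), b != 0 -> hat S k (a +i* b) = g k (a +i* b).
Proof.
have [K1 K10 H1] := hclass_of_entire; have [K2 K20 H2] := rep_exists W m0 m.+2.
have [K3 K30 H3] := coef_ratio W m0; have [K4 K40 H4] := coef_ratio W (ltn0Sn m).
have cg m' k : (0 < m')%N -> 0 <= coef W m' k by move=> ?; rewrite ltW// coef_gt0.
exists (2 * (K2 * K1 * (K3 * K4))); first by rewrite !mulr_ge0// ltW.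
move=> g N N0 eg bg.
have E k : exists S, rep W m m.+2 S (K2 * (K1 * (coef W m k * N))) (g k).
  have cN : 0 <= coef W m k * N by rewrite mulr_ge0// cg.
  by apply: H2; [rewrite mulr_ge0|exact: H1].
pose Sk k := projT1 (cid (E k)).
have HS k : rep W m m.+2 (Sk k) (K2 * (K1 * (coef W m k * N))) (g k) by exact: projT2 (cid (E k)).
pose B (f : Tspace W) := K2 * K1 * (K3 * K4) * N * tnorm m.+2 f.
have aB (f : Tspace W) : absum (B f) (fun k => Sk k (f k)).
  move=> n; apply: le_trans (ler_wpM2l _ (tnorm_partial f n (ltn0Sn m.+1))); last first.
    by rewrite !mulr_ge0// ltW.
  rewrite mulr_sumr; apply: ler_sum => k _.
  have [_ bS _] := HS k.
  apply: le_trans (bS _ _ (qnorm_ge0 _ _ _) (good_Tspace f k)) _.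
  rewrite [leRHS]mulrA; apply: ler_wpM2r (qnorm_ge0 _ _ _) _ _ _.
  have -> : K2 * (K1 * (coef W m k * N)) = K2 * K1 * N * coef W m k by ring.
  have -> : K2 * K1 * (K3 * K4) * N * coef W m.+2 k =
    K2 * K1 * N * (K3 * (K4 * coef W m.+2 k)) by ring.
  rewrite ler_wpM2l ?mulr_ge0//; apply: le_trans (H3 k) _.
  by rewrite ler_wpM2l// ltW.
pose S0 (f : Tspace W) : C := csum (fun k => Sk k (f k)).
have lS0 : linear S0.
  move=> z f h; rewrite /S0 /GRing.scale /= -(csum_lin z (aB f) (aB h)).
  congr csum; apply/funext => k; have [lS _ _] := HS k.
  exact: lS z _ _ _ _ (good_Tspace f k) (good_Tspace h k).
have bS0 f : cabs (S0 f) <= 2 * (K2 * K1 * (K3 * K4)) * N * tnorm m.+2 f.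
  by apply: le_trans (csum_le (aB f)) _; rewrite /B !mulrA.
have cS0 := @tnorm_bounded_continuous _ _ _ _ _ lS0 (ltn0Sn m.+1) bS0.
have TS : S0 \in @Tdual_set R W by apply/mem_set.
exists (MkTdual TS); split=> [|k a b b0]; first exact: bS0.
change (S0 (exp_T W k (a +i* b)) = g k (a +i* b)).
rewrite /S0 (@csum_single _ k).
  have [_ _ <-//] := HS k; congr (Sk k); apply/funext => x.
  by rewrite /exp_T /= /exp_seq eqxx.
move=> j jk; have [_ bS _] := HS j.
have z0 : good W m m.+2 (exp_T W k (a +i* b) j) 0.
  have -> : (exp_T W k (a +i* b) j) = 0.
    by apply/funext => x; rewrite /exp_T /= /exp_seq (negbTE jk).
  split=> [|b' t _]; first exact: cis_Cn0.
  by rewrite cderiv0 cabs0 mul0r.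
apply: cabs_eq0; apply/eqP; rewrite eq_le cabs_ge0 andbT.
by have := bS _ 0 (lexx 0) z0; rewrite mulr0.
Qed.

End Surjectivity.

(** * The transform of a functional *)

Section SmoothSequences.
Context {R : realType}.
Local Notation C := (cplx R).

Lemma derive1n_seq (F : nat -> R -> R) :
  (forall n (x : R), is_derive x 1 (F n) (F n.+1 x)) ->
  forall n, derive1n n (F 0%N) = F n.
Proof.
move=> dF; elim=> [//|n IH]; rewrite derive1nS IH; apply/funext => x.
by rewrite derive1E (@derive_val _ _ _ _ _ _ _ (dF n x)).
Qed.

Lemma is_Cn_seq (F : nat -> R -> R) n :
  (forall n (x : R), is_derive x 1 (F n) (F n.+1 x)) -> is_Cn n (F 0%N).
Proof.
move=> dF; split; first by move=> a an x; rewrite derive1n_seq//; have [] := dF a x.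
by rewrite derive1n_seq// => x; exact: is_derive_continuous (dF n x).
Qed.

Lemma cis_Cn_seq (F : nat -> R -> C) n :
  (forall n (x : R), is_derive x 1 (fun y => Re (F n y)) (Re (F n.+1 x))) ->
  (forall n (x : R), is_derive x 1 (fun y => Im (F n y)) (Im (F n.+1 x))) ->
  cis_Cn n (F 0%N) /\ cderiv n (F 0%N) = F n.
Proof.
move=> dr di; split; first by split; [exact: (is_Cn_seq n dr)|exact: (is_Cn_seq n di)].
apply/funext => x; rewrite /cderiv (derive1n_seq dr) (derive1n_seq di).
by case: (F n x).
Qed.

(** The a-th derivative of x exp(w x). For a = 0 the second summand vanishes through its factor
    [a%:R], whatever [a.-1] is. *)
Definition xexp (w : R[i]) (a : nat) (x : R) : C :=
  (w ^+ a * x%:C + a%:R * w ^+ a.-1) * cexp (w * x%:C).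

Lemma is_derive_affexp (z1 z2 w : R[i]) (x : R) :
  is_derive x 1 (fun y => Re ((z1 * y%:C + z2) * cexp (w * y%:C)))
    (Re ((z1 + (z1 * x%:C + z2) * w) * cexp (w * x%:C))) /\
  is_derive x 1 (fun y => Im ((z1 * y%:C + z2) * cexp (w * y%:C)))
    (Im ((z1 + (z1 * x%:C + z2) * w) * cexp (w * x%:C))).
Proof.
have d1 := is_derive_Re_cexp w x; have d2 := is_derive_Im_cexp w x.
have da (s t : R) : is_derive x 1 (fun y => s * y + t) s.
  by apply: is_derive_eq; rewrite /GRing.scale /= mulr1 addr0.
have r := da (Re z1) (Re z2); have i := da (Im z1) (Im z2).
have RE y : Re ((z1 * y%:C + z2) * cexp (w * y%:C)) =
    (Re z1 * y + Re z2) * Re (cexp (w * y%:C)) - (Im z1 * y + Im z2) * Im (cexp (w * y%:C)).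
  by rewrite ReME ReDE ImDE ReME ImME /= !mulr0 subr0 add0r.
have IE y : Im ((z1 * y%:C + z2) * cexp (w * y%:C)) =
    (Re z1 * y + Re z2) * Im (cexp (w * y%:C)) + (Im z1 * y + Im z2) * Re (cexp (w * y%:C)).
  by rewrite ImME ReDE ImDE ReME ImME /= !mulr0 subr0 add0r.
under eq_fun do rewrite RE; under [X in _ /\ is_derive _ _ X _]eq_fun do rewrite IE.
split.
- apply: is_derive_eq (is_deriveB (is_deriveM r d1) (is_deriveM i d2)) _.
  move: (cexp (w * x%:C)) => e; rewrite /GRing.scale /= !(ReME, ImME, ReDE, ImDE) /=; ring.
- apply: is_derive_eq (is_deriveD (is_deriveM r d2) (is_deriveM i d1)) _.
  move: (cexp (w * x%:C)) => e; rewrite /GRing.scale /= !(ReME, ImME, ReDE, ImDE) /=; ring.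
Qed.

Lemma xexp_seq (w : R[i]) n : cis_Cn n (xexp w 0) /\ cderiv n (xexp w 0) = xexp w n.
Proof.
have E a x : (w ^+ a + (w ^+ a * x%:C + a%:R * w ^+ a.-1) * w) = w ^+ a.+1 * x%:C + a.+1%:R * w ^+ a.
  case: a => [|a] /=; first by rewrite expr0 expr1 mul0r addr0 mul1r mulr1 addrC mulrC.
  have -> : a.+2%:R = a.+1%:R + 1 :> R[i] by rewrite -natr1.
  by rewrite !exprS; ring.
apply: cis_Cn_seq => a x; have [H1 H2] := is_derive_affexp (w ^+ a) (a%:R * w ^+ a.-1) w x.
- by rewrite /xexp -E.
- by rewrite /xexp -E.
Qed.

End SmoothSequences.

Section SecondOrder.
Context {R : realType}.

Lemma expn_second_order (w : R[i]) a : exists2 K : R, 0 <= K & forall h : R[i], cabs h <= 1 ->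
  cabs ((w + h) ^+ a - w ^+ a - a%:R * w ^+ a.-1 * h) <= K * cabs h ^+ 2.
Proof.
elim: a => [|a [K K0 HK]].
  by exists 0 => // h _; rewrite !expr0 subrr mul0r mul0r subr0 cabs0 mul0r.
exists (K * (cabs w + 1) + cabs (a%:R * w ^+ a.-1)) => [|h h1].
  by rewrite addr_ge0 ?mulr_ge0 ?addr_ge0 ?cabs_ge0.
have -> : (w + h) ^+ a.+1 - w ^+ a.+1 - a.+1%:R * w ^+ a * h =
    ((w + h) ^+ a - w ^+ a - a%:R * w ^+ a.-1 * h) * (w + h) + a%:R * w ^+ a.-1 * h ^+ 2.
  case: a {HK} => [|a] /=; first by rewrite !expr0 !expr1; ring.
  have -> : a.+2%:R = a.+1%:R + 1 :> R[i] by rewrite -natr1.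
  by rewrite !exprS; ring.
apply: le_trans (cabsD _ _) _; rewrite [leRHS]mulrDl; apply: lerD; last by rewrite [leLHS]cabsM cabsX.
have -> : K * (cabs w + 1) * cabs h ^+ 2 = K * cabs h ^+ 2 * (cabs w + 1) by ring.
rewrite cabsM; apply: ler_pM; rewrite ?cabs_ge0 ?HK//.
by apply: le_trans (cabsD _ _) _; rewrite lerD2l.
Qed.

Lemma cexp_second_order (h : R[i]) (x : R) : cabs h <= 1 ->
  cabs (cexp (h * x%:C) - 1 - h * x%:C) <= 4 * cabs h ^+ 2 * expR (3 * `|x|).
Proof.
move=> h1; apply: le_trans (cabs_cexp_sub1_le _) _.
rewrite cabsZr exprMn [4 * (_ * _)]mulrA -[leLHS]mulrA; apply: ler_wpM2l.
  by rewrite mulr_ge0// exprn_ge0// cabs_ge0.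
have -> : 3 * `|x| = `|x| + `|x| + `|x| by ring.
rewrite 2!expRD; have xe : `|x| <= expR `|x|.
  by apply: le_trans (expR_ge1Dx _); rewrite lerDr.
apply: ler_pM; rewrite ?exprn_ge0 ?expR_ge0//.
  by rewrite expr2; apply: ler_pM.
by rewrite ler_expR ler_piMl.
Qed.

End SecondOrder.

(** * The transform of a functional is entire and belongs to P *)

Section HatEntire.
Context {R : realType} (W : weights R).
Local Notation C := (cplx R).

Lemma expR_phi_abs m (A : R) : (0 < m)%N -> exists2 B : R, 0 <= B &
  forall x, expR (A * `|x|) <= B * expR (phi W m x).
Proof.
move=> m0; have [B1 H1] := phi_linear_bound W A m0; have [B2 H2] := phi_linear_bound W (- A) m0.
exists (expR (`|B1| + `|B2|)); first exact: expR_ge0.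
move=> x; rewrite -expRD ler_expR; have := H1 x; have := H2 x.
have := ler_norm B1; have := ler_norm B2; have := normr_ge0 B1; have := normr_ge0 B2.
by case: (ger0P x) => x0; lra.
Qed.

Lemma tnorm_single m (f : Tspace W) k B : (0 < m)%N -> (forall j, j != k -> f j = 0) ->
  (forall a x, (a <= m)%N -> cabs (cderiv a (f k) x) <= B * expR (phi W m x)) ->
  tnorm m f <= coef W m k * B.
Proof.
move=> m0 f0 fB; rewrite -lee_fin -tnormE// /T_norm (@nneseriesD1 _ _ k)//; last first.
  by move=> j _; rewrite mule_ge0 ?q_norm_ge0// lee_fin ltW// coef_gt0.
rewrite eseries0 ?adde0; last first.
  by move=> j _ jk; rewrite -[\val f j]/(f j) f0// q_norm0 mule0.
rewrite EFinM lee_wpmul2l ?lee_fin ?(ltW (coef_gt0 W m0 k))//.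
apply: ge_ereal_sup => _ [x [a [am ->]]].
by rewrite lee_fin ler_pdivrMr ?expR_gt0// fB.
Qed.

Lemma exp_T_at k l j : exp_T W k l j = if j == k then (fun x : R => cexp (- 'i * l * x%:C)) else 0.
Proof. by apply/funext => x; rewrite /exp_T /= /exp_seq; case: eqP. Qed.

Lemma tnorm_exp_T m k l : (0 < m)%N ->
  tnorm m (exp_T W k l) <= coef W m k * ((1 + cabs l) ^+ m * expR (phit W m (Im l))).
Proof.
move=> m0; apply: tnorm_single => // [j jk|a x am]; first by rewrite exp_T_at (negbTE jk).
rewrite exp_T_at eqxx cderiv_cexp cabsM cabs_cexp cabsX cabsM cabsN cabs_i mul1r -mulrA.
rewrite -expRD; apply: ler_pM; rewrite ?exprn_ge0 ?cabs_ge0 ?expR_ge0//.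
  apply: le_trans (_ : (1 + cabs l) ^+ a <= _).
    by rewrite lerXn2r ?nnegrE ?addr_ge0 ?cabs_ge0// lerDr.
  by rewrite ler_weXn2l// lerDl cabs_ge0.
rewrite ler_expR -lerBlDr; apply: le_trans (phit_ub W m0 (Im l) x).
by rewrite lerD2r; case: l => a' b' /=; rewrite le_eqVlt; apply/orP; left; apply/eqP; ring.
Qed.

Lemma affine_abs_exp (A B x : R) : 0 <= A -> 0 <= B ->
  A * `|x| + B <= (A + B) * expR `|x|.
Proof.
move=> A0 B0; rewrite mulrDl; have H := expR_ge1Dx `|x|; have n0 := normr_ge0 x.
apply: lerD; first by apply: ler_wpM2l => //; apply: le_trans H; rewrite lerDr.
by rewrite ler_peMr//; apply: le_trans H; rewrite lerDl.
Qed.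

Lemma cabs_cexp_line_le (w : R[i]) (x : R) : cabs (cexp (w * x%:C)) <= expR (cabs w * `|x|).
Proof. by apply: le_trans (cabs_cexp_le _) _; rewrite cabsZr. Qed.

Lemma xexp_le (w : R[i]) a : exists2 K, 0 <= K &
  forall x, cabs (xexp w a x) <= K * expR ((1 + cabs w) * `|x|).
Proof.
exists (cabs (w ^+ a) + cabs (a%:R * w ^+ a.-1)) => [|x]; first by rewrite addr_ge0 ?cabs_ge0.
rewrite [(1 + cabs w) * _]mulrDl mul1r expRD [leRHS]mulrA [leLHS]cabsM; apply: ler_pM; rewrite ?cabs_ge0 ?cabs_cexp_line_le//.
apply: le_trans (affine_abs_exp x (cabs_ge0 _) (cabs_ge0 _)).
by apply: le_trans (cabsD _ _) _; rewrite cabsZr.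
Qed.

(** Monotonicity in the constant lets finitely many constants be merged into one. *)
Lemma le_upto (P : nat -> R -> Prop) m : (forall a, exists2 K : R, 0 <= K & P a K) ->
  (forall a K K', K <= K' -> P a K -> P a K') ->
  exists2 K : R, 0 <= K & forall a, (a <= m)%N -> P a K.
Proof.
move=> H mono; elim: m => [|m [K K0 HK]].
  by have [K K0 HK] := H 0%N; exists K => // a; rewrite leqn0 => /eqP ->.
have [K' K'0 HK'] := H m.+1; exists (K + K') => [|a]; first exact: addr_ge0.
rewrite leq_eqVlt => /orP[/eqP->|/HK]; last by apply: mono; rewrite lerDl.
by apply: mono HK'; rewrite lerDr.
Qed.

Lemma xexp_seq_Tset k w : (fun j => if j == k then xexp w 0 else 0) \in Tset W.
Proof.
apply/mem_set => m m0; split=> [j|].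
  by case: eqP => _; [exact: (xexp_seq w m).1|exact: cis_Cn0].
have [B B0 HB] := @expR_phi_abs m (1 + cabs w) m0.
have [K K0 HK] := @le_upto (fun a K => forall x, cabs (xexp w a x) <= K * expR ((1 + cabs w) * `|x|)) m
  (xexp_le w) (fun a K K' KK' H x => le_trans (H x) (ler_wpM2r (expR_ge0 _) KK')).
rewrite /T_norm (@nneseriesD1 _ _ k)//; last first.
  by move=> j _; rewrite mule_ge0 ?q_norm_ge0// lee_fin ltW// coef_gt0.
rewrite eseries0 ?adde0; last by move=> j _ jk; rewrite (negbTE jk) q_norm0 mule0.
rewrite eqxx lte_mul_pinfty ?lee_fin ?(ltW (coef_gt0 W m0 k))//.
apply: (@le_lt_trans _ _ (K * B)%:E); last exact: ltry.
apply: ge_ereal_sup => _ [x [a [am ->]]]; rewrite lee_fin (xexp_seq w a).2.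
rewrite ler_pdivrMr ?expR_gt0//; apply: le_trans (HK a am x) _.
by rewrite -mulrA ler_wpM2l.
Qed.

Definition xexp_T k w : Tspace W := MkT (xexp_seq_Tset k w).

Lemma xexp_T_at k w j : xexp_T k w j = if j == k then xexp w 0 else 0.
Proof. by []. Qed.

Lemma cexp_difference (w : R[i]) a : exists2 K : R, 0 <= K & forall (h : R[i]) x, cabs h <= 1 ->
  cabs ((w + h) ^+ a * cexp ((w + h) * x%:C) - w ^+ a * cexp (w * x%:C) - h * xexp w a x)
  <= K * expR ((3 + cabs w) * `|x|) * cabs h ^+ 2.
Proof.
have [K1 K10 H1] := expn_second_order w a.
pose A0 := w ^+ a; pose A1 := a%:R * w ^+ a.-1.
exists (K1 + 4 * (cabs A0 + cabs A1) + cabs A1).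
  by rewrite !addr_ge0 ?mulr_ge0 ?addr_ge0 ?cabs_ge0.
move=> h x h1; pose E := cexp (h * x%:C).
have -> : (w + h) ^+ a * cexp ((w + h) * x%:C) - w ^+ a * cexp (w * x%:C) - h * xexp w a x =
  (((w + h) ^+ a - A0 - A1 * h) * E + (A0 + A1 * h) * (E - 1 - h * x%:C) + A1 * h ^+ 2 * x%:C)
   * cexp (w * x%:C).
  by rewrite /xexp -/A0 -/A1 mulrDl cexpD -/E; ring.
have -> : (3 + cabs w) * `|x| = 3 * `|x| + cabs w * `|x| by ring.
rewrite cabsM expRD.
have -> : forall K : R, K * (expR (3 * `|x|) * expR (cabs w * `|x|)) * cabs h ^+ 2 =
  (K * expR (3 * `|x|) * cabs h ^+ 2) * expR (cabs w * `|x|) by move=> K; ring.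
apply: ler_pM; rewrite ?cabs_ge0 ?cabs_cexp_line_le//.
have x3 : `|x| <= 3 * `|x| by have := normr_ge0 x; lra.
set e3 := expR (3 * `|x|); set h2 := cabs h ^+ 2.
have -> : (K1 + 4 * (cabs A0 + cabs A1) + cabs A1) * e3 * h2 =
  K1 * h2 * e3 + (cabs A0 + cabs A1) * (4 * h2 * e3) + cabs A1 * h2 * e3 by ring.
apply: le_trans (cabsD _ _) _; apply: lerD.
  apply: le_trans (cabsD _ _) _; apply: lerD.
    rewrite cabsM; apply: ler_pM; rewrite ?cabs_ge0 ?H1//.
    apply: le_trans (cabs_cexp_line_le _ _) _; rewrite ler_expR.
    by apply: le_trans x3; rewrite ler_piMl.
  rewrite cabsM.
  apply: ler_pM; rewrite ?cabs_ge0 ?cexp_second_order//.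
  apply: le_trans (cabsD _ _) _; rewrite lerD2l cabsM.
  by rewrite ler_piMr ?cabs_ge0.
rewrite cabsZr cabsM cabsX; apply: ler_wpM2l; first by rewrite mulr_ge0 ?exprn_ge0 ?cabs_ge0.
apply: le_trans (_ : expR `|x| <= _); last by rewrite /e3 ler_expR.
by apply: le_trans (expR_ge1Dx _); rewrite lerDr.
Qed.

(** The exponentials depend holomorphically on l as elements of T, with derivative - i x exp(- i l
    x) and a remainder quadratic in h for every norm. Applying a functional to this expansion
    differentiates its transform. *)
Lemma tnorm_difference m k (l : R[i]) : (0 < m)%N -> exists2 K : R, 0 <= K &
  forall h : R[i], cabs h <= 1 -> tnorm m
    (exp_T W k (l + h) - exp_T W k l - (- 'i * h) *: xexp_T k (- 'i * l)) <= K * cabs h ^+ 2.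
Proof.
move=> m0; set w := - 'i * l.
have [B B0 HB] := @expR_phi_abs m (3 + cabs w) m0.
have [K K0 HK] := @le_upto (fun a K => forall (h : R[i]) x, cabs h <= 1 ->
  cabs ((w + h) ^+ a * cexp ((w + h) * x%:C) - w ^+ a * cexp (w * x%:C) - h * xexp w a x)
  <= K * expR ((3 + cabs w) * `|x|) * cabs h ^+ 2) m (cexp_difference w)
  (fun a K K' KK' H h x h1 => le_trans (H h x h1)
     (ler_wpM2r (exprn_ge0 2 (cabs_ge0 h)) (ler_wpM2r (expR_ge0 _) KK'))).
have ck := ltW (coef_gt0 W m0 k).
exists (coef W m k * (K * B)); first by rewrite !mulr_ge0.
move=> h h1; set f := (X in tnorm m X <= _); pose h' := - 'i * h.
have h'h : cabs h' = cabs h by rewrite cabsM cabsN cabs_i mul1r.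
have fE j : f j = (-1) *: (exp_T W k l j) + exp_T W k (l + h) j + (- h') *: xexp_T k w j.
  rewrite /f scaleN1r scaleNr [- _ + _]addrC; reflexivity.
rewrite -mulrA; apply: tnorm_single => // [j jk|a x am].
  by rewrite fE xexp_T_at !exp_T_at (negbTE jk) !scaler0 !addr0.
rewrite fE xexp_T_at !exp_T_at eqxx.
have c1 l' : cis_Cn a (fun x : R => cexp (- 'i * l' * x%:C) : C) by exact: cis_Cn_cexp.
have c2 := (xexp_seq w a).1.
rewrite (cderivD x (leqnn a) (cis_CnD (cis_CnZ (-1) (c1 l)) (c1 (l + h))) (cis_CnZ (- h') c2)).
rewrite (cderivD x (leqnn a) (cis_CnZ (-1) (c1 l)) (c1 (l + h))).
rewrite !(cderivZ _ _ (leqnn a))// !cderiv_cexp (xexp_seq w a).2.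
have -> : - 'i * (l + h) = w + h' by rewrite mulrDr.
rewrite -/w mulN1r [- _ + _]addrC mulNr.
have := HK a am h' x; rewrite h'h => /(_ h1) H; apply: le_trans H _.
have -> : K * B * cabs h ^+ 2 * expR (phi W m x) = K * (B * expR (phi W m x)) * cabs h ^+ 2 by ring.
by rewrite ler_wpM2r ?exprn_ge0 ?cabs_ge0// ler_wpM2l.
Qed.

Lemma Tdual_linear (S : Tdual W) : linear S.
Proof. by have /set_mem[] := valP S. Qed.

Lemma Tdual_bounded (S : Tdual W) :
  exists m M, [/\ (0 < m)%N, 0 <= M & forall f, cabs (S f) <= M * tnorm m f].
Proof. by have /set_mem[lS cS] := valP S; exact: continuous_tnorm_bounded. Qed.

Lemma TdualD (S : Tdual W) f g : S (f + g) = S f + S g.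
Proof. by have := Tdual_linear S 1 f g; rewrite !scale1r. Qed.

Lemma Tdual0 (S : Tdual W) : S 0 = 0.
Proof. by have := Tdual_linear S (-1) 0 0; rewrite scaler0 addr0 scaleN1r addNr. Qed.

Lemma TdualZ (S : Tdual W) (z : R[i]) f : S (z *: f) = z * S f.
Proof. by have := Tdual_linear S z f 0; rewrite addr0 Tdual0 addr0. Qed.

Lemma TdualB (S : Tdual W) f g : S (f - g) = S f - S g.
Proof. by rewrite TdualD -scaleN1r TdualZ mulN1r. Qed.

Lemma entire_hat (S : Tdual W) k : entire (hat S k).
Proof.
move=> l; apply/derivable_cplxP; have [m [M [m0 M0 HS]]] := Tdual_bounded S.
have [K K0 HK] := tnorm_difference k l m0.
exists (- 'i * S (xexp_T k (- 'i * l))) => e e0.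
have MK : 0 < M * K + 1 by rewrite ltr_wpDl ?mulr_ge0.
exists (Num.min 1 (e / (M * K + 1))); first by rewrite lt_min ltr01 divr_gt0.
move=> h; rewrite lt_min => /andP[/ltW h1 h2].
have -> : hat S k (l + h) - hat S k l - - 'i * S (xexp_T k (- 'i * l)) * h =
  S (exp_T W k (l + h) - exp_T W k l - (- 'i * h) *: xexp_T k (- 'i * l)).
  by rewrite !TdualB TdualZ /hat; congr (_ - _); ring.
apply: le_trans (HS _) _; apply: le_trans (ler_wpM2l M0 (HK h h1)) _.
rewrite expr2 !mulrA; apply: ler_wpM2r (cabs_ge0 _) _ _ _.
move: h2; rewrite (ltr_pdivlMr _ _ MK) => h2; apply: ltW; apply: le_lt_trans h2.
by rewrite mulrC ler_wpM2l ?cabs_ge0// lerDl.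
Qed.

(** The weights in [P_norm] are the bounds of p_m on the exponentials given by [tnorm_exp_T], so no
    constant is lost. *)
Lemma P_norm_hat (S : Tdual W) m M : (0 < m)%N -> 0 <= M ->
  (forall f, cabs (S f) <= M * tnorm m f) -> (P_norm W m (hat S) <= M%:E)%E.
Proof.
move=> m0 M0 HS; apply: ge_ereal_sup => _ [k [l ->]]; rewrite lee_fin.
have c0 : 0 < coef W m k * (1 + cabs l) ^+ m * expR (phit W m (Im l)).
  by rewrite !mulr_gt0 ?expR_gt0 ?coef_gt0 ?exprn_gt0 ?ltr_pwDl ?cabs_ge0.
rewrite ler_pdivrMr//; apply: le_trans (HS _) _; apply: ler_wpM2l => //.
by rewrite -mulrA; exact: tnorm_exp_T.
Qed.

Lemma hat_Pset (S : Tdual W) : hat S \in Pset W.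
Proof.
have [m [M [m0 M0 HS]]] := Tdual_bounded S.
apply/mem_set; exists m => //; split; first by move=> k; exact: entire_hat.
by apply: le_lt_trans (P_norm_hat m0 M0 HS) _; exact: ltry.
Qed.

Definition hat_P (S : Tdual W) : Pspace W := MkP (hat_Pset S).

End HatEntire.

(** * Approximation by exponentials *)

Section Cutoff.
Context {R : realType}.
Implicit Types x y z s : R.

(** A criterion suited to functions given by cases, such as the square of a positive part, where the
    remainder is bounded case by case. *)
Lemma is_derive_second_order (f : R -> R) (x l C : R) :
  (forall h, `|f (x + h) - f x - l * h| <= C * h ^+ 2) -> is_derive x 1 f l.
Proof.
move=> H; have C0 : 0 <= C.
  by have := le_trans (normr_ge0 _) (H 1); rewrite expr1n mulr1.
have cv : (fun h : R => h^-1 *: (f (h *: 1 + x) - f x)) @ 0^' --> l.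
  apply/cvgrPdist_le => e e0.
  have C1 : 0 < C + 1 by rewrite ltr_wpDl.
  exists (e / (C + 1)) => /=; first exact: divr_gt0.
  move=> h /=; rewrite sub0r normrN (ltr_pdivlMr _ _ C1) => he h0.
  rewrite /GRing.scale /= mulr1 [h + x]addrC distrC.
  have hp : 0 < `|h| by rewrite normr_gt0.
  have -> : h^-1 * (f (x + h) - f x) - l = h^-1 * (f (x + h) - f x - l * h) by field.
  rewrite normrM normrV ?unitfE// ler_pdivrMl//.
  apply: le_trans (H h) _; rewrite -[h ^+ 2]real_normK ?num_real//.
  by have := normr_ge0 h; nra.
apply: DeriveDef; first by apply/cvg_ex; exists l.
exact: cvg_lim cv.
Qed.

Lemma is_derive_pow p s : is_derive s 1 (fun t : R => t ^+ p) (p%:R * s ^+ p.-1).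
Proof.
elim: p => [|p IH].
  have -> : (fun t : R => t ^+ 0) = cst 1 by apply/funext => t; rewrite expr0.
  by rewrite mul0r; exact: is_derive_cst.
have -> : (fun t : R => t ^+ p.+1) = (fun t => t * t ^+ p) by apply/funext => t; rewrite exprS.
apply: is_derive_eq (is_deriveM (is_derive_id s 1) IH) _; rewrite /GRing.scale /= mulr1.
case: p {IH} => [|p] /=; first by rewrite mul0r mulr0 add0r mul1r.
by rewrite -[in RHS]natr1 exprS; ring.
Qed.

Definition pplus s : R := Num.max 0 s.

Lemma pplus_cases s : (0 <= s /\ pplus s = s) \/ (s <= 0 /\ pplus s = 0).
Proof.
case: (leP 0 s) => s0; [left|right]; rewrite /pplus; split=> //.
- exact/max_idPr.
- exact: ltW.
- by apply/max_idPl; exact: ltW.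
Qed.

Lemma is_derive_pplus2 s : is_derive s 1 (fun t => pplus t ^+ 2) (2 * pplus s).
Proof.
apply: (@is_derive_second_order _ _ _ 1) => h; rewrite mul1r ler_norml.
case: (pplus_cases s) => -[s0 ->]; case: (pplus_cases (s + h)) => -[h0 ->];
  apply/andP; split; nra.
Qed.

Lemma is_derive_pplus p s : is_derive s 1 (fun t => pplus t ^+ p.+2) (p.+2%:R * pplus s ^+ p.+1).
Proof.
have E q t : pplus t ^+ (q + 1) = t ^+ q * pplus t.
  case: (pplus_cases t) => -[_ ->]; first by rewrite exprD expr1.
  by rewrite addn1 expr0n /= mulr0.
have -> : (fun t => pplus t ^+ p.+2) = (fun t => t ^+ p * pplus t ^+ 2).
  apply/funext => t; rewrite expr2 mulrA -E -exprSr addn1 //.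
have d2 := is_derive_pplus2 s.
have d1 := is_derive_pow p s.
apply: is_derive_eq (is_deriveM d1 d2) _; rewrite /GRing.scale /=.
case: p {d1} => [|p] /=; first by rewrite expr0 mul0r mulr0 addr0 mul1r expr1.
have -> : pplus s ^+ p.+2 = s ^+ p.+1 * pplus s by rewrite -E addn1.
have -> : pplus s ^+ 2 = s * pplus s by rewrite -[s in RHS]expr1 -E.
by rewrite -[p.+3]addn2 natrD exprS; ring.
Qed.

(* Iterated derivatives of z^i (1 - z^2)_+^j. *)
Fixpoint bump (a i j : nat) z : R :=
  if a is a'.+1 then i%:R * bump a' i.-1 j z - (2 * j)%:R * bump a' i.+1 j.-1 z
  else z ^+ i * pplus (1 - z ^+ 2) ^+ j.

(** Each derivative may lower the power of the positive part by one, and a power of at least two is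
    needed to differentiate once more. *)
Lemma is_derive_bump a i j z : (a.+2 <= j)%N -> is_derive z 1 (bump a i j) (bump a.+1 i j z).
Proof.
elim: a i j => [|a IH] i j aj.
  case: j aj => [|[|j]] // _.
  have dp := is_derive_pplus j (1 - z ^+ 2).
  have dq : is_derive z 1 (fun z : R => 1 - z ^+ 2) (- (2 * z)).
    apply: (@is_derive_second_order _ _ _ 1) => h; rewrite mul1r.
    have -> : 1 - (z + h) ^+ 2 - (1 - z ^+ 2) - - (2 * z) * h = - h ^+ 2 by ring.
    by rewrite normrN ger0_norm// sqr_ge0.
  have d2 := @is_derive1_comp R (fun t => pplus t ^+ j.+2) (fun z => 1 - z ^+ 2) z _ _ dp dq.
  have d1 := is_derive_pow i z.
  apply: is_derive_eq (is_deriveM d1 d2) _; rewrite /GRing.scale /= /comp.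
  rewrite natrM [z ^+ i.+1]exprS; move: (z ^+ i) (z ^+ i.-1) (pplus _ ^+ j.+2) (pplus _ ^+ j.+1).
  by move: (j.+2%:R) (i%:R) => J I A B E F; ring.
have d1 := IH i.-1 j (ltnW aj).
have d2 : is_derive z 1 (bump a i.+1 j.-1) (bump a.+1 i.+1 j.-1 z).
  by apply: IH; case: j aj {d1}.
exact: (is_deriveB (is_deriveZ i%:R d1) (is_deriveZ (2 * j)%:R d2)).
Qed.

Lemma bump_le a i j : (a < j)%N -> exists2 C, 0 <= C & forall z, `|bump a i j z| <= C.
Proof.
elim: a i j => [|a IH] i j aj.
  exists 1 => // z; rewrite normrM !normrX.
  case: (pplus_cases (1 - z ^+ 2)) => -[s0 ->]; last first.
    by rewrite normr0 expr0n -[j == 0]negbK -lt0n aj /= mulr0.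
  have z1 : `|z| <= 1 by rewrite ler_norml; apply/andP; split; nra.
  rewrite mulr_ile1 ?exprn_ge0 ?exprn_ile1//; rewrite ger0_norm//.
  by have := sqr_ge0 z; lra.
have [C1 C10 H1] := IH i.-1 j (ltnW aj).
have [C2 C20 H2] : exists2 C, 0 <= C & forall z, `|bump a i.+1 j.-1 z| <= C.
  by apply: IH; case: j aj {H1}.
exists (i%:R * C1 + (2 * j)%:R * C2) => [|z]; first by rewrite addr_ge0 ?mulr_ge0.
by rewrite /= (le_trans (ler_normB _ _))// lerD// normrM ger0_norm// ler_wpM2l.
Qed.

Lemma bump_eq0 a i j z : (a < j)%N -> 1 <= `|z| -> bump a i j z = 0.
Proof.
move=> aj z1; elim: a i j aj => [|a IH] i j aj /=.
  case: (pplus_cases (1 - z ^+ 2)) => -[s0 ->]; last by rewrite expr0n -[j == 0]negbK -lt0n aj mulr0.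
  have -> : 1 - z ^+ 2 = 0.
    by apply: le_anti; rewrite s0 andbT -[z ^+ 2]real_normK ?num_real//; nra.
  by rewrite expr0n -[j == 0]negbK -lt0n aj mulr0.
rewrite !IH ?mulr0 ?subr0//; first by case: j aj.
exact: ltnW.
Qed.

(** For a < M this is the a-th derivative of (1 - (y / r)^2)_+^M. Finite smoothness is enough, as
    only boundedly many derivatives enter for a given n. *)
Definition cutoff (M : nat) (r : R) (a : nat) y : R := r^-1 ^+ a * bump a 0 M (y / r).

Lemma is_derive_cutoff M r a y : (a.+2 <= M)%N ->
  is_derive y 1 (cutoff M r a) (cutoff M r a.+1 y).
Proof.
move=> aM; have dl : is_derive y 1 (fun y => y / r) r^-1.
  apply: (@is_derive_second_order _ _ _ 0) => h.
  have -> : (y + h) / r - y / r - r^-1 * h = 0 by ring.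
  by rewrite normr0 mul0r lexx.
have db := is_derive_bump 0 (y / r) aM.
apply: is_derive_eq (is_deriveZ (r^-1 ^+ a) (@is_derive1_comp R (bump a 0 M) (fun y => y / r) y _ _ db dl)) _.
rewrite /GRing.scale /cutoff exprSr; change (r^-1 ^+ a * (bump a.+1 0 M (y / r) / r) = r^-1 ^+ a * r^-1 * bump a.+1 0 M (y / r)).
by rewrite -mulrA [r^-1 * _]mulrC.
Qed.

Lemma cutoff_eq0 M r a y : 0 < r -> (a < M)%N -> r <= `|y| -> cutoff M r a y = 0.
Proof.
move=> r0 aM ry; rewrite /cutoff bump_eq0 ?mulr0//.
by rewrite normrM normfV (gtr0_norm r0) ler_pdivlMr// mul1r.
Qed.

Lemma cutoff_le M a : (a < M)%N -> exists2 C, 0 <= C &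
  forall r y, 1 <= r -> `|cutoff M r a y| <= C * r^-1 ^+ a.
Proof.
move=> aM; have [C C0 HC] := bump_le 0 aM; exists C => // r y r1.
have r0 : 0 < r by exact: lt_le_trans r1.
by rewrite normrM ger0_norm ?exprn_ge0 ?invr_ge0 ?(ltW r0)// mulrC ler_wpM2r// exprn_ge0// invr_ge0 ltW.
Qed.

(** The deviation from 1 is quadratic in y / r, and the gap between phi_m and phi_(m+2) supplies two
    powers of |x| to absorb it. *)
Lemma cutoff0_near1 M r y : 0 < r -> (0 < M)%N -> `|1 - cutoff M r 0 y| <= M%:R * (y / r) ^+ 2.
Proof.
move=> r0 M0; rewrite /cutoff expr0 mul1r /= expr0 mul1r; move: (y / r) => z.
have pow (s : R) : 0 <= s -> s <= 1 -> 0 <= 1 - s ^+ M <= M%:R * (1 - s).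
  move=> s0 s1; elim: M {M0} => [|M /andP[IH1 IH2]]; first by rewrite expr0 subrr mul0r lexx.
  have sM : 0 <= s ^+ M by exact: exprn_ge0.
  rewrite exprS -[M.+1]addn1 natrD; apply/andP; split; nra.
case: (pplus_cases (1 - z ^+ 2)) => -[s0 ->].
  have s1 : 1 - z ^+ 2 <= 1 by rewrite gerBl sqr_ge0.
  have /andP[h1 h2] := pow _ s0 s1; rewrite ger0_norm//.
  by apply: le_trans h2 _; rewrite opprB addrC subrK.
rewrite expr0n -[M == 0]negbK -lt0n M0 subr0 normr1.
have M1 : 1 <= M%:R :> R by rewrite ler1n.
nra.
Qed.

End Cutoff.

(** * Leibniz expansion of a truncated function *)

Section CutoffProduct.
Context {R : realType} (U X : nat -> R -> R).

(** Leibniz's rule without binomial coefficients: the a-th derivative of U_b X_c as a sum of 2^a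
    products, by recursion on a. *)
Fixpoint leib (a b c : nat) (x : R) : R :=
  if a is a'.+1 then leib a' b.+1 c x + leib a' b c.+1 x else U b x * X c x.

Lemma is_derive_leib M a b c (x : R) : (forall b (x : R), is_derive x 1 (U b) (U b.+1 x)) ->
  (forall c (x : R), (c < M)%N -> is_derive x 1 (X c) (X c.+1 x)) -> (a + c < M)%N ->
  is_derive x 1 (leib a b c) (leib a.+1 b c x).
Proof.
move=> dU dX; elim: a b c => [|a IH] b c acM.
  have d1 := dU b x; have d2 := dX c x acM.
  by apply: is_derive_eq (is_deriveM d1 d2) _; rewrite /GRing.scale /=; ring.
have d1 := IH b.+1 c (ltnW acM).
have d2 : is_derive x 1 (leib a b c.+1) (leib a.+1 b c.+1 x) by apply: IH; rewrite addnS.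
exact: is_deriveD d1 d2.
Qed.

Lemma leib_le (u k : R) (n M a b c : nat) x : 0 <= u -> (a + b <= n)%N -> (a + c <= M)%N ->
  (forall b', (b' <= n)%N -> `|U b' x| <= u) ->
  (forall c', (c <= c' <= M)%N -> `|X c' x| <= k) -> `|leib a b c x| <= 2 ^+ a * (u * k).
Proof.
move=> u0; elim: a b c => [|a IH] b c abn acM HU HX /=.
  by rewrite expr0 mul1r normrM; apply: ler_pM => //; [exact: HU|apply: HX; rewrite leqnn].
apply: le_trans (ler_normD _ _) _; rewrite exprS mulr2n -mulrA mulrDl mul1r; apply: lerD.
  by apply: IH => //; [rewrite addnS|exact: ltnW].
apply: IH => //; first exact: ltnW.
  by rewrite addnS.
by move=> c' /andP[cc' c'M]; apply: HX; rewrite (ltnW cc').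
Qed.

(** Apart from the product in which all derivatives fall on U, every term contains an X of index
    above c. For the cutoff these are the small terms. *)
Lemma leib_main (u k : R) (n M a b c : nat) x : 0 <= u -> (a + b <= n)%N -> (a + c <= M)%N -> 0 <= k ->
  (forall b', (b' <= n)%N -> `|U b' x| <= u) ->
  (forall c', (c < c' <= M)%N -> `|X c' x| <= k) ->
  `|leib a b c x - U (a + b) x * X c x| <= 2 ^+ a * (u * k).
Proof.
move=> u0 + + k0; elim: a b => [|a IH] b abn acM HU HX /=.
  by rewrite add0n subrr normr0 expr0 mul1r mulr_ge0.
rewrite addrAC; apply: le_trans (ler_normD _ _) _.
rewrite exprS mulr2n -mulrA mulrDl mul1r; apply: lerD.
  by rewrite addSnnS; apply: IH => //; [rewrite addnS|exact: ltnW].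
apply: (@leib_le u k n M) => //; first exact: ltnW.
by rewrite addnS.
Qed.

End CutoffProduct.

Section SegmentIntegral.
Context {R : realType}.
Local Notation mu := (@lebesgue_measure R).
Local Notation MR := (measurableTypeR R).
Implicit Types f g : R -> R.

Definition seg (a b : R) f : R := \int[mu]_(x in (`[a, b]%classic : set MR)) f x.

Lemma measurable_seg (a b : R) : measurable (`[a, b]%classic : set MR).
Proof. exact: measurable_itv. Qed.

Lemma seg_integrable (a b : R) f : continuous f -> mu.-integrable (`[a, b]%classic : set MR) (EFin \o f).
Proof.
move=> cf; apply: continuous_compact_integrable; first exact: segment_compact.
exact: continuous_subspaceT.
Qed.

Lemma eq_seg a b f g : (forall x, a <= x <= b -> f x = g x) -> seg a b f = seg a b g.
Proof. by move=> fg; apply: eq_Rintegral => x; rewrite inE /= in_itv /= => /fg. Qed.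

Lemma segD a b f g : continuous f -> continuous g ->
  seg a b (fun x => f x + g x) = seg a b f + seg a b g.
Proof. by move=> cf cg; apply: (RintegralD (measurable_seg a b)); exact: seg_integrable. Qed.

Lemma segZ a b r f : continuous f -> seg a b (fun x => r * f x) = r * seg a b f.
Proof. by move=> cf; apply: (RintegralZl _ (measurable_seg a b)); exact: seg_integrable. Qed.

Lemma seg_le a b f g : continuous f -> continuous g ->
  (forall x, a <= x <= b -> f x <= g x) -> seg a b f <= seg a b g.
Proof.
move=> cf cg fg; rewrite /seg; apply: le_Rintegral.
- exact: measurable_seg.
- exact: seg_integrable.
- exact: seg_integrable.
by move=> x; rewrite /= in_itv /= => /fg.
Qed.

Lemma seg_abs a b f g : continuous f -> continuous g ->
  (forall x, a <= x <= b -> `|f x| <= g x) -> `|seg a b f| <= seg a b g.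
Proof.
move=> cf cg fg; have cN : continuous (fun x => -1 * g x).
  by move=> x; apply: cvgM; [exact: cvg_cst|exact: cg].
rewrite ler_norml -[- seg a b g]mulN1r -segZ//; apply/andP; split; apply: seg_le => // x ab.
  by have := fg x ab; rewrite ler_norml mulN1r => /andP[].
by have := fg x ab; rewrite ler_norml => /andP[].
Qed.

Lemma seg_split a b c f : a <= b -> b <= c -> continuous f -> seg a c f = seg a b f + seg b c f.
Proof.
move=> ab bc cf; have ih := @seg_integrable a c f cf.
have := @Rintegral_itvB R f (BLeft a) (BRight c) b ih.
rewrite /seg !bnd_simp => /(_ ab bc)/eqP; rewrite subr_eq addrC => /eqP ->; congr (_ + _).
rewrite Rintegral_itv_obnd_cbnd//; apply: integrableS ih => //.
by apply: subset_itvr; rewrite bnd_simp.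
Qed.

Lemma seg0 a b : seg a b (fun _ => 0) = 0.
Proof. by rewrite /seg Rintegral_cst ?mul0r//; exact: measurable_seg. Qed.

Lemma seg_support a b r f : 0 <= r -> a <= - r -> r <= b -> continuous f ->
  (forall x, r <= `|x| -> f x = 0) -> seg a b f = seg (- r) r f.
Proof.
move=> r0 ar rb cf f0; have rr : - r <= r by rewrite (le_trans _ r0)// oppr_le0.
rewrite (seg_split ar (le_trans rr rb) cf) (seg_split rr rb cf).
rewrite [X in X + _](_ : _ = 0) ?add0r; last first.
  rewrite -(seg0 a (- r)); apply: eq_seg => x /andP[_ xr]; apply: f0.
  by rewrite ler_normr lerNr xr orbT.
rewrite [X in _ + X](_ : _ = 0) ?addr0//.
rewrite -(seg0 r b); apply: eq_seg => x /andP[rx _]; apply: f0.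
by rewrite ler_normr rx.
Qed.

Lemma seg_FTC (F f : R -> R) (a b : R) : a <= b ->
  (forall x : R, is_derive x 1 F (f x)) -> continuous f -> seg a b f = F b - F a.
Proof. exact: Rintegral_FTC2. Qed.

End SegmentIntegral.

(** * Powers of the raised cosine *)

Section Kernel.
Context {R : realType} (D : R).
Hypothesis D0 : 0 < D.

Let be : R := pi / D.

Definition bell (t : R) : R := (1 + cos (be * t)) / 2.

Lemma bell_ge0 t : 0 <= bell t.
Proof. by rewrite divr_ge0//; have := cos_geN1 (be * t); lra. Qed.

Lemma is_derive_cosS (w x y : R) : is_derive y 1 (fun y => cos (w * (x - y))) (w * sin (w * (x - y))).
Proof.
have dl : is_derive y 1 (fun y => w * (x - y)) (- w).
  apply: (@is_derive_second_order _ _ _ _ 0) => h.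
  by rewrite (_ : _ - _ = 0) ?normr0 ?mul0r//; ring.
have := @is_derive1_comp R cos (fun y => w * (x - y)) y _ _ (is_derive_cos _) dl.
by rewrite mulrNN mulrC.
Qed.

Lemma is_derive_sinS (w x y : R) : is_derive y 1 (fun y => sin (w * (x - y))) (- w * cos (w * (x - y))).
Proof.
have dl : is_derive y 1 (fun y => w * (x - y)) (- w).
  apply: (@is_derive_second_order _ _ _ _ 0) => h.
  by rewrite (_ : _ - _ = 0) ?normr0 ?mul0r//; ring.
have := @is_derive1_comp R sin (fun y => w * (x - y)) y _ _ (is_derive_sin _) dl.
by rewrite mulrC.
Qed.

Lemma is_derive_bellX N (x y : R) : is_derive y 1 (fun y => bell (x - y) ^+ N)
  (N%:R * bell (x - y) ^+ N.-1 * (be * sin (be * (x - y)) / 2)).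
Proof.
have db : is_derive y 1 (fun y => bell (x - y)) (be * sin (be * (x - y)) / 2).
  have dc := is_derive_cosS be x y.
  have -> : (fun y => bell (x - y)) = (fun y => 2^-1 * (1 + cos (be * (x - y)))).
    by apply/funext => t; rewrite mulrC.
  have d1 : is_derive y 1 (fun _ : R => 1 : R) 0 by exact: is_derive_cst.
  apply: is_derive_eq (is_deriveZ 2^-1 (is_deriveD d1 dc)) _.
  by rewrite /GRing.scale /= add0r mulrC.
exact: (@is_derive1_comp R (fun t => t ^+ N) (fun y => bell (x - y)) y _ _ (is_derive_pow N _) db).
Qed.

Lemma continuous_bellX N (x : R) : continuous (fun y => bell (x - y) ^+ N).
Proof. by move=> y; exact: is_derive_continuous (is_derive_bellX N x y). Qed.

(** Wallis' recursion for the integral of the N-th power over a full period 2 D. *)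
Fixpoint bellint (N : nat) : R :=
  if N is N'.+1 then (2 * N' + 1)%:R / (2 * N' + 2)%:R * bellint N' else 2 * D.

Lemma bellint_gt0 N : 0 < bellint N.
Proof.
elim: N => [|N IH] /=; first by rewrite mulr_gt0.
by rewrite mulr_gt0// divr_gt0// ltr0n ?addn1// addn2.
Qed.

Lemma seg_bellX N x a : seg a (a + 2 * D) (fun y => bell (x - y) ^+ N) = bellint N.
Proof.
have aD : a <= a + 2 * D by rewrite lerDl mulr_ge0// ltW.
have be0 : be != 0 by rewrite mulf_neq0 ?invr_eq0 ?gt_eqF ?pi_gt0.
elim: N => [|N IH].
  have d0 (y : R) : is_derive y 1 id (bell (x - y) ^+ 0) by rewrite expr0; exact: is_derive_id.
  by rewrite (seg_FTC aD d0 (@continuous_bellX 0 x)) /= addrC addKr.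
have cN := @continuous_bellX N x; have cN1 := @continuous_bellX N.+1 x.
(* F has period 2 D and derivative f, so f has zero integral over a period; this is the recursion (2
   N + 2) I_(N+1) = (2 N + 1) I_N. *)
pose F y := - be^-1 * (sin (be * (x - y)) * bell (x - y) ^+ N).
pose f y := (2 * N + 2)%:R * bell (x - y) ^+ N.+1 + - (2 * N + 1)%:R * bell (x - y) ^+ N.
have dF (y : R) : is_derive y 1 F (f y).
  have d1 := is_derive_sinS be x y; have d2 := is_derive_bellX N x y.
  apply: is_derive_eq (is_deriveZ (- be^-1) (is_deriveM d1 d2)) _.
  rewrite /GRing.scale /= /f.
  have s2 : sin (be * (x - y)) ^+ 2 = 4 * bell (x - y) * (1 - bell (x - y)).
    by rewrite sin2cos2 /bell; field.
  have c2 : cos (be * (x - y)) = 2 * bell (x - y) - 1 by rewrite /bell; field.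
  rewrite c2; set s := sin _ in s2 *; set b := bell _ in s2 *.
  transitivity (- be^-1 * be * (N%:R * b ^+ N.-1 / 2 * s ^+ 2 - b ^+ N * (2 * b - 1))); first by ring.
  have -> : - be^-1 * be = -1 by rewrite mulNr mulVf.
  have e1 : (2 * N + 2)%:R = 2 * N%:R + 2 :> R by rewrite natrD natrM.
  have e2 : (2 * N + 1)%:R = 2 * N%:R + 1 :> R by rewrite natrD natrM.
  rewrite s2 e1 e2.
  case: N {IH cN cN1 F f d2 e1 e2} => [|N] /=; first by rewrite expr0 expr1; ring.
  by rewrite -[N.+1%:R]natr1 !exprS; field.
have cf : continuous f.
  move=> y; apply: cvgD; apply: cvgM; [exact: cvg_cst|exact: cN1|exact: cvg_cst|exact: cN].
have := seg_FTC aD dF cf.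
have -> : F (a + 2 * D) = F a.
  rewrite /F /bell; have -> : be * (x - (a + 2 * D)) = be * (x - a) - pi *+ 2.
    by rewrite /be mulr2n; field; rewrite gt_eqF.
  by rewrite sinB cosB sin2pi cos2pi !mulr0 !mulr1 subr0 addr0.
have cA : continuous (fun y => (2 * N + 2)%:R * bell (x - y) ^+ N.+1).
  by move=> y; apply: cvgM; [exact: cvg_cst|exact: cN1].
have cB : continuous (fun y => - (2 * N + 1)%:R * bell (x - y) ^+ N).
  by move=> y; apply: cvgM; [exact: cvg_cst|exact: cN].
rewrite subrr /f (segD _ _ cA cB) (segZ _ _ _ cN1) (segZ _ _ _ cN) IH => H.
have n0 : (2 * N + 2)%:R != 0 :> R by rewrite pnatr_eq0 addn2.
apply: (mulfI n0); rewrite [bellint N.+1]/= mulrA [_ * (_ / _)]mulrC divfK//.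
by apply/eqP; rewrite -subr_eq0 -mulNr H.
Qed.

(** A crude form of Jordan's inequality, from the mean value theorem on [0, 1] and one doubling of
    the angle. *)
Lemma sin_ge_quarter (s : R) : 0 <= s <= pi / 2 -> s / 4 <= sin s.
Proof.
have sin_le (t : R) : 0 <= t -> sin t <= t.
  move=> t0; have K (x : R) : 0 <= x <= t -> `|cos x| <= 1 by move=> _; rewrite ler_norml cos_geN1 cos_le1.
  have := MVT_bound t0 (fun x => is_derive_sin x) K; rewrite sin0 !subr0 mul1r.
  by apply: le_trans; exact: ler_norm.
have cos_ge (t : R) : 0 <= t <= 1 -> 2^-1 <= cos t.
  move=> /andP[t0 t1]; have h0 : 0 <= t / 2 by rewrite divr_ge0.
  have -> : t = (t / 2) *+ 2 by rewrite mulr2n; field.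
  rewrite cos_mulr2n cos2sin2; have h1 := sin_le _ h0; have := sin_geN1 (t / 2).
  have h2 : 0 <= sin (t / 2).
    apply: sin_ge0_pi; rewrite h0 /=; have := @pi_ge2 R; lra.
  have : sin (t / 2) ^+ 2 <= (1 / 2) ^+ 2.
    by rewrite lerXn2r ?nnegrE//; lra.
  rewrite -mulr_natl; lra.
have sin_ge (t : R) : 0 <= t <= 1 -> t / 2 <= sin t.
  move=> /andP[t0 t1].
  have dG (x : R) : is_derive x 1 (fun x : R => x - sin x) (1 - cos x) by exact: is_deriveB.
  have K (x : R) : 0 <= x <= t -> `|1 - cos x| <= 2^-1.
    move=> /andP[x0 xt]; have := cos_ge x; rewrite x0 (le_trans xt t1) => /(_ isT).
    by have := cos_le1 x => h1 h2; rewrite ler_norml; apply/andP; split; lra.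
  have := MVT_bound t0 dG K; rewrite sin0 !subr0; have := ler_norm (t - sin t); lra.
move=> /andP[s0 sp].
have p4 : pi / 2 < 2 :> R by have /andP[] := @pihalf_02 R.
have -> : sin s = sin ((s / 2) *+ 2) by congr sin; rewrite mulr2n; field.
rewrite sin_mulr2n mulr2n.
have s2 : 0 <= s / 2 <= 1 by apply/andP; split; lra.
have := sin_ge _ s2; have := cos_ge _ s2; move/andP: s2 => [s20 _].
move: (sin _) (cos _) => S Cs h1 h2; nra.
Qed.

(** 1 - bell t is the square of sin(pi t / (2 D)), bounded below by [sin_ge_quarter]. The point is
    to trade t^2 for 1 - bell t, whose integral against bell^N is known from [bellint]. *)
Lemma bell_far t : `|t| <= D -> t ^+ 2 <= 64 * D ^+ 2 * (1 - bell t).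
Proof.
wlog t0 : t / 0 <= t => [H|tD].
  have [/H//|/ltW tn] := leP 0 t.
  move=> tD; have := H (- t); rewrite sqrrN normrN oppr_ge0 /bell mulrN cosN; exact.
rewrite ger0_norm// in tD.
have E : 1 - bell t = sin (be * t / 2) ^+ 2.
  have E0 : be * t = (be * t / 2) *+ 2 by rewrite mulr2n; field.
  rewrite /bell {1}E0 cos_mulr2n cos2sin2 mulr2n; move: (sin _ ^+ 2) => S; lra.
have s0 : 0 <= be * t / 2 by rewrite divr_ge0// mulr_ge0// divr_ge0 ?pi_ge0// ltW.
have sp : be * t / 2 <= pi / 2.
  rewrite ler_pM2r// /be mulrAC ler_pdivrMr//; apply: ler_wpM2l => //; exact: pi_ge0.
have /sin_ge_quarter H : 0 <= be * t / 2 <= pi / 2 by rewrite s0.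
rewrite E; have h : t <= 8 * D * sin (be * t / 2).
  apply: le_trans (_ : 8 * D * (be * t / 2 / 4) <= _); last first.
    by apply: ler_wpM2l H; rewrite mulr_ge0// ltW.
  have -> : 8 * D * (be * t / 2 / 4) = pi * t by rewrite /be; field; rewrite gt_eqF.
  by rewrite ler_peMl//; have := @pi_ge2 R; lra.
have -> : 64 * D ^+ 2 * sin (be * t / 2) ^+ 2 = (8 * D * sin (be * t / 2)) ^+ 2 by ring.
by rewrite lerXn2r ?nnegrE// (le_trans t0 h).
Qed.

Definition cospoly (s : seq (R * R)) (t : R) : R := \sum_(p <- s) p.1 * cos (p.2 * t).

(** The product of two cosines is half the sum of two cosines, so cosine polynomials are stable
    under multiplication by [bell]. *)
Lemma bellX_cospoly N : exists s, forall t, bell t ^+ N = cospoly s t.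
Proof.
elim: N => [|N [s Hs]].
  by exists [:: (1, 0)] => t; rewrite /cospoly big_seq1 /= mul0r cos0 mulr1.
exists ([seq (p.1 / 2, p.2) | p <- s] ++ [seq (p.1 / 4, p.2 + be) | p <- s] ++
        [seq (p.1 / 4, p.2 - be) | p <- s]) => t.
rewrite exprS Hs /cospoly !big_cat !big_map /= mulr_sumr -!big_split /=.
apply: eq_bigr => p _; rewrite mulrDl mulrBl cosD cosB /bell; field.
by [].
Qed.

End Kernel.

(** * Mollification by trigonometric polynomials *)

Section Mollifier.
Context {R : realType} (D r : R).
Hypotheses (D0 : 0 < D) (r0 : 0 <= r) (rD : r <= D).
Implicit Types (w : R -> R) (x : R).

(** The kernel is periodic, so on functions supported in [- r, r] this is an approximate identity
    only for |x| <= D - r; farther out only boundedness is used. *)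
Definition moll (N : nat) w x : R :=
  (bellint D N)^-1 * seg (- r) r (fun y => w y * bell D (x - y) ^+ N).

Lemma continuous_mulR (f g : R -> R) : continuous f -> continuous g -> continuous (fun y => f y * g y).
Proof. by move=> cf cg y; apply: cvgM; [exact: cf|exact: cg]. Qed.

Lemma continuous_scaleR (a : R) (f : R -> R) : continuous f -> continuous (fun y => a * f y).
Proof. by move=> cf y; apply: cvgM; [exact: cvg_cst|exact: cf]. Qed.

Lemma continuous_addR (f g : R -> R) : continuous f -> continuous g -> continuous (fun y => f y + g y).
Proof. by move=> cf cg y; apply: cvgD; [exact: cf|exact: cg]. Qed.

Let rr : - r <= r. Proof. by rewrite (le_trans _ r0)// oppr_le0. Qed.

Let bell_int_le N x : seg (- r) r (fun y => bell D (x - y) ^+ N) <= bellint D N.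
Proof.
have cb := @continuous_bellX _ D N x.
rewrite -(seg_bellX D0 N x (- D)) (_ : - D + 2 * D = D); last by ring.
have Dr : - D <= - r by rewrite lerN2.
rewrite (seg_split Dr (le_trans rr rD) cb) (seg_split rr rD cb) addrCA lerDl.
have ge0 a b : 0 <= seg a b (fun y => bell D (x - y) ^+ N).
  rewrite -(seg0 a b); apply: seg_le => //; first by move=> y; exact: cvg_cst.
  by move=> y _; rewrite exprn_ge0// bell_ge0.
by rewrite addr_ge0.
Qed.

Lemma moll_bound N w A x : continuous w -> (forall y, `|w y| <= A) -> `|moll N w x| <= A.
Proof.
move=> cw wA; have A0 : 0 <= A by exact: le_trans (wA 0).
have cb := @continuous_bellX _ D N x; have J0 := bellint_gt0 D0 N.
rewrite normrM gtr0_norm ?invr_gt0// ler_pdivrMl//.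
apply: le_trans (_ : A * seg (- r) r (fun y => bell D (x - y) ^+ N) <= _).
  rewrite -(segZ _ _ _ cb); apply: seg_abs; first exact: continuous_mulR.
    exact: continuous_scaleR.
  move=> y _; rewrite normrM [`|bell _ _ ^+ _|]ger0_norm ?exprn_ge0 ?bell_ge0//.
  by rewrite ler_wpM2r ?exprn_ge0 ?bell_ge0.
by rewrite mulrC; apply: ler_wpM2r => //; exact: bell_int_le.
Qed.

(** Up to distance eta the Lipschitz bound is used as it stands. Beyond it, |x - y| <= |x - y|^2 /
    eta, and [bell_far] reduces the estimate to the integral of (1 - bell) bell^N, which is
    [bellint] at N divided by 2 N + 2. *)
Lemma moll_near N w L x eta : continuous w -> (forall y, r <= `|y| -> w y = 0) -> 0 <= L ->
  (forall y z, `|w y - w z| <= L * `|y - z|) -> `|x| <= D - r -> 0 < eta ->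
  `|moll N w x - w x| <= L * (eta + 64 * D ^+ 2 / (eta * (2 * N + 2)%:R)).
Proof.
move=> cw w0 L0 wL xD eta0; have J0 := bellint_gt0 D0 N.
have cb := @continuous_bellX _ D N x; have cb1 := @continuous_bellX _ D N.+1 x.
move: xD; rewrite ler_norml => /andP[xD1 xD2].
have cf : continuous (fun y => w y * bell D (x - y) ^+ N) by exact: continuous_mulR.
have cwx : continuous (fun y => - w x * bell D (x - y) ^+ N) by exact: continuous_scaleR.
(* The window [x - D, x + D] is one period, and it contains the support of w because |x| <= D -
   r. *)
have -> : moll N w x - w x = (bellint D N)^-1 *
    seg (x - D) (x - D + 2 * D) (fun y => w y * bell D (x - y) ^+ N + - w x * bell D (x - y) ^+ N).
  rewrite (segD _ _ cf cwx) (segZ _ _ _ cb) (seg_bellX D0).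
  rewrite (@seg_support _ _ _ r) ?mulrDr//; [|lra|lra|by move=> y /w0 ->; rewrite mul0r].
  by congr (_ + _); rewrite mulrCA mulVf ?mulr1// gt_eqF.
rewrite normrM gtr0_norm ?invr_gt0// ler_pdivrMl//.
pose k := L * (64 * D ^+ 2 / eta).
have c1 := continuous_scaleR (a := L * eta + k) cb; have c2 := continuous_scaleR (a := - k) cb1.
apply: le_trans (_ : seg (x - D) (x - D + 2 * D)
  (fun y => (L * eta + k) * bell D (x - y) ^+ N + - k * bell D (x - y) ^+ N.+1) <= _).
  apply: seg_abs; first by move=> y; apply: cvgD; [exact: cf|exact: cwx].
    by move=> y; apply: cvgD; [exact: c1|exact: c2].
  move=> y /andP[y1 y2]; rewrite -mulrDl normrM [`|bell _ _ ^+ _|]ger0_norm ?exprn_ge0 ?bell_ge0//.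
  have -> : (L * eta + k) * bell D (x - y) ^+ N + - k * bell D (x - y) ^+ N.+1 =
    L * (eta + 64 * D ^+ 2 * (1 - bell D (x - y)) / eta) * bell D (x - y) ^+ N.
    by rewrite exprS /k; ring.
  rewrite ler_wpM2r ?exprn_ge0 ?bell_ge0//; apply: le_trans (wL _ _) _; rewrite distrC ler_wpM2l//.
  have tD : `|x - y| <= D by rewrite ler_norml; apply/andP; split; lra.
  have [te|te] := leP `|x - y| eta.
    by apply: le_trans te _; rewrite lerDl divr_ge0 ?(ltW eta0)//; apply: le_trans (bell_far D0 tD); exact: sqr_ge0.
  apply: le_trans (_ : `|x - y| ^+ 2 / eta <= _).
    by rewrite ler_pdivlMr// expr2 ler_wpM2l// ltW.
  rewrite real_normK ?num_real//; apply: le_trans (_ : 64 * D ^+ 2 * (1 - bell D (x - y)) / eta <= _).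
    by rewrite ler_wpM2r ?invr_ge0 ?(ltW eta0)// bell_far.
  by rewrite lerDr ltW.
rewrite (segD _ _ c1 c2) (segZ _ _ _ cb) (segZ _ _ _ cb1) !(seg_bellX D0) /=.
rewrite le_eqVlt; apply/orP; left; apply/eqP.
have e1 : (2 * N + 2)%:R = 2 * N%:R + 2 :> R by rewrite natrD natrM.
have e2 : (2 * N + 1)%:R = 2 * N%:R + 1 :> R by rewrite natrD natrM.
rewrite /k e1 e2; have n0 : 0 <= N%:R :> R by [].
by field; rewrite !gt_eqF//; lra.
Qed.

(** The addition formula for cos (u (x - y)) separates x from y: the mollified function is a
    trigonometric polynomial in x whose coefficients are integrals of w, which makes the operator of
    finite rank. *)
Definition trig (s : seq (R * R)) w x : R := \sum_(p <- s) p.1 *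
  (cos (p.2 * x) * seg (- r) r (fun y => w y * cos (p.2 * y)) +
   sin (p.2 * x) * seg (- r) r (fun y => w y * sin (p.2 * y))).

Lemma trigE s w x : continuous w ->
  seg (- r) r (fun y => w y * cospoly s (x - y)) = trig s w x.
Proof.
move=> cw; rewrite /cospoly /trig.
have cc (p : R * R) : continuous (fun y => w y * cos (p.2 * y)).
  by apply: continuous_mulR => //; exact: continuous_cosM.
have cs (p : R * R) : continuous (fun y => w y * sin (p.2 * y)).
  by apply: continuous_mulR => //; exact: continuous_sinM.
pose T p y := p.1 * (cos (p.2 * x) * (w y * cos (p.2 * y)) + sin (p.2 * x) * (w y * sin (p.2 * y))).
have cT p : continuous (T p).
  by apply/continuous_scaleR/continuous_addR; apply: continuous_scaleR; [exact: cc|exact: cs].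
have E y p : w y * (p.1 * cos (p.2 * (x - y))) = T p y.
  by rewrite mulrBr cosB /T; ring.
have -> : (fun y => w y * (\sum_(p <- s) p.1 * cos (p.2 * (x - y)))) = (fun y => \sum_(p <- s) T p y).
  by apply/funext => y; rewrite mulr_sumr; apply: eq_bigr => p _; exact: E.
have cS s' : continuous (fun y => \sum_(p <- s') T p y).
  elim: s' => [|p s' IH].
    by under eq_fun do rewrite big_nil; move=> y; exact: cvg_cst.
  by under eq_fun do rewrite big_cons; move=> y; apply: cvgD; [exact: cT|exact: IH].
elim: s => [|p s IH].
  by rewrite big_nil; under eq_fun do rewrite big_nil; rewrite seg0.
rewrite big_cons; under eq_fun do rewrite big_cons.
rewrite (segD _ _ (@cT p) (@cS s)) IH; congr (_ + _).
rewrite /T segZ; last by apply: continuous_addR; apply: continuous_scaleR; [exact: cc|exact: cs].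
rewrite segD; [|exact: continuous_scaleR|exact: continuous_scaleR].
by rewrite (segZ _ _ _ (cc p)) (segZ _ _ _ (cs p)).
Qed.

(** Integration by parts moves the derivative onto w, the boundary terms being zero. Hence
    mollification commutes with differentiation, and one estimate serves all derivatives. *)
Lemma is_derive_trig s w w' x : (forall y : R, is_derive y 1 w (w' y)) -> continuous w' ->
  w r = 0 -> w (- r) = 0 -> is_derive x 1 (trig s w) (trig s w' x).
Proof.
move=> dw cw' wr wNr.
have cw : continuous w by move=> y; exact: is_derive_continuous (dw y).
have C (u : R) : seg (- r) r (fun y => w' y * cos (u * y)) = u * seg (- r) r (fun y => w y * sin (u * y)).
  have c1 := continuous_mulR cw' (@continuous_cosM R u).
  have c2 := continuous_mulR cw (@continuous_sinM R u).
  have c3 := continuous_scaleR (a := - u) c2.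
  have dF (y : R) : is_derive y 1 (fun y => w y * cos (u * y)) (w' y * cos (u * y) + - u * (w y * sin (u * y))).
    apply: is_derive_eq (is_deriveM (dw y) (is_derive_cosM u y)) _.
    by rewrite /GRing.scale /=; ring.
  have cF : continuous (fun y => w' y * cos (u * y) + - u * (w y * sin (u * y))).
    by move=> y; apply: cvgD; [exact: c1|exact: c3].
  have := seg_FTC rr dF cF; rewrite wr wNr !mul0r subrr (segD _ _ c1 c3) (segZ _ _ _ c2).
  by rewrite mulNr => /eqP; rewrite subr_eq0 => /eqP.
have S (u : R) : seg (- r) r (fun y => w' y * sin (u * y)) = - u * seg (- r) r (fun y => w y * cos (u * y)).
  have c1 := continuous_mulR cw' (@continuous_sinM R u).
  have c2 := continuous_mulR cw (@continuous_cosM R u).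
  have c3 := continuous_scaleR (a := u) c2.
  have dF (y : R) : is_derive y 1 (fun y => w y * sin (u * y)) (w' y * sin (u * y) + u * (w y * cos (u * y))).
    apply: is_derive_eq (is_deriveM (dw y) (is_derive_sinM u y)) _.
    by rewrite /GRing.scale /=; ring.
  have cF : continuous (fun y => w' y * sin (u * y) + u * (w y * cos (u * y))).
    by move=> y; apply: cvgD; [exact: c1|exact: c3].
  have := seg_FTC rr dF cF; rewrite wr wNr !mul0r subrr (segD _ _ c1 c3) (segZ _ _ _ c2).
  by rewrite mulNr => /eqP; rewrite addr_eq0 => /eqP.
elim: s => [|p s IH].
  have -> : trig [::] w = cst 0 by apply/funext => y; rewrite /trig big_nil.
  by rewrite /trig big_nil; exact: is_derive_cst.
have E v : trig (p :: s) v = (fun x => p.1 * (cos (p.2 * x) * seg (- r) r (fun y => v y * cos (p.2 * y)) +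
   sin (p.2 * x) * seg (- r) r (fun y => v y * sin (p.2 * y))) + trig s v x).
  by apply/funext => y; rewrite /trig big_cons.
rewrite !E C S; set a := seg _ _ _; set b := seg _ _ _.
have d1 := is_derive_cosM p.2 x; have d2 := is_derive_sinM p.2 x.
have da : is_derive x 1 (fun x : R => p.1 * (cos (p.2 * x) * a + sin (p.2 * x) * b))
    (p.1 * (cos (p.2 * x) * (p.2 * b) + sin (p.2 * x) * (- p.2 * a))).
  have dca : is_derive x 1 (fun _ : R => a) 0 by exact: is_derive_cst.
  have dcb : is_derive x 1 (fun _ : R => b) 0 by exact: is_derive_cst.
  apply: is_derive_eq (is_deriveZ p.1 (is_deriveD (is_deriveM d1 dca) (is_deriveM d2 dcb))) _.
  by rewrite /GRing.scale /=; ring.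
exact: is_deriveD da IH.
Qed.

Lemma moll_trig N s w x : (forall t, bell D t ^+ N = cospoly s t) -> continuous w ->
  moll N w x = (bellint D N)^-1 * trig s w x.
Proof.
by move=> Hs cw; rewrite /moll -trigE//; congr (_ * _); apply: eq_seg => y _; rewrite Hs.
Qed.

Lemma is_derive_moll N w w' x : (forall y : R, is_derive y 1 w (w' y)) -> continuous w' ->
  w r = 0 -> w (- r) = 0 -> is_derive x 1 (moll N w) (moll N w' x).
Proof.
move=> dw cw' wr wNr; have [s Hs] := bellX_cospoly D N.
have cw : continuous w by move=> y; exact: is_derive_continuous (dw y).
have -> : moll N w = (fun x => (bellint D N)^-1 * trig s w x).
  by apply/funext => y; rewrite (moll_trig _ Hs).
rewrite (moll_trig _ Hs)//.
exact: is_deriveZ (is_derive_trig s x dw cw' wr wNr).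
Qed.

End Mollifier.

(** * Uniform weighted approximation of real functions *)

Section RealApproximation.
Context {R : realType} (W : weights R).
Implicit Types (U : nat -> R -> R).

Lemma phi_anti m n x : (0 < m)%N -> (m <= n)%N -> phi W n x <= phi W m x.
Proof.
move=> m0 /subnKC <-; elim: (n - m)%N => [|d IH]; first by rewrite addn0.
by rewrite addnS; apply: le_trans IH; apply: phi_le; rewrite addn_gt0 m0.
Qed.

Lemma phi_le_seg m (r x : R) : (0 < m)%N -> 0 < r -> `|x| <= r ->
  phi W m x <= `|phi W m r| + `|phi W m (- r)|.
Proof.
move=> m0 r0; rewrite ler_norml => /andP[x1 x2].
pose t := (x + r) / (2 * r).
have t0 : 0 <= t by rewrite divr_ge0 ?mulr_ge0 ?(ltW r0)//; lra.
have t1 : t <= 1 by rewrite ler_pdivrMr ?mulr_gt0//; lra.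
have := phi_convexE W m0 r (- r) t0 t1.
have -> : t * r + (1 - t) * - r = x by rewrite /t; field; rewrite gt_eqF.
move=> H; apply: le_trans H _; have P1 := normr_ge0 (phi W m r); have P3 := normr_ge0 (phi W m (- r)).
have N1 := ler_norm (phi W m r); have N3 := ler_norm (phi W m (- r)); nra.
Qed.

Definition deriv_seq U : Prop := forall b (x : R), is_derive x 1 (U b) (U b.+1 x).

(** The a-th derivative of the product of U_0 with the cutoff, when U is the sequence of derivatives
    of a function and a < M. *)
Definition trunc (M : nat) (r : R) U (a : nat) : R -> R := leib U (cutoff M r) a 0 0.

Lemma is_derive_trunc M r U a (x : R) : deriv_seq U -> (a.+1 < M)%N ->
  is_derive x 1 (trunc M r U a) (trunc M r U a.+1 x).
Proof.
move=> dU aM; apply: (@is_derive_leib _ _ _ M.-1) => //; last by rewrite addn0; case: M aM.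
by move=> c y cM; apply: is_derive_cutoff; case: M cM {aM}.
Qed.

Lemma trunc_eq0 M r U a x : 0 < r -> (a < M)%N -> r <= `|x| -> trunc M r U a x = 0.
Proof.
move=> r0 aM rx; apply/eqP; rewrite -normr_le0.
pose u := \sum_(b < a.+1) `|U b x|.
have u0 : 0 <= u by apply: sumr_ge0.
have := @leib_le _ U (cutoff M r) u 0 a a a 0 0 x u0.
rewrite !addn0 mulr0 mulr0; apply=> // [b ba|c /andP[_ ca]].
  by rewrite /u (bigD1 (inord b)) //= inordK ?ltnS// lerDl sumr_ge0.
by rewrite cutoff_eq0 ?normr0//; exact: leq_ltn_trans ca aM.
Qed.

Lemma cutoff_bound n M : (n < M)%N -> exists2 C : R, 0 <= C &
  forall r y, 1 <= r -> (forall c, (c <= n)%N -> `|cutoff M r c y| <= C) /\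
    (forall c, (0 < c <= n)%N -> `|cutoff M r c y| <= C / r).
Proof.
move=> nM; pose P c (K : R) := (c < M)%N -> forall r y, 1 <= r -> `|cutoff M r c y| <= K * r^-1 ^+ c.
have H c : exists2 K : R, 0 <= K & P c K.
  have [cM|Mc] := ltnP c M; last by exists 0 => //; rewrite /P ltnNge Mc.
  have [K K0 HK] := @cutoff_le R M c cM; exists K => // _ r y r1; exact: HK.
have mono c (K K' : R) : K <= K' -> P c K -> P c K'.
  move=> KK' HK cM r y r1; apply: le_trans (HK cM r y r1) _; rewrite ler_wpM2r// exprn_ge0// invr_ge0.
  exact: le_trans r1.
have [C C0 HC] := le_upto n H mono; exists C => // r y r1.
have ri0 : 0 <= r^-1 by rewrite invr_ge0 (le_trans _ r1).
have ri1 : r^-1 <= 1 by rewrite invf_le1// (lt_le_trans _ r1).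
split=> c.
  move=> cn; apply: le_trans (HC c cn (leq_ltn_trans cn nM) r y r1) _.
  by rewrite ler_piMr// exprn_ile1.
move=> /andP[c0 cn]; apply: le_trans (HC c cn (leq_ltn_trans cn nM) r y r1) _.
rewrite ler_wpM2l//; case: c c0 {cn} => // c _.
by rewrite exprS ler_piMr// exprn_ile1.
Qed.

Lemma approx_trunc n M eps : (n < M)%N -> 0 < eps -> exists2 r, 1 <= r &
  forall m q U, (0 < m <= n)%N -> 0 <= q ->
    (forall b x, (b <= m.+2)%N -> `|U b x| <= q * expR (phi W m.+2 x)) ->
    forall a x, (a <= m)%N -> `|U a x - trunc M r U a x| <= eps * (q * expR (phi W m x)).
Proof.
move=> nM e0; have [C C0 HC] := cutoff_bound nM.
pose K := 2 ^+ n * C + M%:R.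
have K0 : 0 <= K by rewrite addr_ge0// mulr_ge0// exprn_ge0.
exists (1 + K / eps) => [|m q U /andP[m0 mn] q0 HU a x am]; first by rewrite lerDl divr_ge0// ltW.
set r := 1 + _; have r1 : 1 <= r by rewrite lerDl divr_ge0// ltW.
have r0 : 0 < r by exact: lt_le_trans r1.
have [HC0 HC1] := HC r x r1.
pose u := q * expR (phi W m.+2 x).
have u0 : 0 <= u by rewrite mulr_ge0 ?expR_ge0.
have an : (a <= n)%N by exact: leq_trans am mn.
have H1 : `|trunc M r U a x - U a x * cutoff M r 0 x| <= 2 ^+ a * (u * (C / r)).
  have := @leib_main _ U (cutoff M r) u (C / r) m.+2 n a 0 0 x u0.
  rewrite !addn0; apply=> //; first by rewrite (leq_trans am)// leqW.
    by rewrite divr_ge0// ltW.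
  by move=> b bm; exact: HU.
have H2 : `|U a x - U a x * cutoff M r 0 x| <= u * (M%:R * (x / r) ^+ 2).
  rewrite -[X in X - _]mulr1 -mulrBr normrM; apply: ler_pM => //.
    by apply: HU; rewrite (leq_trans am)// leqW.
  by apply: cutoff0_near1 => //; exact: leq_ltn_trans nM.
have ug : u <= q * expR (phi W m x) * cau x by rewrite -mulrA ler_wpM2l// expR_phi_gap2.
pose Q := q * expR (phi W m x); have Q0 : 0 <= Q by rewrite mulr_ge0 ?expR_ge0.
have u1 : u <= Q by apply: le_trans ug _; rewrite ler_piMr// cau_le1.
(* The two powers of |x| gained between phi_m and phi_(m+2) absorb the x^2 of [cutoff0_near1]. *)
have u2 : u * x ^+ 2 <= Q.
  apply: le_trans (ler_wpM2r (sqr_ge0 x) ug) _; rewrite -/Q -mulrA ler_piMr//.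
  by rewrite /cau mulrC ler_pdivrMr ?onesqr_gt0// mul1r lerDr.
have -> : U a x - trunc M r U a x =
  (U a x - U a x * cutoff M r 0 x) - (trunc M r U a x - U a x * cutoff M r 0 x) by ring.
apply: le_trans (ler_normB _ _) _; apply: le_trans (lerD H2 H1) _.
apply: le_trans (_ : Q * (K / r) <= _); last first.
  rewrite mulrC; apply: ler_wpM2r => //; rewrite ler_pdivrMr// /r mulrDr mulr1 mulrC divfK ?gt_eqF//.
  by rewrite lerDr ltW.
have -> : Q * (K / r) = M%:R * Q / r + 2 ^+ n * (Q * (C / r)) by rewrite /K; ring.
apply: lerD.
  have -> : u * (M%:R * (x / r) ^+ 2) = M%:R * (u * x ^+ 2) * (r^-1 * r^-1) by rewrite exprMn; ring.
  have ri0 : 0 <= r^-1 by rewrite invr_ge0 ltW.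
  apply: ler_pM; [|exact: mulr_ge0| |].
  - by rewrite mulr_ge0// mulr_ge0// sqr_ge0.
  - by rewrite ler_wpM2l.
  - by rewrite ler_piMl// invf_le1.
apply: ler_pM; rewrite ?exprn_ge0 ?mulr_ge0 ?invr_ge0 ?(ltW r0)//.
  by rewrite ler_weXn2l// ler1n.
by rewrite ler_wpM2r// divr_ge0// ltW.
Qed.

Lemma trunc_bound n M r : (n < M)%N -> 1 <= r -> exists2 B, 0 <= B &
  forall m q U, (0 < m)%N -> 0 <= q -> 
    (forall b x, (b <= n)%N -> `|U b x| <= q * expR (phi W m x)) ->
    forall a x, (a <= n)%N -> `|trunc M r U a x| <= q * B.
Proof.
move=> nM r1; have r0 : 0 < r by exact: lt_le_trans r1.
have [C C0 HC] := cutoff_bound nM.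
pose E := expR (`|phi W 1 r| + `|phi W 1 (- r)|).
exists (2 ^+ n * (E * C)) => [|m q U m0 q0 HU a x an]; first by rewrite !mulr_ge0 ?exprn_ge0 ?expR_ge0.
have B0 : 0 <= q * (2 ^+ n * (E * C)) by rewrite !mulr_ge0 ?exprn_ge0 ?expR_ge0.
have [rx|xr] := leP r `|x|; first by rewrite trunc_eq0 ?normr0//; exact: leq_ltn_trans nM.
have phiE : phi W m x <= `|phi W 1 r| + `|phi W 1 (- r)|.
  by apply: le_trans (phi_anti x (isT : (0 < 1)%N) m0) _; apply: phi_le_seg => //; exact: ltW.
apply: le_trans (_ : 2 ^+ a * (q * E * C) <= _).
  apply: (@leib_le _ U (cutoff M r) (q * E) C n n); rewrite ?addn0 ?mulr_ge0 ?expR_ge0//.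
    by move=> b bn; apply: le_trans (HU b x bn) _; rewrite ler_wpM2l// ler_expR.
  by move=> c /andP[_ cn]; have [HC0 _] := HC r x r1; exact: HC0.
have -> : q * (2 ^+ n * (E * C)) = 2 ^+ n * (q * E * C) by ring.
by rewrite ler_wpM2r ?mulr_ge0 ?expR_ge0// ler_weXn2l// ler1n.
Qed.

(** The parameters r, D and N depend on n and eps only, and the size q of U enters linearly; so a
    single linear operator serves all functions, all components and all m <= n. *)
Lemma approx_real n (M := n.+3) eps : (0 < n)%N -> 0 < eps -> exists r D N,
  [/\ 1 <= r, r <= D & forall m q U, (0 < m <= n)%N -> 0 <= q -> deriv_seq U ->
    (forall b x, (b <= m.+2)%N -> `|U b x| <= q * expR (phi W m.+2 x)) ->
    forall a x, (a <= m)%N ->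
      `|U a x - moll D r N (trunc M r U a) x| <= eps * (q * expR (phi W m x))].
Proof.
move=> n0 e0; have nM : (n < M)%N by rewrite /M leqW.
have e2 : 0 < eps / 2 by exact: divr_gt0.
have [r r1 Hr] := approx_trunc nM e2; have r0 : 0 < r by exact: lt_le_trans r1.
have [B B0 HB] : exists2 B, 0 <= B & forall m q U, (0 < m <= n)%N -> 0 <= q ->
    (forall b x, (b <= m.+2)%N -> `|U b x| <= q * expR (phi W m.+2 x)) ->
    forall a x, (a <= m.+1)%N -> `|trunc M r U a x| <= q * B.
  have H k : exists2 B : R, 0 <= B & (forall q U, (0 < k <= n)%N -> 0 <= q ->
      (forall b x, (b <= k.+2)%N -> `|U b x| <= q * expR (phi W k.+2 x)) ->
      forall a x, (a <= k.+1)%N -> `|trunc M r U a x| <= q * B).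
    have [kn|nk] := leqP k n; last by exists 0 => // q U /andP[].
    have kM : (k.+1 < M)%N by rewrite /M !ltnS leqW.
    have [B B0 HB] := trunc_bound kM r1; exists B => // q U _ q0 HU a x ak.
    by apply: (HB k.+2 q U (ltn0Sn _) q0) => // b y bk; apply: HU; exact: leqW.
  have mono k (K K' : R) : K <= K' -> (forall q U, (0 < k <= n)%N -> 0 <= q ->
      (forall b x, (b <= k.+2)%N -> `|U b x| <= q * expR (phi W k.+2 x)) ->
      forall a x, (a <= k.+1)%N -> `|trunc M r U a x| <= q * K) ->
      (forall q U, (0 < k <= n)%N -> 0 <= q ->
      (forall b x, (b <= k.+2)%N -> `|U b x| <= q * expR (phi W k.+2 x)) ->
      forall a x, (a <= k.+1)%N -> `|trunc M r U a x| <= q * K').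
    move=> KK' HK q U kn q0 HU a x ak; apply: le_trans (HK q U kn q0 HU a x ak) _.
    by rewrite ler_wpM2l.
  have [B B0 HB] := le_upto n H mono; exists B => // m q U /andP[m0 mn].
  by apply: HB; rewrite ?m0.
have [B' B'0 HB'] := @expR_phi_abs R W n 1 n0.
pose A := B' + 1; have A0 : 0 < A by rewrite ltr_wpDl.
have HA m x : (0 < m <= n)%N -> 1 + `|x| <= A * expR (phi W m x).
  move=> /andP[m0 mn]; apply: le_trans (expR_ge1Dx _) _; rewrite -[`|x|]mul1r.
  apply: le_trans (HB' x) _; apply: ler_pM; rewrite ?expR_ge0// ?lerDl// ler_expR.
  exact: phi_anti.
(* For |x| > D - r the truncated function vanishes and its mollification is at most q B. There A
   exp(phi) >= |x| >= La, which makes B at most eps / 2 times exp(phi). *)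
pose La := 2 * B * A / eps; have La0 : 0 <= La by rewrite divr_ge0 ?(ltW e0)// mulr_ge0 ?(ltW A0)// mulr_ge0.
pose D := La + r + r; have rD : r <= D by rewrite lerDr addr_ge0// ltW.
have D0 : 0 < D by exact: lt_le_trans rD.
have [eta eta0 Heta] : exists2 eta, 0 < eta & B * (eta + eta) * A <= eps / 2.
  exists (eps / (4 * ((B + 1) * A))); first by rewrite divr_gt0// mulr_gt0// mulr_gt0// ltr_wpDl.
  have B1 : 0 < B + 1 by rewrite ltr_wpDl.
  set X := eps / (4 * _); have -> : B * (X + X) * A = B / (B + 1) * (eps / 2).
    by rewrite /X; field; rewrite !gt_eqF.
  by rewrite ler_piMl ?(ltW e2)// ler_pdivrMr// mul1r lerDl.
have [N HN] : exists N : nat, 64 * D ^+ 2 / (eta * (2 * N + 2)%:R) <= eta.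
  pose t := 64 * D ^+ 2 / eta ^+ 2; have t0 : 0 <= t by rewrite divr_ge0 ?sqr_ge0// mulr_ge0 ?sqr_ge0.
  exists (Num.truncn t).+1; have := truncnS_gt t; set T := (Num.truncn t).+1 => tT.
  have T0 : 0 < T%:R :> R by rewrite ltr0n.
  have T2 : t <= (2 * T + 2)%:R by rewrite natrD natrM; lra.
  have T20 : 0 < (2 * T + 2)%:R :> R by rewrite ltr0n addn2.
  rewrite ler_pdivrMr; last exact: mulr_gt0.
  move: T2; rewrite /t ler_pdivrMr; last exact: exprn_gt0.
  by move=> h; apply: le_trans h _; rewrite le_eqVlt; apply/orP; left; apply/eqP; ring.
exists r, D, N; split=> // m q U mn q0 dU HU a x am.
have /andP[m0 mn'] := mn.
have aM k : (k <= m.+1)%N -> (k.+1 < M)%N by move=> km; rewrite /M !ltnS (leq_trans km)// ltnS.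
have dw k (y : R) : (k <= m)%N -> is_derive y 1 (trunc M r U k) (trunc M r U k.+1 y).
  by move=> km; apply: is_derive_trunc => //; apply: aM; exact: leqW.
have cw : continuous (trunc M r U a) by move=> y; exact: is_derive_continuous (dw a y am).
have wB k y : (k <= m.+1)%N -> `|trunc M r U k y| <= q * B by exact: HB.
pose Q := q * expR (phi W m x); have Q0 : 0 <= Q by rewrite mulr_ge0 ?expR_ge0.
have H1 : `|U a x - trunc M r U a x| <= eps / 2 * Q by exact: Hr.
suff H2 : `|trunc M r U a x - moll D r N (trunc M r U a) x| <= eps / 2 * Q.
  have -> : eps * Q = eps / 2 * Q + eps / 2 * Q by field.
  have -> : U a x - moll D r N (trunc M r U a) x =
    (U a x - trunc M r U a x) + (trunc M r U a x - moll D r N (trunc M r U a) x) by ring.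
  exact: le_trans (ler_normD _ _) (lerD H1 H2).
have w0 k y : (k <= m)%N -> r <= `|y| -> trunc M r U k y = 0.
  by move=> km ry; apply: trunc_eq0 => //; apply: ltnW; apply: aM; exact: leqW.
have [xD|xD] := leP `|x| (D - r).
  rewrite distrC; have L0 : 0 <= q * B by exact: mulr_ge0.
  have Lip y z : `|trunc M r U a y - trunc M r U a z| <= q * B * `|y - z|.
    have Hle y' z' : y' <= z' -> `|trunc M r U a z' - trunc M r U a y'| <= q * B * (z' - y').
      move=> yz; apply: (MVT_bound yz (fun t => dw a t am)) => t _; exact: wB.
    have [yz|/ltW zy] := leP y z; last by rewrite [`|y - z|]ger0_norm ?subr_ge0// Hle.
    by rewrite distrC [`|y - z|]distrC [`|z - y|]ger0_norm ?subr_ge0// Hle.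
  apply: le_trans (moll_near D0 (ltW r0) N cw (w0 a ^~ am) L0 Lip xD eta0) _.
  apply: le_trans (_ : q * B * (eta + eta) <= _); first by rewrite ler_wpM2l// lerD2l.
  apply: le_trans (_ : q * (B * (eta + eta)) * (A * expR (phi W m x)) <= _).
    rewrite -mulrA ler_peMr//; first by rewrite !mulr_ge0// addr_ge0// ltW.
    by apply: le_trans (HA m x mn); rewrite lerDl.
  have -> : q * (B * (eta + eta)) * (A * expR (phi W m x)) = B * (eta + eta) * A * Q by rewrite /Q; ring.
  by rewrite ler_wpM2r.
have xr : r <= `|x|.
  by move: xD; rewrite /D addrK => /ltW; apply: le_trans; rewrite lerDr.
rewrite w0// sub0r normrN.
apply: le_trans (moll_bound D0 (ltW r0) rD N x cw (fun y => wB a y (leqW am))) _.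
have HA' := HA m x mn.
have -> : eps / 2 * Q = q * (eps / 2 * expR (phi W m x)) by rewrite /Q; ring.
rewrite ler_wpM2l//.
have : La <= A * expR (phi W m x).
  apply: le_trans HA'; apply: le_trans (_ : `|x| <= _); last by rewrite lerDr.
  by move: xD; rewrite /D addrK => /ltW; apply: le_trans; rewrite lerDl ltW.
rewrite /La ler_pdivrMr// => h.
have : A * (2 * B) <= A * (expR (phi W m x) * eps) by rewrite mulrA; lra.
rewrite ler_pM2l//; lra.
Qed.

End RealApproximation.

(** * Finite-rank operators with values in the span of the exponentials *)

Section FiniteRank.
Context {R : realType} (W : weights R).
Local Notation C := (cplx R).
Local Notation MR := (measurableTypeR R).

(** The third clause is the form in which membership of the values in the span of the exponentials
    is used. The bound by p_1 alone is possible because the coefficients are integrals over a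
    bounded interval. *)
Definition nice (Q : Tspace W -> Tspace W) : Prop :=
  [/\ linear Q,
      forall m, (0 < m)%N -> exists2 B : R, 0 <= B & forall f, tnorm m (Q f) <= B * tnorm 1 f &
      forall S : Tdual W, (forall k l, hat S k l = 0) -> forall f, S (Q f) = 0].

Lemma nice0 : nice (fun _ => 0).
Proof.
split=> [z f g|m m0|S _ f]; first by rewrite scaler0 addr0.
  by exists 0 => // f; rewrite tnorm0 mul0r.
exact: Tdual0.
Qed.

Lemma niceD P Q : nice P -> nice Q -> nice (fun f => P f + Q f).
Proof.
move=> [lP bP SP] [lQ bQ SQ]; split=> [z f g|m m0|S S0 f].
- by rewrite lP lQ scalerDr addrACA.
- have [A A0 HA] := bP m m0; have [B B0 HB] := bQ m m0; exists (A + B) => [|f]; first exact: addr_ge0.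
  by apply: le_trans (tnormD _ _ m0) _; rewrite mulrDl; exact: lerD.
- by rewrite TdualD SP// SQ// addr0.
Qed.

Lemma nice_sum (I : Type) (s : seq I) (Q : I -> Tspace W -> Tspace W) :
  (forall i, nice (Q i)) -> nice (fun f => \sum_(i <- s) Q i f).
Proof.
move=> nQ; elim: s => [|i s IH].
  by under eq_fun do rewrite big_nil; exact: nice0.
by under eq_fun do rewrite big_cons; exact: niceD.
Qed.

Lemma nice_rank1 (l : Tspace W -> C) k la B : linear l -> 0 <= B ->
  (forall f, cabs (l f) <= B * tnorm 1 f) -> nice (fun f => l f *: exp_T W k la).
Proof.
move=> ll B0 bl; split=> [z f g|m m0|S S0 f].
- by rewrite ll scalerDl scalerA.
- exists (B * tnorm m (exp_T W k la)) => [|f]; first by rewrite mulr_ge0 ?tnorm_ge0.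
  apply: le_trans (tnormZ _ _ m0) _; rewrite mulrAC; apply: ler_wpM2r (bl f).
  exact: tnorm_ge0.
- by rewrite TdualZ [S _]S0 mulr0.
Qed.

Lemma Tspace_continuous (f : Tspace W) k : continuous (f k).
Proof. exact: (cis_Cn_continuous (Tspace_cis_Cn 0 f k)). Qed.

Definition coeff (r : R) (h : R -> C) (k : nat) (f : Tspace W) : C :=
  cint (`[- r, r] : set MR) (fun y => f k y * h y).

Lemma coeff_linear r (h : R -> C) k : continuous h -> linear (coeff r h k).
Proof.
move=> ch z f g; rewrite /coeff /GRing.scale /=.
have mA : measurable (`[- r, r] : set MR) by exact: measurable_itv.
have ci (f' : Tspace W) : cintegrable (`[- r, r] : set MR) (fun y => f' k y * h y).
  by apply: cintegrable_seg; apply: continuous_RcplxM ch; exact: Tspace_continuous.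
rewrite -(cintZ z mA (ci f)) -(cintD mA (cintegrableZ z mA (ci f)) (ci g)).
by apply: eq_cint => y _; rewrite mulrA -mulrDl.
Qed.

Lemma coeff_bounded r (h : R -> C) k H : 0 < r -> continuous h -> (forall y, cabs (h y) <= H) ->
  exists2 B, 0 <= B & forall f, cabs (coeff r h k f) <= B * tnorm 1 f.
Proof.
move=> r0 ch hH; have H0 : 0 <= H by apply: le_trans (hH 0); exact: cabs_ge0.
pose E := expR (`|phi W 1 r| + `|phi W 1 (- r)|).
have c0 := coef_gt0 W (ltn0Sn 0) k.
exists (2 * (E * H) * (r - - r) / coef W 1 k).
  by rewrite divr_ge0 ?(ltW c0)// !mulr_ge0 ?expR_ge0//; lra.
move=> f; have q0 := qnorm_ge0 1 f k.
have qt : qnorm 1 f k <= tnorm 1 f / coef W 1 k by rewrite ler_pdivlMr// mulrC qnorm_le.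
have ci : cintegrable (`[- r, r] : set MR) (fun y => f k y * h y).
  by apply: cintegrable_seg; apply: continuous_RcplxM ch; exact: Tspace_continuous.
have rr : - r <= r by lra.
apply: le_trans (cabs_cint_itv_le (M := qnorm 1 f k * E * H) rr ci _) _.
  move=> y yr; rewrite cabsM; apply: ler_pM; rewrite ?cabs_ge0//.
  rewrite -[f k y]cderiv0E; apply: le_trans (cderiv_qnorm f k y (ltn0Sn 0) (leq0n 1)) _.
  by rewrite ler_wpM2l// ler_expR phi_le_seg// ler_norml.
have -> : 2 * (qnorm 1 f k * E * H) * (r - - r) = 2 * (E * H) * (r - - r) * qnorm 1 f k by ring.
have -> : 2 * (E * H) * (r - - r) / coef W 1 k * tnorm 1 f =
  2 * (E * H) * (r - - r) * (tnorm 1 f / coef W 1 k) by ring.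
by rewrite ler_wpM2l// !mulr_ge0 ?expR_ge0//; lra.
Qed.

Lemma bellX_expsum (D : R) N : exists s : seq (R * R), forall t : R,
  (bell D t ^+ N)%:C = \sum_(p <- s) p.1%:C * cexp ('i * (p.2 * t)%:C).
Proof.
have [s Hs] := bellX_cospoly D N.
exists ([seq (p.1 / 2, p.2) | p <- s] ++ [seq (p.1 / 2, - p.2) | p <- s]) => t.
rewrite Hs /cospoly big_cat !big_map /= -big_split /= rmorph_sum; apply: eq_bigr => p _.
rewrite !cexp_i mulNr sinN cosN; apply: cplx_eq; rewrite ?ReDE ?ImDE ?ReME ?ImME /=; field; by [].
Qed.

Section Operator.
Variables (r D : R) (N M K0 : nat) (s : seq (R * R)).
Hypotheses (r1 : 1 <= r) (rD : r <= D) (M1 : (1 < M)%N).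
Hypothesis Hs : forall t : R, (bell D t ^+ N)%:C = \sum_(p <- s) p.1%:C * cexp ('i * (p.2 * t)%:C).

Let r0 : 0 < r. Proof. exact: lt_le_trans r1. Qed.
Let D0 : 0 < D. Proof. exact: lt_le_trans rD. Qed.

(** The y-dependent part of one exponential term of the normalised kernel, times the cutoff; the
    x-dependent part is left to [exp_T]. *)
Definition coeff_fun (p : R * R) (y : R) : C :=
  ((bellint D N)^-1 * p.1 * cutoff M r 0 y)%:C * cexp (- 'i * p.2%:C * y%:C).

(** Only the components below [K0] are kept. The frequency - p.2 produces the function exp(i p.2 x),
    because of the sign convention in [exp_T]. *)
Definition trigapprox (f : Tspace W) : Tspace W :=
  \sum_(k <- iota 0 K0) \sum_(p <- s) coeff r (coeff_fun p) k f *: exp_T W k (- p.2%:C).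

Lemma continuous_cutoff a : (a.+1 < M)%N -> continuous (cutoff M r a).
Proof. by move=> aM y; exact: is_derive_continuous (is_derive_cutoff r y aM). Qed.

Lemma continuous_coeff_fun p : continuous (coeff_fun p).
Proof.
apply: continuous_RcplxM; last exact: continuous_cexp_line.
move=> y; apply: continuous_ReIm; last exact: cvg_cst.
exact: (continuous_scaleR (@continuous_cutoff 0 M1)).
Qed.

Lemma coeff_fun_le p : exists H, forall y, cabs (coeff_fun p y) <= H.
Proof.
have [Cc C0 HC] := @cutoff_bound R _ _ (ltnW M1).
exists (`|(bellint D N)^-1 * p.1| * Cc) => y.
rewrite cabsM cabs_real cabs_cexp.
have -> : Re (- 'i * p.2%:C * y%:C) = 0 by rewrite ReME ReME ImME ReNE ImNE /=; ring.
rewrite expR0 mulr1 normrM ler_wpM2l//; have [H _] := HC r y r1; exact: H.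
Qed.

Lemma nice_trigapprox : nice trigapprox.
Proof.
apply: nice_sum => k; apply: nice_sum => p.
have [H HH] := coeff_fun_le p.
have [B B0 HB] := coeff_bounded k r0 (@continuous_coeff_fun p) HH.
exact: nice_rank1 (coeff_linear r k (@continuous_coeff_fun p)) B0 HB.
Qed.

Lemma Tspace_sumE (I : Type) (t : seq I) (F : I -> Tspace W) j x :
  (\sum_(i <- t) F i) j x = \sum_(i <- t) F i j x.
Proof.
elim: t => [|i t IH]; first by rewrite !big_nil.
by rewrite !big_cons -IH.
Qed.

Lemma trigapprox_high f j : (K0 <= j)%N -> trigapprox f j = 0.
Proof.
move=> Kj; apply/funext => x; rewrite Tspace_sumE big_seq big1// => k.
rewrite mem_iota add0n => /andP[_ kK]; rewrite Tspace_sumE big1// => p _.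
have -> : (coeff r (coeff_fun p) k f *: exp_T W k (- p.2%:C)) j x =
  coeff r (coeff_fun p) k f * exp_T W k (- p.2%:C) j x by [].
by rewrite exp_T_at gtn_eqF ?mulr0//; exact: leq_trans kK Kj.
Qed.

(** Summing the exponential terms under the integral restores the kernel, so the finite-rank
    operator is truncation followed by mollification of real and imaginary parts. *)
Lemma trigapprox_low f j x : (j < K0)%N ->
  trigapprox f j x = (moll D r N (fun y => Re (f j y) * cutoff M r 0 y) x)
    +i* (moll D r N (fun y => Im (f j y) * cutoff M r 0 y) x).
Proof.
move=> jK; rewrite Tspace_sumE.
have -> : \sum_(k <- iota 0 K0) (\sum_(p <- s) coeff r (coeff_fun p) k f *: exp_T W k (- p.2%:C)) j x =
   \sum_(p <- s) coeff r (coeff_fun p) j f * cexp ('i * (p.2 * x)%:C).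
  rewrite (bigD1_seq j) ?iota_uniq ?mem_iota//= [X in _ + X]big1 ?addr0.
    rewrite Tspace_sumE; apply: eq_bigr => p _.
    have -> : (coeff r (coeff_fun p) j f *: exp_T W j (- p.2%:C)) j x =
      coeff r (coeff_fun p) j f * exp_T W j (- p.2%:C) j x by [].
    by rewrite exp_T_at eqxx rmorphM mulrA mulrNN.
  move=> k kj; rewrite Tspace_sumE big1// => p _.
  have -> : (coeff r (coeff_fun p) k f *: exp_T W k (- p.2%:C)) j x =
    coeff r (coeff_fun p) k f * exp_T W k (- p.2%:C) j x by [].
  by rewrite exp_T_at eq_sym (negbTE kj) mulr0.
have mA : measurable (`[- r, r] : set MR) by exact: measurable_itv.
have cf := @Tspace_continuous f j.
have ci p : cintegrable (`[- r, r] : set MR) (fun y => cexp ('i * (p.2 * x)%:C) * (f j y * coeff_fun p y)).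
  by apply: (cintegrableZ _ mA); apply: cintegrable_seg; exact: continuous_RcplxM cf (@continuous_coeff_fun p).
have -> : \sum_(p <- s) coeff r (coeff_fun p) j f * cexp ('i * (p.2 * x)%:C) =
    cint (`[- r, r] : set MR) (fun y => \sum_(p <- s) cexp ('i * (p.2 * x)%:C) * (f j y * coeff_fun p y)).
  pose G t y := \sum_(p <- t) cexp ('i * (p.2 * x)%:C) * (f j y * coeff_fun p y).
  have Gcons p t : G (p :: t) = fun y => cexp ('i * (p.2 * x)%:C) * (f j y * coeff_fun p y) + G t y.
    by apply/funext => y; rewrite /G big_cons.
  have Gnil : G [::] = fun=> 0 by apply/funext => y; rewrite /G big_nil.
  have cG t : cintegrable (`[- r, r] : set MR) (G t).
    elim: t => [|p t IH]; last by rewrite Gcons; exact: (cintegrableD mA (ci p) IH).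
    by rewrite Gnil; apply: cintegrable_seg => y; exact: cvg_cst.
  rewrite -/(G s); elim: (s) => [|p t IH].
    rewrite big_nil Gnil; apply: cplx_eq; rewrite [RHS]/= Rintegral_cst ?mul0r//.
  rewrite big_cons IH -[coeff _ _ _ _ * _]mulrC -(cintZ _ mA); last first.
    by apply: cintegrable_seg; exact: continuous_RcplxM cf (@continuous_coeff_fun p).
  by rewrite -(cintD mA (ci p) (cG t)) -Gcons.
have -> : cint (`[- r, r] : set MR) (fun y => \sum_(p <- s) cexp ('i * (p.2 * x)%:C) * (f j y * coeff_fun p y)) =
    cint (`[- r, r] : set MR) (fun y => ((bellint D N)^-1)%:C * (f j y * (cutoff M r 0 y * bell D (x - y) ^+ N)%:C)).
  apply: eq_cint => y _.
  have -> : (cutoff M r 0 y * bell D (x - y) ^+ N)%:C = (cutoff M r 0 y)%:C * (bell D (x - y) ^+ N)%:C.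
    by rewrite rmorphM.
  rewrite Hs !mulr_sumr; apply: eq_bigr => p _.
  have -> : cexp ('i * (p.2 * (x - y))%:C) = cexp ('i * (p.2 * x)%:C) * cexp (- 'i * p.2%:C * y%:C).
    by rewrite -cexpD; congr cexp; rewrite mulrBr rmorphB !rmorphM; ring.
  by rewrite /coeff_fun !rmorphM; ring.
have cc : continuous (fun y => cutoff M r 0 y * bell D (x - y) ^+ N).
  by apply: continuous_mulR; [exact: continuous_cutoff|exact: continuous_bellX].
have cr : continuous (fun y => Re (f j y)) by exact: continuous_ReR cf.
have cim : continuous (fun y => Im (f j y)) by exact: continuous_ImR cf.
apply: cplx_eq; rewrite [LHS]/= [RHS]/= /moll -segZ.
- by apply: eq_Rintegral => y _; rewrite ReME ReME /=; ring.
- apply: continuous_mulR; last exact: continuous_bellX.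
  by apply: continuous_mulR => //; exact: continuous_cutoff.
- by apply: eq_Rintegral => y _; rewrite ImME ImME /=; ring.
- apply: continuous_mulR; last exact: continuous_bellX.
  by apply: continuous_mulR => //; exact: continuous_cutoff.
Qed.

End Operator.

End FiniteRank.

(** * Approximation by finite-rank operators in the norms of T *)

Section Approximation.
Context {R : realType} (W : weights R).
Local Notation C := (cplx R).

Lemma derive1n_upto (F : nat -> R -> R) n :
  (forall a (x : R), (a < n)%N -> is_derive x 1 (F a) (F a.+1 x)) ->
  forall a, (a <= n)%N -> derive1n a (F 0%N) = F a.
Proof.
move=> dF; elim=> [//|a IH] an; rewrite derive1nS IH ?(ltnW an)//; apply/funext => x.
by rewrite derive1E (@derive_val _ _ _ _ _ _ _ (dF a x an)).
Qed.

Lemma is_Cn_deriv_seq (g : R -> R) : (forall n, is_Cn n g) -> deriv_seq (fun a => derive1n a g).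
Proof.
move=> Cg b x; rewrite derive1nS derive1E; apply: derivableP.
by have [dg _] := Cg b.+1; exact: (dg b (ltnSn b)).
Qed.

Lemma qnorm_le_bound m (f : Tspace W) k B : (0 < m)%N ->
  (forall a x, (a <= m)%N -> cabs (cderiv a (f k) x) <= B * expR (phi W m x)) -> qnorm m f k <= B.
Proof.
move=> m0 fB; rewrite -lee_fin -qnormE//; apply: ge_ereal_sup => _ [x [a [am ->]]].
by rewrite lee_fin ler_pdivrMr ?expR_gt0// fB.
Qed.

Lemma qnorm_mono m (f : Tspace W) k : (0 < m)%N -> qnorm m f k <= qnorm m.+1 f k.
Proof. by move=> m0; rewrite -lee_fin -!qnormE//; exact: q_norm_mono. Qed.

Lemma tnorm_le_terms m m' e (f g : Tspace W) : (0 < m)%N -> (0 < m')%N -> 0 <= e ->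
  (forall k, coef W m k * qnorm m f k <= e * (coef W m' k * qnorm m' g k)) ->
  tnorm m f <= e * tnorm m' g.
Proof.
move=> m0 m'0 e0 H; rewrite -lee_fin EFinM -!tnorm_series// -nneseriesZl.
  apply: lee_nneseries => k _; first by rewrite lee_fin mulr_ge0 ?qnorm_ge0// ltW// coef_gt0.
  by rewrite -EFinM lee_fin.
by move=> k _; rewrite lee_fin mulr_ge0 ?qnorm_ge0// ltW// coef_gt0.
Qed.

(** The terms of a convergent series tend to zero. This makes the loss of all components from some
    index on a small error. *)
Lemma coef_ratio_cvg0 m e : (0 < m)%N -> 0 < e ->
  exists K0, forall k, (K0 <= k)%N -> coef W m k <= e * coef W m.+1 k.
Proof.
move=> m0 e0; have c1 k := coef_gt0 W (ltn0Sn m) k; have c0 k := coef_gt0 W m0 k.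
have r0 k : 0 <= coef W m k / coef W m.+1 k by rewrite divr_ge0 ?ltW.
have := coef_summable W m0; set s := (X in (X < _)%E) => soo.
have s0 : (0 <= s)%E by apply: nneseries_ge0 => k _ _; rewrite lee_fin.
have sfin : s \is a fin_num by rewrite ge0_fin_numE.
have cv : cvgn (series (fun k => coef W m k / coef W m.+1 k)).
  apply: (@bounded_series_cvg _ (fine s)) => n.
  rewrite -lee_fin fineK// -sumEFin; apply: le_trans (nneseries_lim_ge (m := 0) n _).
    by rewrite le_eqVlt; apply/orP; left; apply/eqP; apply: eq_bigr => k _; rewrite ger0_norm.
  by move=> k _ _; rewrite lee_fin.
have /cvgrPdist_le/(_ e e0)[K0 _ HK] := cvg_series_cvg_0 cv.
exists K0 => k Kk; have := HK k Kk; rewrite sub0r normrN ger0_norm// ler_pdivrMr//.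
Qed.

Lemma TspaceB (f g : Tspace W) k x : (f - g) k x = f k x - g k x.
Proof. by []. Qed.

(** Components below K0 are truncated and mollified; on the others Q f is zero and the error is paid
    for by the small ratio of coefficients. One Q has to serve all m <= n at once for the later
    construction of a bounded set. *)
Lemma exists_approx n (eps : R) : (0 < n)%N -> 0 < eps -> exists2 Q : Tspace W -> Tspace W, nice Q &
  forall m (f : Tspace W), (0 < m <= n)%N -> tnorm m (f - Q f) <= eps * tnorm m.+2 f.
Proof.
move=> n0 e0.
have [A A0 HA] : exists2 A : R, 0 < A & forall m k, (0 < m <= n)%N ->
    coef W m k <= A * coef W m.+2 k /\ coef W m.+1 k <= A * coef W m.+2 k.
  pose P m (A : R) := (0 < m)%N -> forall k,
    coef W m k <= A * coef W m.+2 k /\ coef W m.+1 k <= A * coef W m.+2 k.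
  have c0 m k : 0 < coef W m.+1 k by exact: coef_gt0.
  have H m : exists2 A : R, 0 <= A & P m A.
    case: m => [|m]; first by exists 0.
    have [K K0 HK] := coef_ratio W (ltn0Sn m); have [K' K'0 HK'] := coef_ratio W (ltn0Sn m.+1).
    exists (K * K' + K') => [|_ k]; first by rewrite addr_ge0 ?mulr_ge0 ?ltW.
    split.
      apply: le_trans (HK k) _; apply: le_trans (ler_wpM2l (ltW K0) (HK' k)) _.
      by rewrite mulrA ler_wpM2r ?(ltW (c0 _ _))// lerDl ltW.
    apply: le_trans (HK' k) _; rewrite ler_wpM2r ?(ltW (c0 _ _))// lerDr.
    by rewrite mulr_ge0 ?ltW.
  have mono m (K K' : R) : K <= K' -> P m K -> P m K'.
    move=> KK' HK m0 k; have [h1 h2] := HK m0 k.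
    by split; [apply: le_trans h1 _|apply: le_trans h2 _]; rewrite ler_wpM2r ?(ltW (c0 _ _)).
  have [B B0 HB] := le_upto n H mono; exists (B + 1); first by rewrite ltr_wpDl.
  move=> m k /andP[m0 mn]; apply: (mono m B _ _ (HB m mn) m0 k).
  by rewrite lerDl.
(* The factor 2 is for real and imaginary parts, A for the comparison of the coefficients of orders
   m and m + 1 with those of order m + 2. *)
have e1 : 0 < eps / (2 * A) by rewrite divr_gt0// mulr_gt0.
have e2 : 0 < eps / A by exact: divr_gt0.
have [K0 HK0] : exists K0, forall m k, (0 < m <= n)%N -> (K0 <= k)%N -> coef W m k <= eps / A * coef W m.+1 k.
  elim: (n) => [|n' [K0 HK0]]; first by exists 0%N => m k /andP[]; rewrite leqn0 => m0 /eqP mE; move: m0; rewrite mE.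
  have [K1 HK1] := coef_ratio_cvg0 (ltn0Sn n') e2.
  exists (maxn K0 K1) => m k /andP[m0]; rewrite leq_eqVlt geq_max => /orP[/eqP->|mn] /andP[k0 k1].
    exact: HK1.
  by apply: HK0 => //; rewrite m0.
have [r [D [N [r1 rD HU]]]] := approx_real W n0 e1.
have [s Hs] := bellX_expsum D N.
have M1 : (1 < n.+3)%N by [].
exists (@trigapprox R W r D N n.+3 K0 s); first exact: nice_trigapprox.
move=> m f mn; have /andP[m0 mn'] := mn; set Q := trigapprox _ _ _ _ _ _ f.
apply: tnorm_le_terms => //; first exact: ltW.
move=> k; have q0 := qnorm_ge0 m.+2 f k; have c0 := ltW (coef_gt0 W m0 k).
have [h1 h2] := HA m k mn.
have [Kk|kK] := leqP K0 k; last first.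
  suff H : qnorm m (f - Q) k <= 2 * (eps / (2 * A)) * qnorm m.+2 f k.
    apply: le_trans (ler_wpM2l c0 H) _.
    have -> : 2 * (eps / (2 * A)) = eps / A by field; rewrite gt_eqF.
    have -> : eps * (coef W m.+2 k * qnorm m.+2 f k) = (A * coef W m.+2 k) * (eps / A * qnorm m.+2 f k).
      by field; rewrite gt_eqF.
    by rewrite ler_wpM2r// mulr_ge0// ltW.
  have r0 : 0 < r by exact: lt_le_trans r1.
  have D0 : 0 < D by exact: lt_le_trans rD.
  have part (g : R -> R) : (forall n, is_Cn n g) ->
      (forall b x, (b <= m.+2)%N -> `|derive1n b g x| <= qnorm m.+2 f k * expR (phi W m.+2 x)) ->
      forall a x, (a <= m)%N ->
      `|derive1n a (fun x => g x - moll D r N (fun y => g y * cutoff n.+3 r 0 y) x) x| <=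
      eps / (2 * A) * (qnorm m.+2 f k * expR (phi W m x)).
    move=> Cg Hg a x am; have dU := is_Cn_deriv_seq Cg.
    pose U b := derive1n b g; pose F b x := U b x - moll D r N (trunc n.+3 r U b) x.
    have dF b (y : R) : (b < m)%N -> is_derive y 1 (F b) (F b.+1 y).
      move=> bm; have bM : (b.+2 < n.+3)%N by rewrite !ltnS (leq_trans (ltnW bm)).
      have d1 := dU b y.
      have d2 : is_derive y 1 (moll D r N (trunc n.+3 r U b)) (moll D r N (trunc n.+3 r U b.+1) y).
        apply: is_derive_moll => //.
        - exact: ltW.
        - by move=> z; apply: is_derive_trunc => //; exact: ltnW.
        - by move=> z; exact: is_derive_continuous (is_derive_trunc r z dU bM).
        - by apply: trunc_eq0; rewrite ?ler_norm// ltnW// ltnW.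
        - by apply: trunc_eq0; rewrite ?normrN ?ler_norm// ltnW// ltnW.
      exact: is_deriveB d1 d2.
    have := derive1n_upto dF am; rewrite [X in derive1n a X](_ : _ = (fun x => g x - moll D r N (fun y => g y * cutoff n.+3 r 0 y) x))//.
    move=> ->; exact: HU.
  apply: qnorm_le_bound => // a x am.
  have fE : (f - Q) k = (fun x => (Re (f k x) - moll D r N (fun y => Re (f k y) * cutoff n.+3 r 0 y) x) +i*
     (Im (f k x) - moll D r N (fun y => Im (f k y) * cutoff n.+3 r 0 y) x)).
    apply/funext => y; rewrite TspaceB (trigapprox_low r M1 Hs f y kK).
    by case: (f k y).
  rewrite fE; apply: le_trans (cabs_le_ReIm _) _.
  have -> : 2 * (eps / (2 * A)) * qnorm m.+2 f k * expR (phi W m x) =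
     eps / (2 * A) * (qnorm m.+2 f k * expR (phi W m x)) + eps / (2 * A) * (qnorm m.+2 f k * expR (phi W m x)) by ring.
  apply: lerD; [apply: (part (fun x => Re (f k x))) => //|apply: (part (fun x => Im (f k x))) => //].
  - by move=> j; have [] := Tspace_cis_Cn j f k.
  - by move=> b y bm; apply: le_trans (cderiv_qnorm f k y (ltn0Sn m.+1) bm); exact: (Re_le_cabs (cderiv b (f k) y)).
  - by move=> j; have [] := Tspace_cis_Cn j f k.
  - by move=> b y bm; apply: le_trans (cderiv_qnorm f k y (ltn0Sn m.+1) bm); exact: (Im_le_cabs (cderiv b (f k) y)).
have -> : qnorm m (f - Q) k = qnorm m f k.
  have E : (f - Q) k = f k.
    have Q0 : Q k = 0 by exact: trigapprox_high.
    by apply/funext => y; rewrite TspaceB Q0; exact: subr0.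
  by rewrite /qnorm E.
apply: le_trans (_ : eps / A * coef W m.+1 k * qnorm m.+2 f k <= _).
  apply: ler_pM; rewrite ?qnorm_ge0//; first exact: HK0.
  by apply: le_trans (qnorm_mono f k m0) _; exact: qnorm_mono.
have -> : eps * (coef W m.+2 k * qnorm m.+2 f k) = eps / A * (A * coef W m.+2 k) * qnorm m.+2 f k.
  by field; rewrite gt_eqF.
by rewrite ler_wpM2r// ler_wpM2l// ltW.
Qed.

End Approximation.

(** * Bijectivity and continuity *)

Section Bijection.
Context {R : realType} (W : weights R).
Local Notation C := (cplx R).

Lemma Tdual_eq (S S' : Tdual W) : (forall f, S f = S' f) -> S = S'.
Proof. by move=> E; apply: val_inj; apply/funext. Qed.

Lemma Tdual_subE (S S' : Tdual W) f : (S - S') f = S f - S' f.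
Proof. by []. Qed.

Lemma Tdual_scaleE (z : R[i]) (S : Tdual W) f : (z *: S) f = z * S f.
Proof. by []. Qed.

Lemma bounded_Tdual (S0 : Tspace W -> C) m M : linear S0 -> (0 < m)%N ->
  (forall f, cabs (S0 f) <= M * tnorm m f) -> exists S : Tdual W, forall f, S f = S0 f.
Proof.
move=> lS m0 bS; have cS := @tnorm_bounded_continuous _ _ _ _ _ lS m0 bS.
have TS : S0 \in @Tdual_set R W by apply/mem_set.
by exists (MkTdual TS).
Qed.

Lemma hat_eq0 (S : Tdual W) : (forall k l, hat S k l = 0) -> S = 0.
Proof.
move=> S0; apply: Tdual_eq => f; have [m [M [m0 M0 HS]]] := Tdual_bounded S.
apply: cabs_eq0; apply/eqP; rewrite eq_le cabs_ge0 andbT; apply/ler_addgt0Pr => e e0; rewrite add0r.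
pose B := M * tnorm m.+2 f; have B0 : 0 <= B by rewrite mulr_ge0// tnorm_ge0.
have d0 : 0 < e / (B + 1) by rewrite divr_gt0// ltr_wpDl.
have [Q [_ _ SQ] HQ] := exists_approx W m0 d0.
have -> : S f = S (f - Q f) by rewrite TdualB SQ// subr0.
apply: le_trans (HS _) _; apply: le_trans (ler_wpM2l M0 (HQ m f _)) _; first by rewrite m0 leqnn.
rewrite mulrCA -/B mulrAC ler_pdivrMr ?ltr_wpDl//.
by rewrite ler_wpM2l ?(ltW e0)// lerDl.
Qed.

Lemma hat_P_linear : linear (@hat_P R W).
Proof. by move=> z S S'; apply: val_inj. Qed.

Lemma hat_P_inj : injective (@hat_P R W).
Proof.
move=> S S' E; apply/eqP; rewrite -subr_eq0; apply/eqP; apply: hat_eq0 => k l.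
have : hat S k l = hat S' k l by have := congr1 (fun g : Pspace W => \val g k l) E.
by rewrite /hat Tdual_subE => ->; rewrite subrr.
Qed.

(** The constructed functional has the prescribed transform off the real axis; this carries the
    identity over to the axis. *)
Lemma continuous_eq_real (f g : C -> C) : (forall z : C, {for z, continuous f}) ->
  (forall z : C, {for z, continuous g}) ->
  (forall a b : R, b != 0 -> f (a +i* b) = g (a +i* b)) -> forall z, f z = g z.
Proof.
move=> cf cg fg [a b]; have [->|b0] := eqVneq b 0; last exact: fg.
apply/eqP; rewrite -subr_eq0; apply/eqP; apply: cabs_eq0; apply/eqP.
rewrite eq_le cabs_ge0 andbT; apply/ler_addgt0Pr => e e0; rewrite add0r.
have e2 : 0 < e / 2 by exact: divr_gt0.
pose z : C := a +i* 0.
have /continuous_cplx_epsP/(_ _ e2)[d d0 Hd] := cf z.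
have /continuous_cplx_epsP/(_ _ e2)[d' d'0 Hd'] := cg z.
pose t := Num.min d d' / 2; have t0 : 0 < t by rewrite divr_gt0// lt_min d0.
pose w : C := a +i* t.
have wz : cabs (w - z) = t.
  by rewrite /cabs /= subrr subr0 expr0n add0r sqrtr_sqr gtr0_norm.
have td : t < Num.min d d' by rewrite ltr_pdivrMr// ltr_pMr ?lt_min ?d0// ltr1n.
move: td; rewrite lt_min => /andP[td td'].
have h1 : cabs (f w - f z) < e / 2 by apply: Hd; rewrite wz.
have h2 : cabs (g w - g z) < e / 2 by apply: Hd'; rewrite wz.
have -> : f z - g z = (g w - g z) - (f w - f z) by rewrite (fg a t (lt0r_neq0 t0)); ring.
by apply: le_trans (cabsD _ _) _; rewrite cabsN [e]splitr; apply: ltW; exact: ltrD.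
Qed.

Lemma P_norm_inverse m : (0 < m)%N -> exists2 K, 0 <= K & forall (g : Pspace W) N, 0 <= N ->
  (P_norm W m (\val g) <= N%:E)%E ->
  exists2 S : Tdual W, hat_P S = g & forall f, cabs (S f) <= K * N * tnorm m.+2 f.
Proof.
move=> m0; have [K K0 HK] := exists_functional W m0; exists K => // g N N0 gN.
have eg k : entire (\val g k).
  by have /set_mem[m' m'0 [eg _]] := valP g; exact: eg.
have bg k : Pbound W m (coef W m k * N) (\val g k).
  move=> l; have := le_trans (Pnorm_ub W m (\val g) k l) gN; rewrite lee_fin.
  rewrite ler_pdivrMr; last by rewrite !mulr_gt0 ?expR_gt0 ?coef_gt0 ?exprn_gt0 ?ltr_pwDl ?cabs_ge0.
  by move=> h; apply: le_trans h _; rewrite le_eqVlt; apply/orP; left; apply/eqP; ring.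
have [S [bS hS]] := HK (\val g) N N0 eg bg; exists S => //.
apply: val_inj; apply/funext => k; apply/funext; apply: continuous_eq_real.
- by move=> z; apply: derivable_continuous_cplx; exact: entire_hat.
- by move=> z; apply: derivable_continuous_cplx; exact: eg.
- by move=> a b b0; exact: hS.
Qed.

Lemma hat_P_surj (g : Pspace W) : exists S, hat_P S = g.
Proof.
have /set_mem[m m0 [_ goo]] := valP g.
have [K K0 HK] := P_norm_inverse m0.
have fin : P_norm W m (\val g) \is a fin_num by rewrite ge0_fin_numE// Pnorm_ge0.
have [|S hS _] := HK g (fine (P_norm W m (\val g))) (fine_ge0 (Pnorm_ge0 W _ m0)); last by exists S.
by rewrite fineK.
Qed.

End Bijection.

(** * Neighbourhoods in the strong dual and bounded sets of T *)

Section StrongTopology.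
Context {R : realType} (W : weights R).
Local Notation C := (cplx R).

Lemma entourage_cplxP (E : set (C * C)) :
  entourage E <-> exists2 e : R, 0 < e & forall z w, cabs (w - z) < e -> E (z, w).
Proof.
rewrite -entourage_ballE; split.
- move=> [d /= d0 Hd]; have d1 : (0 : R[i]) < d by [].
  have dE : d = (Re d)%:C by move: d1; case: d {d0 Hd} => a b; rewrite ltcE /= => /andP[/eqP-> _].
  exists (Re d); first by move: d1; rewrite ltcE => /andP[].
  move=> z w zw; apply: (Hd (z, w)) => /=; rewrite -ball_normE /= distrC normc_cabs dE.
  by rewrite ltcR.
- move=> [e e0 He]; exists e%:C; first by rewrite /= ltcR.
  move=> [z w] /=; rewrite -ball_normE /= distrC normc_cabs ltcR; exact: He.
Qed.

Lemma strong_nbhs (S : Tdual W) (B : set (Tspace W)) (e : R) : vn_bounded B -> 0 < e ->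
  nbhs S [set S' : Tdual W | forall f, B f -> cabs (S' f - S f) < e].
Proof.
move=> bB e0.
pose F := {family @vn_bounded R (Tspace W), Tspace W -> C}.
have cv : {family @vn_bounded R (Tspace W), nbhs (\val S : F) --> (\val S : Tspace W -> C)} by move=> A.
have /(fam_cvgP _ _ (nbhs_filter (\val S : F)))/(_ B bB) cB := cv.
have := @initial_continuous (Tdual W) F (fun S : Tdual W => (\val S : F)) S.
move=> /(_ [set h : F | forall f, B f -> cabs (h f - S f) < e]); apply.
apply: cB; apply/uniform_nbhs; exists [set p : C * C | cabs (p.2 - p.1) < e].
split; first by apply/entourage_cplxP; exists e.
by [].
Qed.

Lemma strong_continuous (T : topologicalType) (G : T -> Tdual W) :
  (forall x (B : set (Tspace W)) (e : R), vn_bounded B -> 0 < e ->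
     nbhs x [set y | forall f, B f -> cabs (G y f - G x f) < e]) -> continuous G.
Proof.
move=> H; apply: continuous_comp_initial => x.
apply/fam_cvgP => B bB U /uniform_nbhs[E [/entourage_cplxP[e e0 He] HU]].
apply: filterS (H x B e bB e0) => y Hy; apply: HU => f Bf.
by apply: He; exact: Hy.
Qed.

Lemma bounded_vn (B : set (Tspace W)) :
  (forall m, (0 < m)%N -> exists M, forall f, B f -> tnorm m f <= M) -> vn_bounded B.
Proof.
move=> bB U /nbhs_tnormP[m [e [m0 e0 He]]]; have [M HM] := bB m m0.
have M1 : 0 < `|M| + 1 by rewrite ltr_wpDl.
exists ((`|M| + 1) / e); first exact: divr_gt0.
move=> t; rewrite ltr_pdivrMr// => te f Bf.
have t0 : 0 < t.
  by rewrite -(pmulr_lgt0 _ e0); exact: lt_trans M1 te.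
exists (t^-1%:C *: f); last first.
  by rewrite scalerA -rmorphM mulfV ?gt_eqF// scale1r.
apply: He; rewrite subr0; apply: le_lt_trans (tnormZ _ _ m0) _.
rewrite cabs_real gtr0_norm ?invr_gt0// mulrC ltr_pdivrMr//.
by apply: le_lt_trans (HM f Bf) _; have := ler_norm M; lra.
Qed.

Lemma vn_bounded_tnorm (B : set (Tspace W)) m : vn_bounded B -> (0 < m)%N ->
  exists2 M, 0 < M & forall f, B f -> tnorm m f <= M.
Proof.
move=> bB m0; have n0 : nbhs (0 : Tspace W) [set f | tnorm m f < 1].
  by apply/nbhs_tnormP; exists m, 1; split=> // g; rewrite subr0.
have [r r0 Hr] := bB _ n0; exists (r + 1); first by rewrite addr_gt0.
move=> f Bf; have [g /= g1 <-] : [set (r + 1)%:C *: v | v in [set f | tnorm m f < 1]] f.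
  by apply: Hr Bf; rewrite ltrDl.
apply: le_trans (tnormZ _ _ m0) _; rewrite cabs_real ger0_norm ?addr_ge0 ?(ltW r0)//.
by rewrite -[leRHS]mulr1 ler_wpM2l ?addr_ge0 ?(ltW r0)// ltW.
Qed.

End StrongTopology.

(** * Continuity in both directions *)

Section InductiveTopology.
Context {R : realType} (W : weights R).
Local Notation C := (cplx R).

Lemma nbhs_ind (g : Pspace W) (U : set (Pspace W)) : nbhs g U ->
  exists2 V, ind_nbhs0 V & forall v, V v -> U (g + v).
Proof.
rewrite nbhsE => -[B [oB Bg] BU]; have [V nV VB] := oB g Bg.
by exists V => // v /VB/BU.
Qed.

(** The polar of a bounded set, pulled back by the inverse, is absolutely convex. It contains a ball
    of each P_m, since the functional of an element of that ball is bounded by a uniform multiple of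
    p_(m+2), and p_(m+2) is bounded on B. *)
Lemma inv_continuous (G : Pspace W -> Tdual W) : (forall S, G (hat_P S) = S) ->
  (forall g, hat_P (G g) = g) -> continuous G.
Proof.
move=> GF FG.
have GD g h f : G (g + h) f = G g f + G h f.
  by rewrite -{1}(FG g) -{1}(FG h) -[X in G X](_ : hat_P (G g + G h) = _) ?GF//; apply: val_inj.
have GZ (z : R[i]) g f : G (z *: g) f = z * G g f.
  by rewrite -{1}(FG g) -[X in G X](_ : hat_P (z *: G g) = _) ?GF//; apply: val_inj.
apply: strong_continuous => g0 B e bB e0.
pose ball (d : R) := [set v | forall f, B f -> cabs (G v f) <= d].
have nball d : 0 < d -> ind_nbhs0 (ball d).
  move=> d0; split; first split.
  - move=> x y t /set_mem Bx /set_mem By; apply/mem_set => f Bf.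
    have tp : (0 : R[i]) <= t%:num by [].
    have t1 : t%:num <= (1 : R[i]) by [].
    have [s s0 [s1 tE]] : exists2 s : R, 0 <= s & s <= 1 /\ t%:num = s%:C.
      move: (t%:num) tp t1 => [a b]; rewrite !lecE /= => /andP[/eqP b0 a0] /andP[_ a1].
      by exists a => //; split=> //; rewrite b0.
    have -> : conv t x y = t%:num *: (x : Pspace W) + (1 - t%:num) *: (y : Pspace W) by [].
    rewrite tE; have -> : 1 - s%:C = (1 - s)%:C :> R[i] by rewrite rmorphB rmorph1.
    rewrite GD !GZ; apply: le_trans (cabsD _ _) _; rewrite !cabsM !cabs_real.
    rewrite !ger0_norm ?subr_ge0//; have := Bx f Bf; have := By f Bf => h1 h2.
    have h3 := ler_wpM2l s0 h2; have h4 : (1 - s) * cabs (G y f) <= (1 - s) * d.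
      by apply: ler_wpM2l h1; rewrite subr_ge0.
    by apply: le_trans (lerD h3 h4) _; rewrite -mulrDl addrC subrK mul1r.
  - move=> a v a1 Bv f Bf; rewrite GZ cabsM; apply: le_trans (Bv f Bf).
    by rewrite ler_piMl ?cabs_ge0//; move: a1; rewrite normc_cabs -[1]/(1%:C) lecR.
  move=> m m0; have [K K0 HK] := P_norm_inverse W m0.
  have [M M0 HM] := vn_bounded_tnorm bB (ltn0Sn m.+1).
  have KM : 0 < K * M + 1 by rewrite ltr_wpDl// mulr_ge0// ltW.
  exists (d / (K * M + 1)) => [|v vd f Bf]; first exact: divr_gt0.
  have [S Sv HS] := HK v (d / (K * M + 1)) (ltW (divr_gt0 d0 KM)) (ltW vd).
  rewrite -Sv GF; apply: le_trans (HS f) _.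
  apply: le_trans (ler_wpM2l _ (HM f Bf)) _; first by rewrite mulr_ge0// divr_ge0// ltW.
  have -> : K * (d / (K * M + 1)) * M = K * M * d / (K * M + 1) by ring.
  by rewrite ler_pdivrMr// mulrC ler_wpM2l ?(ltW d0)// lerDl.
(* The strict inequality d < e leaves the room e - d, half of which is spent to see that U is
   open. *)
pose U := [set g | exists2 d, d < e & ball d (g - g0)].
have oU : ind_open U.
  move=> g [d de Bd].
  exists (ball ((e - d) / 2)); first by apply: nball; rewrite divr_gt0// subr_gt0.
  move=> v Bv; exists (d + (e - d) / 2); first by lra.
  move=> f Bf; rewrite addrAC GD; apply: le_trans (cabsD _ _) _.
  by apply: lerD; [exact: Bd|exact: Bv].
rewrite nbhsE; exists U.
  split; first exact: oU.
  exists 0 => // f Bf; rewrite subrr.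
  by have := GZ 0 0 f; rewrite scale0r mul0r => ->; rewrite cabs0.
move=> g [d de Bd] f Bf; apply: le_lt_trans de.
have -> : G g f - G g0 f = G (g - g0) f by have := GD (g - g0) g0 f; rewrite subrK => ->; rewrite addrK.
exact: Bd.
Qed.

Lemma nice_comp (S : Tdual W) (Q : Tspace W -> Tspace W) : nice Q ->
  exists SQ : Tdual W, forall f, SQ f = S (Q f).
Proof.
move=> [lQ bQ _]; have [m [M [m0 M0 HS]]] := Tdual_bounded S; have [B B0 HB] := bQ m m0.
apply: (@bounded_Tdual R W (fun f => S (Q f)) 1 (M * B)); last 2 first.
- exact: ltn0Sn.
- move=> f; apply: le_trans (HS _) _; rewrite -mulrA; exact: ler_wpM2l.
- by move=> z f g; rewrite lQ TdualD TdualZ.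
Qed.

(** Each p_m is bounded by a constant times p_(m+1); multiplied by the product of the preceding
    constants, the norms increase with m. *)
Lemma tnorm_monotone_scale : exists2 a : nat -> R, forall m, 0 < a m &
  forall m n f, (0 < m <= n)%N -> a m * tnorm m (f : Tspace W) <= a n * tnorm n f.
Proof.
have H m : exists K : R, 0 < K /\ ((0 < m)%N -> forall f : Tspace W, tnorm m f <= K * tnorm m.+1 f).
  case: m => [|m]; first by exists 1; split.
  by have [K K0 HK] := tnorm_step W (ltn0Sn m); exists K; split.
have [K HK] := choice H.
pose a m := \prod_(i < m) K i; have a0 m : 0 < a m.
  by apply: prodr_gt0 => i _; exact: (HK i).1.
exists a; first exact: a0.
move=> m n f /andP[m0 /subnKC <-]; elim: (n - m)%N => [|d IH]; first by rewrite addn0.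
apply: le_trans IH _; rewrite addnS /a big_ord_recr /= -/(a (m + d)%N) -mulrA.
apply: ler_wpM2l; first exact: ltW.
by apply: (HK _).2; rewrite addn_gt0 m0.
Qed.

(** The infinite convex combination is realised by a finite descent. For large N, 2^N (S - S o Q_N)
    lies in V because S is bounded by some p_m. Then 2^n (S - S o Q_n) is the midpoint of 2^(n+1) S
    o P_n and 2^(n+1) (S - S o Q_(n+1)), and at n = 0 it is S, since Q_0 = 0. *)
Lemma bounded_absorb (V : set (Pspace W)) : ind_nbhs0 V -> exists2 B : set (Tspace W),
  vn_bounded B & forall S : Tdual W, (forall f, B f -> cabs (S f) <= 1) -> V (hat_P S).
Proof.
move=> [[cV _] nV].
have H m : exists e : R, 0 < e /\ ((0 < m)%N -> forall g : Pspace W, (P_norm W m (\val g) < e%:E)%E -> V g).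
  case: m => [|m]; first by exists 1; split.
  by have [e e0 He] := nV m.+1 (ltn0Sn m); exists e; split.
have [e He] := choice H => {H}; have e0 m : 0 < e m by exact: (He m).1.
have [a a0 Ha] := tnorm_monotone_scale.
have small m M (S : Tdual W) : (0 < m)%N -> 0 <= M -> M < e m ->
    (forall f, cabs (S f) <= M * tnorm m f) -> V (hat_P S).
  move=> m0 M0 Me HS; apply: (He m).2 => //; apply: le_lt_trans (P_norm_hat m0 M0 HS) _.
  by rewrite lte_fin.
have half (g h : Pspace W) : V g -> V h -> V (2^-1 *: g + 2^-1 *: h).
  have p0 : (0 : R[i]) <= 2^-1 by rewrite invr_ge0.
  have p1 : 2^-1 <= (1 : R[i]) by rewrite invf_le1 ?ltr0n// ler1n.
  move=> /mem_set Vg /mem_set Vh; have H := set_mem (cV g h (Itv01 p0 p1) Vg Vh).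
  have -> : 2^-1 *: g + 2^-1 *: h = 2^-1 *: g + (1 - 2^-1) *: h by congr (_ + _ *: _); field.
  exact: H.
(* Chosen so that 2^(n+1) S o P_n is bounded by half of [e n.+2] times p_(n+2), strictly within the
   radius for V. *)
pose tau n := e n.+2 / 2 ^+ n.+2.
have tau0 n : 0 < tau n by rewrite divr_gt0// exprn_gt0.
(* The first entry at n and the second at n + 1 both give tau_n / a_(n+2), so that Q_n and Q_(n+1)
   are both compared with tau_n; this serves the boundedness of B. The third entry beats the factor
   2^N of the descent. *)
pose delta n := Num.min (Num.min (tau n / a n.+2) (tau n.-1 / a n.+1)) ((4^-1 : R) ^+ n).
have delta0 n : 0 < delta n by rewrite !lt_min !divr_gt0// exprn_gt0.
have HQ n : exists Q : Tspace W -> Tspace W, [/\ nice Q, n = 0%N -> Q = (fun _ => 0) &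
    forall m f, (0 < m <= n)%N -> tnorm m (f - Q f) <= delta n * tnorm m.+2 f].
  (* Q_0 = 0 is admissible since no m satisfies 0 < m <= 0. *)
  case: n => [|n].
    exists (fun _ => 0); split=> //; first exact: nice0.
    by move=> m f /andP[m0]; rewrite leqNgt m0.
  by have [Q nQ HQ] := exists_approx W (ltn0Sn n) (delta0 n.+1); exists Q; split.
have [Q HQn] := choice HQ => {HQ}.
have nQ n : nice (Q n) by case: (HQn n).
have Qd n m f : (0 < m <= n)%N -> tnorm m (f - Q n f) <= delta n * tnorm m.+2 f.
  by case: (HQn n) => _ _; apply.
pose P n f := Q n.+1 f - Q n f.
pose B := [set g | exists n f, tnorm n.+2 f <= 1 /\ g = (tau n)^-1%:C *: P n f].
exists B.
  apply: bounded_vn => j j0.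
  have scal n (g : Tspace W) : tnorm j ((tau n)^-1%:C *: g) <= (tau n)^-1 * tnorm j g.
    by apply: le_trans (tnormZ _ _ j0) _; rewrite cabs_real gtr0_norm// invr_gt0.
  pose Pr n (K : R) := forall f, tnorm n.+2 f <= 1 -> tnorm j ((tau n)^-1%:C *: P n f) <= K.
  (* In the norm p_j the finitely many n <= j are bounded one by one; for n > j both Q_n and Q_(n+1)
     approximate in p_j, which gives a bound independent of n. *)
  have H n : exists2 K : R, 0 <= K & Pr n K.
    have [_ /(_ j j0)[K1 K10 HK1] _] := nQ n.+1; have [_ /(_ j j0)[K2 K20 HK2] _] := nQ n.
    have [K3 K30 HK3] := @tnorm_mono R W 1 n.+2 (ltn0Sn 0) (ltn0Sn _).
    exists ((tau n)^-1 * ((K1 + K2) * K3)) => [|f f1].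
      by rewrite mulr_ge0 ?invr_ge0 ?(ltW (tau0 n))// mulr_ge0 ?addr_ge0// ltW.
    apply: le_trans (scal _ _) _; apply: ler_wpM2l; first by rewrite invr_ge0 ltW.
    apply: le_trans (tnormB _ _ j0) _; apply: le_trans (lerD (HK1 f) (HK2 f)) _.
    rewrite -mulrDl; apply: ler_wpM2l; first exact: addr_ge0.
    apply: le_trans (HK3 f) _; rewrite -[leRHS]mulr1; apply: ler_wpM2l f1; exact: ltW.
  have [K K0 HK] := le_upto j H (fun n K K' KK' HP f f1 => le_trans (HP f f1) KK').
  exists (K + 2 / a j.+2) => g [n [f [f1 ->]]].
  have [nj|jn] := leqP n j.
    by apply: le_trans (HK n nj f f1) _; rewrite lerDl divr_ge0// ltW.
  apply: (@le_trans _ _ (2 / a j.+2)); last by rewrite lerDr.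
  apply: le_trans (scal _ _) _; rewrite ler_pdivrMl//.
  have -> : P n f = (f - Q n f) - (f - Q n.+1 f).
    by rewrite /P opprB [RHS]addrC addrA subrK.
  apply: le_trans (tnormB _ _ j0) _.
  have h1 : tnorm j (f - Q n f) <= delta n * tnorm j.+2 f by apply: Qd; rewrite j0 ltnW.
  have h2 : tnorm j (f - Q n.+1 f) <= delta n.+1 * tnorm j.+2 f by apply: Qd; rewrite j0 ltnW// ltnW.
  apply: le_trans (lerD h1 h2) _; rewrite -mulrDl.
  have fj : tnorm j.+2 f <= a n.+2 / a j.+2.
    rewrite ler_pdivlMr// mulrC; apply: le_trans (Ha j.+2 n.+2 f _) _; first by rewrite /= !ltnS ltnW.
    by rewrite -[leRHS]mulr1; apply: ler_wpM2l f1; exact: ltW.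
  have d1 : delta n <= tau n / a n.+2 by rewrite /delta !ge_min lexx.
  have d2 : delta n.+1 <= tau n / a n.+2 by rewrite /delta !ge_min lexx orbT.
  apply: le_trans (ler_pM _ _ (lerD d1 d2) fj) _; rewrite ?addr_ge0 ?(ltW (delta0 _))//.
    exact: tnorm_ge0.
  rewrite le_eqVlt; apply/orP; left; apply/eqP; field.
  by rewrite !gt_eqF.
move=> S SB.
(* Membership in B controls S o P_n on the unit ball of p_(n+2). When p_(n+2)(f) = 0, every multiple
   of f is in that ball, which forces the value to be zero. *)
have SP n f : cabs (S (P n f)) <= tau n * tnorm n.+2 f.
  have scaled (t : R) : 0 < t -> t * tnorm n.+2 f <= 1 -> t * cabs (S (P n f)) <= tau n.
    move=> t0 tf; have [lQ1 _ _] := nQ n.+1; have [lQ0 _ _] := nQ n.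
    have PZ : P n (t%:C *: f) = t%:C *: P n f.
      have Q0 k : Q k (t%:C *: f) = t%:C *: Q k f.
        have [lQ _ _] := nQ k; have Qk0 : Q k 0 = 0.
          by have := lQ (-1) 0 0; rewrite scaler0 addr0 scaleN1r addNr.
        by have := lQ t%:C f 0; rewrite addr0 Qk0 addr0.
      by rewrite /P !Q0 scalerBr.
    have : cabs (S ((tau n)^-1%:C *: P n (t%:C *: f))) <= 1.
      apply: SB; exists n, (t%:C *: f); split=> //.
      by apply: le_trans (tnormZ _ _ (ltn0Sn _)) _; rewrite cabs_real gtr0_norm.
    rewrite PZ !TdualZ !cabsM !cabs_real !gtr0_norm ?invr_gt0// ler_pdivrMl// mulr1 //.
  have p0 := tnorm_ge0 f (ltn0Sn n.+1); have x0 := cabs_ge0 (S (P n f)).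
  move: p0; rewrite le_eqVlt => /orP[/eqP p0|p0]; last first.
    have := scaled (tnorm n.+2 f)^-1; rewrite invr_gt0 => /(_ p0).
    by rewrite mulVf ?gt_eqF// => /(_ (lexx 1)); rewrite ler_pdivrMl// mulrC.
  rewrite -p0 mulr0 leNgt; apply/negP => x1.
  have t0 : 0 < (tau n + 1) / cabs (S (P n f)) by rewrite divr_gt0// addr_gt0.
  have := scaled _ t0; rewrite -p0 mulr0 => /(_ ler01).
  by rewrite divfK ?gt_eqF// gerDl ler10.
have [SQ HSQ] := choice (fun n => nice_comp S (nQ n)).
have p2 k : 0 <= 2 ^+ k :> R by exact: exprn_ge0.
have two n : cabs ((2 ^+ n)%:C : R[i]) = 2 ^+ n by rewrite cabs_real ger0_norm ?exprn_ge0.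
have [m [M [m0 M0 HS]]] := Tdual_bounded S.
have [N0 HN0] := exists_half_pow_lt M (e0 m.+2).
(* N0 makes M / 2^N smaller than the radius [e m.+2]; adding m ensures that Q_N approximates in the
   norm p_m. *)
pose N := (N0 + m)%N.
have base : V (hat_P ((2 ^+ N)%:C *: (S - SQ N))).
  apply: (@small m.+2 (M / 2 ^+ N)).
  - exact: ltn0Sn.
  - by rewrite divr_ge0// exprn_ge0.
  - apply: le_lt_trans HN0; apply: ler_wpM2l => //.
    by rewrite lef_pV2 ?posrE ?exprn_gt0// ler_weXn2l ?ler1n// leq_addr.
  move=> f; rewrite Tdual_scaleE cabsM two Tdual_subE HSQ -TdualB.
  have mN : (0 < m <= N)%N by rewrite m0 leq_addl.
  have h := le_trans (HS (f - Q N f)) (ler_wpM2l M0 (Qd N m f mN)).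
  apply: le_trans (ler_wpM2l (p2 N) h) _.
  have d3 : delta N <= (4^-1 : R) ^+ N by rewrite /delta ge_min lexx orbT.
  have t0 := tnorm_ge0 f (ltn0Sn m.+1).
  have -> : M / 2 ^+ N * tnorm m.+2 f = 2 ^+ N * (M * ((4^-1) ^+ N * tnorm m.+2 f)).
    have -> : (4^-1 : R) = 2^-1 * 2^-1 by field.
    rewrite exprMn exprVn; field; by rewrite gt_eqF ?exprn_gt0.
  by apply: ler_wpM2l; [exact: p2|apply: ler_wpM2l => //; exact: ler_wpM2r].
have step n : V (hat_P ((2 ^+ n.+1)%:C *: (S - SQ n.+1))) -> V (hat_P ((2 ^+ n)%:C *: (S - SQ n))).
  move=> V1; have V2 : V (hat_P ((2 ^+ n.+1)%:C *: (SQ n.+1 - SQ n))).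
    apply: (@small n.+2 (e n.+2 / 2)).
    - exact: ltn0Sn.
    - by rewrite divr_ge0// ltW.
    - by rewrite ltr_pdivrMr// ltr_pMr// ltr1n.
    move=> f; rewrite Tdual_scaleE cabsM two Tdual_subE !HSQ -TdualB.
    apply: le_trans (ler_wpM2l (p2 n.+1) (SP n f)) _.
    rewrite le_eqVlt; apply/orP; left; apply/eqP; rewrite /tau [2 ^+ n.+2]exprS; field.
    by rewrite gt_eqF ?exprn_gt0.
  have := half _ _ V2 V1; suff -> : 2^-1 *: hat_P ((2 ^+ n.+1)%:C *: (SQ n.+1 - SQ n)) +
      2^-1 *: hat_P ((2 ^+ n.+1)%:C *: (S - SQ n.+1)) = hat_P ((2 ^+ n)%:C *: (S - SQ n)) by [].
  apply: val_inj; apply/funext => k; apply/funext => l.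
  change (2^-1 * ((2 ^+ n.+1)%:C * (SQ n.+1 (exp_T W k l) - SQ n (exp_T W k l))) +
    2^-1 * ((2 ^+ n.+1)%:C * (S (exp_T W k l) - SQ n.+1 (exp_T W k l))) =
    (2 ^+ n)%:C * (S (exp_T W k l) - SQ n (exp_T W k l))).
  have -> : ((2 ^+ n.+1)%:C : R[i]) = 2 * (2 ^+ n)%:C by rewrite exprS rmorphM rmorph_nat.
  by field.
have all n : (n <= N)%N -> V (hat_P ((2 ^+ (N - n))%:C *: (S - SQ (N - n)%N))).
  elim: n => [|n IH] nN; first by rewrite subn0.
  by apply: step; rewrite -subSn// subSS; apply: IH; exact: ltnW.
have := all N (leqnn N); rewrite subnn expr0.
suff -> : (1%:C : R[i]) *: (S - SQ 0%N) = S by [].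
apply: Tdual_eq => f; rewrite Tdual_scaleE mul1r Tdual_subE HSQ.
by case: (HQn 0%N) => _ /(_ erefl) -> _; rewrite Tdual0 subr0.
Qed.

Lemma hat_P_continuous : continuous (@hat_P R W).
Proof.
move=> S U /nbhs_ind[V nV VU]; have [B bB HB] := bounded_absorb nV.
apply: filterS (strong_nbhs S bB ltr01) => S' HS'.
change (U (hat_P S')).
have -> : hat_P S' = hat_P S + hat_P (S' - S).
  have E : S + (S' - S) = S' by rewrite addrC subrK.
  by rewrite -{1}E; apply: val_inj.
by apply/VU/HB => f Bf; rewrite Tdual_subE; apply: ltW; exact: HS'.
Qed.

End InductiveTopology.

End PaleyWiener.

Theorem theorem3 (R : realType) (varphi : nat -> R -> R) (c : nat -> nat -> R)
  (varphi_convex : forall m, (0 < m)%N ->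
    convex_function [set: R^o] (varphi m))
  (varphi_superlinear : forall m, (0 < m)%N ->
    varphi m x / `|x| @[x --> @at_infinity R] --> +oo)
  (varphi_gap : forall m, (0 < m)%N -> forall x,
    ln (1 + `|x|) <= varphi m x - varphi m.+1 x)
  (c_gt0 : forall m, (0 < m)%N -> forall k, 0 < c m k)
  (c_summable : forall m, (0 < m)%N ->
    (\sum_(0 <= k <oo) (c m k / c m.+1 k)%:E < +oo)%E) :
  let W := Weights varphi_convex varphi_superlinear varphi_gap c_gt0 c_summable in
  exists F : Tdual W -> Pspace W,
    (forall S : Tdual W, \val (F S) = hat S) /\ topological_isomorphism F.
Proof.
move=> W; exists (@hat_P R W); split=> //; split; first exact: hat_P_linear.
have [G FG] := choice (@hat_P_surj R W).
have GF : cancel (@hat_P R W) G by move=> S; apply: hat_P_inj; exact: FG.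
exists G; split=> //; first exact: hat_P_continuous.
exact: inv_continuous GF FG.
Qed.
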